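(* Let $T>0$. Suppose that $u=u(x,y,t)$ is sufficiently smooth on $\mathbb{R}\times\mathbb{R}_+\times(0,T)$ up to the boundary and decays sufficiently fast as $|(x,y)|\to\infty$; that is, the following holds for some sufficiently large integer $N$: $u\in C^N(\mathbb{R}\times[0,\infty)\times[0,T])$ and all partial derivatives of $u$ of order at most $N$ are bounded by $C(1+|x|+|y|)^{-N}$ for some constant $C$. Suppose that $u$ solves the fourth order heat equation problem $$u_t+\Delta^2u=0\ \text{ in }\mathbb{R}\times\mathbb{R}_+\times(0,T),$$ $$u(x,0,t)=g_0(x,t),\qquad u_y(x,0,t)=g_1(x,t),\qquad u(x,y,0)=u_0(x,y),$$ where $\Delta^2u=\partial_x^4u+2\partial_x^2\partial_y^2u+\partial_y^4u$. Then for all $(x,y,t)\in\mathbb{R}\times\mathbb{R}_+\times(0,T)$, $$u(x,y,t)=\frac{1}{(2\pi)^2}\int_{-\infty}^\infty\int_{-\infty}^{\infty}E(\kappa,\lambda;x,y,t)\,\widehat{u_0}(\kappa,\lambda)\,d\lambda\, d\kappa+\frac{1}{(2\pi)^2}\int_{-\infty}^\infty\int_{\partial D_\kappa^+}E(\kappa,\lambda;x,y,t)\,G(\kappa,\lambda;t)\,d\lambda\, d\kappa,$$ where $E(\kappa,\lambda;x,y,t)=\exp(-(\kappa^2+\lambda^2)^2t+i\kappa x+i\lambda y)$ and $$G(\kappa,\lambda;t)=-\frac{\nu_\kappa(\lambda)+\lambda}{\nu_\kappa(\lambda)-\lambda}\,\widehat{u_0}(\kappa,-\lambda)+\frac{2\lambda}{\nu_\kappa(\lambda)-\lambda}\,\widehat{u_0}(\kappa,-\nu_\kappa(\lambda))$$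 $$-2\lambda[\lambda+\nu_\kappa(\lambda)]\,\widetilde{g_1}(\kappa,(\kappa^2+\lambda^2)^2,t)+2i\lambda\nu_\kappa(\lambda)[\nu_\kappa(\lambda)+\lambda]\,\widetilde{g_0}(\kappa,(\kappa^2+\lambda^2)^2,t),$$ with $\nu_\kappa(\lambda)=\sqrt{-\lambda^2-2\kappa^2}$, where $\sqrt{z}=|z|^{1/2}e^{i\arg(z)/2}$ with $\arg z\in[0,2\pi)$.
   Context: Notation: $\mathbb{R}_+=(0,\infty)$, $\mathbb{C}_+=\{\lambda\in\mathbb{C}:\operatorname{Im}\lambda>0\}$. Half space Fourier transform: for $\kappa\in\mathbb{R}$ and $\operatorname{Im}\lambda\le 0$, $$\widehat{u_0}(\kappa,\lambda)=\int_{-\infty}^\infty\int_0^\infty e^{-ix\kappa-iy\lambda}u_0(x,y)\,dy\,dx.$$ $t$-transforms: for $j=0,1$, $\kappa\in\mathbb{R}$, $\eta\in\mathbb{C}$, $$\widetilde{g_j}(\kappa,\eta,t)=\int_0^t e^{\eta\tau}\Big(\int_{-\infty}^\infty e^{-ix\kappa}g_j(x,\tau)\,dx\Big)d\tau.$$ For $\kappa\in\mathbb{R}$, $D_\kappa=\{\lambda\in\mathbb{C}:\operatorname{Re}(\kappa^2+\lambda^2)^2<0\}$ and $D_\kappa^+=D_\kappa\cap\mathbb{C}_+$. The contour $\partial D_\kappa^+$ is the boundary of $D_\kappa^+$ oriented so that $D_\kappa^+$ lies to its left. On this contour $\nu_\kappa(\lambda)=\lambda$ only at $\lambda=i|\kappa|$,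 which is a removable singularity of $G$. All double integrals are iterated (inner integral in $\lambda$, outer in $\kappa$). Integrals in $\lambda$ over unbounded contours are understood, where necessary, as improper integrals, i.e. limits as $R\to\infty$ of the integrals over the part of the contour in $|\lambda|\le R$. ''Sufficiently large $N$'' means: there exists an absolute integer $N$ for which the statement is true. *)

(* Defs.v *)
From Stdlib Require Import Reals Lra List.
From Coquelicot Require Import Coquelicot.
Import ListNotations.

Open Scope R_scope.

(** * Complex exponential and square root *)

Definition Cexp (z : C) : C := (exp (Re z) * cos (Im z), exp (Re z) * sin (Im z)).

(** The argument in [0, 2 pi); see [Carg_bound] and [Carg_polar].  [Carg 0] is
    irrelevant, since it only enters [Csqrt] multiplied by [sqrt (Cmod 0)]. *)
Definition Carg (z : C) : R :=
  if Rle_dec 0 (Im z) then acos (Re z / Cmod z) else 2 * PI - acos (Re z / Cmod z).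

Definition Csqrt (z : C) : C := (sqrt (Cmod z) * Cexp (Ci * (Carg z / 2)%R))%C.

(** * Improper integrals of complex-valued functions of a real variable *)

Notation is_CRInt_gen := (@is_RInt_gen C_R_NormedModule) (only parsing).
Notation CRInt_gen := (@RInt_gen C_R_CompleteNormedModule) (only parsing).
Notation CRInt := (@RInt C_R_CompleteNormedModule) (only parsing).

Definition is_CRInt_line (f : R -> C) (v : C) : Prop :=
  is_CRInt_gen f (Rbar_locally m_infty) (Rbar_locally p_infty) v.

Definition CRInt_line (f : R -> C) : C :=
  CRInt_gen f (Rbar_locally m_infty) (Rbar_locally p_infty).

Definition CRInt_halfline (f : R -> C) : C :=
  CRInt_gen f (at_point 0) (Rbar_locally p_infty).

(** * Derivatives relative to a set, and the class C^N up to the boundary *)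

(** Derivative at [x] of the restriction of [f] to [S]: the ordinary derivative
    in the interior of [S], the one-sided one at an end point.  It is unique
    when [x] is not an isolated point of [S]. *)
Definition is_derive_on (S : R -> Prop) (f : R -> C) (x : R) (l : C) : Prop :=
  @filterdiff R_AbsRing R_NormedModule C_R_NormedModule
    f (within S (locally x)) (fun h => scal h l).

Definition derive_on (S : R -> Prop) (f : R -> C) (x : R) : C :=
  @iota C_R_CompleteNormedModule (is_derive_on S f x).

Inductive dir : Set := dx | dy | dt.

Definition closed_dom (T : R) (p : R * R * R) : Prop :=
  let '(x, y, t) := p in 0 <= y /\ 0 <= t <= T.

Definition is_partial (T : R) (d : dir) (f : R -> R -> R -> C) (x y t : R) (l : C) : Prop :=
  match d with
  | dx => is_derive_on (fun _ => True) (fun s => f s y t) x l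
  | dy => is_derive_on (fun s => 0 <= s) (fun s => f x s t) y l
  | dt => is_derive_on (fun s => 0 <= s <= T) (fun s => f x y s) t l
  end.

Definition partial (T : R) (d : dir) (f : R -> R -> R -> C) (x y t : R) : C :=
  match d with
  | dx => derive_on (fun _ => True) (fun s => f s y t) x
  | dy => derive_on (fun s => 0 <= s) (fun s => f x s t) y
  | dt => derive_on (fun s => 0 <= s <= T) (fun s => f x y s) t
  end.

(** [partials T [d1; ...; dk] f] is d1 (d2 (... (dk f))): the last direction of
    the list is differentiated first. *)
Definition partials (T : R) (w : list dir) (f : R -> R -> R -> C) : R -> R -> R -> C :=
  fold_right (partial T) f w.

(** [f] is of class C^N on R x [0, oo) x [0, T]: the partial derivatives of
    order at most [N], taken in any order, exist and are continuous there. *)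
Definition class_C (T : R) (N : nat) (f : R -> R -> R -> C) : Prop :=
  (forall w d, (length w < N)%nat -> forall x y t, closed_dom T (x, y, t) ->
     exists l, is_partial T d (partials T w f) x y t l) /\
  (forall w, (length w <= N)%nat ->
     continuous_on (closed_dom T)
       (fun p : R * R * R => let '(x, y, t) := p in partials T w f x y t)).

Definition decays (T : R) (N : nat) (f : R -> R -> R -> C) : Prop :=
  exists M : R, forall w, (length w <= N)%nat ->
    forall x y t, closed_dom T (x, y, t) ->
      Cmod (partials T w f x y t) <= M * / (1 + Rabs x + Rabs y) ^ N.

(** * Integral transforms *)

Definition hat (u0 : R -> R -> C) (k : R) (l : C) : C :=
  CRInt_line (fun x => CRInt_halfline (fun y =>
    (Cexp (- (Ci * x * k) - Ci * y * l) * u0 x y)%C)).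

Definition ttilde (g : R -> R -> C) (k : R) (eta : C) (t : R) : C :=
  CRInt (fun tau =>
    (Cexp (eta * tau) * CRInt_line (fun x => Cexp (- (Ci * x * k)) * g x tau))%C) 0 t.

(** * Contour integrals *)

(** A contour is a list of parametrised curves; each is differentiable except
    at finitely many parameters, where the value of its velocity is irrelevant. *)
Definition contour : Type := list (R -> C).

Definition velocity (gam : R -> C) : R -> C := derive_on (fun _ => True) gam.

Definition is_curve_int_upto (r : R) (gam : R -> C) (f : C -> C) (v : C) : Prop :=
  is_CRInt_line
    (fun s => if Rle_dec (Cmod (gam s)) r then (f (gam s) * velocity gam s)%C else RtoC 0) v.

(** The integral over the part of the contour in |l| <= r. *)
Fixpoint is_contour_int_upto (r : R) (Gam : contour) (f : C -> C) (v : C) : Prop :=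
  match Gam with
  | [] => v = RtoC 0
  | gam :: Gam' => exists v1 v2, is_curve_int_upto r gam f v1 /\
      is_contour_int_upto r Gam' f v2 /\ v = (v1 + v2)%C
  end.

Definition is_contour_int (Gam : contour) (f : C -> C) (v : C) : Prop :=
  exists I : R -> C,
    Rbar_locally p_infty (fun r => is_contour_int_upto r Gam f (I r)) /\
    filterlim I (Rbar_locally p_infty) (locally v).

Definition is_double_int (Gam : R -> contour) (F : R -> C -> C) (v : C) : Prop :=
  exists I : R -> C,
    (forall k, is_contour_int (Gam k) (F k) (I k)) /\ is_CRInt_line I v.

Definition real_line : contour := [RtoC].

(** * The domain D_k^+ and its boundary *)

Definition Dom (k : R) (l : C) : Prop := Re ((k ^ 2 + l ^ 2) ^ 2)%C < 0.

Definition Domp (k : R) (l : C) : Prop := Dom k l /\ 0 < Im l.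

(** D_k^+ consists of two components, exchanged by the reflection in the
    imaginary axis.  For k <> 0 their closures meet exactly in i|k|.  For
    l = a + i b we have Re (k^2 + l^2)^2 = (w^2 - (b + a)^2) (w^2 - (b - a)^2)
    with w = sqrt (2 a^2 + k^2), so that in the closed upper half plane the
    boundary is given by b = w - a or b = w + a. *)
Definition bd_right (k s : R) : C := (Rabs s, sqrt (2 * s ^ 2 + k ^ 2) - s).
Definition bd_left (k s : R) : C := (- Rabs s, sqrt (2 * s ^ 2 + k ^ 2) + s).

(** Lemmas [bd_Domp_frontier], [bd_Domp_oriented] and [bd_Domp_simple] below
    verify that this is the boundary of [Domp k], traversed once, with [Domp k]
    on its left. *)
Definition bd_Domp (k : R) : contour := [bd_right k; bd_left k].

(** * The solution formula *)

Definition nu (k : R) (l : C) : C := Csqrt (- l ^ 2 - 2 * k ^ 2)%C.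

Definition symb (k : R) (l : C) : C := ((k ^ 2 + l ^ 2) ^ 2)%C.

Definition E (x y t k : R) (l : C) : C :=
  Cexp (- (symb k l * t) + Ci * k * x + Ci * l * y)%C.

(** On the contour nu k l = l only at the single point l = i|k|, a removable
    singularity; the value taken there by [G], a quotient by 0, does not affect
    the integrals. *)
Definition G (u0 g0 g1 : R -> R -> C) (t k : R) (l : C) : C :=
  (- ((nu k l + l) / (nu k l - l)) * hat u0 k (- l)
   + 2 * l / (nu k l - l) * hat u0 k (- nu k l)
   - 2 * l * (l + nu k l) * ttilde g1 k (symb k l) t
   + 2 * Ci * l * nu k l * (nu k l + l) * ttilde g0 k (symb k l) t)%C.

(** * Verification of the encodings *)

Lemma Cmod_sqr_eq (z : C) : Cmod z * Cmod z = Re z * Re z + Im z * Im z.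
Proof.
  unfold Cmod. rewrite sqrt_sqrt; unfold Re, Im; nra.
Qed.

Lemma Carg_ratio (z : C) : z <> RtoC 0 ->
  0 < Cmod z /\ -1 <= Re z / Cmod z <= 1 /\
  Rabs (Im z) = Cmod z * sqrt (1 - (Re z / Cmod z)²).
Proof.
  intros Hz. assert (Hm : 0 < Cmod z) by now apply Cmod_gt_0.
  pose proof (Cmod_sqr_eq z) as Hs.
  split; [exact Hm|]. split.
  - split.
    + apply (Rmult_le_reg_r (Cmod z)); [lra|].
      unfold Rdiv; rewrite Rmult_assoc, Rinv_l by lra. nra.
    + apply (Rmult_le_reg_r (Cmod z)); [lra|].
      unfold Rdiv; rewrite Rmult_assoc, Rinv_l by lra. nra.
  - replace (1 - (Re z / Cmod z)²) with ((Im z / Cmod z)²).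
    + rewrite sqrt_Rsqr_abs. unfold Rdiv. rewrite Rabs_mult, (Rabs_pos_eq (/ Cmod z)).
      * field; lra.
      * left; now apply Rinv_0_lt_compat.
    + unfold Rsqr. apply (Rmult_eq_reg_r (Cmod z * Cmod z)); [|nra].
      field_simplify; [|lra|lra]. nra.
Qed.

Lemma Carg_bound (z : C) : z <> RtoC 0 -> 0 <= Carg z < 2 * PI.
Proof.
  intros Hz. destruct (Carg_ratio z Hz) as (Hm & Hr & Hi).
  pose proof (acos_bound (Re z / Cmod z)) as Hb. pose proof PI_RGT_0.
  unfold Carg. destruct (Rle_dec 0 (Im z)) as [H0|H0]; [lra|].
  split; [lra|].
  destruct (Rle_lt_or_eq_dec 0 (acos (Re z / Cmod z)) (proj1 Hb)) as [Hl|He]; [lra|].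
  exfalso. apply H0. rewrite <- sin_acos in Hi by lra.
  rewrite <- He, sin_0, Rmult_0_r in Hi.
  destruct (Rle_dec 0 (Im z)) as [|Hn]; [assumption|].
  rewrite Rabs_left in Hi by lra. lra.
Qed.

Lemma Carg_polar (z : C) : z <> RtoC 0 -> z = (Cmod z * Cexp (Ci * Carg z))%C.
Proof.
  intros Hz. destruct (Carg_ratio z Hz) as (Hm & Hr & Hi).
  assert (HE : Cexp (Ci * Carg z)%C = (cos (Carg z), sin (Carg z))).
  { unfold Cexp, Ci, Re, Im, RtoC, Cmult; simpl.
    replace (0 * Carg z - 1 * 0) with 0 by ring.
    replace (0 * 0 + 1 * Carg z) with (Carg z) by ring.
    rewrite exp_0, !Rmult_1_l. reflexivity. }
  assert (HC : Cmod z * cos (Carg z) = Re z /\ Cmod z * sin (Carg z) = Im z).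
  { rewrite <- sin_acos in Hi by lra.
    assert (Hc : Cmod z * cos (acos (Re z / Cmod z)) = Re z).
    { rewrite cos_acos by lra. field; lra. }
    unfold Carg. destruct (Rle_dec 0 (Im z)) as [H0|H0].
    - split; [exact Hc|]. rewrite <- Hi. apply Rabs_pos_eq; lra.
    - rewrite cos_minus, sin_minus, cos_2PI, sin_2PI.
      rewrite Rabs_left in Hi by lra. split; lra. }
  rewrite HE. destruct HC as [H1 H2]. rewrite (surjective_pairing z) at 1.
  unfold RtoC, Cmult; simpl. unfold Re, Im in *.
  f_equal; lra.
Qed.

Lemma symb_factor (k a b : R) :
  Re ((k ^ 2 + (a, b) ^ 2) ^ 2)%C =
  (2 * a ^ 2 + k ^ 2 - (b + a) ^ 2) * (2 * a ^ 2 + k ^ 2 - (b - a) ^ 2).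
Proof. unfold Re, RtoC; simpl. ring. Qed.

Definition frontier (D : C -> Prop) (z : C) : Prop :=
  forall eps : R, 0 < eps ->
    (exists z1, Cmod (z1 - z)%C < eps /\ D z1) /\
    (exists z2, Cmod (z2 - z)%C < eps /\ ~ D z2).

Lemma cont_pos (f : R * R -> R) (z : R * R) :
  continuous f z -> 0 < f z ->
  exists eps, 0 < eps /\ forall z' : C, Cmod (z' - z)%C < eps -> 0 < f z'.
Proof.
  intros Hc Hp.
  destruct (Hc (fun r => 0 < r) (open_gt 0 (f z) Hp)) as [e He].
  exists e. split; [apply cond_pos|]. intros z' Hz'. apply He.
  pose proof (Rmax_Cmod (z' - z)%C) as Hm.
  pose proof (Rmax_l (Rabs (fst (z' - z)%C)) (Rabs (snd (z' - z)%C))).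
  pose proof (Rmax_r (Rabs (fst (z' - z)%C)) (Rabs (snd (z' - z)%C))).
  split; unfold ball; simpl; unfold AbsRing_ball, abs, minus, plus, opp; simpl;
    simpl in *; unfold Rminus in *; lra.
Qed.

Definition symb_poly (k : R) (p : R * R) : R :=
  (2 * (fst p * fst p) + k ^ 2 - (snd p + fst p) * (snd p + fst p)) *
  (2 * (fst p * fst p) + k ^ 2 - (snd p - fst p) * (snd p - fst p)).

Lemma Dom_poly (k : R) (l : C) : Dom k l <-> symb_poly k l < 0.
Proof.
  unfold Dom. destruct l as [a b]. rewrite symb_factor. unfold symb_poly; simpl.
  split; intros H; ring_simplify in H; ring_simplify; exact H.
Qed.

Lemma symb_poly_cont (k : R) (z : R * R) : continuous (symb_poly k) z.
Proof.
  assert (H1 : continuous (fun p : R * R => fst p) z) by apply continuous_fst.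
  assert (H2 : continuous (fun p : R * R => snd p) z) by apply continuous_snd.
  assert (HM : forall f g : R * R -> R, continuous f z -> continuous g z ->
    continuous (fun p => f p * g p) z).
  { intros f g. exact (continuous_mult (K := R_AbsRing) f g z). }
  assert (HP : forall f g : R * R -> R, continuous f z -> continuous g z ->
    continuous (fun p => f p + g p) z).
  { intros f g. exact (continuous_plus (V := R_NormedModule) f g z). }
  assert (HN : forall f g : R * R -> R, continuous f z -> continuous g z ->
    continuous (fun p => f p - g p) z).
  { intros f g. exact (continuous_minus (V := R_NormedModule) f g z). }
  assert (HC : forall c : R, continuous (fun _ : R * R => c) z).
  { intros c. exact (continuous_const (V := R_UniformSpace) c z). }
  assert (H3 : continuous (fun p : R * R => 2 * (fst p * fst p) + k ^ 2) z).
  { exact (HP _ _ (HM _ _ (HC 2) (HM _ _ H1 H1)) (HC (k ^ 2))). }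
  exact (HM _ _ (HN _ _ H3 (HM _ _ (HP _ _ H2 H1) (HP _ _ H2 H1)))
                (HN _ _ H3 (HM _ _ (HN _ _ H2 H1) (HN _ _ H2 H1)))).
Qed.

Lemma sqrt_facts (k s : R) : let w := sqrt (2 * s ^ 2 + k ^ 2) in
  0 <= w /\ w * w = 2 * (s * s) + k * k /\ Rabs s <= w /\ (s <> 0 -> Rabs s < w).
Proof.
  intros w.
  assert (H0 : 0 <= w) by apply sqrt_pos.
  assert (H1 : w * w = 2 * (s * s) + k * k).
  { unfold w. rewrite sqrt_sqrt; nra. }
  assert (H2 : Rabs s * Rabs s = s * s).
  { rewrite <- Rabs_mult. apply Rabs_pos_eq. nra. }
  pose proof (Rabs_pos s).
  repeat split; auto; [nra|]. intros Hs. nra.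
Qed.

Lemma quad_pos (c0 c1 c2 : R) : 0 < c0 ->
  exists d, 0 < d /\ forall h, Rabs h < d -> 0 < c0 + c1 * h + c2 * h ^ 2.
Proof.
  intros H0. pose proof (Rabs_pos c1). pose proof (Rabs_pos c2).
  assert (Hq : 0 < c0 / (1 + Rabs c1 + Rabs c2)) by (apply Rdiv_lt_0_compat; lra).
  exists (Rmin 1 (c0 / (1 + Rabs c1 + Rabs c2))). split.
  { apply Rmin_pos; lra. }
  intros h Hh.
  assert (Hh1 : Rabs h < 1) by (eapply Rlt_le_trans; [exact Hh|apply Rmin_l]).
  assert (Hh2 : Rabs h < c0 / (1 + Rabs c1 + Rabs c2))
    by (eapply Rlt_le_trans; [exact Hh|apply Rmin_r]).
  apply (Rmult_lt_compat_r (1 + Rabs c1 + Rabs c2)) in Hh2; [|lra].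
  unfold Rdiv in Hh2. rewrite Rmult_assoc, Rinv_l, Rmult_1_r in Hh2 by lra.
  pose proof (Rabs_pos h).
  assert (A1 : Rabs (c1 * h) <= Rabs c1 * Rabs h) by (rewrite Rabs_mult; lra).
  assert (A2 : Rabs (c2 * h ^ 2) <= Rabs c2 * Rabs h).
  { rewrite Rabs_mult, <- RPow_abs. simpl. rewrite Rmult_1_r.
    apply Rmult_le_compat_l; [lra|]. nra. }
  pose proof (Rle_abs (- (c1 * h))) as B1. pose proof (Rle_abs (- (c2 * h ^ 2))) as B2.
  rewrite Rabs_Ropp in B1, B2. nra.
Qed.

Lemma is_derive_abs_pos (s : R) : 0 < s -> is_derive Rabs s 1.
Proof.
  intros Hs. apply (is_derive_ext_loc (fun x => x)).
  - apply (filter_imp (fun x => 0 < x)); [|now apply open_gt].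
    intros x Hx. symmetry. apply Rabs_pos_eq. lra.
  - apply (is_derive_id (K := R_AbsRing)).
Qed.

Lemma is_derive_abs_neg (s : R) : s < 0 -> is_derive Rabs s (-1).
Proof.
  intros Hs. apply (is_derive_ext_loc (fun x => - x)).
  - apply (filter_imp (fun x => x < 0)); [|now apply open_lt].
    intros x Hx. symmetry. apply Rabs_left. lra.
  - apply (is_derive_opp (V := R_NormedModule) (fun x => x)).
    apply (is_derive_id (K := R_AbsRing)).
Qed.

Lemma is_derive_w (k s : R) : s <> 0 ->
  is_derive (fun x => sqrt (2 * x ^ 2 + k ^ 2)) s (2 * s / sqrt (2 * s ^ 2 + k ^ 2)).
Proof.
  intros Hs. assert (Hp : 0 < 2 * s ^ 2 + k ^ 2) by nra.
  pose proof (sqrt_lt_R0 _ Hp).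
  auto_derive.
  - simpl in *; lra.
  - replace (2 * (s * (s * 1)) + k * (k * 1)) with (2 * s ^ 2 + k ^ 2) by ring. field. lra.
Qed.

Lemma is_derive_pair (f g : R -> R) (s a b : R) :
  is_derive f s a -> is_derive g s b ->
  @is_derive R_AbsRing C_R_NormedModule (fun x => (f x, g x)) s (a, b).
Proof.
  intros Hf Hg.
  refine (filterdiff_comp_2 (K := R_AbsRing) (T := R_NormedModule) (U := R_NormedModule)
    (V := R_NormedModule) (W := C_R_NormedModule)
    f g (fun x y => (x, y)) (fun h => scal h a) (fun h => scal h b) (fun x y => (x, y))
    Hf Hg _).
  apply filterdiff_linear.
  exact (is_linear_prod (K := R_AbsRing)
    (T := prod_NormedModule R_AbsRing R_NormedModule R_NormedModule)
    (U := R_NormedModule) (V := R_NormedModule) _ _ is_linear_fst is_linear_snd).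
Qed.

Lemma is_derive_bd_right (k s sg : R) : s <> 0 -> is_derive Rabs s sg ->
  @is_derive R_AbsRing C_R_NormedModule (bd_right k) s
    (sg, 2 * s / sqrt (2 * s ^ 2 + k ^ 2) - 1).
Proof.
  intros Hs Ha. apply is_derive_pair; [exact Ha|].
  apply (is_derive_minus (V := R_NormedModule)); [now apply is_derive_w|].
  apply (is_derive_id (K := R_AbsRing)).
Qed.

Lemma is_derive_bd_left (k s sg : R) : s <> 0 -> is_derive Rabs s sg ->
  @is_derive R_AbsRing C_R_NormedModule (bd_left k) s
    (- sg, 2 * s / sqrt (2 * s ^ 2 + k ^ 2) + 1).
Proof.
  intros Hs Ha. apply is_derive_pair.
  - apply (is_derive_opp (V := R_NormedModule)). exact Ha.
  - apply (is_derive_plus (V := R_NormedModule)); [now apply is_derive_w|].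
    apply (is_derive_id (K := R_AbsRing)).
Qed.

(** Sign of the symbol along a line through a boundary point. *)
Lemma sign_change (c1 c2 q0 q1 q2 : R) : c1 * q0 < 0 ->
  exists d, 0 < d /\ forall h, 0 < h < d ->
    (c1 * h + c2 * h ^ 2) * (q0 + q1 * h + q2 * h ^ 2) < 0 /\
    0 < (c1 * - h + c2 * (- h) ^ 2) * (q0 + q1 * - h + q2 * (- h) ^ 2).
Proof.
  intros H0.
  assert (Hc : exists d, 0 < d /\ forall h, Rabs h < d ->
     (c1 + c2 * h) * (q0 + q1 * h + q2 * h ^ 2) < 0).
  { destruct (Rlt_or_le 0 c1) as [Hc1|Hc1].
    - assert (Hq : 0 < - q0) by nra.
      destruct (quad_pos c1 c2 0 Hc1) as (e1 & He1 & G1).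
      destruct (quad_pos (- q0) (- q1) (- q2) Hq) as (e2 & He2 & G2).
      exists (Rmin e1 e2). split; [now apply Rmin_pos|]. intros h Hh.
      pose proof (Rmin_l e1 e2). pose proof (Rmin_r e1 e2).
      specialize (G1 h ltac:(lra)). specialize (G2 h ltac:(lra)). 
      assert (0 < (c1 + c2 * h) * (- (q0 + q1 * h + q2 * h ^ 2)))
        by (apply Rmult_lt_0_compat; lra). lra.
    - assert (Hc1' : 0 < - c1).
      { destruct (Rle_lt_or_eq_dec _ _ Hc1) as [|He]; [lra|]. rewrite He in H0; lra. }
      assert (Hq : 0 < q0) by nra.
      destruct (quad_pos (- c1) (- c2) 0 Hc1') as (e1 & He1 & G1).
      destruct (quad_pos q0 q1 q2 Hq) as (e2 & He2 & G2).
      exists (Rmin e1 e2). split; [now apply Rmin_pos|]. intros h Hh.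
      pose proof (Rmin_l e1 e2). pose proof (Rmin_r e1 e2).
      specialize (G1 h ltac:(lra)). specialize (G2 h ltac:(lra)).
      assert (0 < (- (c1 + c2 * h)) * (q0 + q1 * h + q2 * h ^ 2))
        by (apply Rmult_lt_0_compat; lra). lra. }
  destruct Hc as (d & Hd & H). exists d. split; [exact Hd|]. intros h [Hh0 Hh].
  assert (Ha : Rabs h = h) by (apply Rabs_pos_eq; lra).
  assert (Hb : Rabs (- h) = h) by (rewrite Rabs_Ropp; exact Ha).
  pose proof (H h ltac:(lra)) as Hp. pose proof (H (- h) ltac:(lra)) as Hm.
  split.
  - replace (c1 * h + c2 * h ^ 2) with (h * (c1 + c2 * h)) by ring.
    rewrite Rmult_assoc. set (X := _ * (q0 + _ + _)) in *. nra.
  - replace (c1 * - h + c2 * (- h) ^ 2) with (- h * (c1 + c2 * - h)) by ring.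
    rewrite Rmult_assoc. set (X := _ * (q0 + _ + _)) in *. nra.
Qed.

Lemma symb_sign (k a b p q P0 P1 Q0 Q1 : R) :
  0 < b ->
  P0 = 2 * a ^ 2 + k ^ 2 - (b + a) ^ 2 -> P1 = 4 * a * p - 2 * (b + a) * (q + p) ->
  Q0 = 2 * a ^ 2 + k ^ 2 - (b - a) ^ 2 -> Q1 = 4 * a * p - 2 * (b - a) * (q - p) ->
  (P0 = 0 /\ P1 * Q0 < 0) \/ (Q0 = 0 /\ Q1 * P0 < 0) ->
  exists d, 0 < d /\ forall h, 0 < h < d ->
    Domp k (a + h * p, b + h * q) /\ ~ Domp k (a + - h * p, b + - h * q).
Proof.
  intros Hb EP0 EP1 EQ0 EQ1 Hs.
  assert (HF : forall h, symb_poly k (a + h * p, b + h * q) =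
    (P0 + P1 * h + (2 * p ^ 2 - (q + p) ^ 2) * h ^ 2) *
    (Q0 + Q1 * h + (2 * p ^ 2 - (q - p) ^ 2) * h ^ 2)).
  { intros h. unfold symb_poly; simpl fst; simpl snd. rewrite EP0, EP1, EQ0, EQ1. ring. }
  assert (HS : exists d, 0 < d /\ forall h, 0 < h < d ->
    symb_poly k (a + h * p, b + h * q) < 0 /\
    0 < symb_poly k (a + - h * p, b + - h * q)).
  { destruct Hs as [[H0 H1]|[H0 H1]].
    - destruct (sign_change P1 (2 * p ^ 2 - (q + p) ^ 2) Q0 Q1
        (2 * p ^ 2 - (q - p) ^ 2) H1) as (d & Hd & H).
      exists d. split; [exact Hd|]. intros h Hh.
      rewrite !HF, H0, !Rplus_0_l. exact (H h Hh).
    - destruct (sign_change Q1 (2 * p ^ 2 - (q - p) ^ 2) P0 P1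
        (2 * p ^ 2 - (q + p) ^ 2) H1) as (d & Hd & H).
      exists d. split; [exact Hd|]. intros h Hh.
      rewrite !HF, H0, !Rplus_0_l, (Rmult_comm (P0 + _ + _)), (Rmult_comm (P0 + _ + _)).
      exact (H h Hh). }
  destruct HS as (d & Hd & H).
  destruct (quad_pos b q 0 Hb) as (e & He & Hq).
  exists (Rmin d e). split; [now apply Rmin_pos|]. intros h [Hh0 Hh].
  pose proof (Rmin_l d e). pose proof (Rmin_r d e).
  destruct (H h ltac:(lra)) as [Hp Hm]. split.
  - split; [now apply Dom_poly|].
    specialize (Hq h). rewrite Rabs_pos_eq in Hq by lra. specialize (Hq ltac:(lra)).
    unfold Im; simpl; lra.
  - intros [HD _]. apply Dom_poly in HD. lra.
Qed.

Lemma bd_Domp_oriented (k : R) (gam : R -> C) (s : R) :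
  In gam (bd_Domp k) -> s <> 0 ->
  exists v : C, @is_derive R_AbsRing C_R_NormedModule gam s v /\ v <> RtoC 0 /\
    exists d, 0 < d /\ forall h : R, 0 < h < d ->
      Domp k (gam s + h * (Ci * v))%C /\ ~ Domp k (gam s - h * (Ci * v))%C.
Proof.
  intros Hin Hs.
  destruct (sqrt_facts k s) as (W0 & W1 & _ & W2). specialize (W2 Hs).
  pose proof (is_derive_bd_right k s) as DR. pose proof (is_derive_bd_left k s) as DL.
  unfold bd_Domp in Hin.
  assert (VR : bd_right k s = (Rabs s, sqrt (2 * s ^ 2 + k ^ 2) - s)) by reflexivity.
  assert (VL : bd_left k s = (- Rabs s, sqrt (2 * s ^ 2 + k ^ 2) + s)) by reflexivity.
  set (w := sqrt (2 * s ^ 2 + k ^ 2)) in *. clearbody w.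
  assert (Hw : 0 < w) by (pose proof (Rabs_pos s); lra).
  assert (Hk : k ^ 2 = w * w - 2 * s ^ 2) by (simpl; lra).
  remember (s / w) as r eqn:Er.
  assert (E2 : 2 * s / w = 2 * r) by (subst r; field; lra).
  assert (Hr : s = r * w) by (subst r; field; lra).
  rewrite E2 in DR, DL. clear Er E2.
  assert (Hr2 : 0 < 1 - 2 * r + 2 * (r * r)) by nra.
  assert (Hr3 : 0 < 1 + 2 * r + 2 * (r * r)) by nra.
  assert (Hpm : (0 < s /\ Rabs s = s /\ is_derive Rabs s 1) \/
                (s < 0 /\ Rabs s = - s /\ is_derive Rabs s (-1))).
  { destruct (Rtotal_order s 0) as [H|[H|H]]; [right|lra|left].
    - split; [exact H|]. split; [apply Rabs_left; lra|now apply is_derive_abs_neg].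
    - split; [lra|]. split; [apply Rabs_pos_eq; lra|now apply is_derive_abs_pos]. }
  assert (Hrot : forall (a b p q : R) (z v : C), z = (a, b) -> v = (q, - p) ->
    (exists d, 0 < d /\ forall h, 0 < h < d ->
      Domp k (a + h * p, b + h * q) /\ ~ Domp k (a + - h * p, b + - h * q)) ->
    exists d, 0 < d /\ forall h : R, 0 < h < d ->
      Domp k (z + h * (Ci * v))%C /\ ~ Domp k (z - h * (Ci * v))%C).
  { intros a b p q z v -> -> (d & Hd & H). exists d. split; [exact Hd|].
    intros h Hh. specialize (H h Hh).
    replace ((a, b) + h * (Ci * (q, (- p)%R)))%C with ((a + h * p, b + h * q) : C)
      by (unfold RtoC, Ci, Cmult, Cplus; simpl; f_equal; ring).
    replace ((a, b) - h * (Ci * (q, (- p)%R)))%C with ((a + - h * p, b + - h * q) : C)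
      by (unfold Cminus, RtoC, Ci, Cmult, Cplus, Copp; simpl; f_equal; ring).
    exact H. }
  assert (K1 : 0 < w * (1 - 2 * r + 2 * (r * r))) by (now apply Rmult_lt_0_compat).
  assert (K2 : 0 < w * (1 + 2 * r + 2 * (r * r))) by (now apply Rmult_lt_0_compat).
  destruct Hin as [<-|[<-|[]]].
  - destruct Hpm as [(Hp & Ha & Hd)|(Hp & Ha & Hd)]; rewrite Ha in W2, VR.
    + exists (1, 2 * r - 1). split; [now apply DR|]. split.
      { intros H; apply (f_equal fst) in H; simpl in H; lra. }
      assert (K3 : 0 < s * (w - s)) by (apply Rmult_lt_0_compat; lra).
      apply (Hrot s (w - s) (1 - 2 * r) 1 _ _ VR); [f_equal; ring|].
      apply (symb_sign k _ _ _ _ 0 (- 4 * (w * (1 - 2 * r + 2 * (r * r))))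
        (4 * (s * (w - s))) (4 * s * (1 - 2 * r) - 2 * (w - 2 * s) * (2 * r)));
        [lra|rewrite Hk; ring|rewrite Hr; ring|rewrite Hk; ring|ring|].
      left; split; [reflexivity|]. pose proof (Rmult_lt_0_compat _ _ K1 K3); lra.
    + exists (-1, 2 * r - 1). split; [now apply DR|]. split.
      { intros H; apply (f_equal fst) in H; simpl in H; lra. }
      assert (K3 : 0 < - s * (w - s)) by (apply Rmult_lt_0_compat; lra).
      apply (Hrot (- s) (w - s) (1 - 2 * r) (-1) _ _ VR); [f_equal; ring|].
      apply (symb_sign k _ _ _ _ (- 4 * (- s * (w - s)))
        (- 4 * s * (1 - 2 * r) - 2 * (w - 2 * s) * (- 2 * r))
        0 (4 * (w * (1 - 2 * r + 2 * (r * r)))));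
        [lra|rewrite Hk; ring|ring|rewrite Hk; ring|rewrite Hr; ring|].
      right; split; [reflexivity|]. pose proof (Rmult_lt_0_compat _ _ K1 K3); lra.
  - destruct Hpm as [(Hp & Ha & Hd)|(Hp & Ha & Hd)]; rewrite Ha in W2, VL.
    + exists (- 1, 2 * r + 1). split; [now apply DL|]. split.
      { intros H; apply (f_equal fst) in H; simpl in H; lra. }
      assert (K3 : 0 < s * (w + s)) by (apply Rmult_lt_0_compat; lra).
      apply (Hrot (- s) (w + s) (- 1 - 2 * r) (- 1) _ _ VL); [f_equal; ring|].
      apply (symb_sign k _ _ _ _ 0 (4 * (w * (1 + 2 * r + 2 * (r * r))))
        (- 4 * (s * (w + s))) (- 4 * s * (- 1 - 2 * r) - 2 * (w + 2 * s) * (2 * r)));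
        [lra|rewrite Hk; ring|rewrite Hr; ring|rewrite Hk; ring|ring|].
      left; split; [reflexivity|]. pose proof (Rmult_lt_0_compat _ _ K2 K3); lra.
    + exists (- -1, 2 * r + 1). split; [now apply DL|]. split.
      { intros H; apply (f_equal fst) in H; simpl in H; lra. }
      assert (K3 : 0 < - s * (w + s)) by (apply Rmult_lt_0_compat; lra).
      rewrite Ropp_involutive in VL.
      apply (Hrot s (w + s) (- 1 - 2 * r) 1 _ _ VL); [f_equal; ring|].
      apply (symb_sign k _ _ _ _ (4 * (- s * (w + s)))
        (4 * s * (- 1 - 2 * r) - 2 * (w + 2 * s) * (- 2 * r))
        0 (- 4 * (w * (1 + 2 * r + 2 * (r * r)))));
        [lra|rewrite Hk; ring|ring|rewrite Hk; ring|rewrite Hr; ring|].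
      right; split; [reflexivity|]. pose proof (Rmult_lt_0_compat _ _ K2 K3); lra.
Qed.

Lemma bd_Domp_sub (k : R) (gam : R -> C) (s : R) : In gam (bd_Domp k) ->
  symb_poly k (gam s) = 0.
Proof.
  destruct (sqrt_facts k s) as (W0 & W1 & _ & _).
  assert (Ha : Rabs s * Rabs s = s * s).
  { rewrite <- Rabs_mult. apply Rabs_pos_eq. nra. }
  intros [<-|[<-|[]]]; unfold symb_poly, bd_right, bd_left; simpl fst; simpl snd;
    set (w := sqrt _) in *; clearbody w;
    destruct (Rle_lt_dec 0 s) as [H|H].
  all: first [rewrite (Rabs_pos_eq s) by lra | rewrite (Rabs_left s) by lra].
  all: replace (k ^ 2) with (w * w - 2 * (s * s)) by (simpl; lra); ring.
Qed.

Lemma bd_cont (k : R) (gam : R -> C) (s : R) (eps : R) : In gam (bd_Domp k) -> 0 < eps ->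
  exists s', s' <> 0 /\ Cmod (gam s' - gam s)%C < eps.
Proof.
  intros Hin He.
  assert (Hw : continuous (fun x => sqrt (2 * x ^ 2 + k ^ 2)) s).
  { apply (continuous_comp (fun x => 2 * x ^ 2 + k ^ 2) sqrt).
    - apply (ex_derive_continuous (V := R_NormedModule)). auto_derive; auto.
    - apply continuous_sqrt. }
  assert (Hid : continuous (fun x : R => x) s) by apply continuous_id.
  assert (Hab : continuous Rabs s) by apply continuous_Rabs.
  assert (Hc : exists f g : R -> R, gam = (fun x => (f x, g x)) /\
     continuous f s /\ continuous g s).
  { destruct Hin as [<-|[<-|[]]]; do 2 eexists; (split; [reflexivity|]); split.
    - exact Hab.
    - apply (continuous_minus (V := R_NormedModule)); assumption.
    - apply (continuous_opp (V := R_NormedModule)); assumption.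
    - apply (continuous_plus (V := R_NormedModule)); assumption. }
  destruct Hc as (f & g & -> & Hf & Hg).
  assert (He2 : 0 < eps / 2) by lra.
  destruct (proj1 (filterlim_locally _ _) Hf (mkposreal _ He2)) as [d1 H1].
  destruct (proj1 (filterlim_locally _ _) Hg (mkposreal _ He2)) as [d2 H2].
  assert (Hd : 0 < Rmin d1 d2) by (apply Rmin_pos; apply cond_pos).
  pose proof (Rmin_l d1 d2). pose proof (Rmin_r d1 d2).
  assert (Hs' : exists s', s' <> 0 /\ Rabs (s' - s) < Rmin d1 d2).
  { destruct (Req_dec s 0) as [->|Hs].
    - exists (Rmin d1 d2 / 2). split; [lra|]. rewrite Rabs_pos_eq; lra.
    - exists s. split; [exact Hs|]. rewrite Rminus_diag, Rabs_R0. exact Hd. }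
  destruct Hs' as (s' & Hs' & Hds). exists s'. split; [exact Hs'|].
  specialize (H1 s'). specialize (H2 s').
  unfold ball in H1, H2; simpl in H1, H2; unfold AbsRing_ball, abs, minus, plus, opp in H1, H2;
    simpl in H1, H2.
  specialize (H1 ltac:(unfold Rminus in *; lra)). specialize (H2 ltac:(unfold Rminus in *; lra)).
  apply (Rle_lt_trans _ (Rabs (f s' - f s) + Rabs (g s' - g s))); [|unfold Rminus; lra].
  replace ((f s', g s') - (f s, g s))%C
    with ((f s' - f s)%R + Ci * (g s' - g s)%R)%C
    by (unfold Cminus, RtoC, Ci, Cmult, Cplus, Copp; simpl; f_equal; ring).
  eapply Rle_trans; [apply Cmod_triangle|].
  rewrite Cmod_mult, !Cmod_R.
  replace (Cmod Ci) with 1; [lra|]. unfold Cmod, Ci; simpl.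
  replace (0 * (0 * 1) + 1 * (1 * 1)) with 1 by ring. now rewrite sqrt_1.
Qed.

Lemma bd_Domp_frontier (k : R) (l : C) :
  frontier (Domp k) l <-> exists gam s, In gam (bd_Domp k) /\ gam s = l.
Proof.
  split.
  - intros HF.
    assert (Hle : symb_poly k l <= 0).
    { apply Rnot_lt_le. intros Hp.
      destruct (cont_pos _ l (symb_poly_cont k l) Hp) as (e & He & H).
      destruct (HF e He) as [(z & Hz & Hd & _) _].
      apply Dom_poly in Hd. specialize (H z Hz). lra. }
    assert (Hb : 0 <= snd l).
    { apply Rnot_lt_le. intros Hp.
      destruct (cont_pos (fun p => - snd p) l) as (e & He & H); [|lra|].
      - apply (continuous_opp (V := R_NormedModule)). apply continuous_snd.
      - destruct (HF e He) as [(z & Hz & _ & Hd) _].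
        specialize (H z Hz). unfold Im in Hd. lra. }
    assert (H0 : symb_poly k l = 0).
    { destruct (Rle_lt_or_eq_dec _ _ Hle) as [Hn|Hn]; [|exact Hn].
      destruct (Rle_lt_or_eq_dec _ _ Hb) as [Hp|Hp].
      - destruct (cont_pos (fun p => - symb_poly k p) l) as (e1 & He1 & H1); [|lra|].
        { apply (continuous_opp (V := R_NormedModule)). apply symb_poly_cont. }
        destruct (cont_pos (fun p => snd p) l) as (e2 & He2 & H2);
          [apply continuous_snd|exact Hp|].
        destruct (HF (Rmin e1 e2)) as [_ (z & Hz & Hd)]; [now apply Rmin_pos|].
        exfalso. apply Hd.
        pose proof (Rmin_l e1 e2). pose proof (Rmin_r e1 e2).
        specialize (H1 z ltac:(lra)). specialize (H2 z ltac:(lra)).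
        split; [apply Dom_poly; lra|exact H2].
      - exfalso. unfold symb_poly in Hn. rewrite <- Hp in Hn.
        assert (0 <= (fst l * fst l + k ^ 2) * (fst l * fst l + k ^ 2)) by apply Rle_0_sqr.
        lra. }
    clear HF Hle. destruct l as [a b]. simpl in Hb.
    unfold symb_poly in H0; simpl fst in H0; simpl snd in H0.
    destruct (sqrt_facts k a) as (W0 & W1 & W2 & _).
    assert (HB : b = sqrt (2 * a ^ 2 + k ^ 2) - a \/ b = sqrt (2 * a ^ 2 + k ^ 2) + a).
    { set (w := sqrt _) in *. clearbody w.
      assert (W3 : - w <= a <= w).
      { pose proof (Rle_abs a). pose proof (Rle_abs (- a)). rewrite Rabs_Ropp in *. lra. }
      replace (k ^ 2) with (w * w - 2 * (a * a)) in H0 by (simpl; lra).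
      assert (H1 : (w - a - b) * (w + a + b) * ((w + a - b) * (w - a + b)) = 0)
        by (rewrite <- H0; ring).
      apply Rmult_integral in H1. destruct H1 as [H1|H1];
      apply Rmult_integral in H1; destruct H1; lra. }
    assert (Hsq : forall x, x ^ 2 = a ^ 2 ->
      sqrt (2 * x ^ 2 + k ^ 2) = sqrt (2 * a ^ 2 + k ^ 2)) by (intros x ->; reflexivity).
    destruct (Rle_lt_dec 0 a) as [Ha|Ha]; destruct HB as [HB|HB].
    + exists (bd_right k), a. split; [now left|].
      unfold bd_right. rewrite Rabs_pos_eq by lra. now rewrite HB.
    + exists (bd_right k), (- a). split; [now left|].
      unfold bd_right. rewrite Rabs_Ropp, Rabs_pos_eq by lra.
      rewrite Hsq by ring. rewrite HB. f_equal; ring.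
    + exists (bd_left k), (- a). split; [now right; left|].
      unfold bd_left. rewrite Rabs_Ropp, Rabs_left by lra.
      rewrite Hsq by ring. rewrite HB. f_equal; ring.
    + exists (bd_left k), a. split; [now right; left|].
      unfold bd_left. rewrite Rabs_left by lra. rewrite HB. f_equal; ring.
  - intros (gam & s & Hin & <-) eps He. split.
    + destruct (bd_cont k gam s (eps / 2) Hin) as (s' & Hs' & Hc); [lra|].
      destruct (bd_Domp_oriented k gam s' Hin Hs') as (v & _ & Hv & d & Hd & H).
      assert (Hm : 0 < Cmod v) by now apply Cmod_gt_0.
      pose (h := Rmin (d / 2) (eps / 2 / (2 * Cmod v))).
      assert (Hq : 0 < eps / 2 / (2 * Cmod v)) by (apply Rdiv_lt_0_compat; lra).
      assert (Hh : 0 < h) by (apply Rmin_pos; lra).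
      assert (Hh1 : h <= d / 2) by apply Rmin_l.
      assert (Hh2 : h <= eps / 2 / (2 * Cmod v)) by apply Rmin_r.
      exists (gam s' + h * (Ci * v))%C. split; [|apply H; lra].
      replace (gam s' + h * (Ci * v) - gam s)%C
        with ((gam s' - gam s) + h * (Ci * v))%C by ring.
      eapply Rle_lt_trans; [apply Cmod_triangle|].
      rewrite !Cmod_mult, Cmod_R, Rabs_pos_eq by lra.
      replace (Cmod Ci) with 1.
      2:{ unfold Cmod, Ci; simpl. replace (0 * (0 * 1) + 1 * (1 * 1)) with 1 by ring.
          now rewrite sqrt_1. }
      apply (Rmult_le_compat_r (Cmod v)) in Hh2; [|lra].
      replace (eps / 2 / (2 * Cmod v) * Cmod v) with (eps / 4) in Hh2 by (field; lra).
      lra.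
    + exists (gam s). split.
      * replace (gam s - gam s)%C with (RtoC 0) by ring. rewrite Cmod_0. exact He.
      * intros [Hd _]. apply Dom_poly in Hd. rewrite (bd_Domp_sub k gam s Hin) in Hd. lra.
Qed.

Lemma sqrt_w_lt (k s s' : R) :
  sqrt (2 * s ^ 2 + k ^ 2) - s = sqrt (2 * s' ^ 2 + k ^ 2) - s' ->
  Rabs s = Rabs s' -> s = s'.
Proof.
  intros H Ha.
  assert (Hs : s ^ 2 = s' ^ 2) by (rewrite <- (pow2_abs s), <- (pow2_abs s'), Ha; reflexivity).
  rewrite Hs in H. lra.
Qed.

Lemma bd_Domp_simple (k : R) :
  (forall s s', bd_right k s = bd_right k s' -> s = s') /\
  (forall s s', bd_left k s = bd_left k s' -> s = s') /\
  (forall s s', bd_right k s = bd_left k s' -> s = 0 /\ s' = 0) /\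
  bd_right k 0 = (Ci * Rabs k)%C /\ bd_left k 0 = (Ci * Rabs k)%C.
Proof.
  assert (Hk : sqrt (2 * 0 ^ 2 + k ^ 2) = Rabs k).
  { replace (2 * 0 ^ 2 + k ^ 2) with (k²) by (unfold Rsqr; ring). apply sqrt_Rsqr_abs. }
  repeat split.
  - intros s s' H. injection H as H1 H2. now apply (sqrt_w_lt k).
  - intros s s' H. pose proof (f_equal fst H) as H1. pose proof (f_equal snd H) as H2.
    unfold bd_left in H1, H2. cbn [fst snd] in H1, H2.
    assert (Hs : s ^ 2 = s' ^ 2)
      by (rewrite <- (pow2_abs s), <- (pow2_abs s'); f_equal; lra).
    rewrite Hs in H2. lra.
  - injection H as H1 _. pose proof (Rabs_pos s). pose proof (Rabs_pos s').
    apply Rabs_eq_0. lra.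
  - injection H as H1 _. pose proof (Rabs_pos s). pose proof (Rabs_pos s').
    apply Rabs_eq_0. lra.
  - unfold bd_right. rewrite Hk, Rabs_R0. unfold Ci, RtoC, Cmult; simpl. f_equal; ring.
  - unfold bd_left. rewrite Hk, Rabs_R0. unfold Ci, RtoC, Cmult; simpl. f_equal; ring.
Qed.

(* Main.v *)
Require Import Defs.
From Stdlib Require Import Reals Lra Lia List Classical ClassicalEpsilon FunctionalExtensionality.
From Coquelicot Require Import Coquelicot.
Import ListNotations.
Open Scope R_scope.

(** A partial Fourier transform in x reduces the problem, for each frequency k, to one for
    v(y, t) on the half line, v_t + k^4 v - 2 k^2 v_yy + v_yyyy = 0.  Its half-line transform
    V(l, t), the integral of exp (i l y) v(y, t) for Im l >= 0, satisfies the global relation: exp (w t) V(l, t)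
    is V(l, 0) plus the t-transforms at w = (k^2 + l^2)^2 of the four boundary values.  Since l, -l and nu give
    the same w, the relations at l and nu, both in the upper half plane, can be used to rewrite G.  On the
    contour the integrand E G becomes f + h, where f = exp (i l y - w t) times the transform of all boundary
    values is entire and h, a combination of V(l, t) and V(nu, t) without the factor exp (- w t), is holomorphic
    and O ((1 + |l|) exp (- y Im l)) in each open quadrant of the upper half plane.  By Cauchy's theorem the integral of h vanishes, and that of f
    may be moved to the real axis, where the global relation at -l and Fourier inversion turn it into 2 pi v(y, t)
    minus the integral of the initial datum.  Inverting the Fourier transform in k gives the formula.

    Cauchy's theorem is needed only for C^1 functions on convex open sets, where it follows from the star
    primitive and an exchange of integrals.  The decay in x and y enters through the weight
    1 / (1 + x^2). *)

(** * Continuity of complex-valued functions *)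

(** The contour passes through i|k|, where nu meets l, and the cut of nu lies on the imaginary axis.
    So h is handled separately in the two open quadrants, and its behaviour at i|k| is never
    studied. Each branch of the contour lies in one quadrant apart from that point, and its two ends
    are joined inside the quadrant by a vertical segment: short near i|k|, exponentially damped far
    out. The pole at nu = l is harmless because the coefficients combine to -V(l) + 2 l (V(nu) -
    V(l)) / (nu - l), and V is Lipschitz. The function f may cross i|k| freely but is controlled
    only where Re w >= 0, hence along paths that avoid D. Its boundary polynomial has degree 3 in l,
    and one integration by parts in time gains 1/w, of order |l|^-4. So f = O(1/|l|): enough to
    close the contour, not enough for absolute convergence on the real axis. This is why inversion
    on the half line is proved as a limit over symmetric intervals. The order N = 6 pays for the
    weights 1/(1+x^2) in x and 1/(1+y^2)^2 in y; the second factor in y absorbs the x^2 of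
    second-order Taylor bounds in l. *)

Notation is_CI := (@is_RInt C_R_NormedModule).
Definition CI (f : R -> C) (a b : R) : C := @RInt C_R_CompleteNormedModule f a b.
Notation ex_CI := (@ex_RInt C_R_NormedModule).
Notation Rderive := (@is_derive R_AbsRing C_R_NormedModule).
Notation Ccont := (@continuous _ C_UniformSpace).

Lemma C_ext (z w : C) : Re z = Re w -> Im z = Im w -> z = w.
Proof. destruct z, w; simpl; intros -> ->; reflexivity. Qed.

Lemma norm_C (z : C) : @norm R_AbsRing C_R_NormedModule z = Cmod z.
Proof.
  unfold norm; simpl. unfold prod_norm, Cmod. f_equal.
  change (@norm R_AbsRing R_NormedModule (fst z)) with (Rabs (fst z)).
  change (@norm R_AbsRing R_NormedModule (snd z)) with (Rabs (snd z)).
  rewrite <- (pow2_abs (fst z)), <- (pow2_abs (snd z)). simpl. ring.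
Qed.

Lemma Re_le_Cmod (z : C) : Rabs (Re z) <= Cmod z.
Proof. eapply Rle_trans; [|apply Rmax_Cmod]. apply Rmax_l. Qed.

Lemma Im_le_Cmod (z : C) : Rabs (Im z) <= Cmod z.
Proof. eapply Rle_trans; [|apply Rmax_Cmod]. apply Rmax_r. Qed.

Lemma Cmod_le_sum (z : C) : Cmod z <= Rabs (Re z) + Rabs (Im z).
Proof.
  pose proof (Cmod_sqr_eq z) as H. pose proof (Cmod_ge_0 z).
  pose proof (Rabs_pos (Re z)). pose proof (Rabs_pos (Im z)).
  pose proof (pow2_abs (Re z)). pose proof (pow2_abs (Im z)). nra.
Qed.

Lemma Cmod_minus_sym (z w : C) : Cmod (z - w) = Cmod (w - z).
Proof. rewrite <- Cmod_opp. f_equal. ring. Qed.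

Lemma Cmod_triangle_minus (z w : C) : Cmod (z - w) <= Cmod z + Cmod w.
Proof. unfold Cminus. rewrite <- (Cmod_opp w). apply Cmod_triangle. Qed.

Lemma Cmod_RtoC_pos (r : R) : 0 <= r -> Cmod (RtoC r) = r.
Proof. intros H. rewrite Cmod_R. now apply Rabs_pos_eq. Qed.

Lemma Cmod_Ci : Cmod Ci = 1.
Proof.
  unfold Cmod, Ci; simpl. replace (0 * (0 * 1) + 1 * (1 * 1)) with 1 by ring. apply sqrt_1.
Qed.

Lemma continuous_C_pair {U : UniformSpace} (f : U -> C) (x : U) :
  Ccont f x <-> continuous (fun y => Re (f y)) x /\ continuous (fun y => Im (f y)) x.
Proof.
  split.
  - intros H. split.
    + apply (continuous_comp f (fun z : C_UniformSpace => fst z)); [exact H|apply continuous_fst].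
    + apply (continuous_comp f (fun z : C_UniformSpace => snd z)); [exact H|apply continuous_snd].
  - intros [H1 H2]. apply filterlim_locally. intros eps.
    pose proof (proj1 (filterlim_locally _ _) H1 eps) as G1.
    pose proof (proj1 (filterlim_locally _ _) H2 eps) as G2.
    generalize (filter_and _ _ G1 G2). apply filter_imp. intros y [K1 K2]. split; assumption.
Qed.

(** The uniform structure of [C] is that of a product, so its balls are boxes; a box of half-width
    eps/2 fits into the disc of radius eps. This lemma and its converse let every later estimate be
    made with [Cmod]. *)
Lemma locally_Cmod (z : C) (eps : R) : 0 < eps ->
  locally (T := C_UniformSpace) z (fun w => Cmod (w - z) < eps).
Proof.
  intros He. assert (He2 : 0 < eps / 2) by lra.
  exists (mkposreal _ He2). intros w [H1 H2].
  unfold ball in H1, H2; simpl in H1, H2; unfold AbsRing_ball, abs, minus, plus, opp in H1, H2;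
    simpl in H1, H2.
  eapply Rle_lt_trans; [apply Cmod_le_sum|].
  unfold Re, Im; simpl. lra.
Qed.

Lemma locally_Cmod_inv (z : C) (P : C -> Prop) :
  locally (T := C_UniformSpace) z P -> exists eps, 0 < eps /\ forall w, Cmod (w - z) < eps -> P w.
Proof.
  intros [e He]. exists e. split; [apply cond_pos|]. intros w Hw. apply He.
  pose proof (Re_le_Cmod (w - z)). pose proof (Im_le_Cmod (w - z)).
  unfold Re, Im in *; simpl in *.
  split; unfold ball; simpl; unfold AbsRing_ball, abs, minus, plus, opp; simpl; lra.
Qed.

Lemma filterlim_C_eps {T : Type} {F : (T -> Prop) -> Prop} {FF : Filter F} (f : T -> C) (z : C) :
  filterlim f F (locally (T := C_UniformSpace) z) <->
  forall eps, 0 < eps -> F (fun y => Cmod (f y - z) < eps).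
Proof.
  split.
  - intros H eps He. apply (H (fun w => Cmod (w - z) < eps)). now apply locally_Cmod.
  - intros H P HP. destruct (locally_Cmod_inv _ _ HP) as (e & He & K).
    unfold filtermap. generalize (H e He). apply filter_imp. auto.
Qed.

Lemma continuous_C_eps {U : UniformSpace} (f : U -> C) (x : U) :
  Ccont f x <-> forall eps, 0 < eps -> locally x (fun y => Cmod (f y - f x) < eps).
Proof. apply filterlim_C_eps. Qed.

Lemma locally_R_eps (x : R) (P : R -> Prop) :
  locally x P <-> exists d, 0 < d /\ forall y, Rabs (y - x) < d -> P y.
Proof.
  split.
  - intros [d Hd]. exists d. split; [apply cond_pos|]. intros y Hy. now apply Hd.
  - intros (d & Hd & H). exists (mkposreal _ Hd). intros y Hy. now apply H.
Qed.

Lemma continuous_RC_eps (f : R -> C) (x : R) :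
  Ccont f x <-> forall eps, 0 < eps ->
    exists d, 0 < d /\ forall y, Rabs (y - x) < d -> Cmod (f y - f x) < eps.
Proof.
  rewrite continuous_C_eps. split; intros H eps He; specialize (H eps He);
    now apply locally_R_eps.
Qed.

Section ContC.
Context {U : UniformSpace}.
Implicit Types f g : U -> C.

Lemma Ccont_const (c : C) (x : U) : Ccont (fun _ : U => c) x.
Proof. apply continuous_const. Qed.

Lemma Ccont_plus f g x : Ccont f x -> Ccont g x -> Ccont (fun y => f y + g y)%C x.
Proof.
  rewrite !continuous_C_pair. intros [H1 H2] [H3 H4]. split.
  - apply (continuous_plus (V := R_NormedModule) (fun y => Re (f y)) (fun y => Re (g y))); auto.
  - apply (continuous_plus (V := R_NormedModule) (fun y => Im (f y)) (fun y => Im (g y))); auto.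
Qed.

Lemma Ccont_opp f x : Ccont f x -> Ccont (fun y => - f y)%C x.
Proof.
  rewrite !continuous_C_pair. intros [H1 H2]. split.
  - apply (continuous_opp (V := R_NormedModule) (fun y => Re (f y))); auto.
  - apply (continuous_opp (V := R_NormedModule) (fun y => Im (f y))); auto.
Qed.

Lemma Ccont_minus f g x : Ccont f x -> Ccont g x -> Ccont (fun y => f y - g y)%C x.
Proof. intros Hf Hg. apply Ccont_plus; [exact Hf|]. now apply Ccont_opp. Qed.

Lemma Ccont_mult f g x : Ccont f x -> Ccont g x -> Ccont (fun y => f y * g y)%C x.
Proof.
  rewrite !continuous_C_pair. intros [H1 H2] [H3 H4]. split.
  - apply (continuous_minus (V := R_NormedModule) (fun y => Re (f y) * Re (g y))
      (fun y => Im (f y) * Im (g y)));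
      apply (continuous_mult (K := R_AbsRing)); auto.
  - apply (continuous_plus (V := R_NormedModule) (fun y => Re (f y) * Im (g y))
      (fun y => Im (f y) * Re (g y)));
      apply (continuous_mult (K := R_AbsRing)); auto.
Qed.

Lemma Ccont_RtoC (f : U -> R) x : continuous f x -> Ccont (fun y => RtoC (f y)) x.
Proof. intros H. apply continuous_C_pair. split; [exact H|apply continuous_const]. Qed.

Lemma Ccont_pair (f g : U -> R) x : continuous f x -> continuous g x ->
  Ccont (fun y => (f y, g y)) x.
Proof. intros H1 H2. apply continuous_C_pair. now split. Qed.

Lemma Ccont_Re f x : Ccont f x -> continuous (fun y => Re (f y)) x.
Proof. now intros H%continuous_C_pair. Qed.

Lemma Ccont_Im f x : Ccont f x -> continuous (fun y => Im (f y)) x.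
Proof. now intros H%continuous_C_pair. Qed.

Lemma Ccont_exp f x : Ccont f x -> Ccont (fun y => Cexp (f y)) x.
Proof.
  rewrite !continuous_C_pair. intros [H1 H2].
  assert (He : continuous (fun y => exp (Re (f y))) x).
  { apply (continuous_comp (fun y => Re (f y)) exp); [exact H1|].
    apply (ex_derive_continuous (V := R_NormedModule)). auto_derive; auto. }
  split; apply (continuous_mult (K := R_AbsRing)); try exact He.
  - apply (continuous_comp (fun y => Im (f y)) cos); [exact H2|apply continuous_cos].
  - apply (continuous_comp (fun y => Im (f y)) sin); [exact H2|apply continuous_sin].
Qed.

Lemma Ccont_mod f x : Ccont f x -> continuous (fun y => Cmod (f y)) x.
Proof.
  intros H. apply filterlim_locally. intros eps.
  generalize (proj1 (continuous_C_eps f x) H eps (cond_pos eps)). apply filter_imp.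
  intros y Hy. unfold ball; simpl; unfold AbsRing_ball, abs, minus, plus, opp; simpl.
  eapply Rle_lt_trans; [|exact Hy].
  apply Rabs_le. pose proof (Cmod_triangle (f y - f x) (f x)).
  pose proof (Cmod_triangle (f x - f y) (f y)).
  rewrite Cmod_minus_sym in H1.
  replace (f y - f x + f x)%C with (f y) in H0 by ring.
  replace (f x - f y + f y)%C with (f x) in H1 by ring. lra.
Qed.

Lemma Ccont_inv f x : Ccont f x -> f x <> 0 -> Ccont (fun y => / f y)%C x.
Proof.
  intros Hf H0. assert (Hm : 0 < Cmod (f x)) by now apply Cmod_gt_0.
  rewrite continuous_C_eps. intros eps He.
  (* The first bound keeps |f y| above |f x|/2; the second then makes |f y - f x| / |f y f x|
     smaller than eps. *)
  assert (Hd : 0 < Rmin (Cmod (f x) / 2) (eps * (Cmod (f x) * Cmod (f x)) / 2)).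
  { apply Rmin_pos; [lra|]. apply Rdiv_lt_0_compat; [|lra].
    apply Rmult_lt_0_compat; [lra|]. now apply Rmult_lt_0_compat. }
  generalize (proj1 (continuous_C_eps f x) Hf _ Hd). apply filter_imp. intros y Hy.
  pose proof (Rmin_l (Cmod (f x) / 2) (eps * (Cmod (f x) * Cmod (f x)) / 2)) as M1.
  pose proof (Rmin_r (Cmod (f x) / 2) (eps * (Cmod (f x) * Cmod (f x)) / 2)) as M2.
  set (d := Rmin _ _) in *. clearbody d.
  assert (Hy2 : Cmod (f x) / 2 < Cmod (f y)).
  { pose proof (Cmod_triangle (f x - f y) (f y)) as Ht. rewrite Cmod_minus_sym in Ht.
    replace (f x - f y + f y)%C with (f x) in Ht by ring. lra. }
  assert (Hy0 : f y <> 0). { apply Cmod_gt_0. lra. }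
  replace (/ f y - / f x)%C with (- (f y - f x) / (f y * f x))%C by (field; split; auto).
  rewrite Cmod_div by (apply Cmult_neq_0; auto). rewrite Cmod_opp, Cmod_mult.
  apply Rlt_div_l; [nra|]. 
  eapply Rlt_le_trans; [exact Hy|]. eapply Rle_trans; [exact M2|].
  assert (Cmod (f x) * Cmod (f x) / 2 <= Cmod (f y) * Cmod (f x)) by nra.
  replace (eps * (Cmod (f x) * Cmod (f x)) / 2) with (eps * (Cmod (f x) * Cmod (f x) / 2)) by field.
  apply Rmult_le_compat_l; lra.
Qed.

Lemma Ccont_pow f n x : Ccont f x -> Ccont (fun y => f y ^ n)%C x.
Proof.
  intros H. induction n; [apply Ccont_const|]. simpl. now apply Ccont_mult.
Qed.

End ContC.

Ltac ccont := lazymatch goal with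
  | |- continuous (fun y => Cplus _ _) _ => apply Ccont_plus; ccont
  | |- continuous (fun y => Cminus _ _) _ => apply Ccont_minus; ccont
  | |- continuous (fun y => Cmult _ _) _ => apply Ccont_mult; ccont
  | |- continuous (fun y => Copp _) _ => apply Ccont_opp; ccont
  | |- continuous (fun y => Cexp _) _ => apply Ccont_exp; ccont
  | |- continuous (fun y => Cpow _ _) _ => apply Ccont_pow; ccont
  | |- continuous (fun y => ?c) _ => first [apply Ccont_const | idtac]
  | |- _ => idtac
  end; try assumption.

Lemma Ccont_comp_C {U : UniformSpace} (f : U -> C) (F : C -> C) (x : U) :
  Ccont f x -> Ccont F (f x) -> Ccont (fun y => F (f y)) x.
Proof. intros. apply (continuous_comp f F); assumption. Qed.

Lemma Ccont_comp_R {U : UniformSpace} (f : U -> R) (F : R -> C) (x : U) :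
  continuous f x -> Ccont F (f x) -> Ccont (fun y => F (f y)) x.
Proof. intros. apply (continuous_comp f F); assumption. Qed.

Lemma Cexp_plus (z w : C) : Cexp (z + w) = (Cexp z * Cexp w)%C.
Proof.
  apply C_ext; unfold Cexp, Re, Im; simpl; rewrite exp_plus, ?cos_plus, ?sin_plus; ring.
Qed.

Lemma Cexp_0 : Cexp 0 = 1.
Proof. apply C_ext; unfold Cexp, Re, Im; simpl; rewrite exp_0, ?cos_0, ?sin_0; ring. Qed.

Lemma Cmod_Cexp (z : C) : Cmod (Cexp z) = exp (Re z).
Proof.
  pose proof (Cmod_sqr_eq (Cexp z)) as H. unfold Cexp in H at 3 4 5 6.
  unfold Re, Im in H; simpl in H. 
  pose proof (sin2_cos2 (snd z)) as Hs. unfold Rsqr in Hs.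
  pose proof (exp_pos (fst z)). pose proof (Cmod_ge_0 (Cexp z)).
  assert (Cmod (Cexp z) * Cmod (Cexp z) = exp (fst z) * exp (fst z)).
  { rewrite H. transitivity (exp (fst z) * exp (fst z) * (sin (snd z) * sin (snd z) + cos (snd z) * cos (snd z))).
    ring. rewrite Hs. ring. }
  unfold Re. nra.
Qed.

(** * Derivatives and integrals of complex-valued functions *)

Ltac cring := match goal with |- @eq _ ?a ?b => change (@eq C a b) end; cbv beta; ring.

Lemma Rderive_pair (f : R -> C) (x : R) (l : C) :
  Rderive f x l <-> is_derive (fun y => Re (f y)) x (Re l) /\ is_derive (fun y => Im (f y)) x (Im l).
Proof.
  split.
  - intros H. split.
    + apply (filterdiff_comp (K := R_AbsRing) (U := R_NormedModule) (V := C_R_NormedModule)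
        (W := R_NormedModule) f (fun z => fst z) _ (fun z => fst z) H).
      apply filterdiff_linear. exact is_linear_fst.
    + apply (filterdiff_comp (K := R_AbsRing) (U := R_NormedModule) (V := C_R_NormedModule)
        (W := R_NormedModule) f (fun z => snd z) _ (fun z => snd z) H).
      apply filterdiff_linear. exact is_linear_snd.
  - intros [H1 H2]. pose proof (is_derive_pair _ _ _ _ _ H1 H2) as H.
    destruct l as [a b]; simpl in H.
    apply (is_derive_ext (V := C_R_NormedModule) (fun y => (Re (f y), Im (f y)))); [|exact H].
    intros y. now destruct (f y).
Qed.

Lemma scal_C (r : R) (z : C) : @scal R_AbsRing C_R_NormedModule r z = (RtoC r * z)%C.
Proof. apply C_ext; unfold Re, Im; simpl; unfold scal; simpl; unfold mult; simpl; ring. Qed.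

Lemma is_derive_on_eps (S : R -> Prop) (f : R -> C) (x : R) (l : C) :
  S x -> is_derive_on S f x l <-> forall eps, 0 < eps -> exists d, 0 < d /\
    forall y, S y -> Rabs (y - x) < d -> Cmod (f y - f x - RtoC (y - x) * l) <= eps * Rabs (y - x).
Proof.
  intros Sx. split.
  - intros [_ H] eps He. specialize (H x).
    assert (Hl : is_filter_lim (within S (locally x)) x).
    { intros P HP. unfold within. revert HP. apply filter_imp. auto. }
    specialize (H Hl (mkposreal _ He)). unfold within in H.
    apply locally_R_eps in H. destruct H as (d & Hd & H). exists d. split; [exact Hd|].
    intros y Hy Hyd. specialize (H y Hyd Hy). simpl in H.
    rewrite norm_C, scal_C in H. exact H.
  - intros H. split; [apply (is_linear_scal_l (K := R_AbsRing) (V := C_R_NormedModule))|].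
    intros x' Hx' eps.
    (* Since [x] lies in [S], every set of the relative neighbourhood filter contains [x]; a limit
       of that filter is thus also a limit of the point filter at [x]. *)
    assert (Hxx : x' = x).
    { apply (is_filter_lim_unique (K := R_AbsRing) (V := R_NormedModule) (F := at_point x)).
      - intros P HP. unfold at_point. specialize (Hx' P HP). unfold within in Hx'.
        apply locally_singleton in Hx'. auto.
      - intros P HP. exact (locally_singleton x P HP). }
    subst x'. unfold within. apply locally_R_eps.
    destruct (H eps (cond_pos eps)) as (d & Hd & K). exists d. split; [exact Hd|].
    intros y Hy Sy. rewrite norm_C, scal_C. exact (K y Sy Hy).
Qed.

Lemma Rderive_eps (f : R -> C) (x : R) (l : C) :
  Rderive f x l <-> forall eps, 0 < eps -> exists d, 0 < d /\
    forall y, Rabs (y - x) < d -> Cmod (f y - f x - RtoC (y - x) * l) <= eps * Rabs (y - x).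
Proof.
  assert (E : Rderive f x l <-> is_derive_on (fun _ => True) f x l).
  { split; intros [H1 H2]; (split; [exact H1|]); intros x' Hx' eps.
    - assert (K : is_filter_lim (locally x) x').
      { intros P HP. generalize (Hx' P HP). unfold within. apply filter_imp. auto. }
      generalize (H2 x' K eps). unfold within. apply filter_imp. auto.
    - assert (K : is_filter_lim (within (fun _ => True) (locally x)) x').
      { intros P HP. generalize (Hx' P HP). unfold within. apply filter_imp. auto. }
      generalize (H2 x' K eps). unfold within. apply filter_imp. auto. }
  rewrite E, is_derive_on_eps by exact I.
  split; intros H eps He; destruct (H eps He) as (d & Hd & K); exists d; split; auto.
Qed.

Lemma Rderive_cont (f : R -> C) (x : R) (l : C) : Rderive f x l -> Ccont f x.
Proof. intros H. apply (ex_derive_continuous (V := C_R_NormedModule)). now exists l. Qed.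

Lemma Rderive_plus (f g : R -> C) (x : R) (a b : C) :
  Rderive f x a -> Rderive g x b -> Rderive (fun y => f y + g y)%C x (a + b)%C.
Proof. apply (is_derive_plus (V := C_R_NormedModule)). Qed.

Lemma Rderive_const (c : C) (x : R) : Rderive (fun _ => c) x (RtoC 0).
Proof. apply (is_derive_const (V := C_R_NormedModule)). Qed.

Lemma Rderive_minus (f g : R -> C) (x : R) (a b : C) :
  Rderive f x a -> Rderive g x b -> Rderive (fun y => f y - g y)%C x (a - b)%C.
Proof. apply (is_derive_minus (V := C_R_NormedModule)). Qed.

Lemma Rderive_mult (f g : R -> C) (x : R) (a b : C) :
  Rderive f x a -> Rderive g x b -> Rderive (fun y => f y * g y)%C x (a * g x + f x * b)%C.
Proof.
  rewrite !Rderive_pair. intros [H1 H2] [H3 H4].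
  assert (M : forall u v du dv, is_derive u x du -> is_derive v x dv ->
    is_derive (fun y => u y * v y) x (du * v x + u x * dv)).
  { intros u v du dv Hu Hv. apply (is_derive_mult (K := R_AbsRing) u v x du dv Hu Hv).
    intros n m; apply Rmult_comm. }
  split.
  - replace (Re (a * g x + f x * b)%C) with
      ((Re a * Re (g x) + Re (f x) * Re b) - (Im a * Im (g x) + Im (f x) * Im b))
      by (unfold Re, Im; simpl; ring).
    apply (is_derive_minus (V := R_NormedModule) (fun y => Re (f y) * Re (g y))
      (fun y => Im (f y) * Im (g y))); apply M; assumption.
  - replace (Im (a * g x + f x * b)%C) with
      ((Re a * Im (g x) + Re (f x) * Im b) + (Im a * Re (g x) + Im (f x) * Re b))
      by (unfold Re, Im; simpl; ring).
    apply (is_derive_plus (V := R_NormedModule) (fun y => Re (f y) * Im (g y))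
      (fun y => Im (f y) * Re (g y))); apply M; assumption.
Qed.

Lemma Rderive_RtoC (f : R -> R) (x a : R) : is_derive f x a -> Rderive (fun y => RtoC (f y)) x (RtoC a).
Proof. intros H. apply Rderive_pair. split; [exact H|]. exact (is_derive_const (K := R_AbsRing) (V := R_NormedModule) 0 x). Qed.

Lemma Rderive_id (x : R) : Rderive RtoC x (RtoC 1).
Proof. apply (Rderive_RtoC (fun y => y) x 1). apply (is_derive_id (K := R_AbsRing)). Qed.

Lemma Rderive_exp (f : R -> C) (x : R) (a : C) :
  Rderive f x a -> Rderive (fun y => Cexp (f y)) x (a * Cexp (f x))%C.
Proof.
  rewrite !Rderive_pair. intros [H1 H2]. unfold Cexp, Re, Im in *; simpl in *.
  assert (E1 : is_derive (fun y => exp (fst (f y))) x (fst a * exp (fst (f x)))).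
  { apply (is_derive_comp (K := R_AbsRing) (V := R_NormedModule) exp (fun y => fst (f y))); [|exact H1].
    apply is_derive_exp. }
  assert (E2 : is_derive (fun y => cos (snd (f y))) x (snd a * - sin (snd (f x)))).
  { apply (is_derive_comp (K := R_AbsRing) (V := R_NormedModule) cos (fun y => snd (f y))); [|exact H2].
    apply is_derive_cos. }
  assert (E3 : is_derive (fun y => sin (snd (f y))) x (snd a * cos (snd (f x)))).
  { apply (is_derive_comp (K := R_AbsRing) (V := R_NormedModule) sin (fun y => snd (f y))); [|exact H2].
    apply is_derive_sin. }
  split.
  - replace (fst a * (exp (fst (f x)) * cos (snd (f x))) - snd a * (exp (fst (f x)) * sin (snd (f x))))
    with (fst a * exp (fst (f x)) * cos (snd (f x)) + exp (fst (f x)) * (snd a * - sin (snd (f x)))) by ring.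
    apply (is_derive_mult (K := R_AbsRing) _ _ x _ _ E1 E2). intros; apply Rmult_comm.
  - replace (fst a * (exp (fst (f x)) * sin (snd (f x))) + snd a * (exp (fst (f x)) * cos (snd (f x))))
    with (fst a * exp (fst (f x)) * sin (snd (f x)) + exp (fst (f x)) * (snd a * cos (snd (f x)))) by ring.
    apply (is_derive_mult (K := R_AbsRing) _ _ x _ _ E1 E3). intros; apply Rmult_comm.
Qed.

Lemma Rderive_eq (f : R -> C) (x : R) (a b : C) : Rderive f x a -> a = b -> Rderive f x b.
Proof. now intros H <-. Qed.

Lemma ex_CI_cont (f : R -> C) (a b : R) :
  (forall x, Rmin a b <= x <= Rmax a b -> Ccont f x) -> ex_CI f a b.
Proof. apply (ex_RInt_continuous (V := C_R_CompleteNormedModule)). Qed.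

Lemma CI_correct (f : R -> C) (a b : R) : ex_CI f a b -> is_CI f a b (CI f a b).
Proof. apply (RInt_correct (V := C_R_CompleteNormedModule)). Qed.

Lemma CI_unique (f : R -> C) (a b : R) (v : C) : is_CI f a b v -> CI f a b = v.
Proof. apply (is_RInt_unique (V := C_R_CompleteNormedModule)). Qed.

Lemma is_CI_eq (f : R -> C) (a b : R) (v w : C) : is_CI f a b v -> v = w -> is_CI f a b w.
Proof. now intros H <-. Qed.

Lemma is_CI_inj (f : R -> C) (a b : R) (v w : C) : is_CI f a b v -> is_CI f a b w -> v = w.
Proof. intros H1 H2. rewrite <- (CI_unique _ _ _ _ H1). now apply CI_unique. Qed.

Lemma is_CI_pair (f : R -> C) (a b : R) (v : C) :
  is_CI f a b v <-> is_RInt (fun x => Re (f x)) a b (Re v) /\ is_RInt (fun x => Im (f x)) a b (Im v).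
Proof.
  split.
  - intros H. split.
    + exact (is_RInt_fct_extend_fst (U := R_NormedModule) (V := R_NormedModule) _ _ _ _ H).
    + exact (is_RInt_fct_extend_snd (U := R_NormedModule) (V := R_NormedModule) _ _ _ _ H).
  - intros [H1 H2]. exact (is_RInt_fct_extend_pair (U := R_NormedModule) (V := R_NormedModule) f a b _ _ H1 H2).
Qed.

Lemma is_CI_plus (f g : R -> C) (a b : R) (v w : C) :
  is_CI f a b v -> is_CI g a b w -> is_CI (fun x => f x + g x)%C a b (v + w)%C.
Proof. apply (is_RInt_plus (V := C_R_NormedModule)). Qed.

Lemma is_CI_minus (f g : R -> C) (a b : R) (v w : C) :
  is_CI f a b v -> is_CI g a b w -> is_CI (fun x => f x - g x)%C a b (v - w)%C.
Proof. apply (is_RInt_minus (V := C_R_NormedModule)). Qed.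

Lemma is_CI_opp (f : R -> C) (a b : R) (v : C) :
  is_CI f a b v -> is_CI (fun x => - f x)%C a b (- v)%C.
Proof. apply (is_RInt_opp (V := C_R_NormedModule)). Qed.

Lemma is_CI_scal (c : C) (f : R -> C) (a b : R) (v : C) :
  is_CI f a b v -> is_CI (fun x => c * f x)%C a b (c * v)%C.
Proof.
  rewrite !is_CI_pair. intros [H1 H2].
  assert (S : forall (k : R) h u, is_RInt h a b u -> is_RInt (fun x => k * h x) a b (k * u)).
  { intros k h u. apply (is_RInt_scal (V := R_NormedModule)). }
  split.
  - apply (is_RInt_minus (V := R_NormedModule) (fun x => Re c * Re (f x)) (fun x => Im c * Im (f x)));
      now apply S.
  - apply (is_RInt_plus (V := R_NormedModule) (fun x => Re c * Im (f x)) (fun x => Im c * Re (f x)));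
      now apply S.
Qed.

Lemma is_CI_const (c : C) (a b : R) : is_CI (fun _ => c) a b (RtoC (b - a) * c)%C.
Proof.
  eapply is_CI_eq; [apply (is_RInt_const (V := C_R_NormedModule))|].
  apply C_ext; unfold Re, Im; simpl; unfold scal; simpl; unfold mult; simpl; ring.
Qed.

Lemma is_CI_ext (f g : R -> C) (a b : R) (v : C) :
  (forall x, Rmin a b < x < Rmax a b -> f x = g x) -> is_CI f a b v -> is_CI g a b v.
Proof. apply (is_RInt_ext (V := C_R_NormedModule)). Qed.

Lemma CI_ext (f g : R -> C) (a b : R) :
  (forall x, Rmin a b < x < Rmax a b -> f x = g x) -> CI f a b = CI g a b.
Proof. apply (RInt_ext (V := C_R_CompleteNormedModule)). Qed.

Lemma is_CI_Chasles (f : R -> C) (a b c : R) (v w : C) :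
  is_CI f a b v -> is_CI f b c w -> is_CI f a c (v + w)%C.
Proof. apply (is_RInt_Chasles (V := C_R_NormedModule)). Qed.

Lemma is_CI_swap (f : R -> C) (a b : R) (v : C) : is_CI f a b v -> is_CI f b a (- v)%C.
Proof. apply (is_RInt_swap (V := C_R_NormedModule)). Qed.

Lemma is_CI_point (f : R -> C) (a : R) : is_CI f a a (RtoC 0).
Proof. apply (is_RInt_point (V := C_R_NormedModule)). Qed.

Lemma is_CI_norm (f : R -> C) (g : R -> R) (a b : R) (v : C) (w : R) :
  a <= b -> (forall x, a <= x <= b -> Cmod (f x) <= g x) ->
  is_CI f a b v -> is_RInt g a b w -> Cmod v <= w.
Proof.
  intros Hab H Hf Hg. rewrite <- norm_C.
  apply (norm_RInt_le (V := C_R_NormedModule) f g a b v w Hab); auto.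
  intros x Hx. rewrite norm_C. auto.
Qed.

Lemma is_CI_norm_const (f : R -> C) (M a b : R) (v : C) :
  a <= b -> (forall x, a <= x <= b -> Cmod (f x) <= M) -> is_CI f a b v -> Cmod v <= (b - a) * M.
Proof.
  intros Hab H Hf. apply (is_CI_norm f (fun _ => M) a b v _ Hab H Hf).
  apply (is_RInt_const (V := R_NormedModule)).
Qed.

Lemma FTC_C (F f : R -> C) (a b : R) :
  (forall x, Rmin a b <= x <= Rmax a b -> Rderive F x (f x)) ->
  (forall x, Rmin a b <= x <= Rmax a b -> Ccont f x) ->
  is_CI f a b (F b - F a)%C.
Proof. apply (is_RInt_derive (V := C_R_CompleteNormedModule)). Qed.

Lemma Rderive_CI (f : R -> C) (a x : R) :
  (forall y, Ccont f y) -> Rderive (fun y => CI f a y) x (f x).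
Proof.
  intros H. apply (is_derive_RInt (V := C_R_NormedModule) f (fun y => CI f a y) a x); [|apply H].
  apply filter_forall. intros y. apply CI_correct. apply ex_CI_cont. auto.
Qed.

Lemma is_CI_comp_opp (f : R -> C) (a b : R) (v : C) :
  is_CI f (- a) (- b) v -> is_CI (fun x => f (- x)) a b (- v)%C.
Proof.
  intros H. pose proof (is_RInt_comp_opp (V := C_R_NormedModule) f a b v H) as K.
  apply is_CI_opp in K. eapply is_CI_ext; [|exact K].
  intros x _. simpl. apply C_ext; unfold Re, Im; simpl; unfold opp; simpl; ring.
Qed.

Lemma is_CI_shift (f : R -> C) (c a b : R) (v : C) :
  is_CI f (a + c) (b + c) v -> is_CI (fun x => f (x + c)) a b v.
Proof.
  intros H.
  assert (H' : is_CI f (1 * a + c) (1 * b + c) v) by (rewrite !Rmult_1_l; exact H).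
  apply (is_RInt_comp_lin (V := C_R_NormedModule)) in H'.
  eapply is_CI_ext; [|exact H'].
  intros x _. simpl. rewrite Rmult_1_l.
  apply C_ext; unfold Re, Im; simpl; unfold scal; simpl; unfold mult; simpl; ring.
Qed.

Lemma FTC_C_open (F f : R -> C) (a b : R) : a <= b ->
  (forall x, a < x < b -> Rderive F x (f x)) ->
  (forall x, a <= x <= b -> Ccont F x) ->
  (forall x, Ccont f x) ->
  is_CI f a b (F b - F a)%C.
Proof.
  intros Hab HF HFc Hf.
  pose (Gf := fun y => (F y - CI f a y)%C).
  assert (HG : forall x, a < x < b -> Rderive Gf x (RtoC 0)).
  { intros x Hx. eapply Rderive_eq; [apply Rderive_minus; [now apply HF|now apply Rderive_CI]|]. ring. }
  assert (HGc : forall x, a <= x <= b -> Ccont Gf x).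
  { intros x Hx. apply Ccont_minus; [now apply HFc|]. eapply Rderive_cont. now apply Rderive_CI. }
  assert (K : Gf b = Gf a).
  { destruct (Rle_lt_or_eq_dec a b Hab) as [Hlt|<-]; [|reflexivity].
    assert (Q : forall p : C -> R, (forall x, a < x < b -> is_derive (fun y => p (Gf y)) x 0) ->
      (forall x, a <= x <= b -> continuous (fun y => p (Gf y)) x) -> p (Gf b) = p (Gf a)).
    { intros p P1 P2. destruct (MVT_gen (fun y => p (Gf y)) a b (fun _ => 0)) as (c & _ & Hc).
      - intros x Hx. rewrite Rmin_left, Rmax_right in Hx by lra. now apply P1.
      - intros x Hx. rewrite Rmin_left, Rmax_right in Hx by lra.
        apply continuity_pt_filterlim. now apply P2.
      - lra. }
    apply C_ext.
    - apply Q; intros x Hx; [|apply Ccont_Re; auto].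
      apply (proj1 (proj1 (Rderive_pair Gf x (RtoC 0)) (HG x Hx))).
    - apply Q; intros x Hx; [|apply Ccont_Im; auto].
      apply (proj2 (proj1 (Rderive_pair Gf x (RtoC 0)) (HG x Hx))). }
  eapply is_CI_eq; [apply CI_correct; apply ex_CI_cont; auto|].
  unfold Gf in K. rewrite (CI_unique f a a (RtoC 0)) in K by apply is_CI_point.
  replace (F b) with ((F b - CI f a b) + CI f a b)%C by cring. rewrite K. cring.
Qed.

(** * Integrals depending on a point *)

Notation Ccont2 f p x := (@continuous _ C_UniformSpace (fun q => f (fst q) (snd q)) (p, x)).

Lemma CI_bound (f : R -> C) (M a b : R) (v : C) :
  (forall x, Rmin a b <= x <= Rmax a b -> Cmod (f x) <= M) -> is_CI f a b v -> Cmod v <= Rabs (b - a) * M.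
Proof.
  intros H Hf. destruct (Rle_lt_dec a b) as [Hab|Hab].
  - rewrite Rmin_left, Rmax_right in H by lra. rewrite Rabs_pos_eq by lra.
    now apply (is_CI_norm_const f).
  - rewrite Rmin_right, Rmax_left in H by lra. rewrite Rabs_left by lra.
    apply is_CI_swap in Hf. rewrite <- Cmod_opp.
    replace (- (b - a)) with (a - b) by ring.
    apply (is_CI_norm_const f M b a); auto. lra.
Qed.

Section Tube.
Context {P : UniformSpace}.
Variable f : P -> R -> C.

(** Compactness of [a, b] turns joint continuity along the slice over [p0] into an estimate uniform
    in x. [compactness_value_1d] delivers its point under a double negation, hence the classical
    step. *)
Lemma tube (p0 : P) (a b eps : R) : 0 < eps ->
  (forall x, a <= x <= b -> Ccont2 f p0 x) ->
  locally p0 (fun p => forall x, a <= x <= b -> Cmod (f p x - f p0 x) < eps).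
Proof.
  intros He Hc.
  (* The gauge has to be defined on the whole line; outside [a, b] its value 1 is a dummy. *)
  assert (H : forall t, exists d : posreal, a <= t <= b ->
    forall p x, ball p0 d p -> Rabs (x - t) < d -> Cmod (f p x - f p0 t) < eps / 2).
  { intros t. destruct (classic (a <= t <= b)) as [Ht|Ht].
    - destruct (proj1 (continuous_C_eps _ _) (Hc t Ht) (eps / 2) ltac:(lra)) as [d Hd].
      exists d. intros _ p x Hp Hx. exact (Hd (p, x) (conj Hp Hx)).
    - exists (mkposreal 1 Rlt_0_1). intros K. contradiction. }
  pose (del := fun t => proj1_sig (constructive_indefinite_description _ (H t))).
  assert (Hdel : forall t, a <= t <= b ->
    forall p x, ball p0 (del t) p -> Rabs (x - t) < del t -> Cmod (f p x - f p0 t) < eps / 2).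
  { intros t. unfold del. destruct (constructive_indefinite_description _ (H t)) as [d Hd]; exact Hd. }
  destruct (compactness_value_1d a b del) as [d Hd].
  exists d. intros p Hp x Hx. specialize (Hd x Hx). apply NNPP in Hd.
  destruct Hd as (t & Ht & Hxt & Hdt).
  assert (K1 := Hdel t Ht p x (ball_le _ _ _ Hdt _ Hp) Hxt).
  assert (K2 := Hdel t Ht p0 x (ball_center _ _) Hxt).
  replace (f p x - f p0 x)%C with ((f p x - f p0 t) - (f p0 x - f p0 t))%C by ring.
  eapply Rle_lt_trans; [apply Cmod_triangle_minus|]. lra.
Qed.

Lemma CI_param_cont (p0 : P) (a b : R) : a <= b ->
  (forall x, a <= x <= b -> Ccont2 f p0 x) ->
  locally p0 (fun p => ex_CI (f p) a b) ->
  Ccont (fun p => CI (f p) a b) p0.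
Proof.
  intros Hab Hc Hex. apply continuous_C_eps. intros eps He.
  assert (Hq : 0 < eps / (b - a + 1)) by (apply Rdiv_lt_0_compat; lra).
  generalize (filter_and _ _ Hex (tube p0 a b _ Hq Hc)). apply filter_imp.
  intros p [H1 H2].
  assert (H0 : ex_CI (f p0) a b) by (now apply locally_singleton in Hex).
  pose proof (is_CI_minus _ _ _ _ _ _ (CI_correct _ _ _ H1) (CI_correct _ _ _ H0)) as H.
  eapply Rle_lt_trans; [apply (is_CI_norm_const (fun x => f p x - f p0 x)%C (eps / (b - a + 1)) a b _ Hab)|].
  - intros x Hx. left. now apply H2.
  - exact H.
  - apply (Rmult_lt_reg_r (b - a + 1)); [lra|].
    replace ((b - a) * (eps / (b - a + 1)) * (b - a + 1)) with ((b - a) * eps) by (field; lra). nra.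
Qed.

End Tube.

Lemma Ccont2_slice {P : UniformSpace} (f : P -> R -> C) (p : P) (x : R) : Ccont2 f p x -> Ccont (f p) x.
Proof.
  intros H. apply (continuous_comp (fun y : R => (p, y)) (fun q => f (fst q) (snd q)) x); [|exact H].
  apply (continuous_comp_2 (fun _ : R => p) (fun y : R => y) (fun a b => (a, b)));
    [apply continuous_const|apply continuous_id|].
  apply (continuous_ext (fun x0 => x0)); [now intros []|]. apply continuous_id.
Qed.

Lemma Ccont2_swap (f : R -> R -> C) (p x : R) : Ccont2 f p x -> Ccont2 (fun y q => f q y) x p.
Proof.
  intros H. apply (continuous_comp (fun q : R * R => (snd q, fst q)) (fun q => f (fst q) (snd q)) (x, p)); [|exact H].
  apply (continuous_comp_2 (fun q : R * R => snd q) (fun q : R * R => fst q) (fun a b => (a, b)));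
    [apply continuous_snd|apply continuous_fst|].
  apply (continuous_ext (fun x0 => x0)); [now intros []|]. apply continuous_id.
Qed.

Lemma Ccont2_comp {U V W : UniformSpace} (f : V -> W -> C) (g : U -> V) (h : U -> W) (u : U) :
  continuous g u -> continuous h u -> Ccont2 f (g u) (h u) -> Ccont (fun z => f (g z) (h z)) u.
Proof. intros Hg Hh Hf. apply (continuous_comp_2 g h f); assumption. Qed.

(** Both sides, as functions of the upper limit b, vanish at a and have the same derivative. For the
    right-hand side the difference quotient is controlled uniformly in x by [tube]. *)
Lemma CI_Fubini (f : R -> R -> C) (a b c d : R) : a <= b -> c <= d ->
  (forall p x, Ccont2 f p x) ->
  CI (fun p => CI (f p) c d) a b = CI (fun x => CI (fun p => f p x) a b) c d.
Proof.
  intros Hab Hcd Hc.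
  assert (Hc1 : forall p x, Ccont (f p) x) by (intros; now apply Ccont2_slice).
  assert (Hc2 : forall p x, Ccont (fun q => f q x) p).
  { intros p x. apply (Ccont2_slice (fun y q => f q y)). now apply Ccont2_swap. }
  assert (HA : forall p, Ccont (fun q => CI (f q) c d) p).
  { intros p. apply CI_param_cont; auto. apply filter_forall. intros q. apply ex_CI_cont; auto. }
  assert (HI : forall u v x, Ccont (fun y => CI (fun q => f q y) u v) x).
  { assert (HI0 : forall u v x, u <= v -> Ccont (fun y => CI (fun q => f q y) u v) x).
    { intros u v x Huv. apply (CI_param_cont (fun y q => f q y)); auto.
      - intros; now apply Ccont2_swap.
      - apply filter_forall. intros y. apply ex_CI_cont; auto. }
    intros u v x. destruct (Rle_lt_dec u v); [auto|].
    apply (continuous_ext (fun y => - CI (fun q => f q y) v u)%C).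
    - intros y. symmetry. apply CI_unique. apply is_CI_swap. apply CI_correct. apply ex_CI_cont; auto.
    - apply Ccont_opp. apply HI0. lra. }
  pose (D := fun p => (CI (fun q => CI (f q) c d) a p - CI (fun x => CI (fun q => f q x) a p) c d)%C).
  assert (HD : forall p, Rderive D p (RtoC 0)).
  { intros p.
    assert (HB : Rderive (fun r => CI (fun x => CI (fun q => f q x) a r) c d) p (CI (f p) c d)).
    { apply Rderive_eps. intros eps He.
      assert (Hq : 0 < eps / (d - c + 1)) by (apply Rdiv_lt_0_compat; lra).
      pose proof (tube f p c d _ Hq (fun x _ => Hc p x)) as HT.
      apply locally_R_eps in HT. destruct HT as (del & Hdel & HT).
      exists del. split; [exact Hdel|]. intros r Hr.
      assert (K : is_CI (fun x => CI (fun q => f q x - f p x)%C p r) c d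
        (CI (fun x => CI (fun q => f q x) a r) c d - CI (fun x => CI (fun q => f q x) a p) c d
          - RtoC (r - p) * CI (f p) c d)%C).
      { eapply is_CI_ext; [|apply is_CI_minus; [apply is_CI_minus|apply is_CI_scal]; apply CI_correct; apply ex_CI_cont; auto].
        intros x _. symmetry. apply CI_unique. simpl.
        apply is_CI_minus.
        - assert (K1 : is_CI (fun q => f q x) a r (CI (fun q => f q x) a r)) by (apply CI_correct, ex_CI_cont; auto).
          assert (K2 : is_CI (fun q => f q x) a p (CI (fun q => f q x) a p)) by (apply CI_correct, ex_CI_cont; auto).
          apply is_CI_swap in K2. eapply is_CI_eq; [apply (is_CI_Chasles _ _ _ _ _ _ K2 K1)|]. cring.
        - apply is_CI_const. }
      assert (Hb : Cmod (CI (fun x => CI (fun q => f q x) a r) c d - CI (fun x => CI (fun q => f q x) a p) c d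
          - RtoC (r - p) * CI (f p) c d)%C <= (d - c) * (Rabs (r - p) * (eps / (d - c + 1)))).
      { apply (is_CI_norm_const (fun x => CI (fun q => f q x - f p x)%C p r) _ c d _ Hcd); [|exact K].
        intros x Hx. apply (CI_bound (fun q => f q x - f p x)%C _ p r).
        - intros q Hq'. left. apply HT; [|exact Hx].
          eapply Rle_lt_trans; [|exact Hr]. unfold Rmin, Rmax in Hq'.
          destruct (Rle_dec p r); unfold Rabs; repeat destruct Rcase_abs; lra.
        - apply CI_correct, ex_CI_cont. intros q _. apply Ccont_minus; [auto|apply Ccont_const]. }
      eapply Rle_trans; [exact Hb|].
      pose proof (Rabs_pos (r - p)).
      replace ((d - c) * (Rabs (r - p) * (eps / (d - c + 1)))) with
        (Rabs (r - p) * ((d - c) * eps / (d - c + 1))) by (field; lra).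
      rewrite (Rmult_comm eps). apply Rmult_le_compat_l; [lra|].
      apply Rle_div_l; [lra|]. nra. }
    eapply Rderive_eq; [apply Rderive_minus; [apply (Rderive_CI (fun q => CI (f q) c d)); auto|exact HB]|]. cring. }
  assert (K : (D b - D a)%C = RtoC 0).
  { apply (is_CI_inj (fun _ => RtoC 0) a b).
    - apply FTC_C; intros; [apply HD|apply Ccont_const].
    - eapply is_CI_eq; [apply is_CI_const|]. cring. }
  assert (Da : D a = RtoC 0).
  { unfold D. rewrite (CI_unique _ a a (RtoC 0)) by apply is_CI_point.
    rewrite (CI_unique _ c d (RtoC 0)); [cring|].
    eapply is_CI_ext; [|eapply is_CI_eq; [apply (is_CI_const (RtoC 0))|cring]].
    intros x _. simpl. symmetry. apply CI_unique, is_CI_point. }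
  rewrite Da in K. unfold D in K.
  transitivity (CI (fun q => CI (f q) c d) a b - CI (fun x => CI (fun q => f q x) a b) c d - RtoC 0 + CI (fun x => CI (fun q => f q x) a b) c d)%C; [cring|].
  rewrite K. cring.
Qed.

(** The retraction of the line onto [a, b]. Composition with it extends a function that is known
    only on an interval or a rectangle to a globally continuous one, without changing integrals over
    that set. *)
Definition clamp (a b x : R) : R := Rmax a (Rmin b x).

Lemma clamp_in (a b x : R) : a <= b -> a <= clamp a b x <= b.
Proof.
  intros H. unfold clamp, Rmax, Rmin. repeat destruct Rle_dec; lra.
Qed.

Lemma clamp_id (a b x : R) : a <= x <= b -> clamp a b x = x.
Proof.
  intros H. unfold clamp, Rmax, Rmin. repeat destruct Rle_dec; lra.
Qed.

Lemma clamp_lip (a b x y : R) : Rabs (clamp a b x - clamp a b y) <= Rabs (x - y).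
Proof.
  unfold clamp, Rmax, Rmin, Rabs. repeat destruct Rle_dec; repeat destruct Rcase_abs; lra.
Qed.

Lemma continuous_R_lip (g : R -> R) (x : R) :
  (forall y, Rabs (g y - g x) <= Rabs (y - x)) -> continuous g x.
Proof.
  intros H. apply filterlim_locally. intros eps. exists eps. intros y Hy.
  eapply Rle_lt_trans; [apply H|]. exact Hy.
Qed.

Lemma clamp_cont (a b x : R) : continuous (clamp a b) x.
Proof. apply continuous_R_lip. intros y. apply clamp_lip. Qed.

Lemma CI_Fubini_rect (f : R -> R -> C) (a b c d : R) : a <= b -> c <= d ->
  (forall p x, a <= p <= b -> c <= x <= d -> Ccont2 f p x) ->
  CI (fun p => CI (f p) c d) a b = CI (fun x => CI (fun p => f p x) a b) c d.
Proof.
  intros Hab Hcd Hc.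
  transitivity (CI (fun p => CI (fun x => f (clamp a b p) (clamp c d x)) c d) a b).
  { apply CI_ext. intros p Hp. rewrite Rmin_left, Rmax_right in Hp by lra.
    apply CI_ext. intros x Hx. rewrite Rmin_left, Rmax_right in Hx by lra.
    rewrite !clamp_id by lra. reflexivity. }
  rewrite (CI_Fubini (fun p x => f (clamp a b p) (clamp c d x)) a b c d Hab Hcd).
  { apply CI_ext. intros x Hx. rewrite Rmin_left, Rmax_right in Hx by lra.
    apply CI_ext. intros p Hp. rewrite Rmin_left, Rmax_right in Hp by lra.
    rewrite !clamp_id by lra. reflexivity. }
  intros p x. apply (Ccont2_comp f (fun q => clamp a b (fst q)) (fun q => clamp c d (snd q)) (p, x)).
  - apply (continuous_comp (fun q : R * R => fst q) (clamp a b)); [apply continuous_fst|apply clamp_cont].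
  - apply (continuous_comp (fun q : R * R => snd q) (clamp c d)); [apply continuous_snd|apply clamp_cont].
  - apply Hc; now apply clamp_in.
Qed.

(** * Complex differentiability *)

(* Caratheodory's form of complex differentiability. *)
Definition Cdiff (f : C -> C) (z l : C) : Prop :=
  exists q : C -> C, (forall w, f w = (f z + q w * (w - z))%C) /\ Ccont q z /\ q z = l.

Lemma Cdiff_eps (f : C -> C) (z l : C) :
  (forall eps, 0 < eps -> exists d, 0 < d /\ forall w, Cmod (w - z) < d ->
     Cmod (f w - f z - l * (w - z)) <= eps * Cmod (w - z)) -> Cdiff f z l.
Proof.
  intros H.
  pose (q := fun w => if excluded_middle_informative (w = z) then l else ((f w - f z) / (w - z))%C).
  assert (Hq : q z = l).
  { unfold q. destruct excluded_middle_informative; [reflexivity|contradiction]. }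
  exists q. split; [|split; [|exact Hq]].
  - intros w. unfold q. destruct excluded_middle_informative as [->|Hw]; [ring|].
    assert (w - z <> 0)%C. { intros K. apply Hw. replace w with (w - z + z)%C by ring. rewrite K. ring. }
    field. assumption.
  - apply (continuous_C_eps (U := C_UniformSpace)). intros eps He.
    destruct (H (eps / 2) ltac:(lra)) as (d & Hd & K).
    generalize (locally_Cmod z d Hd). apply filter_imp. intros w Hw. rewrite Hq.
    unfold q. destruct excluded_middle_informative as [->|Hwz].
    { replace (l - l)%C with (RtoC 0) by ring. now rewrite Cmod_0. }
    assert (Hn : (w - z <> 0)%C). { intros E. apply Hwz. replace w with (w - z + z)%C by ring. rewrite E. ring. }
    specialize (K w Hw).
    replace ((f w - f z) / (w - z) - l)%C with ((f w - f z - l * (w - z)) / (w - z))%C by (field; exact Hn).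
    rewrite Cmod_div by exact Hn. pose proof (proj1 (Cmod_gt_0 _) Hn).
    apply Rlt_div_l; [lra|]. nra.
Qed.

(** The form in which differentiability arises here: inverses, exponentials and transforms all come
    with a quadratic Taylor remainder. *)
Lemma Cdiff_quad (f : C -> C) (z l : C) (K d : R) : 0 < d -> 0 <= K ->
  (forall w, Cmod (w - z) < d -> Cmod (f w - f z - l * (w - z)) <= K * (Cmod (w - z) * Cmod (w - z))) ->
  Cdiff f z l.
Proof.
  intros Hd HK H. apply Cdiff_eps. intros eps He.
  assert (Hq : 0 < eps / (K + 1)) by (apply Rdiv_lt_0_compat; lra).
  exists (Rmin d (eps / (K + 1))). split; [now apply Rmin_pos|]. intros w Hw.
  pose proof (Rmin_l d (eps / (K + 1))). pose proof (Rmin_r d (eps / (K + 1))).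
  eapply Rle_trans; [apply H; lra|]. rewrite <- Rmult_assoc.
  pose proof (Cmod_ge_0 (w - z)).
  apply Rmult_le_compat_r; [lra|].
  assert (K2 : Cmod (w - z) <= eps / (K + 1)) by lra.
  apply Rle_div_r in K2; [|lra]. pose proof (Rmult_comm K (Cmod (w - z))). lra.
Qed.

Lemma Cdiff_cont (f : C -> C) (z l : C) : Cdiff f z l -> Ccont f z.
Proof.
  intros (q & Hq & Hc & _).
  apply (continuous_ext (fun w => f z + q w * (w - z))%C); [intros w; symmetry; apply Hq|].
  apply (Ccont_plus (U := C_UniformSpace)); [apply Ccont_const|].
  apply (Ccont_mult (U := C_UniformSpace)); [exact Hc|].
  apply (Ccont_minus (U := C_UniformSpace)); [apply continuous_id|apply Ccont_const].
Qed.

Lemma Cdiff_const (c z : C) : Cdiff (fun _ => c) z 0.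
Proof.
  exists (fun _ => RtoC 0). repeat split; [intros; ring|apply Ccont_const].
Qed.

Lemma Cdiff_id (z : C) : Cdiff (fun w => w) z 1.
Proof.
  exists (fun _ => RtoC 1). repeat split; [intros; ring|apply Ccont_const].
Qed.

Lemma Cdiff_plus (f g : C -> C) (z a b : C) :
  Cdiff f z a -> Cdiff g z b -> Cdiff (fun w => f w + g w)%C z (a + b)%C.
Proof.
  intros (p & Hp & Cp & Ep) (q & Hq & Cq & Eq). exists (fun w => p w + q w)%C. repeat split.
  - intros w. rewrite (Hp w), (Hq w). ring.
  - now apply (Ccont_plus (U := C_UniformSpace)).
  - now rewrite Ep, Eq.
Qed.

Lemma Cdiff_mult (f g : C -> C) (z a b : C) :
  Cdiff f z a -> Cdiff g z b -> Cdiff (fun w => f w * g w)%C z (a * g z + f z * b)%C.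
Proof.
  intros Hf Hg. pose proof (Cdiff_cont _ _ _ Hg) as Cg.
  destruct Hf as (p & Hp & Cp & Ep). destruct Hg as (q & Hq & Cq & Eq).
  exists (fun w => p w * g w + f z * q w)%C. repeat split.
  - intros w. rewrite (Hp w) at 1. rewrite (Hq w). ring.
  - apply (Ccont_plus (U := C_UniformSpace)); apply (Ccont_mult (U := C_UniformSpace)); auto. apply Ccont_const.
  - now rewrite Ep, Eq.
Qed.

Lemma Cdiff_comp (f g : C -> C) (z a b : C) :
  Cdiff f (g z) a -> Cdiff g z b -> Cdiff (fun w => f (g w)) z (a * b)%C.
Proof.
  intros Hf Hg. pose proof (Cdiff_cont _ _ _ Hg) as Cg.
  destruct Hf as (p & Hp & Cp & Ep). destruct Hg as (q & Hq & Cq & Eq).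
  exists (fun w => p (g w) * q w)%C. repeat split.
  - intros w. rewrite (Hp (g w)). rewrite (Hq w) at 2. ring.
  - apply (Ccont_mult (U := C_UniformSpace)); auto. now apply (Ccont_comp_C (U := C_UniformSpace)).
  - now rewrite Ep, Eq.
Qed.

Lemma Cdiff_inv (z : C) : z <> 0 -> Cdiff Cinv z (- / (z * z))%C.
Proof.
  intros Hz. assert (Hm : 0 < Cmod z) by now apply Cmod_gt_0.
  (* The remainder is exactly (w - z)^2 / (w z^2), and |w| > |z|/2 in the disc of radius |z|/2. *)
  apply (Cdiff_quad _ z _ (2 / (Cmod z * Cmod z * Cmod z)) (Cmod z / 2)); [lra| |].
  { left. apply Rdiv_lt_0_compat; [lra|]. repeat apply Rmult_lt_0_compat; lra. }
  intros w Hw.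
  assert (Hw2 : Cmod z / 2 < Cmod w).
  { pose proof (Cmod_triangle (z - w) w) as Ht. rewrite Cmod_minus_sym in Ht.
    replace (z - w + w)%C with z in Ht by ring. lra. }
  assert (Hw0 : w <> 0) by (apply Cmod_gt_0; lra).
  replace (/ w - / z - - / (z * z) * (w - z))%C with ((w - z) * (w - z) / (w * (z * z)))%C by (field; auto).
  rewrite Cmod_div, !Cmod_mult by (repeat apply Cmult_neq_0; auto).
  pose proof (Cmod_ge_0 (w - z)). set (s := Cmod (w - z)) in *. set (m := Cmod z) in *. set (n := Cmod w) in *.
  apply Rle_div_l; [apply Rmult_lt_0_compat; nra|].
  replace (2 / (m * m * m) * (s * s) * (n * (m * m))) with ((s * s) * (2 * n / m)) by (field; lra).
  rewrite <- (Rmult_1_r (s * s)) at 1. apply Rmult_le_compat_l; [nra|].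
  apply Rle_div_r; lra.
Qed.

(* [q (g y) - q (g s)] tends to 0 while [(g y - g s) / (y - s)] is bounded. *)
Lemma Cdiff_chain (F : C -> C) (g : R -> C) (s : R) (l a : C) :
  Cdiff F (g s) l -> Rderive g s a -> Rderive (fun x => F (g x)) s (l * a)%C.
Proof.
  intros (q & Hq & Cq & Eq) Hg. pose proof (Rderive_cont _ _ _ Hg) as Cg.
  assert (Cqg : Ccont (fun x => q (g x)) s) by now apply Ccont_comp_C.
  rewrite Rderive_eps in Hg. apply Rderive_eps. intros eps He.
  pose proof (Cmod_ge_0 a). pose proof (Cmod_ge_0 l).
  assert (H1 : 0 < Rmin 1 (eps / 2 / (Cmod l + 1))).
  { apply Rmin_pos; [lra|]. repeat apply Rdiv_lt_0_compat; lra. }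
  assert (H2 : 0 < eps / 2 / (Cmod a + 1)) by (repeat apply Rdiv_lt_0_compat; lra).
  destruct (Hg _ H1) as (d1 & Hd1 & K1).
  pose proof (proj1 (continuous_RC_eps _ _) Cqg _ H2) as (d2 & Hd2 & K2).
  exists (Rmin d1 d2). split; [now apply Rmin_pos|]. intros y Hy.
  pose proof (Rmin_l d1 d2). pose proof (Rmin_r d1 d2).
  specialize (K1 y ltac:(lra)). specialize (K2 y ltac:(lra)).
  pose proof (Rmin_r 1 (eps / 2 / (Cmod l + 1))) as M1. pose proof (Rmin_l 1 (eps / 2 / (Cmod l + 1))) as M2.
  set (m := Rmin 1 _) in *. clearbody m.
  rewrite (Hq (g y)). rewrite Eq in K2.
  replace (F (g s) + q (g y) * (g y - g s) - F (g s) - RtoC (y - s) * (l * a))%C with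
   (l * (g y - g s - RtoC (y - s) * a) + (q (g y) - l) * (g y - g s))%C by ring.
  pose proof (Rabs_pos (y - s)).
  assert (Hgy : Cmod (g y - g s) <= Rabs (y - s) * (Cmod a + 1)).
  { replace (g y - g s)%C with ((g y - g s - RtoC (y - s) * a) + RtoC (y - s) * a)%C by ring.
    eapply Rle_trans; [apply Cmod_triangle|]. rewrite Cmod_mult, Cmod_R. nra. }
  eapply Rle_trans; [apply Cmod_triangle|]. rewrite !Cmod_mult.
  apply Rle_div_r in M1; [|lra].
  assert (T1 : Cmod l * Cmod (g y - g s - RtoC (y - s) * a) <= eps / 2 * Rabs (y - s)).
  { eapply Rle_trans; [apply Rmult_le_compat_l; [lra|exact K1]|].
    rewrite <- Rmult_assoc. apply Rmult_le_compat_r; nra. }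
  assert (T2 : Cmod (q (g y) - l) * Cmod (g y - g s) <= eps / 2 / (Cmod a + 1) * (Rabs (y - s) * (Cmod a + 1))).
  { apply Rmult_le_compat; try apply Cmod_ge_0; lra. }
  replace (eps / 2 / (Cmod a + 1) * (Rabs (y - s) * (Cmod a + 1))) with (eps / 2 * Rabs (y - s)) in T2 by (field; lra).
  lra.
Qed.

(** Continuity of the derivative is built in: Cauchy's theorem is obtained by exchanging integrals
    of an expression that contains h', and no Goursat argument is made. *)
Definition holo (U : C -> Prop) (h : C -> C) : Prop :=
  exists h' : C -> C, forall z, U z -> Cdiff h z (h' z) /\ Ccont h' z.

Lemma holo_cont (U : C -> Prop) (h : C -> C) (z : C) : holo U h -> U z -> Ccont h z.
Proof. intros [h' H] Hz. eapply Cdiff_cont. now apply H. Qed.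

Lemma holo_const (U : C -> Prop) (c : C) : holo U (fun _ => c).
Proof. exists (fun _ => RtoC 0). intros z _. split; [apply Cdiff_const|apply Ccont_const]. Qed.

Lemma holo_id (U : C -> Prop) : holo U (fun z => z).
Proof. exists (fun _ => RtoC 1). intros z _. split; [apply Cdiff_id|apply Ccont_const]. Qed.

Lemma holo_plus (U : C -> Prop) (f g : C -> C) : holo U f -> holo U g -> holo U (fun z => f z + g z)%C.
Proof.
  intros [f' Hf] [g' Hg]. exists (fun z => f' z + g' z)%C. intros z Hz.
  destruct (Hf z Hz), (Hg z Hz). split; [now apply Cdiff_plus|now apply (Ccont_plus (U := C_UniformSpace))].
Qed.

Lemma holo_mult (U : C -> Prop) (f g : C -> C) : holo U f -> holo U g -> holo U (fun z => f z * g z)%C.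
Proof.
  intros [f' Hf] [g' Hg]. exists (fun z => f' z * g z + f z * g' z)%C. intros z Hz.
  destruct (Hf z Hz) as [F1 F2], (Hg z Hz) as [G1 G2]. split; [now apply Cdiff_mult|].
  pose proof (Cdiff_cont _ _ _ F1). pose proof (Cdiff_cont _ _ _ G1).
  apply (Ccont_plus (U := C_UniformSpace)); now apply (Ccont_mult (U := C_UniformSpace)).
Qed.

Lemma holo_comp (U V : C -> Prop) (f g : C -> C) :
  holo V f -> holo U g -> (forall z, U z -> V (g z)) -> holo U (fun z => f (g z)).
Proof.
  intros [f' Hf] [g' Hg] HUV. exists (fun z => f' (g z) * g' z)%C. intros z Hz.
  destruct (Hf _ (HUV z Hz)) as [F1 F2], (Hg z Hz) as [G1 G2]. split; [now apply Cdiff_comp|].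
  apply (Ccont_mult (U := C_UniformSpace)); [|assumption].
  apply (Ccont_comp_C (U := C_UniformSpace)); [now apply Cdiff_cont in G1|assumption].
Qed.

Lemma holo_ext (U : C -> Prop) (f g : C -> C) : (forall z, f z = g z) -> holo U f -> holo U g.
Proof.
  intros E [f' Hf]. exists f'. intros z Hz. destruct (Hf z Hz) as [(q & H1 & H2) H3].
  split; [|exact H3]. exists q. split; [|exact H2]. intros w. rewrite <- !E. apply H1.
Qed.

Lemma holo_opp (U : C -> Prop) (f : C -> C) : holo U f -> holo U (fun z => - f z)%C.
Proof.
  intros H. apply (holo_ext U (fun z => RtoC (-1) * f z)%C).
  - intros z. apply C_ext; unfold Re, Im; simpl; ring.
  - apply holo_mult; [apply holo_const|exact H].
Qed.

Lemma holo_minus (U : C -> Prop) (f g : C -> C) : holo U f -> holo U g -> holo U (fun z => f z - g z)%C.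
Proof. intros Hf Hg. apply holo_plus; [exact Hf|]. now apply holo_opp. Qed.

Lemma holo_pow (U : C -> Prop) (f : C -> C) (n : nat) : holo U f -> holo U (fun z => f z ^ n)%C.
Proof.
  intros H. induction n; [exact (holo_const U 1)|]. apply (holo_ext U (fun z => f z * f z ^ n)%C); [reflexivity|].
  now apply holo_mult.
Qed.

Lemma holo_inv (U : C -> Prop) (f : C -> C) :
  holo U f -> (forall z, U z -> f z <> 0) -> holo U (fun z => / f z)%C.
Proof.
  intros Hf H0. apply (holo_comp U (fun z => z <> 0) Cinv f); auto.
  exists (fun z => - / (z * z))%C. intros z Hz. split; [now apply Cdiff_inv|].
  apply (Ccont_opp (U := C_UniformSpace)). apply (Ccont_inv (U := C_UniformSpace)); [|now apply Cmult_neq_0].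
  apply (Ccont_mult (U := C_UniformSpace)); apply continuous_id.
Qed.

Lemma holo_quad (U : C -> Prop) (h h' : C -> C) :
  (forall z, U z -> exists d K, 0 < d /\ 0 <= K /\ forall w, Cmod (w - z) < d ->
     Cmod (h w - h z - h' z * (w - z)) <= K * (Cmod (w - z) * Cmod (w - z)) /\
     Cmod (h' w - h' z) <= K * Cmod (w - z)) -> holo U h.
Proof.
  intros H. exists h'. intros z Hz. destruct (H z Hz) as (d & K & Hd & HK & Hw). split.
  - apply (Cdiff_quad _ _ _ K d); auto. intros w Hww. now apply Hw.
  - apply (continuous_C_eps (U := C_UniformSpace)). intros eps He.
    assert (Hq : 0 < Rmin d (eps / (K + 1))) by (apply Rmin_pos; [|apply Rdiv_lt_0_compat]; lra).
    generalize (locally_Cmod z _ Hq). apply filter_imp. intros w Hww.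
    pose proof (Rmin_l d (eps / (K + 1))). pose proof (Rmin_r d (eps / (K + 1))) as K2.
    eapply Rle_lt_trans; [apply Hw; lra|].
    apply Rlt_le_trans with (r2 := (eps / (K + 1)) * (K + 1)); [|right; field; lra].
    pose proof (Cmod_ge_0 (w - z)). set (e := eps / (K + 1)) in *.
    assert (0 < e) by (apply Rdiv_lt_0_compat; lra). nra.
Qed.

(** * Local primitives and Cauchy's theorem *)

Definition segm (z w : C) (s : R) : C := (z + RtoC s * (w - z))%C.

Definition convexC (U : C -> Prop) : Prop :=
  forall z w s, U z -> U w -> 0 <= s <= 1 -> U (segm z w s).

Definition openC (U : C -> Prop) : Prop :=
  forall z, U z -> exists d, 0 < d /\ forall w, Cmod (w - z) < d -> U w.

Lemma Rderive_segm (z w : C) (s : R) : Rderive (segm z w) s (w - z)%C.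
Proof.
  unfold segm. eapply Rderive_eq.
  - apply Rderive_plus; [apply Rderive_const|]. apply (Rderive_mult (fun s => RtoC s) (fun _ => (w - z)%C));
    [apply Rderive_id|apply Rderive_const].
  - cring.
Qed.

Lemma segm_cont (z w : C) (s : R) : Ccont (segm z w) s.
Proof. eapply Rderive_cont, Rderive_segm. Qed.

Section Primitive.
Variables (U : C -> Prop) (h : C -> C) (c : C).
Hypotheses (HUc : convexC U) (HUo : openC U) (Hc : U c) (Hh : holo U h).

Definition prim (z : C) : C := CI (fun s => h (segm c z s) * (z - c))%C 0 1.

(** Cauchy's theorem for the triangle with vertices c, z0, z1. The map [Gam] sweeps the triangle,
    and [m] is the s-derivative of h(Gam) s (z1 - z0) as well as the t-derivative of h(Gam) (segm z0
    z1 t - c). Integrating [m] over the unit square in the two orders gives the two sides. *)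
Lemma prim_diff (z0 z1 : C) : U z0 -> U z1 ->
  (prim z1 - prim z0)%C = CI (fun s => h (segm z0 z1 s) * (z1 - z0))%C 0 1.
Proof.
  intros H0 H1. destruct Hh as [h' Hh'].
  pose (Gam := fun t s : R => segm c (segm z0 z1 t) s).
  assert (HG : forall t s, 0 <= t <= 1 -> 0 <= s <= 1 -> U (Gam t s)).
  { intros t s Ht Hs. apply HUc; auto. }
  pose (m := fun t s : R => (h' (Gam t s) * (RtoC s * (z1 - z0)) * (segm z0 z1 t - c) + h (Gam t s) * (z1 - z0))%C).
  assert (GC : forall t s, Ccont (fun q : R * R => Gam (fst q) (snd q)) (t, s)).
  { intros t s. unfold Gam, segm. 
    assert (C1 : Ccont (fun q : R * R => RtoC (fst q)) (t, s)) by (apply Ccont_RtoC, continuous_fst).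
    assert (C2 : Ccont (fun q : R * R => RtoC (snd q)) (t, s)) by (apply Ccont_RtoC, continuous_snd).
    ccont. }
  assert (mC : forall t s, 0 <= t <= 1 -> 0 <= s <= 1 -> Ccont2 m t s).
  { intros t s Ht Hs. unfold m. specialize (HG t s Ht Hs). specialize (GC t s).
    destruct (Hh' _ HG) as [D1 D2]. apply Cdiff_cont in D1.
    assert (C1 : Ccont (fun q : R * R => RtoC (fst q)) (t, s)) by (apply Ccont_RtoC, continuous_fst).
    assert (C2 : Ccont (fun q : R * R => RtoC (snd q)) (t, s)) by (apply Ccont_RtoC, continuous_snd).
    assert (C3 : Ccont (fun q : R * R => h (Gam (fst q) (snd q))) (t, s)) by (apply Ccont_comp_C; auto).
    assert (C4 : Ccont (fun q : R * R => h' (Gam (fst q) (snd q))) (t, s)) by (apply Ccont_comp_C; auto).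
    unfold segm at 1. ccont. }
  pose proof (CI_Fubini_rect m 0 1 0 1 Rle_0_1 Rle_0_1 mC) as HF.
  assert (E1 : CI (fun t => CI (m t) 0 1) 0 1 = CI (fun s => h (segm z0 z1 s) * (z1 - z0))%C 0 1).
  { apply CI_ext. intros t Ht. rewrite Rmin_left, Rmax_right in Ht by lra.
    apply CI_unique.
    eapply is_CI_eq; [apply (FTC_C (fun s => h (Gam t s) * (RtoC s * (z1 - z0)))%C)|].
    - intros s Hs. rewrite Rmin_left, Rmax_right in Hs by lra.
      assert (HU : U (Gam t s)) by (apply HG; lra).
      eapply Rderive_eq; [apply Rderive_mult|].
      + apply (Cdiff_chain h (Gam t)); [apply Hh'; exact HU|apply Rderive_segm].
      + apply (Rderive_mult (fun s => RtoC s) (fun _ => (z1 - z0)%C)); [apply Rderive_id|apply Rderive_const].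
      + unfold m. cring.
    - intros s Hs. rewrite Rmin_left, Rmax_right in Hs by lra.
      apply (Ccont2_slice m). apply mC; lra.
    - unfold Gam, segm. replace (c + 1 * (z0 + t * (z1 - z0) - c))%C with (z0 + t * (z1 - z0))%C by ring. ring. }
  assert (E2 : CI (fun s => CI (fun t => m t s) 0 1) 0 1 = (prim z1 - prim z0)%C).
  { apply CI_unique.
    assert (HE : forall z, U z -> ex_CI (fun s => h (segm c z s) * (z - c))%C 0 1).
    { intros z Hz. apply ex_CI_cont. intros s Hs. rewrite Rmin_left, Rmax_right in Hs by lra.
      assert (HU : U (segm c z s)) by (apply HUc; auto).
      apply Ccont_mult; [|apply Ccont_const]. apply Ccont_comp_C; [apply segm_cont|].
      eapply Cdiff_cont. now apply Hh'. }
    eapply is_CI_ext; [|apply is_CI_minus; apply CI_correct, HE; assumption].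
    intros s Hs. rewrite Rmin_left, Rmax_right in Hs by lra. simpl. symmetry. apply CI_unique.
    eapply is_CI_eq; [apply (FTC_C (fun t => h (Gam t s) * (segm z0 z1 t - c))%C)|].
    - intros t Ht. rewrite Rmin_left, Rmax_right in Ht by lra.
      assert (HU : U (Gam t s)) by (apply HG; lra).
      assert (HS : Rderive (fun t => segm z0 z1 t - c)%C t (z1 - z0)%C).
      { eapply Rderive_eq; [apply Rderive_minus; [apply Rderive_segm|apply Rderive_const]|]. cring. }
      eapply Rderive_eq; [apply Rderive_mult; [|exact HS]|].
      + apply (Cdiff_chain h (fun t => Gam t s) t (h' (Gam t s)) (RtoC s * (z1 - z0))%C); [apply Hh'; exact HU|].
        unfold Gam. change (fun t0 => segm c (segm z0 z1 t0) s) with (fun t0 => c + RtoC s * (segm z0 z1 t0 - c))%C.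
        eapply Rderive_eq; [apply Rderive_plus; [apply Rderive_const|apply Rderive_mult; [apply Rderive_const|exact HS]]|].
        cring.
      + unfold m. cring.
    - intros t Ht. rewrite Rmin_left, Rmax_right in Ht by lra.
      apply (Ccont2_slice (fun s t => m t s)). apply Ccont2_swap. apply mC; lra.
    - unfold Gam. replace (segm z0 z1 1) with z1 by (unfold segm; ring).
      replace (segm z0 z1 0) with z0 by (unfold segm; ring). reflexivity. }
  rewrite <- E1, <- E2. symmetry. exact HF.
Qed.

Lemma prim_Cdiff (z : C) : U z -> Cdiff prim z (h z).
Proof.
  intros Hz. apply Cdiff_eps. intros eps He.
  destruct (HUo z Hz) as (d1 & Hd1 & K1).
  pose proof (proj1 (continuous_C_eps (U := C_UniformSpace) _ _) (holo_cont U h z Hh Hz) eps He) as HC.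
  destruct (locally_Cmod_inv _ _ HC) as (d2 & Hd2 & K2).
  exists (Rmin d1 d2). split; [now apply Rmin_pos|]. intros w Hw.
  pose proof (Rmin_l d1 d2). pose proof (Rmin_r d1 d2).
  assert (Uw : U w) by (apply K1; lra).
  rewrite (prim_diff z w Hz Uw).
  assert (HS : forall s, 0 <= s <= 1 -> U (segm z w s)) by (intros; apply HUc; auto).
  assert (Hex : is_CI (fun s => h (segm z w s) * (w - z))%C 0 1 (CI (fun s => h (segm z w s) * (w - z))%C 0 1)).
  { apply CI_correct, ex_CI_cont. intros s Hs. rewrite Rmin_left, Rmax_right in Hs by lra.
    apply Ccont_mult; [|apply Ccont_const]. apply Ccont_comp_C; [apply segm_cont|].
    apply (holo_cont U); auto. }
  pose proof (is_CI_minus _ _ _ _ _ _ Hex (is_CI_const (h z * (w - z))%C 0 1)) as HI.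
  replace (RtoC (1 - 0) * (h z * (w - z)))%C with (h z * (w - z))%C in HI
    by (apply C_ext; unfold Re, Im; simpl; ring).
  replace (eps * Cmod (w - z)) with ((1 - 0) * (eps * Cmod (w - z))) by ring.
  eapply is_CI_norm_const; [lra| |exact HI].
  intros s Hs. simpl.
  replace (h (segm z w s) * (w - z) - h z * (w - z))%C with ((h (segm z w s) - h z) * (w - z))%C by ring.
  rewrite Cmod_mult. apply Rmult_le_compat_r; [apply Cmod_ge_0|]. left. apply K2.
  unfold segm. replace (z + s * (w - z) - z)%C with (RtoC s * (w - z))%C by ring.
  rewrite Cmod_mult, Cmod_R, Rabs_pos_eq by lra. pose proof (Cmod_ge_0 (w - z)). nra.
Qed.

End Primitive.

Theorem holo_primitive (U : C -> Prop) (h : C -> C) (c : C) :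
  convexC U -> openC U -> U c -> holo U h -> exists H, forall z, U z -> Cdiff H z (h z).
Proof. intros. exists (prim h c). intros. now apply (prim_Cdiff U). Qed.

Lemma is_CI_primitive (U : C -> Prop) (h H : C -> C) (g g' : R -> C) (a b : R) :
  holo U h -> (forall z, U z -> Cdiff H z (h z)) ->
  (forall s, Rmin a b <= s <= Rmax a b -> U (g s) /\ Rderive g s (g' s) /\ Ccont g' s) ->
  is_CI (fun s => h (g s) * g' s)%C a b (H (g b) - H (g a))%C.
Proof.
  intros Hh HH Hg. apply (FTC_C (fun s => H (g s))).
  - intros s Hs. destruct (Hg s Hs) as (H1 & H2 & H3). apply Cdiff_chain; auto.
  - intros s Hs. destruct (Hg s Hs) as (H1 & H2 & H3). apply Ccont_mult; [|exact H3].
    apply Ccont_comp_C; [now apply Rderive_cont in H2|]. now apply (holo_cont U).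
Qed.

(** * Estimates for the exponential function *)

Lemma exp_le_exp (a b : R) : a <= b -> exp a <= exp b.
Proof. intros [H| ->]; [left; now apply exp_increasing|apply Rle_refl]. Qed.

(** Writing the increment as an integral along a segment yields the Lipschitz and Taylor bounds
    below with a constant that depends only on an upper bound for the real parts. In the transforms
    over the half line this bound is 0, uniformly in the integration variable. *)
Lemma Cexp_segm_int (z w : C) :
  is_CI (fun s => (w - z) * Cexp (segm z w s))%C 0 1 (Cexp w - Cexp z)%C.
Proof.
  eapply is_CI_eq; [apply (FTC_C (fun s => Cexp (segm z w s)))|].
  - intros s _. apply Rderive_exp, Rderive_segm.
  - intros s _. apply Ccont_mult; [apply Ccont_const|]. apply Ccont_exp, segm_cont.
  - simpl. replace (segm z w 1) with w by (unfold segm; ring).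
    replace (segm z w 0) with z by (unfold segm; ring). reflexivity.
Qed.

Lemma segm_Re_le (z w : C) (s K : R) : Re z <= K -> Re w <= K -> 0 <= s <= 1 -> Re (segm z w s) <= K.
Proof. intros. unfold segm, Re in *; simpl in *. nra. Qed.

Lemma Cexp_lip (z w : C) (K : R) : Re z <= K -> Re w <= K ->
  Cmod (Cexp w - Cexp z) <= exp K * Cmod (w - z).
Proof.
  intros Hz Hw. replace (exp K * Cmod (w - z)) with ((1 - 0) * (exp K * Cmod (w - z))) by ring.
  eapply is_CI_norm_const; [lra| |apply Cexp_segm_int].
  intros s Hs. simpl. rewrite Cmod_mult, Cmod_Cexp, Rmult_comm.
  apply Rmult_le_compat_r; [apply Cmod_ge_0|]. apply exp_le_exp. now apply segm_Re_le.
Qed.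

Lemma Cexp_taylor (z w : C) (K : R) : Re z <= K -> Re w <= K ->
  Cmod (Cexp w - Cexp z - (w - z) * Cexp z) <= exp K * (Cmod (w - z) * Cmod (w - z)).
Proof.
  intros Hz Hw. replace (exp K * (Cmod (w - z) * Cmod (w - z))) with ((1 - 0) * (exp K * (Cmod (w - z) * Cmod (w - z)))) by ring.
  pose proof (is_CI_minus _ _ _ _ _ _ (Cexp_segm_int z w) (is_CI_const ((w - z) * Cexp z)%C 0 1)) as HI.
  replace (RtoC (1 - 0) * ((w - z) * Cexp z))%C with ((w - z) * Cexp z)%C in HI
    by (replace (1 - 0) with 1 by ring; ring).
  eapply is_CI_norm_const; [lra| |exact HI].
  intros s Hs. simpl.
  replace ((w - z) * Cexp (segm z w s) - (w - z) * Cexp z)%C with ((w - z) * (Cexp (segm z w s) - Cexp z))%C by ring.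
  rewrite Cmod_mult, (Rmult_comm (exp K)), Rmult_assoc. apply Rmult_le_compat_l; [apply Cmod_ge_0|].
  eapply Rle_trans; [apply (Cexp_lip _ _ K); auto; now apply segm_Re_le|].
  rewrite (Rmult_comm (Cmod (w - z))). apply Rmult_le_compat_l; [left; apply exp_pos|].
  unfold segm. replace (z + s * (w - z) - z)%C with (RtoC s * (w - z))%C by ring.
  rewrite Cmod_mult, Cmod_R, Rabs_pos_eq by lra. pose proof (Cmod_ge_0 (w - z)). nra.
Qed.

Lemma holo_Cexp (U : C -> Prop) : holo U Cexp.
Proof.
  apply (holo_quad U Cexp Cexp). intros z _. exists 1, (exp (Re z + 1)).
  split; [lra|]. split; [left; apply exp_pos|]. intros w Hw.
  assert (Hr : Re w <= Re z + 1).
  { pose proof (Re_le_Cmod (w - z)) as H. pose proof (Rle_abs (Re (w - z))).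
    replace (Re (w - z)) with (Re w - Re z) in * by (unfold Re; simpl; ring). lra. }
  split; [|apply Cexp_lip; lra].
  replace (Cexp z * (w - z))%C with ((w - z) * Cexp z)%C by ring. apply Cexp_taylor; lra.
Qed.

Lemma holo_exp (U : C -> Prop) (f : C -> C) : holo U f -> holo U (fun z => Cexp (f z)).
Proof. intros H. apply (holo_comp U (fun _ => True) Cexp f); auto. apply holo_Cexp. Qed.

(** * Improper integrals *)

(** The one integrable majorant used throughout: its integral beyond A is at most 1/A, which gives
    explicit rates for all truncations. *)
Definition phi (x : R) : R := / (1 + x * x).

Lemma phi_pos (x : R) : 0 < phi x.
Proof. apply Rinv_0_lt_compat. nra. Qed.

Lemma phi_le_1 (x : R) : phi x <= 1.
Proof. unfold phi. rewrite <- Rinv_1. apply Rinv_le_contravar; nra. Qed.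

Lemma phi_opp (x : R) : phi (- x) = phi x.
Proof. unfold phi. f_equal. ring. Qed.

Lemma is_RInt_inv_sqr (a b : R) : 0 < a -> a <= b -> is_RInt (fun x => / (x * x)) a b (/ a - / b).
Proof.
  intros Ha Hab.
  replace (/ a - / b) with (minus (- / b) (- / a)) by (unfold minus, plus, opp; simpl; ring).
  apply (is_RInt_derive (V := R_CompleteNormedModule) (fun x => - / x)).
  - intros x Hx. rewrite Rmin_left, Rmax_right in Hx by lra. auto_derive; [lra|]. field. lra.
  - intros x Hx. rewrite Rmin_left, Rmax_right in Hx by lra.
    apply (ex_derive_continuous (V := R_NormedModule)). auto_derive. nra.
Qed.

Lemma CI_tail (f : R -> C) (M a b : R) (v : C) : 0 <= M -> 0 < a -> a <= b ->
  (forall x, a <= x <= b -> Cmod (f x) <= M * phi x) -> is_CI f a b v -> Cmod v <= M / a.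
Proof.
  intros HM Ha Hab Hf Hv.
  apply Rle_trans with (M * (/ a - / b)).
  - eapply (is_CI_norm f (fun x => M * / (x * x)) a b); [exact Hab| |exact Hv|].
    + intros x Hx. eapply Rle_trans; [now apply Hf|]. apply Rmult_le_compat_l; [exact HM|].
      apply Rinv_le_contravar; nra.
    + apply (is_RInt_scal (V := R_NormedModule)). now apply is_RInt_inv_sqr.
  - unfold Rdiv. apply Rmult_le_compat_l; [exact HM|].
    assert (0 < / b) by (apply Rinv_0_lt_compat; lra). lra.
Qed.

(** The factor 2 is the sum of 1 from [0, 1], where [phi] is at most 1, and 1 from the tail beyond
    1. *)
Lemma CI_dom (f : R -> C) (M b : R) (v : C) : 0 <= M -> 0 <= b ->
  (forall x, Ccont f x) ->
  (forall x, 0 <= x <= b -> Cmod (f x) <= M * phi x) -> is_CI f 0 b v -> Cmod v <= 2 * M.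
Proof.
  intros HM Hb Hc Hf Hv.
  assert (Hf1 : forall x, 0 <= x <= b -> Cmod (f x) <= M).
  { intros x Hx. eapply Rle_trans; [now apply Hf|]. pose proof (phi_le_1 x). nra. }
  destruct (Rle_lt_dec b 1) as [H1|H1].
  - pose proof (is_CI_norm_const f M 0 b v Hb Hf1 Hv). nra.
  - assert (K1 : is_CI f 0 1 (CI f 0 1)) by (apply CI_correct, ex_CI_cont; auto).
    assert (K2 : is_CI f 1 b (CI f 1 b)) by (apply CI_correct, ex_CI_cont; auto).
    rewrite (is_CI_inj _ _ _ _ _ Hv (is_CI_Chasles _ _ _ _ _ _ K1 K2)).
    eapply Rle_trans; [apply Cmod_triangle|].
    assert (Cmod (CI f 0 1) <= (1 - 0) * M) by (apply (is_CI_norm_const f M 0 1); auto; [lra|intros; apply Hf1; lra]).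
    assert (Cmod (CI f 1 b) <= M / 1) by (apply (CI_tail f M 1 b); auto; try lra; intros; apply Hf; lra).
    lra.
Qed.

Definition is_I0 (f : R -> C) (v : C) : Prop := is_CRInt_gen f (at_point 0) (Rbar_locally p_infty) v.
Definition I0 (f : R -> C) : C := CRInt_halfline f.

Lemma is_I0_eps (f : R -> C) (v : C) :
  is_I0 f v <-> forall eps, 0 < eps -> exists B, forall b, B <= b ->
    exists z : C, is_CI f 0 b z /\ Cmod (z - v) < eps.
Proof.
  split.
  - intros H eps He. specialize (H _ (locally_Cmod v eps He)). unfold filtermapi in H.
    destruct H as [Q W HQ HW H]. unfold at_point in HQ. destruct HW as [B HB].
    exists (B + 1). intros b Hb. specialize (H 0 b HQ (HB b ltac:(lra))). exact H.
  - intros H P HP. destruct (locally_Cmod_inv _ _ HP) as (e & He & K).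
    destruct (H e He) as [B HB]. unfold filtermapi.
    apply (Filter_prod _ _ _ (fun a => a = 0) (fun b => B <= b)).
    + reflexivity.
    + exists B. intros; lra.
    + intros a b -> Hb. simpl. destruct (HB b Hb) as (z & Hz1 & Hz2). exists z. auto.
Qed.

Lemma I0_unique (f : R -> C) (v : C) : is_I0 f v -> I0 f = v.
Proof.
  intros H. unfold I0, CRInt_halfline.
  apply (is_RInt_gen_unique (V := C_R_CompleteNormedModule) (Fa := at_point 0) (Fb := Rbar_locally p_infty) f v H).
Qed.

Lemma is_I0_inj (f : R -> C) (v w : C) : is_I0 f v -> is_I0 f w -> v = w.
Proof. intros H1 H2. rewrite <- (I0_unique _ _ H1). now apply I0_unique. Qed.

Lemma is_I0_eq (f : R -> C) (v w : C) : is_I0 f v -> v = w -> is_I0 f w.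
Proof. now intros H <-. Qed.

Lemma is_I0_ext (f g : R -> C) (v : C) : (forall x, 0 < x -> f x = g x) -> is_I0 f v -> is_I0 g v.
Proof.
  rewrite !is_I0_eps. intros E H eps He. destruct (H eps He) as [B HB].
  exists (Rmax 0 B). intros b Hb. pose proof (Rmax_l 0 B). pose proof (Rmax_r 0 B).
  destruct (HB b ltac:(lra)) as (z & Hz1 & Hz2). exists z. split; [|exact Hz2].
  eapply is_CI_ext; [|exact Hz1]. intros x Hx. rewrite Rmin_left in Hx by lra. apply E. lra.
Qed.

Lemma is_I0_plus (f g : R -> C) (v w : C) : is_I0 f v -> is_I0 g w -> is_I0 (fun x => f x + g x)%C (v + w)%C.
Proof.
  intros Hf Hg.
  exact (is_RInt_gen_plus (V := C_R_NormedModule) (Fa := at_point 0) (Fb := Rbar_locally p_infty) f g v w Hf Hg).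
Qed.

Lemma is_I0_scal (c : C) (f : R -> C) (v : C) : is_I0 f v -> is_I0 (fun x => c * f x)%C (c * v)%C.
Proof.
  rewrite !is_I0_eps. intros H eps He. pose proof (Cmod_ge_0 c).
  destruct (H (eps / (Cmod c + 1))) as [B HB]; [apply Rdiv_lt_0_compat; lra|].
  exists B. intros b Hb. destruct (HB b Hb) as (z & Hz1 & Hz2). exists (c * z)%C.
  split; [now apply is_CI_scal|].
  replace (c * z - c * v)%C with (c * (z - v))%C by ring. rewrite Cmod_mult.
  apply Rlt_div_r in Hz2; [|lra]. pose proof (Cmod_ge_0 (z - v)). nra.
Qed.

Lemma is_I0_minus (f g : R -> C) (v w : C) : is_I0 f v -> is_I0 g w -> is_I0 (fun x => f x - g x)%C (v - w)%C.
Proof.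
  intros Hf Hg. apply (is_I0_ext (fun x => f x + RtoC (-1) * g x)%C).
  - intros x _. apply C_ext; unfold Re, Im; simpl; ring.
  - replace (v - w)%C with (v + RtoC (-1) * w)%C by (apply C_ext; unfold Re, Im; simpl; ring).
    apply is_I0_plus; [exact Hf|]. now apply is_I0_scal.
Qed.

Lemma small_eq_0 (z : C) (K : R) : (forall A, 1 <= A -> Cmod z <= K / A) -> z = RtoC 0.
Proof.
  intros H. apply NNPP. intros Hz. apply Cmod_gt_0 in Hz.
  pose proof (Rle_abs K).
  assert (HA : 1 <= Rmax 1 ((Rabs K + 1) / Cmod z)) by apply Rmax_l.
  specialize (H _ HA). pose proof (Rmax_r 1 ((Rabs K + 1) / Cmod z)) as H2.
  set (A := Rmax 1 _) in *. apply Rle_div_r in H; [|lra]. apply Rle_div_l in H2; lra.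
Qed.

Lemma dom_M_pos (f : R -> C) (M : R) : (forall x, 0 <= x -> Cmod (f x) <= M * phi x) -> 0 <= M.
Proof.
  intros Hb. pose proof (Hb 0 (Rle_refl 0)) as H. pose proof (Cmod_ge_0 (f 0)). pose proof (phi_pos 0). nra.
Qed.

(** Only integrability on bounded intervals is asked for, since the integrands along the contour may
    jump at the parameter of the corner. *)
Lemma ex_I0_dom (f : R -> C) (M : R) : (forall a b, ex_CI f a b) ->
  (forall x, 0 <= x -> Cmod (f x) <= M * phi x) -> exists v, is_I0 f v.
Proof.
  intros Hf HfM. pose proof (dom_M_pos f M HfM) as HM0.
  assert (Hlim : exists v, filterlim (fun b => CI f 0 b) (Rbar_locally p_infty) (locally (T := C_UniformSpace) v)).
  { apply (filterlim_locally_cauchy (U := CompleteNormedModule.CompleteSpace _ C_R_CompleteNormedModule)). intros eps.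
    pose proof (cond_pos eps) as Hep.
    assert (Hq : 0 < (M + 1) / (eps / 2)) by (apply Rdiv_lt_0_compat; lra).
    exists (fun b => (M + 1) / (eps / 2) < b). split; [now exists ((M + 1) / (eps / 2))|].
    assert (S : forall u v, (M + 1) / (eps / 2) < u -> u <= v -> Cmod (CI f 0 v - CI f 0 u) < eps).
    { intros u v Hu Huv.
      pose proof (is_CI_Chasles _ _ _ _ _ _ (is_CI_swap _ _ _ _ (CI_correct _ _ _ (Hf 0 u))) (CI_correct _ _ _ (Hf 0 v))) as K3.
      replace (CI f 0 v - CI f 0 u)%C with (- CI f 0 u + CI f 0 v)%C by ring.
      eapply Rle_lt_trans; [apply (CI_tail f M u v _ HM0 ltac:(lra) Huv); [|exact K3]|].
      - intros x Hx. apply HfM. lra.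
      - assert (0 < u) by lra. apply Rlt_div_l in Hu; [|lra]. apply Rlt_div_l; [lra|]. nra. }
    assert (BC : forall z w : C, Cmod (w - z) < eps -> ball (M := C_UniformSpace) z eps w).
    { intros z w H. pose proof (Re_le_Cmod (w - z)). pose proof (Im_le_Cmod (w - z)).
      unfold Re, Im in *; simpl in *.
      split; unfold ball; simpl; unfold AbsRing_ball, abs, minus, plus, opp; simpl; lra. }
    intros u v Hu Hv. apply BC. destruct (Rle_lt_dec u v).
    - now apply S.
    - rewrite Cmod_minus_sym. apply S; lra. }
  destruct Hlim as [v Hv]. exists v. apply is_I0_eps. intros eps He. specialize (Hv _ (locally_Cmod v eps He)).
  destruct Hv as [B HB]. exists (B + 1). intros b Hb'. exists (CI f 0 b). split; [apply CI_correct, Hf|apply HB; lra].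
Qed.

Section Dom.
Variables (f : R -> C) (M : R).
Hypotheses (Hc : forall x, Ccont f x) (Hb : forall x, 0 <= x -> Cmod (f x) <= M * phi x).

Lemma is_I0_dom : is_I0 f (I0 f).
Proof.
  destruct (ex_I0_dom f M) as [v H]; [intros; apply ex_CI_cont; auto|exact Hb|].
  rewrite (I0_unique _ _ H). exact H.
Qed.

Lemma I0_tail (A : R) : 0 < A -> Cmod (I0 f - CI f 0 A) <= M / A.
Proof.
  intros HA. apply le_epsilon. intros eps He.
  destruct (proj1 (is_I0_eps _ _) is_I0_dom eps He) as [B HB].
  destruct (HB (Rmax A B) (Rmax_r _ _)) as (z & Hz1 & Hz2).
  pose proof (Rmax_l A B) as HAB.
  assert (K1 : is_CI f 0 A (CI f 0 A)) by (apply CI_correct, ex_CI_cont; auto).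
  pose proof (is_CI_Chasles _ _ _ _ _ _ (is_CI_swap _ _ _ _ K1) Hz1) as K3.
  assert (Cmod (- CI f 0 A + z) <= M / A).
  { apply (CI_tail f M A (Rmax A B) _ (dom_M_pos f M Hb) HA HAB); [|exact K3]. intros x Hx. apply Hb. lra. }
  replace (I0 f - CI f 0 A)%C with ((- CI f 0 A + z) - (z - I0 f))%C by ring.
  eapply Rle_trans; [apply Cmod_triangle_minus|]. lra.
Qed.

Lemma I0_bound : Cmod (I0 f) <= 2 * M.
Proof.
  apply le_epsilon. intros eps He.
  destruct (proj1 (is_I0_eps _ _) is_I0_dom eps He) as [B HB].
  destruct (HB (Rmax 0 B) (Rmax_r _ _)) as (z & Hz1 & Hz2).
  pose proof (Rmax_l 0 B) as HAB.
  assert (Cmod z <= 2 * M) by (apply (CI_dom f M (Rmax 0 B) _ (dom_M_pos f M Hb) HAB Hc); [intros; apply Hb; lra|exact Hz1]).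
  replace (I0 f) with (z - (z - I0 f))%C by ring.
  eapply Rle_trans; [apply Cmod_triangle_minus|]. lra.
Qed.

End Dom.

Lemma I0_ext (f g : R -> C) (M : R) : (forall x, Ccont f x) -> (forall x, 0 <= x -> Cmod (f x) <= M * phi x) ->
  (forall x, 0 < x -> f x = g x) -> I0 f = I0 g.
Proof.
  intros H1 H2 E. symmetry. apply I0_unique. apply (is_I0_ext f); auto. now apply (is_I0_dom f M).
Qed.

(** The tail bound M/A is uniform in the parameter, so continuity follows from that of the integral
    over [0, A], with one third of eps for each tail and one for the middle. *)
Lemma I0_param_cont {P : UniformSpace} (f : P -> R -> C) (M : R) (p0 : P) :
  (forall x, 0 <= x -> Ccont2 f p0 x) ->
  locally p0 (fun p => (forall x, Ccont (f p) x) /\ forall x, 0 <= x -> Cmod (f p x) <= M * phi x) ->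
  Ccont (fun p => I0 (f p)) p0.
Proof.
  intros Hj Hl. apply continuous_C_eps. intros eps He.
  destruct (locally_singleton _ _ Hl) as [Hc0 Hb0].
  pose proof (dom_M_pos _ _ Hb0) as HM.
  pose (A := (M + 1) / (eps / 3)).
  assert (HA : 0 < A) by (apply Rdiv_lt_0_compat; lra).
  assert (HMA : M / A < eps / 3).
  { unfold A. apply Rlt_div_l; [exact HA|]. unfold A. replace (eps / 3 * ((M + 1) / (eps / 3))) with (M + 1) by (field; lra). lra. }
  assert (Hcont : Ccont (fun p => CI (f p) 0 A) p0).
  { apply CI_param_cont; [lra|intros; apply Hj; lra|].
    generalize Hl. apply filter_imp. intros p [Hp _]. apply ex_CI_cont. auto. }
  pose proof (proj1 (continuous_C_eps _ _) Hcont (eps / 3) ltac:(lra)) as K.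
  generalize (filter_and _ _ Hl K). apply filter_imp. intros p [[Hc Hb] Hp].
  pose proof (I0_tail _ _ Hc Hb A HA). pose proof (I0_tail _ _ Hc0 Hb0 A HA).
  replace (I0 (f p) - I0 (f p0))%C with
    ((I0 (f p) - CI (f p) 0 A) + ((CI (f p) 0 A - CI (f p0) 0 A) - (I0 (f p0) - CI (f p0) 0 A)))%C by ring.
  eapply Rle_lt_trans; [apply Cmod_triangle|].
  pose proof (Cmod_triangle_minus (CI (f p) 0 A - CI (f p0) 0 A) (I0 (f p0) - CI (f p0) 0 A)). lra.
Qed.

(** Cutting the half line at A changes either side by O(1/A), and the cut integrals agree by
    [CI_Fubini]. Clamping p first makes the bound valid for all parameters. *)
Lemma I0_Fubini_fin (f : R -> R -> C) (M a b : R) : a <= b ->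
  (forall p x, Ccont2 f p x) ->
  (forall p x, a <= p <= b -> 0 <= x -> Cmod (f p x) <= M * phi x) ->
  is_CI (fun p => I0 (f p)) a b (I0 (fun x => CI (fun p => f p x) a b)).
Proof.
  intros Hab Hj Hb.
  assert (HM : 0 <= M) by (apply (dom_M_pos (f a)); intros; apply Hb; lra).
  pose (g := fun p => f (clamp a b p)).
  assert (Hcl : forall p, a <= clamp a b p <= b) by (intros; now apply clamp_in).
  assert (Hgc : forall p x, Ccont2 g p x).
  { intros p x. apply (Ccont2_comp f (fun q => clamp a b (fst q)) (fun q => snd q) (p, x)).
    - apply (continuous_comp (fun q : R * R => fst q) (clamp a b)); [apply continuous_fst|apply clamp_cont].
    - apply continuous_snd.
    - apply Hj. }
  assert (Hgb : forall p x, 0 <= x -> Cmod (g p x) <= M * phi x) by (intros; apply Hb; auto).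
  assert (Hc1 : forall p x, Ccont (g p) x) by (intros; now apply Ccont2_slice).
  assert (Hc2 : forall p x, Ccont (fun q => g q x) p).
  { intros p x. apply (Ccont2_slice (fun y q => g q y)). now apply Ccont2_swap. }
  assert (Hgi : forall p, Ccont (fun q => I0 (g q)) p).
  { intros p. apply (I0_param_cont g M); auto. apply filter_forall. intros q. split; auto. }
  assert (HxC : forall x, Ccont (fun y => CI (fun q => g q y) a b) x).
  { intros x. apply (CI_param_cont (fun y q => g q y)); auto.
    - intros; now apply Ccont2_swap.
    - apply filter_forall. intros y. apply ex_CI_cont; auto. }
  assert (HxB : forall x, 0 <= x -> Cmod (CI (fun q => g q x) a b) <= ((b - a) * M) * phi x).
  { intros x Hx. rewrite Rmult_assoc. eapply (is_CI_norm_const (fun q => g q x)); [exact Hab|intros; now apply Hgb|].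
    apply CI_correct, ex_CI_cont; auto. }
  assert (E : CI (fun p => I0 (g p)) a b = I0 (fun x => CI (fun p => g p x) a b)).
  { assert (Z : (CI (fun p => I0 (g p)) a b - I0 (fun x => CI (fun p => g p x) a b))%C = RtoC 0).
    { apply (small_eq_0 _ (2 * ((b - a) * M))). intros A HA.
      pose proof (I0_tail (fun x => CI (fun p => g p x) a b) _ HxC HxB A ltac:(lra)) as T1.
      rewrite <- (CI_Fubini g a b 0 A Hab ltac:(lra) Hgc) in T1.
      assert (HCA : forall p, Ccont (fun q => CI (g q) 0 A) p).
      { intros p. apply CI_param_cont; auto; [lra|]. apply filter_forall. intros q. apply ex_CI_cont; auto. }
      assert (T2 : Cmod (CI (fun p => I0 (g p)) a b - CI (fun p => CI (g p) 0 A) a b) <= (b - a) * (M / A)).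
      { eapply (is_CI_norm_const (fun p => I0 (g p) - CI (g p) 0 A)%C); [exact Hab| |].
        - intros p Hp. apply I0_tail; auto. lra.
        - apply is_CI_minus; apply CI_correct, ex_CI_cont; auto. }
      match goal with |- Cmod (?u - ?v) <= _ =>
        replace (u - v)%C with ((u - CI (fun p => CI (g p) 0 A) a b) - (v - CI (fun p => CI (g p) 0 A) a b))%C by ring end.
      eapply Rle_trans; [apply Cmod_triangle_minus|].
      replace (2 * ((b - a) * M) / A) with ((b - a) * (M / A) + (b - a) * M / A) by (field; lra). lra. }
    match goal with |- ?u = ?v => replace u with (u - v + v)%C by ring end. rewrite Z. ring. }
  assert (E2 : I0 (fun x => CI (fun p => g p x) a b) = I0 (fun x => CI (fun p => f p x) a b)).
  { apply (I0_ext _ _ _ HxC HxB). intros x Hx. apply CI_ext. intros p Hp.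
    rewrite Rmin_left, Rmax_right in Hp by lra. unfold g. now rewrite clamp_id by lra. }
  rewrite <- E2, <- E.
  eapply is_CI_ext; [|apply CI_correct, ex_CI_cont; auto].
  intros p Hp. rewrite Rmin_left, Rmax_right in Hp by lra. unfold g. now rewrite clamp_id by lra.
Qed.

(** For each b the exchange over 0 <= p <= b is the previous lemma; what remains is at most (M / b)
    [phi] x under the outer integral, so the error is 2M/b. *)
Lemma I0_Fubini (f : R -> R -> C) (M : R) :
  (forall p x, Ccont2 f p x) ->
  (forall p x, 0 <= p -> 0 <= x -> Cmod (f p x) <= M * phi p * phi x) ->
  is_I0 (fun p => I0 (f p)) (I0 (fun x => I0 (fun p => f p x))).
Proof.
  intros Hj Hb.
  assert (HM : 0 <= M).
  { apply (dom_M_pos (fun x => f 0 x)). intros x Hx. replace M with (M * phi 0) by (unfold phi; field). apply Hb; lra. }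
  (* Freezing both variables at 0 keeps the bounds available for negative arguments, where nothing
     is assumed on [f]. *)
  pose (g := fun p x => f (Rmax 0 p) (Rmax 0 x)).
  assert (Hm : forall x, continuous (Rmax 0) x).
  { intros x. apply continuous_R_lip. intros y. unfold Rmax, Rabs. repeat destruct Rle_dec; repeat destruct Rcase_abs; lra. }
  assert (Hmi : forall x, 0 <= x -> Rmax 0 x = x) by (intros; now apply Rmax_right).
  assert (Hm0 : forall x, 0 <= Rmax 0 x) by (intros; apply Rmax_l).
  assert (Hgc : forall p x, Ccont2 g p x).
  { intros p x. apply (Ccont2_comp f (fun q => Rmax 0 (fst q)) (fun q => Rmax 0 (snd q)) (p, x)).
    - apply (continuous_comp (fun q : R * R => fst q) (Rmax 0)); [apply continuous_fst|apply Hm].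
    - apply (continuous_comp (fun q : R * R => snd q) (Rmax 0)); [apply continuous_snd|apply Hm].
    - apply Hj. }
  assert (Hgb : forall p x, 0 <= x -> Cmod (g p x) <= M * phi (Rmax 0 p) * phi x).
  { intros p x Hx. unfold g. rewrite (Hmi x Hx). now apply Hb. }
  assert (Hgb1 : forall p x, 0 <= x -> Cmod (g p x) <= M * phi x).
  { intros p x Hx. eapply Rle_trans; [now apply Hgb|]. pose proof (phi_le_1 (Rmax 0 p)).
    pose proof (phi_pos x). pose proof (phi_pos (Rmax 0 p)).
    apply Rmult_le_compat_r; [lra|]. nra. }
  assert (Hgb2 : forall x p, 0 <= p -> Cmod (g p x) <= M * phi (Rmax 0 x) * phi p).
  { intros x p Hp. unfold g. rewrite (Hmi p Hp). eapply Rle_trans; [now apply Hb|]. right. ring. }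
  assert (Hc1 : forall p x, Ccont (g p) x) by (intros; now apply Ccont2_slice).
  assert (Hc2 : forall p x, Ccont (fun q => g q x) p).
  { intros p x. apply (Ccont2_slice (fun y q => g q y)). now apply Ccont2_swap. }
  assert (HX : forall x, Ccont (fun y => I0 (fun p => g p y)) x).
  { intros x. apply (I0_param_cont (fun y p => g p y) M).
    - intros; now apply Ccont2_swap.
    - apply filter_forall. intros y. split; [auto|]. intros p Hp. eapply Rle_trans; [now apply Hgb2|].
      pose proof (phi_le_1 (Rmax 0 y)). pose proof (phi_pos p). pose proof (phi_pos (Rmax 0 y)).
      apply Rmult_le_compat_r; [lra|]. nra. }
  assert (HXb : forall x, 0 <= x -> Cmod (I0 (fun p => g p x)) <= (2 * M) * phi x).
  { intros x Hx. apply Rle_trans with (2 * (M * phi (Rmax 0 x))); [|rewrite (Hmi x Hx); lra]. apply I0_bound; auto. }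
  assert (E2 : I0 (fun x => I0 (fun p => g p x)) = I0 (fun x => I0 (fun p => f p x))).
  { apply (I0_ext _ _ _ HX HXb). intros x Hx. apply (I0_ext _ _ (M * phi (Rmax 0 x))); auto.
    intros p Hp. unfold g. rewrite !Hmi by lra. reflexivity. }
  rewrite <- E2. apply (is_I0_ext (fun p => I0 (g p))).
  { intros p Hp. apply (I0_ext _ _ (M * phi (Rmax 0 p))); auto.
    intros x Hx. unfold g. rewrite !Hmi by lra. reflexivity. }
  apply is_I0_eps. intros eps He.
  pose (B := (2 * M + 1) / eps).
  assert (HB : 0 < B) by (apply Rdiv_lt_0_compat; lra).
  exists B. intros b Hb'. eexists. split.
  { apply (I0_Fubini_fin g M 0 b); auto. lra. }
  assert (HY : forall x, Ccont (fun y => CI (fun q => g q y) 0 b) x).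
  { intros x. apply (CI_param_cont (fun y q => g q y)); [lra| |].
    - intros; now apply Ccont2_swap.
    - apply filter_forall. intros y. apply ex_CI_cont; auto. }
  assert (HYb : forall x, 0 <= x -> Cmod (CI (fun q => g q x) 0 b) <= (2 * M) * phi x).
  { intros x Hx. apply Rle_trans with (2 * (M * phi (Rmax 0 x))); [|rewrite (Hmi x Hx); lra].
    pose proof (phi_pos (Rmax 0 x)).
    apply (CI_dom (fun q => g q x) (M * phi (Rmax 0 x)) b); auto; try nra.
    - intros q Hq. apply Hgb2. lra.
    - apply CI_correct, ex_CI_cont; auto. }
  pose proof (is_I0_minus _ _ _ _ (is_I0_dom _ _ HX HXb) (is_I0_dom _ _ HY HYb)) as HD.
  rewrite Cmod_minus_sym.
  replace (I0 (fun x => I0 (fun p => g p x)) - I0 (fun x => CI (fun p => g p x) 0 b))%C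
    with (I0 (fun x => I0 (fun p => g p x) - CI (fun p => g p x) 0 b)%C) by (apply I0_unique; exact HD).
  apply Rle_lt_trans with (2 * (M / b)).
  - apply I0_bound.
    + intros x. apply Ccont_minus; auto.
    + intros x Hx. replace (M / b * phi x) with (M * phi (Rmax 0 x) / b) by (rewrite (Hmi x Hx); field; lra).
      apply I0_tail; auto. lra.
  - replace (2 * (M / b)) with (2 * M / b) by (field; lra). apply Rlt_div_l; [lra|].
    unfold B in Hb'. apply Rle_div_l in Hb'; lra.
Qed.

Lemma is_I0_FTC (F f : R -> C) (M : R) :
  (forall b, 0 <= b -> is_CI f 0 b (F b - F 0)%C) ->
  (forall x, 0 <= x -> Cmod (F x) <= M * phi x) -> is_I0 f (- F 0)%C.
Proof.
  intros HF HM. apply is_I0_eps. intros eps He.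
  pose proof (dom_M_pos _ _ HM) as M0.
  pose (B := (M + 1) / eps + 1).
  assert (HB : 0 < (M + 1) / eps) by (apply Rdiv_lt_0_compat; lra).
  exists B. intros b Hb. unfold B in Hb. exists (F b - F 0)%C. split; [apply HF; lra|].
  replace (F b - F 0 - - F 0)%C with (F b) by ring.
  eapply Rle_lt_trans; [apply HM; lra|].
  assert (phi b <= / b). { unfold phi. apply Rinv_le_contravar; nra. }
  apply Rle_lt_trans with (M / b); [unfold Rdiv; apply Rmult_le_compat_l; auto|].
  apply Rlt_div_l; [lra|]. assert ((M + 1) / eps <= b) by lra. apply Rle_div_l in H0; lra.
Qed.

(** * Fourier inversion *)

(** A limit at plus infinity, not a lower limit. It serves for integrals over [-S, S], which need
    not converge as double-ended improper integrals. *)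
Definition lim_inf (F : R -> C) (v : C) : Prop :=
  forall eps, 0 < eps -> exists B, forall S, B <= S -> Cmod (F S - v) < eps.

Lemma lim_inf_plus (F G : R -> C) (v w : C) :
  lim_inf F v -> lim_inf G w -> lim_inf (fun S => F S + G S)%C (v + w)%C.
Proof.
  intros HF HG eps He. destruct (HF (eps / 2) ltac:(lra)) as [B1 H1].
  destruct (HG (eps / 2) ltac:(lra)) as [B2 H2].
  exists (Rmax B1 B2). intros S HS. pose proof (Rmax_l B1 B2). pose proof (Rmax_r B1 B2).
  specialize (H1 S ltac:(lra)). specialize (H2 S ltac:(lra)).
  replace (F S + G S - (v + w))%C with ((F S - v) + (G S - w))%C by ring.
  eapply Rle_lt_trans; [apply Cmod_triangle|]. lra.
Qed.

Lemma lim_inf_scal (c : C) (F : R -> C) (v : C) : lim_inf F v -> lim_inf (fun S => c * F S)%C (c * v)%C.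
Proof.
  intros HF eps He. pose proof (Cmod_ge_0 c).
  destruct (HF (eps / (Cmod c + 1))) as [B H1]; [apply Rdiv_lt_0_compat; lra|].
  exists B. intros S HS. specialize (H1 S HS). apply Rlt_div_r in H1; [|lra].
  replace (c * F S - c * v)%C with (c * (F S - v))%C by ring. rewrite Cmod_mult.
  pose proof (Cmod_ge_0 (F S - v)). nra.
Qed.

Lemma lim_inf_minus (F G : R -> C) (v w : C) :
  lim_inf F v -> lim_inf G w -> lim_inf (fun S => F S - G S)%C (v - w)%C.
Proof.
  intros HF HG eps He.
  destruct (lim_inf_plus _ _ _ _ HF (lim_inf_scal (RtoC (-1)) _ _ HG) eps He) as [B HB].
  exists B. intros S HS. specialize (HB S HS).
  replace (F S - G S - (v - w))%C with (F S + RtoC (-1) * G S - (v + RtoC (-1) * w))%C; [exact HB|].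
  apply C_ext; unfold Re, Im; simpl; ring.
Qed.

Lemma lim_inf_ext (F G : R -> C) (v : C) (B0 : R) :
  (forall S, B0 <= S -> F S = G S) -> lim_inf F v -> lim_inf G v.
Proof.
  intros E HF eps He. destruct (HF eps He) as [B HB]. exists (Rmax B0 B). intros S HS.
  pose proof (Rmax_l B0 B). pose proof (Rmax_r B0 B). rewrite <- E by lra. apply HB. lra.
Qed.

Lemma lim_inf_unique (F : R -> C) (v w : C) : lim_inf F v -> lim_inf F w -> v = w.
Proof.
  intros H1 H2. assert (Z : (v - w)%C = RtoC 0).
  { apply NNPP. intros Hz. apply Cmod_gt_0 in Hz.
    destruct (H1 (Cmod (v - w) / 2) ltac:(lra)) as [B1 K1].
    destruct (H2 (Cmod (v - w) / 2) ltac:(lra)) as [B2 K2].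
    specialize (K1 (Rmax B1 B2) (Rmax_l _ _)). specialize (K2 (Rmax B1 B2) (Rmax_r _ _)).
    rewrite Cmod_minus_sym in K1.
    pose proof (Cmod_triangle (v - F (Rmax B1 B2)) (F (Rmax B1 B2) - w)) as T.
    replace (v - F (Rmax B1 B2) + (F (Rmax B1 B2) - w))%C with (v - w)%C in T by ring. lra. }
  replace v with (v - w + w)%C by ring. rewrite Z. ring.
Qed.

(** * Improper integrals over the whole line *)

Lemma is_line_eps (f : R -> C) (v : C) :
  is_CRInt_line f v <-> forall eps, 0 < eps -> exists B, forall a b, a <= - B -> B <= b ->
    exists z : C, is_CI f a b z /\ Cmod (z - v) < eps.
Proof.
  split.
  - intros H eps He. specialize (H _ (locally_Cmod v eps He)). unfold filtermapi in H.
    destruct H as [Q W HQ HW H]. destruct HQ as [A HA]. destruct HW as [B HB].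
    exists (Rmax (- A) B + 1). intros a b Ha Hb. pose proof (Rmax_l (- A) B). pose proof (Rmax_r (- A) B).
    apply (H a b); [apply HA|apply HB]; lra.
  - intros H P HP. destruct (locally_Cmod_inv _ _ HP) as (e & He & K).
    destruct (H e He) as [B HB]. unfold filtermapi.
    apply (Filter_prod _ _ _ (fun a => a <= - B) (fun b => B <= b)).
    + exists (- B). intros; lra.
    + exists B. intros; lra.
    + intros a b Ha Hb. simpl. destruct (HB a b Ha Hb) as (z & Hz1 & Hz2). exists z. auto.
Qed.

Lemma line_unique (f : R -> C) (v : C) : is_CRInt_line f v -> CRInt_line f = v.
Proof.
  intros H. unfold CRInt_line.
  apply (is_RInt_gen_unique (V := C_R_CompleteNormedModule) (Fa := Rbar_locally m_infty) (Fb := Rbar_locally p_infty) f v H).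
Qed.

Lemma is_line_I0 (f : R -> C) (v w : C) :
  is_I0 f v -> is_I0 (fun x => f (- x)) w -> is_CRInt_line f (v + w)%C.
Proof.
  rewrite !is_I0_eps, is_line_eps. intros H1 H2 eps He.
  destruct (H1 (eps / 2) ltac:(lra)) as [B1 K1]. destruct (H2 (eps / 2) ltac:(lra)) as [B2 K2].
  exists (Rmax B1 B2). intros a b Ha Hb. pose proof (Rmax_l B1 B2). pose proof (Rmax_r B1 B2).
  destruct (K1 b ltac:(lra)) as (z1 & Hz1 & E1).
  destruct (K2 (- a) ltac:(lra)) as (z2 & Hz2 & E2).
  exists (z2 + z1)%C. split.
  - apply (is_CI_Chasles _ a 0 b); [|exact Hz1].
    apply is_CI_swap in Hz2. replace 0 with (- 0) in Hz2 by ring.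
    apply is_CI_comp_opp in Hz2. replace (- - z2)%C with z2 in Hz2 by ring.
    eapply is_CI_ext; [|exact Hz2]. intros x _. simpl. f_equal. ring.
  - replace (z2 + z1 - (v + w))%C with ((z1 - v) + (z2 - w))%C by ring.
    eapply Rle_lt_trans; [apply Cmod_triangle|]. lra.
Qed.

Lemma is_line_plus (f g : R -> C) (v w : C) :
  is_CRInt_line f v -> is_CRInt_line g w -> is_CRInt_line (fun x => f x + g x)%C (v + w)%C.
Proof.
  intros Hf Hg.
  exact (is_RInt_gen_plus (V := C_R_NormedModule) (Fa := Rbar_locally m_infty) (Fb := Rbar_locally p_infty) f g v w Hf Hg).
Qed.

Lemma is_line_scal (c : C) (f : R -> C) (v : C) :
  is_CRInt_line f v -> is_CRInt_line (fun x => c * f x)%C (c * v)%C.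
Proof.
  rewrite !is_line_eps. intros H eps He. pose proof (Cmod_ge_0 c).
  destruct (H (eps / (Cmod c + 1))) as [B HB]; [apply Rdiv_lt_0_compat; lra|].
  exists B. intros a b Ha Hb. destruct (HB a b Ha Hb) as (z & Hz1 & Hz2). exists (c * z)%C.
  split; [now apply is_CI_scal|].
  replace (c * z - c * v)%C with (c * (z - v))%C by ring. rewrite Cmod_mult.
  apply Rlt_div_r in Hz2; [|lra]. pose proof (Cmod_ge_0 (z - v)). nra.
Qed.

Lemma is_line_ext (f g : R -> C) (v : C) : (forall x, f x = g x) -> is_CRInt_line f v -> is_CRInt_line g v.
Proof.
  rewrite !is_line_eps. intros E H eps He. destruct (H eps He) as [B HB]. exists B. intros a b Ha Hb.
  destruct (HB a b Ha Hb) as (z & Hz1 & Hz2). exists z. split; [|exact Hz2].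
  eapply is_CI_ext; [|exact Hz1]. intros; apply E.
Qed.

Lemma is_line_lim (f : R -> C) (v : C) : (forall x, Ccont f x) ->
  is_CRInt_line f v -> lim_inf (fun S => CI f (- S) S) v.
Proof.
  intros Hc. rewrite is_line_eps. intros H eps He. destruct (H eps He) as [B HB].
  exists B. intros S HS. destruct (HB (- S) S ltac:(lra) HS) as (z & Hz1 & Hz2).
  now rewrite (CI_unique _ _ _ _ Hz1).
Qed.

(** * Oscillatory integrals and the Riemann-Lebesgue lemma *)

Lemma Ccont_bounded (f : R -> C) (a b : R) : (forall x, a <= x <= b -> Ccont f x) ->
  exists M, 0 <= M /\ forall x, a <= x <= b -> Cmod (f x) <= M.
Proof.
  intros Hc. destruct (Rle_lt_dec a b) as [Hab|Hab].
  - destruct (continuity_ab_maj (fun x => Cmod (f x)) a b Hab) as (Mx & HM & _).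
    + intros x Hx. apply continuity_pt_filterlim. apply Ccont_mod. now apply Hc.
    + exists (Cmod (f Mx)). split; [apply Cmod_ge_0|exact HM].
  - exists 0. split; [lra|]. intros; lra.
Qed.

Definition osc (s x : R) : C := Cexp (Ci * RtoC (s * x))%C.

Lemma osc_eq (s x : R) : osc s x = (cos (s * x), sin (s * x)).
Proof.
  unfold osc, Cexp, Re, Im; simpl. replace (0 * (s * x) - 1 * 0) with 0 by ring.
  replace (0 * 0 + 1 * (s * x)) with (s * x) by ring. rewrite exp_0. f_equal; ring.
Qed.

Lemma Cmod_osc (s x : R) : Cmod (osc s x) = 1.
Proof.
  unfold osc. rewrite Cmod_Cexp. unfold Re; simpl.
  replace (0 * (s * x) - 1 * 0) with 0 by ring. apply exp_0.
Qed.

Lemma osc_cont (s x : R) : Ccont (osc s) x.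
Proof.
  unfold osc. apply Ccont_exp, Ccont_mult; [apply Ccont_const|]. apply Ccont_RtoC.
  apply (continuous_mult (K := R_AbsRing)); [apply continuous_const|apply continuous_id].
Qed.

Lemma osc_plus (s x y : R) : osc s (x + y) = (osc s x * osc s y)%C.
Proof. unfold osc. rewrite <- Cexp_plus. f_equal. rewrite Rmult_plus_distr_l, RtoC_plus. ring. Qed.

Lemma osc_opp (s x : R) : osc (- s) x = osc s (- x).
Proof. unfold osc. do 3 f_equal. ring. Qed.

Lemma osc_shift (s x : R) : s <> 0 -> osc s (x + PI / s) = (- osc s x)%C.
Proof.
  intros Hs. rewrite !osc_eq. replace (s * (x + PI / s)) with (s * x + PI) by (field; lra).
  rewrite neg_cos, neg_sin. reflexivity.
Qed.

(* Shifting the variable by half a period changes the sign of the exponential, so that the integral is half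
   the integral of a difference of translates. *)
Lemma Riemann_Lebesgue (q : R -> C) (a b eps : R) : a <= b -> (forall x, Ccont q x) -> 0 < eps ->
  exists B, 0 < B /\ forall s, B <= Rabs s -> Cmod (CI (fun x => osc s x * q x)%C a b) < eps.
Proof.
  intros Hab Hq He.
  destruct (Ccont_bounded q (a - 1) (b + 1)) as (K & HK0 & HK); [auto|].
  assert (T : exists d, 0 < d /\ forall h, Rabs h < d -> forall x, a <= x <= b -> Cmod (q (x + h) - q x) < eps / (b - a + 1)).
  { assert (HT : locally (0 : R) (fun h => forall x, a <= x <= b -> Cmod (q (x + h) - q (x + 0)) < eps / (b - a + 1))).
    { apply (tube (fun h x => q (x + h)) 0 a b); [apply Rdiv_lt_0_compat; lra|].
      intros x _. apply (Ccont_comp_R (U := prod_UniformSpace R_UniformSpace R_UniformSpace) (fun p => snd p + fst p) q); [|apply Hq].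
      apply (continuous_plus (V := R_NormedModule)); [apply continuous_snd|apply continuous_fst]. }
    apply locally_R_eps in HT. destruct HT as (d & Hd & H). exists d. split; [exact Hd|].
    intros h Hh x Hx. specialize (H h ltac:(rewrite Rminus_0_r; exact Hh) x Hx). now rewrite Rplus_0_r in H. }
  destruct T as (d & Hd & T).
  (* The shift h = pi/s has to stay below the modulus of continuity d, below 1 so that translates
     remain in [a - 1, b + 1], and so small that the two end pieces of length |h| contribute less
     than eps together. *)
  pose (e1 := Rmin (Rmin d 1) (eps / (2 * K + 2))).
  assert (He1 : 0 < e1).
  { repeat apply Rmin_pos; try lra. apply Rdiv_lt_0_compat; lra. }
  pose proof PI_RGT_0 as HPI.
  exists (PI / e1 + 1). split. { assert (0 < PI / e1) by (apply Rdiv_lt_0_compat; lra). lra. }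
  intros s Hs. assert (Hs0 : s <> 0).
  { intros ->. rewrite Rabs_R0 in Hs. assert (0 < PI / e1) by (apply Rdiv_lt_0_compat; lra). lra. }
  pose proof (Rabs_pos_lt s Hs0) as Hsp.
  pose (h := PI / s).
  assert (Hh : Rabs h < e1).
  { unfold h, Rdiv. rewrite Rabs_mult, Rabs_inv, (Rabs_pos_eq PI) by lra.
    apply Rlt_div_l; [lra|]. assert (PI / e1 < Rabs s) as H%Rlt_div_l by lra; lra. }
  assert (B1 : Rabs h < d) by (eapply Rlt_le_trans; [exact Hh|]; eapply Rle_trans; [apply Rmin_l|apply Rmin_l]).
  assert (B2 : Rabs h < 1) by (eapply Rlt_le_trans; [exact Hh|]; eapply Rle_trans; [apply Rmin_l|apply Rmin_r]).
  assert (B3 : Rabs h < eps / (2 * K + 2)) by (eapply Rlt_le_trans; [exact Hh|apply Rmin_r]).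
  pose (F := fun x => (osc s x * q x)%C).
  assert (FC : forall x, Ccont F x) by (intros x; apply Ccont_mult; [apply osc_cont|auto]).
  assert (FI : forall u v, is_CI F u v (CI F u v)) by (intros; apply CI_correct, ex_CI_cont; auto).
  assert (FB : forall x, a - 1 <= x <= b + 1 -> Cmod (F x) <= K).
  { intros x Hx. unfold F. rewrite Cmod_mult, Cmod_osc, Rmult_1_l. now apply HK. }
  change (Cmod (CI F a b) < eps).
  assert (E1 : is_CI (fun x => osc s x * (q x - q (x + h)%R))%C a b (CI F a b + CI F (a + h)%R (b + h)%R)%C).
  { eapply is_CI_ext; [|apply is_CI_plus; [apply (FI a b)|apply (is_CI_shift F h a b); apply FI]].
    intros x _. simpl. unfold F. unfold h. rewrite osc_shift by exact Hs0. ring. }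
  assert (E2 : Cmod (CI F a b + CI F (a + h)%R (b + h)%R) <= (b - a) * (eps / (b - a + 1))).
  { eapply is_CI_norm_const; [exact Hab| |exact E1]. intros x Hx. simpl.
    rewrite Cmod_mult, Cmod_osc, Rmult_1_l, Cmod_minus_sym. left. now apply T. }
  assert (E3 : CI F (a + h) (b + h) = (- CI F a (a + h)%R + (CI F a b + CI F b (b + h)%R))%C).
  { apply CI_unique. eapply is_CI_Chasles; [apply is_CI_swap, FI|]. eapply is_CI_Chasles; apply FI. }
  assert (Hin : forall c x, a <= c <= b -> Rmin c (c + h) <= x <= Rmax c (c + h) -> a - 1 <= x <= b + 1).
  { intros c x Hc Hx. apply Rabs_def2 in B2. unfold Rmin, Rmax in Hx. destruct Rle_dec; lra. }
  assert (E4 : Cmod (CI F a (a + h)) <= Rabs h * K).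
  { replace h with (a + h - a) at 2 by ring. apply (CI_bound F K a (a + h)); [|apply FI].
    intros x Hx. apply FB. apply (Hin a); auto. lra. }
  assert (E5 : Cmod (CI F b (b + h)) <= Rabs h * K).
  { replace h with (b + h - b) at 2 by ring. apply (CI_bound F K b (b + h)); [|apply FI].
    intros x Hx. apply FB. apply (Hin b); auto. lra. }
  rewrite E3 in E2.
  assert (E6 : 2 * Cmod (CI F a b) <= (b - a) * (eps / (b - a + 1)) + 2 * (Rabs h * K)).
  { rewrite <- (Cmod_RtoC_pos 2) at 1 by lra. rewrite <- Cmod_mult.
    replace (2 * CI F a b)%C with ((CI F a b + (- CI F a (a + h)%R + (CI F a b + CI F b (b + h)%R))) + (CI F a (a + h)%R - CI F b (b + h)%R))%C by ring.
    eapply Rle_trans; [apply Cmod_triangle|].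
    pose proof (Cmod_triangle_minus (CI F a (a + h)) (CI F b (b + h))). lra. }
  assert (E7 : (b - a) * (eps / (b - a + 1)) <= eps).
  { replace ((b - a) * (eps / (b - a + 1))) with ((b - a) * eps / (b - a + 1)) by (field; lra).
    apply Rle_div_l; nra. }
  apply Rlt_div_r in B3; [|lra]. pose proof (Rabs_pos h). nra.
Qed.

Lemma Riemann_Lebesgue_I0 (q : R -> C) (M eps : R) : (forall x, Ccont q x) ->
  (forall x, 0 <= x -> Cmod (q x) <= M * phi x) -> 0 < eps ->
  exists B, 0 < B /\ forall s, B <= Rabs s -> Cmod (I0 (fun x => osc s x * q x)%C) < eps.
Proof.
  intros Hq HM He. pose proof (dom_M_pos _ _ HM) as M0.
  pose (A := 2 * (M + 1) / eps). assert (HA : 0 < A) by (apply Rdiv_lt_0_compat; lra).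
  destruct (Riemann_Lebesgue q 0 A (eps / 2) ltac:(lra) Hq ltac:(lra)) as (B & HB & H).
  exists B. split; [exact HB|]. intros s Hs. specialize (H s Hs).
  assert (T : Cmod (I0 (fun x => osc s x * q x)%C - CI (fun x => osc s x * q x)%C 0 A) <= M / A).
  { apply I0_tail; auto.
    - intros x. apply Ccont_mult; [apply osc_cont|auto].
    - intros x Hx. rewrite Cmod_mult, Cmod_osc, Rmult_1_l. auto. }
  assert (M / A < eps / 2).
  { apply Rlt_div_l; [lra|]. unfold A. replace (eps / 2 * (2 * (M + 1) / eps)) with (M + 1) by (field; lra). lra. }
  match type of T with Cmod (?u - ?v) <= _ => replace u with ((u - v) + v)%C by ring end.
  eapply Rle_lt_trans; [apply Cmod_triangle|]. lra.
Qed.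

Lemma exp_ge_quad (x : R) : 0 <= x -> 1 + x + x * x / 2 <= exp x.
Proof.
  intros Hx.
  assert (H : is_RInt (fun t => exp t - (1 + t)) 0 x (minus (exp x - (x + x * x / 2)) (exp 0 - (0 + 0 * 0 / 2)))).
  { apply (is_RInt_derive (V := R_CompleteNormedModule) (fun t => exp t - (t + t * t / 2))).
    - intros t _. auto_derive; auto. field.
    - intros t _. apply (ex_derive_continuous (V := R_NormedModule)). auto_derive; auto. }
  assert (P : 0 <= minus (exp x - (x + x * x / 2)) (exp 0 - (0 + 0 * 0 / 2))).
  { apply (is_RInt_ge_0 (fun t => exp t - (1 + t)) 0 x _ Hx H). intros t Ht. pose proof (exp_ineq1_le t). lra. }
  unfold minus, plus, opp in P; simpl in P. rewrite exp_0 in P. lra.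
Qed.

Lemma exp_neg_phi (x : R) : 0 <= x -> exp (- x) <= 2 * phi x.
Proof.
  intros Hx. rewrite exp_Ropp. unfold phi.
  pose proof (exp_ge_quad x Hx). pose proof (exp_pos x).
  assert (0 < 1 + x * x) by nra.
  replace (2 * / (1 + x * x)) with (/ ((1 + x * x) / 2)) by (field; lra).
  apply Rinv_le_contravar; nra.
Qed.

(** Peetre's inequality: a translation costs only a constant, so translates of dominated functions
    are dominated. *)
Lemma phi_peetre (a x : R) : phi (a + x) <= 2 * (1 + a * a) * phi x.
Proof.
  unfold phi. assert (P1 : 0 < 1 + (a + x) * (a + x)) by (pose proof (Rle_0_sqr (a + x)) as H0; unfold Rsqr in H0; lra). assert (P2 : 0 < 1 + x * x) by nra.
  apply (Rmult_le_reg_l ((1 + (a + x) * (a + x)) * (1 + x * x))); [now apply Rmult_lt_0_compat|].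
  replace ((1 + (a + x) * (a + x)) * (1 + x * x) * / (1 + (a + x) * (a + x))) with (1 + x * x) by (field; lra).
  replace ((1 + (a + x) * (a + x)) * (1 + x * x) * (2 * (1 + a * a) * / (1 + x * x)))
    with ((1 + (a + x) * (a + x)) * (2 * (1 + a * a))) by (field; lra).
  (* 2 (a + x)^2 + 2 a^2 - x^2 = (2a + x)^2, and the cross term of the product is 2 (a (a +
     x))^2. *)
  pose proof (Rle_0_sqr (2 * a + x)) as Q1. pose proof (Rle_0_sqr (a * (a + x))) as Q2. unfold Rsqr in Q1, Q2. nra.
Qed.

Lemma osc_cont2 (p x : R) : Ccont (fun q : R * R => osc (- fst q) (snd q)) (p, x).
Proof.
  unfold osc. apply Ccont_exp, Ccont_mult; [apply Ccont_const|]. apply Ccont_RtoC.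
  apply (continuous_mult (K := R_AbsRing)); [|apply continuous_snd].
  apply (continuous_opp (V := R_NormedModule)). apply continuous_fst.
Qed.

Lemma Rderive_osc (x p : R) : Rderive (fun p => osc (- p) x) p (- (Ci * RtoC x) * osc (- p) x)%C.
Proof.
  unfold osc. apply (Rderive_exp (fun p => Ci * RtoC (- p * x))%C).
  eapply Rderive_eq.
  - apply Rderive_mult; [apply Rderive_const|].
    apply (Rderive_RtoC (fun p => - p * x) p (- x)). auto_derive; auto. ring.
  - rewrite RtoC_opp. cring.
Qed.

(** The weight x cancels the 1/x produced by integrating in p. What is left are two pure
    oscillations at frequencies S and -S, ready for the Riemann-Lebesgue lemma. *)
Lemma CI_osc (x S : R) :
  is_CI (fun p => RtoC x * osc (- p) x)%C (- S) S (Ci * osc (- S) x - Ci * osc S x)%C.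
Proof.
  eapply is_CI_eq; [apply (FTC_C (fun p => Ci * osc (- p) x)%C)|].
  - intros p _. eapply Rderive_eq; [apply Rderive_mult; [apply Rderive_const|apply Rderive_osc]|].
    apply C_ext; unfold Re, Im; simpl; ring.
  - intros p _. apply Ccont_mult; [apply Ccont_const|]. eapply Rderive_cont. apply Rderive_osc.
  - simpl. now rewrite Ropp_involutive.
Qed.

Lemma inv_1_il (p : R) : (1 + Ci * RtoC p)%C <> 0.
Proof. intros H. apply (f_equal Re) in H. unfold Re in H; simpl in H. lra. Qed.

Lemma CI_osc_exp (p b : R) :
  is_CI (fun x => osc (- p) x * RtoC (exp (- x)))%C 0 b
    (/ (1 + Ci * RtoC p) - RtoC (exp (- b)) * (osc (- p) b * / (1 + Ci * RtoC p)))%C.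
Proof.
  pose proof (inv_1_il p) as Hz.
  eapply is_CI_eq; [apply (FTC_C (fun x => - / (1 + Ci * RtoC p) * (osc (- p) x * RtoC (exp (- x))))%C)|].
  - intros x _. eapply Rderive_eq.
    + apply Rderive_mult; [apply Rderive_const|]. apply Rderive_mult.
      * unfold osc. apply (Rderive_exp (fun x => Ci * RtoC (- p * x))%C x (- (Ci * RtoC p))%C).
        eapply Rderive_eq; [apply Rderive_mult; [apply Rderive_const|]|].
        -- apply (Rderive_RtoC (fun x => - p * x) x (- p)). auto_derive; auto. ring.
        -- rewrite RtoC_opp. cring.
      * apply (Rderive_RtoC (fun x => exp (- x)) x (- exp (- x))). auto_derive; auto. ring.
    + cbv beta. rewrite RtoC_opp.
      match goal with |- @eq _ ?a ?b => change (@eq C a b) end. unfold osc. field. exact Hz.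
  - intros x _. apply Ccont_mult; [apply osc_cont|]. apply Ccont_RtoC.
    apply (ex_derive_continuous (V := R_NormedModule)). auto_derive; auto.
  - replace (osc (- p) 0) with (RtoC 1) by (unfold osc; rewrite Rmult_0_r, Cmult_0_r, Cexp_0; reflexivity).
    rewrite Ropp_0, exp_0. ring.
Qed.

Lemma is_I0_osc_exp (p : R) :
  is_I0 (fun x => osc (- p) x * RtoC (exp (- x)))%C (/ (1 + Ci * RtoC p))%C.
Proof.
  pose (F := fun x => (- / (1 + Ci * RtoC p) * (osc (- p) x * RtoC (exp (- x))))%C).
  assert (F0 : F 0 = (- / (1 + Ci * RtoC p))%C).
  { unfold F. replace (osc (- p) 0) with (RtoC 1) by (unfold osc; rewrite Rmult_0_r, Cmult_0_r, Cexp_0; reflexivity).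
    rewrite Ropp_0, exp_0. ring. }
  eapply is_I0_eq; [apply (is_I0_FTC F _ (Cmod (/ (1 + Ci * RtoC p)) * 2))|].
  - intros b Hb. eapply is_CI_eq; [apply CI_osc_exp|]. rewrite F0. unfold F. cring.
  - intros x Hx. unfold F. rewrite !Cmod_mult, Cmod_opp, Cmod_osc, Rmult_1_l, Cmod_R, Rabs_pos_eq by (left; apply exp_pos).
    rewrite Rmult_assoc. apply Rmult_le_compat_l; [apply Cmod_ge_0|]. now apply exp_neg_phi.
  - rewrite F0. ring.
Qed.

Lemma atan_large : lim_inf (fun S => RtoC (2 * atan S)) (RtoC PI).
Proof.
  intros eps He.
  assert (H : continuous atan 0).
  { apply continuity_pt_filterlim. apply derivable_continuous_pt. eexists. apply derivable_pt_lim_atan. }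
  destruct (proj1 (filterlim_locally _ _) H (mkposreal (eps / 2) ltac:(lra))) as [d Hd].
  pose proof (cond_pos d) as Hdp.
  exists (2 / d). intros S HS.
  assert (Hq : 0 < 2 / d) by (apply Rdiv_lt_0_compat; lra).
  assert (HS0 : 0 < S) by lra.
  assert (Hi : / S < d).
  { apply Rle_div_l in HS; [|lra]. rewrite <- (Rmult_1_l (/ S)). apply Rlt_div_l; lra. }
  assert (Hi0 : 0 < / S) by now apply Rinv_0_lt_compat.
  specialize (Hd (/ S)). unfold ball in Hd; simpl in Hd; unfold AbsRing_ball, abs, minus, plus, opp in Hd; simpl in Hd.
  rewrite atan_0, Ropp_0, !Rplus_0_r in Hd. rewrite Rabs_pos_eq in Hd by lra. specialize (Hd Hi).
  rewrite atan_inv in Hd by exact HS0.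
  rewrite <- RtoC_minus, Cmod_R.
  replace (2 * atan S - PI) with (- (2 * (PI / 2 - atan S))) by field.
  rewrite Rabs_Ropp, Rabs_mult, (Rabs_pos_eq 2) by lra. lra.
Qed.

(** The primitive is atan p - (i/2) log (1 + p^2), whose imaginary part is even and cancels over
    [-S, S]; it is unbounded, so the symmetry of the interval is essential. Since 1 / (1 + i p) is
    the transform of exp (-x), this is where the constant pi of Fourier inversion comes from. *)
Lemma CI_inv_1_il (S : R) : is_CI (fun p => / (1 + Ci * RtoC p))%C (- S) S (RtoC (2 * atan S)).
Proof.
  eapply is_CI_eq; [apply (FTC_C (fun p => (atan p, - (ln (1 + p * p) / 2))))|].
  - intros p _. apply Rderive_pair. simpl. split.
    + replace (Re (/ (1 + Ci * RtoC p))%C) with (/ (1 + p * p))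
        by (unfold Re, Cinv; simpl; field; nra).
      auto_derive; auto. field. nra.
    + replace (Im (/ (1 + Ci * RtoC p))%C) with (- p / (1 + p * p))
        by (unfold Im, Cinv; simpl; field; nra).
      auto_derive; [nra|]. field. nra.
  - intros p _. apply Ccont_inv; [|apply inv_1_il].
    apply Ccont_plus; [apply Ccont_const|]. apply Ccont_mult; [apply Ccont_const|].
    apply Ccont_RtoC. apply continuous_id.
  - rewrite atan_opp. apply C_ext; unfold Re, Im; simpl; [ring|].
    replace (- S * - S) with (S * S) by ring. ring.
Qed.

(** * Inversion at the end of a half line *)

Section HalfInversion.
Variables (beta : R -> C) (l : C).
Hypotheses (Hc : forall x, Ccont beta x) (Hd : Rderive beta 0 l).

(** Subtracting beta(0) exp (-x), whose transform is explicit, leaves a function divisible by x. The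
    value at 0 is the derivative of the numerator there, which is all the smoothness of [beta] that
    is used. *)
Let q (x : R) : C :=
  if Req_EM_T x 0 then (l + beta 0)%C else ((beta x - beta 0 * RtoC (exp (- x))) / RtoC x)%C.

Lemma half_q_eq (x : R) : beta x = (beta 0 * RtoC (exp (- x)) + RtoC x * q x)%C.
Proof.
  unfold q. destruct (Req_EM_T x 0) as [->|Hx].
  - rewrite Ropp_0, exp_0. ring.
  - field. intros H. apply Hx. now apply (f_equal Re) in H.
Qed.

Lemma half_q_cont (x : R) : Ccont q x.
Proof.
  assert (HF : Ccont (fun x => beta x - beta 0 * RtoC (exp (- x)))%C x).
  { apply Ccont_minus; [apply Hc|]. apply Ccont_mult; [apply Ccont_const|]. apply Ccont_RtoC.
    apply (ex_derive_continuous (V := R_NormedModule)). auto_derive; auto. }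
  destruct (Req_dec x 0) as [->|Hx].
  - assert (HD : Rderive (fun x => beta x - beta 0 * RtoC (exp (- x)))%C 0 (l + beta 0)%C).
    { eapply Rderive_eq; [apply Rderive_minus; [exact Hd|apply Rderive_mult; [apply Rderive_const|]]|].
      - apply (Rderive_RtoC (fun x => exp (- x)) 0 (- 1)). auto_derive; auto. rewrite Ropp_0, exp_0. ring.
      - apply C_ext; unfold Re, Im; simpl; ring. }
    rewrite Rderive_eps in HD. apply continuous_RC_eps. intros eps He.
    destruct (HD (eps / 2) ltac:(lra)) as (d & Hdp & K). exists d. split; [exact Hdp|].
    intros y Hy. specialize (K y Hy). unfold q. destruct (Req_EM_T 0 0); [|lra].
    destruct (Req_EM_T y 0) as [->|Hy0].
    + replace (l + beta 0 - (l + beta 0))%C with (RtoC 0) by ring. rewrite Cmod_0. exact He.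
    + rewrite Rminus_0_r in K. rewrite Ropp_0, exp_0 in K.
      assert (HyC : RtoC y <> 0) by (intros H; apply Hy0; now apply (f_equal Re) in H).
      replace ((beta y - beta 0 * RtoC (exp (- y))) / RtoC y - (l + beta 0))%C with
        ((beta y - beta 0 * RtoC (exp (- y)) - (beta 0 - beta 0 * 1) - RtoC y * (l + beta 0)) / RtoC y)%C
        by (field; exact HyC).
      rewrite Cmod_div by exact HyC. rewrite Cmod_R. pose proof (Rabs_pos_lt y Hy0).
      apply Rlt_div_l; [lra|]. nra.
  - apply (continuous_ext_loc (T := R_UniformSpace) (U := C_UniformSpace) q (fun x => (beta x - beta 0 * RtoC (exp (- x))) / RtoC x)%C x).
    + apply locally_R_eps. exists (Rabs x). split; [now apply Rabs_pos_lt|]. intros y Hy.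
      unfold q. destruct (Req_EM_T y 0) as [->|]; [|reflexivity].
      rewrite Rminus_0_l, Rabs_Ropp in Hy. lra.
    + unfold Cdiv. apply Ccont_mult; [exact HF|]. apply Ccont_inv.
      * apply Ccont_RtoC, continuous_id.
      * intros H; apply Hx; now apply (f_equal Re) in H.
Qed.

(** The reference part contributes beta(0) 2 atan S, which tends to pi beta(0), half of the full
    inversion; the part x q(x) gives oscillations in S that vanish in the limit. On [0, c] the
    reference function must also lose its tail beyond c, and this correction tends to 0 as well. *)
Lemma half_inversion_fin (c : R) : 0 < c ->
  lim_inf (fun S => CI (fun p => CI (fun x => osc (- p) x * beta x)%C 0 c) (- S) S) (RtoC PI * beta 0)%C.
Proof.
  intros Hcp.
  (* The tail of exp (-x) beyond c, shifted to 0 and divided by the factor c + x that [CI_osc]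
     requires; [Rabs] makes it continuous for negative x too. *)
  pose (g := fun x => (RtoC (exp (- (c + Rabs x)) / (c + Rabs x)))%C).
  assert (gC : forall x, Ccont g x).
  { intros x. unfold g. apply Ccont_RtoC. pose proof (Rabs_pos x).
    apply (continuous_comp Rabs (fun r => exp (- (c + r)) / (c + r))); [apply continuous_Rabs|].
    apply (ex_derive_continuous (V := R_NormedModule)). auto_derive. lra. }
  assert (gB : forall x, 0 <= x -> Cmod (g x) <= 2 / c * phi x).
  { intros x Hx. unfold g. rewrite (Rabs_pos_eq x Hx). rewrite Cmod_RtoC_pos.
    - replace (2 / c * phi x) with ((2 * phi x) / c) by (field; lra).
      unfold Rdiv. apply Rmult_le_compat; [left; apply exp_pos|left; apply Rinv_0_lt_compat; lra| |apply Rinv_le_contravar; lra].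
      eapply Rle_trans; [|now apply exp_neg_phi]. apply exp_le_exp. lra.
    - left. apply Rdiv_lt_0_compat; [apply exp_pos|lra]. }
  assert (qI : forall s u v, is_CI (fun x => osc s x * q x)%C u v (CI (fun x => osc s x * q x)%C u v)).
  { intros. apply CI_correct, ex_CI_cont. intros. apply Ccont_mult; [apply osc_cont|apply half_q_cont]. }
  (* the part of the reference function [beta 0 * exp (- x)] on [c, oo) *)
  assert (T1 : forall S, 0 <= S -> is_CI (fun p => RtoC (exp (- c)) * (osc (- p) c * / (1 + Ci * RtoC p)))%C (- S) S
     (I0 (fun x => (Ci * osc (- S) (c + x) - Ci * osc S (c + x)) * g x)%C)).
  { intros S HS.
    pose (f := fun p x => (RtoC (c + Rabs x) * osc (- p) (c + x) * g x)%C).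
    assert (fC : forall p x, Ccont2 f p x).
    { intros p x. unfold f. apply Ccont_mult; [apply Ccont_mult|].
      - apply Ccont_RtoC. apply (continuous_plus (V := R_NormedModule)); [apply continuous_const|].
        apply (continuous_comp (fun q : R * R => snd q) Rabs); [apply continuous_snd|apply continuous_Rabs].
      - unfold osc. apply Ccont_exp, Ccont_mult; [apply Ccont_const|]. apply Ccont_RtoC.
        apply (continuous_mult (K := R_AbsRing)).
        + apply (continuous_opp (V := R_NormedModule)). apply continuous_fst.
        + apply (continuous_plus (V := R_NormedModule)); [apply continuous_const|apply continuous_snd].
      - apply (continuous_comp (fun q : R * R => snd q) g); [apply continuous_snd|apply gC]. }
    assert (fE : forall p x, 0 <= x -> f p x = (RtoC (exp (- c)) * (osc (- p) c * (osc (- p) x * RtoC (exp (- x)))))%C).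
    { intros p x Hx. unfold f, g. rewrite (Rabs_pos_eq x Hx), osc_plus.
      replace (- (c + x)) with (- c + - x) by ring. rewrite exp_plus.
      unfold Rdiv. rewrite !RtoC_mult, RtoC_inv by lra. field.
      intros H; apply (f_equal Re) in H; unfold Re in H; simpl in H; lra. }
    assert (fB : forall p x, - S <= p <= S -> 0 <= x -> Cmod (f p x) <= 2 * phi x).
    { intros p x _ Hx. rewrite fE by exact Hx. rewrite !Cmod_mult, !Cmod_osc, !Cmod_RtoC_pos, !Rmult_1_l by (left; apply exp_pos).
      pose proof (exp_neg_phi x Hx). pose proof (exp_pos (- x)).
      assert (exp (- c) <= 1) by (rewrite <- exp_0; apply exp_le_exp; lra). nra. }
    pose proof (I0_Fubini_fin f 2 (- S) S ltac:(lra) fC fB) as HF.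
    assert (E : I0 (fun x => CI (fun p => f p x) (- S) S) = I0 (fun x => (Ci * osc (- S) (c + x) - Ci * osc S (c + x)) * g x)%C).
    { symmetry. apply (I0_ext _ _ (2 * (2 / c))).
      - intros x. apply Ccont_mult; [|apply gC]. 
        assert (O : forall s, Ccont (fun x => osc s (c + x)) x).
        { intros s. apply (Ccont_comp_R (U := R_UniformSpace) (fun x => c + x) (osc s)); [|apply osc_cont].
          apply (continuous_plus (V := R_NormedModule)); [apply continuous_const|apply continuous_id]. }
        apply Ccont_minus; (apply Ccont_mult; [apply Ccont_const|apply O]).
      - intros x Hx. rewrite Cmod_mult, Rmult_assoc. apply Rmult_le_compat; try apply Cmod_ge_0; [|now apply gB].
        eapply Rle_trans; [apply Cmod_triangle_minus|]. rewrite !Cmod_mult, Cmod_Ci, !Cmod_osc. lra.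
      - intros x Hx. symmetry. apply CI_unique. unfold f. rewrite (Rabs_pos_eq x) by lra.
        eapply is_CI_ext; [|eapply is_CI_eq; [apply (is_CI_scal (g x)), (CI_osc (c + x) S)|cring]].
        intros p _. simpl. ring. }
    rewrite <- E. eapply is_CI_ext; [|exact HF].
    intros p _. simpl. apply I0_unique.
    eapply is_I0_ext; [|apply is_I0_scal, is_I0_scal, (is_I0_osc_exp p)].
    intros x Hx. simpl. rewrite fE by lra. reflexivity. }
  assert (T2 : forall S, 0 <= S -> is_CI (fun p => CI (fun x => RtoC x * osc (- p) x * q x)%C 0 c) (- S) S
     (Ci * CI (fun x => osc (- S) x * q x)%C 0 c - Ci * CI (fun x => osc S x * q x)%C 0 c)%C).
  { intros S HS.
    assert (fC : forall p x, Ccont2 (fun p x => RtoC x * osc (- p) x * q x)%C p x).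
    { intros p x. apply Ccont_mult; [apply Ccont_mult|].
      - apply Ccont_RtoC, continuous_snd.
      - apply osc_cont2.
      - apply (continuous_comp (fun q : R * R => snd q) q); [apply continuous_snd|apply half_q_cont]. }
    pose proof (CI_Fubini (fun p x => RtoC x * osc (- p) x * q x)%C (- S) S 0 c ltac:(lra) ltac:(lra) fC) as HF.
    eapply is_CI_eq.
    - apply CI_correct, ex_CI_cont. intros p _. apply CI_param_cont; [lra|auto|].
      apply filter_forall. intros r. apply ex_CI_cont. intros x _. apply (Ccont2_slice (fun p x => RtoC x * osc (- p) x * q x)%C). apply fC.
    - rewrite HF. apply CI_unique.
      eapply is_CI_ext; [|apply is_CI_minus; apply is_CI_scal; apply qI].
      intros x _. symmetry. apply CI_unique. simpl.
      eapply is_CI_ext; [|eapply is_CI_eq; [apply (is_CI_scal (q x)), (CI_osc x S)|cring]].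
      intros p _. simpl. ring. }
  assert (L1 : lim_inf (fun S => I0 (fun x => (Ci * osc (- S) (c + x) - Ci * osc S (c + x)) * g x)%C) (RtoC 0)).
  { intros eps He.
    destruct (Riemann_Lebesgue_I0 g _ (eps / 2) gC gB ltac:(lra)) as (B & HB & K).
    exists B. intros S HS.
    assert (HI : forall s, is_I0 (fun x => osc s x * g x)%C (I0 (fun x => osc s x * g x)%C)).
    { intros s. apply (is_I0_dom _ (2 / c)).
      - intros x. apply Ccont_mult; [apply osc_cont|apply gC].
      - intros x Hx. rewrite Cmod_mult, Cmod_osc, Rmult_1_l. now apply gB. }
    rewrite (I0_unique _ (Ci * osc (- S) c * I0 (fun x => osc (- S) x * g x)%C - Ci * osc S c * I0 (fun x => osc S x * g x)%C)%C).
    - match goal with |- Cmod (Cminus ?a (RtoC 0)) < _ => replace (a - 0)%C with a by ring end.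
      eapply Rle_lt_trans; [apply Cmod_triangle_minus|]. rewrite !Cmod_mult, Cmod_Ci, !Cmod_osc.
      pose proof (K S ltac:(rewrite Rabs_pos_eq; lra)). pose proof (K (- S) ltac:(rewrite Rabs_Ropp, Rabs_pos_eq; lra)). lra.
    - eapply is_I0_ext; [|apply is_I0_minus; apply is_I0_scal; apply HI].
      intros x _. simpl. rewrite !osc_plus. ring. }
  assert (L2 : lim_inf (fun S => (Ci * CI (fun x => osc (- S) x * q x)%C 0 c - Ci * CI (fun x => osc S x * q x)%C 0 c)%C) (RtoC 0)).
  { intros eps He.
    destruct (Riemann_Lebesgue q 0 c (eps / 2) ltac:(lra) half_q_cont ltac:(lra)) as (B & HB & K).
    exists B. intros S HS.
    match goal with |- Cmod (Cminus ?a (RtoC 0)) < _ => replace (a - 0)%C with a by ring end.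
    eapply Rle_lt_trans; [apply Cmod_triangle_minus|]. rewrite !Cmod_mult, Cmod_Ci.
    pose proof (K S ltac:(rewrite Rabs_pos_eq; lra)). pose proof (K (- S) ltac:(rewrite Rabs_Ropp, Rabs_pos_eq; lra)). lra. }
  pose proof (lim_inf_plus _ _ _ _ (lim_inf_minus _ _ _ _ (lim_inf_scal (beta 0) _ _ atan_large) (lim_inf_scal (beta 0) _ _ L1)) L2) as L.
  replace (beta 0 * RtoC PI - beta 0 * RtoC 0 + RtoC 0)%C with (RtoC PI * beta 0)%C in L by ring.
  apply (lim_inf_ext _ _ _ 0) with (2 := L). intros S HS. symmetry. apply CI_unique.
  eapply is_CI_ext; [|apply is_CI_plus; [apply is_CI_minus; apply is_CI_scal; [apply (CI_inv_1_il S)|apply (T1 S HS)]|apply (T2 S HS)]].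
  intros p _. simpl. symmetry. apply CI_unique.
  eapply is_CI_ext; [|eapply is_CI_eq; [apply is_CI_plus; [apply (is_CI_scal (beta 0)), (CI_osc_exp p c)|apply (CI_correct (fun x => RtoC x * osc (- p) x * q x)%C 0 c)]|]].
  - intros x _. simpl. rewrite (half_q_eq x). ring.
  - apply ex_CI_cont. intros x _. apply Ccont_mult; [apply Ccont_mult|apply half_q_cont].
    + apply Ccont_RtoC, continuous_id.
    + apply osc_cont.
  - cring.
Qed.

Lemma half_inversion (M : R) : (forall x, 0 <= x -> Cmod (beta x) <= M * phi x) ->
  lim_inf (fun S => CI (fun p => I0 (fun x => osc (- p) x * beta x)%C) (- S) S) (RtoC PI * beta 0)%C.
Proof.
  intros HM.
  assert (xqE : forall x, (RtoC x * q x)%C = (beta x - beta 0 * RtoC (exp (- x)))%C).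
  { intros x. rewrite (half_q_eq x). ring. }
  pose (M1 := M + 2 * Cmod (beta 0)).
  assert (xqB : forall x, 0 <= x -> Cmod (RtoC x * q x) <= M1 * phi x).
  { intros x Hx. rewrite xqE. eapply Rle_trans; [apply Cmod_triangle_minus|].
    rewrite Cmod_mult, Cmod_RtoC_pos by (left; apply exp_pos). specialize (HM x Hx).
    pose proof (exp_neg_phi x Hx). pose proof (Cmod_ge_0 (beta 0)). unfold M1. nra. }
  destruct (Ccont_bounded q 0 1) as (K & HK0 & HK); [intros; apply half_q_cont|].
  pose proof (dom_M_pos _ _ HM) as HM0. pose proof (Cmod_ge_0 (beta 0)) as Hb0.
  (* On [0, 1] the bound K is compared with [phi] x >= 1/2; beyond 1 the bound on x q(x) is divided
     by x > 1. *)
  assert (qB : forall x, 0 <= x -> Cmod (q x) <= (M1 + 2 * K) * phi x).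
  { intros x Hx. pose proof (phi_pos x). assert (0 <= M1) by (unfold M1; lra).
    destruct (Rle_lt_dec x 1) as [H1|H1].
    - specialize (HK x (conj Hx H1)). assert (/ 2 <= phi x). { unfold phi. apply Rinv_le_contravar; nra. } nra.
    - specialize (xqB x Hx). rewrite Cmod_mult, Cmod_RtoC_pos in xqB by lra.
      pose proof (Cmod_ge_0 (q x)). nra. }
  assert (qI : forall s, is_I0 (fun x => osc s x * q x)%C (I0 (fun x => osc s x * q x)%C)).
  { intros s. apply (is_I0_dom _ (M1 + 2 * K)).
    - intros x. apply Ccont_mult; [apply osc_cont|apply half_q_cont].
    - intros x Hx. rewrite Cmod_mult, Cmod_osc, Rmult_1_l. now apply qB. }
  assert (T2 : forall S, 0 <= S -> is_CI (fun p => I0 (fun x => RtoC x * osc (- p) x * q x)%C) (- S) S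
     (Ci * I0 (fun x => osc (- S) x * q x)%C - Ci * I0 (fun x => osc S x * q x)%C)%C).
  { intros S HS.
    assert (fC : forall p x, Ccont2 (fun p x => RtoC x * osc (- p) x * q x)%C p x).
    { intros p x. apply Ccont_mult; [apply Ccont_mult|].
      - apply Ccont_RtoC, continuous_snd.
      - apply osc_cont2.
      - apply (continuous_comp (fun q : R * R => snd q) q); [apply continuous_snd|apply half_q_cont]. }
    eapply is_CI_eq; [apply (I0_Fubini_fin (fun p x => RtoC x * osc (- p) x * q x)%C M1); auto; [lra|]|].
    - intros p x _ Hx. replace (RtoC x * osc (- p) x * q x)%C with (osc (- p) x * (RtoC x * q x))%C by ring.
      rewrite Cmod_mult, Cmod_osc, Rmult_1_l. now apply xqB.
    - apply I0_unique. eapply is_I0_ext; [|apply is_I0_minus; apply is_I0_scal; apply qI].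
      intros x _. symmetry. apply CI_unique. simpl.
      eapply is_CI_ext; [|eapply is_CI_eq; [apply (is_CI_scal (q x)), (CI_osc x S)|cring]].
      intros p _. simpl. ring. }
  assert (L2 : lim_inf (fun S => (Ci * I0 (fun x => osc (- S) x * q x)%C - Ci * I0 (fun x => osc S x * q x)%C)%C) (RtoC 0)).
  { intros eps He.
    destruct (Riemann_Lebesgue_I0 q _ (eps / 2) half_q_cont qB ltac:(lra)) as (B & HB & KB).
    exists B. intros S HS.
    match goal with |- Cmod (Cminus ?a (RtoC 0)) < _ => replace (a - 0)%C with a by ring end.
    eapply Rle_lt_trans; [apply Cmod_triangle_minus|]. rewrite !Cmod_mult, Cmod_Ci.
    pose proof (KB S ltac:(rewrite Rabs_pos_eq; lra)). pose proof (KB (- S) ltac:(rewrite Rabs_Ropp, Rabs_pos_eq; lra)). lra. }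
  pose proof (lim_inf_plus _ _ _ _ (lim_inf_scal (beta 0) _ _ atan_large) L2) as L.
  replace (beta 0 * RtoC PI + RtoC 0)%C with (RtoC PI * beta 0)%C in L by ring.
  apply (lim_inf_ext _ _ _ 0) with (2 := L). intros S HS. symmetry. apply CI_unique.
  eapply is_CI_ext; [|apply is_CI_plus; [apply is_CI_scal; apply (CI_inv_1_il S)|apply (T2 S HS)]].
  intros p _. simpl. symmetry. apply I0_unique.
  apply (is_I0_ext (fun x => beta 0 * (osc (- p) x * RtoC (exp (- x))) + RtoC x * osc (- p) x * q x)%C).
  { intros x _. rewrite (half_q_eq x). ring. }
  apply is_I0_plus.
  - apply is_I0_scal, is_I0_osc_exp.
  - apply (is_I0_dom _ M1).
    + intros x. apply Ccont_mult; [apply Ccont_mult|apply half_q_cont]; [apply Ccont_RtoC, continuous_id|apply osc_cont].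
    + intros x Hx. replace (RtoC x * osc (- p) x * q x)%C with (osc (- p) x * (RtoC x * q x))%C by ring.
      rewrite Cmod_mult, Cmod_osc, Rmult_1_l. now apply xqB.
Qed.

End HalfInversion.

Lemma Rderive_comp_R (f : R -> C) (g : R -> R) (x a : R) (l : C) :
  is_derive g x a -> Rderive f (g x) l -> Rderive (fun y => f (g y)) x (RtoC a * l)%C.
Proof.
  intros Hg Hf. rewrite <- scal_C. apply (is_derive_comp (V := C_R_NormedModule) f g x l a Hf Hg).
Qed.

Lemma Ccont_comp_R1 (f : R -> C) (g : R -> R) (x : R) : (forall y, Ccont f y) -> continuous g x -> Ccont (fun y => f (g y)) x.
Proof. intros Hf Hg. now apply (Ccont_comp_R (U := R_UniformSpace)). Qed.

Lemma continuous_shift (c x : R) : continuous (fun y => c + y) x.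
Proof. apply (continuous_plus (V := R_NormedModule)); [apply continuous_const|apply continuous_id]. Qed.

Lemma continuous_reflect (c x : R) : continuous (fun y => c - y) x.
Proof. apply (continuous_minus (V := R_NormedModule)); [apply continuous_const|apply continuous_id]. Qed.

Lemma CI_sym_opp (f : R -> C) (S : R) : (forall x, Ccont f x) ->
  CI (fun p => f (- p)) (- S) S = CI f (- S) S.
Proof.
  intros Hf. apply CI_unique.
  assert (K : is_CI f (- - S) (- S) (- CI f (- S) S)%C).
  { rewrite Ropp_involutive. apply is_CI_swap. apply CI_correct, ex_CI_cont. auto. }
  apply is_CI_comp_opp in K. eapply is_CI_eq; [exact K|]. cring.
Qed.

Lemma is_line_shift (f : R -> C) (c : R) (v : C) : is_CRInt_line f v -> is_CRInt_line (fun x => f (x + c)) v.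
Proof.
  rewrite !is_line_eps. intros H eps He. destruct (H eps He) as [B HB].
  exists (B + Rabs c). intros a b Ha Hb. pose proof (Rle_abs c). pose proof (Rle_abs (- c)) as H1. rewrite Rabs_Ropp in H1.
  destruct (HB (a + c) (b + c) ltac:(lra) ltac:(lra)) as (z & Hz1 & Hz2). exists z. split; [|exact Hz2].
  now apply is_CI_shift.
Qed.

Lemma is_line_dom (f : R -> C) (M : R) : (forall x, Ccont f x) -> (forall x, Cmod (f x) <= M * phi x) ->
  is_CRInt_line f (I0 f + I0 (fun x => f (- x)%R))%C.
Proof.
  intros Hc HM. apply is_line_I0.
  - now apply (is_I0_dom _ M).
  - apply (is_I0_dom _ M).
    + intros x. apply (Ccont_comp_R1 f); auto. apply (continuous_opp (V := R_NormedModule)), continuous_id.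
    + intros x _. rewrite <- phi_opp. auto.
Qed.

Lemma I0_osc_cont (f : R -> C) (M p : R) : (forall x, Ccont f x) -> (forall x, 0 <= x -> Cmod (f x) <= M * phi x) ->
  Ccont (fun p => I0 (fun x => osc (- p) x * f x)%C) p.
Proof.
  intros Hc HM. apply (I0_param_cont (fun p x => osc (- p) x * f x)%C M).
  - intros x _. apply Ccont_mult; [apply osc_cont2|].
    apply (continuous_comp (fun q : R * R => snd q) f); [apply continuous_snd|apply Hc].
  - apply filter_forall. intros r. split.
    + intros x. apply Ccont_mult; [apply osc_cont|apply Hc].
    + intros x Hx. rewrite Cmod_mult, Cmod_osc, Rmult_1_l. auto.
Qed.

(** * Inversion on the line *)

Section LineInversion.
Variables (u : R -> C) (M : R).
Hypotheses (Hc : forall x, Ccont u x) (HM : forall x, Cmod (u x) <= M * phi x).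

(** Written exactly as the inner integral of [ttilde], so that it can be recognised there. *)
Definition line_transform (k : R) : C := CRInt_line (fun x => Cexp (- (Ci * RtoC x * RtoC k)) * u x)%C.

Lemma Cexp_osc (x k : R) : Cexp (- (Ci * RtoC x * RtoC k)) = osc (- k) x.
Proof. unfold osc. f_equal. rewrite RtoC_mult, RtoC_opp. ring. Qed.

Lemma osc_cancel (x0 k x : R) : (osc x0 k * osc (- k) (x0 + x)%R)%C = osc (- k) x.
Proof. unfold osc. rewrite <- Cexp_plus. f_equal. rewrite !RtoC_mult, RtoC_plus, RtoC_opp. ring. Qed.

Lemma is_line_transform (k : R) : is_CRInt_line (fun x => osc (- k) x * u x)%C (line_transform k).
Proof.
  assert (H1 := is_line_dom (fun x => osc (- k) x * u x)%C M).
  match type of H1 with _ -> _ -> is_CRInt_line _ ?v => assert (H2 : is_CRInt_line (fun x => osc (- k) x * u x)%C v) end.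
  { apply H1.
    - intros x. apply Ccont_mult; [apply osc_cont|apply Hc].
    - intros x. rewrite Cmod_mult, Cmod_osc, Rmult_1_l. auto. }
  unfold line_transform. erewrite line_unique; [exact H2|].
  eapply is_line_ext; [|exact H2]. intros x. simpl. now rewrite Cexp_osc.
Qed.

(** The factor exp (i x0 k) moves the origin to x0; folding the line at x0 leaves two half-line
    transforms, each in the form of [half_inversion]. *)
Lemma line_transform_eq (x0 k : R) :
  (osc x0 k * line_transform k)%C =
    (I0 (fun x => osc (- k) x * u (x0 + x)%R) + I0 (fun x => osc k x * u (x0 - x)%R))%C.
Proof.
  assert (HM0 : 0 <= M) by (apply (dom_M_pos u); auto).
  pose proof (Rle_0_sqr x0) as Hx0. unfold Rsqr in Hx0.
  pose proof (is_line_transform k) as H1.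
  apply (is_line_shift _ x0), (is_line_scal (osc x0 k)) in H1.
  assert (H2 : is_CRInt_line (fun x => osc (- k) x * u (x0 + x)%R)%C
    (I0 (fun x => osc (- k) x * u (x0 + x)%R) + I0 (fun x => osc (- k) (- x)%R * u (x0 + - x)%R))%C).
  { apply (is_line_dom (fun x => osc (- k) x * u (x0 + x)%R)%C (M * (2 * (1 + x0 * x0)))).
    - intros x. apply Ccont_mult; [apply osc_cont|apply (Ccont_comp_R1 u); auto; apply continuous_shift].
    - intros x. rewrite Cmod_mult, Cmod_osc, Rmult_1_l, Rmult_assoc. eapply Rle_trans; [apply HM|].
      apply Rmult_le_compat_l; [exact HM0|]. apply phi_peetre. }
  rewrite <- (line_unique _ _ H1). 
  assert (E : CRInt_line (fun x => osc x0 k * (osc (- k) (x + x0)%R * u (x + x0)%R))%C = (I0 (fun x => osc (- k) x * u (x0 + x)%R) + I0 (fun x => osc (- k) (- x)%R * u (x0 + - x)%R))%C).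
  { apply line_unique. eapply is_line_ext; [|exact H2]. intros x. simpl.
    rewrite (Rplus_comm x x0), <- (osc_cancel x0 k x). ring. }
  rewrite E. f_equal. apply (f_equal I0). 
  apply functional_extensionality. intros x.
  rewrite osc_opp, Ropp_involutive. reflexivity.
Qed.

Lemma phi_reflect (x0 x : R) : phi (x0 - x) <= 2 * (1 + x0 * x0) * phi x.
Proof. rewrite <- (phi_opp x). apply phi_peetre. Qed.

(** Each side of x0 contributes pi u(x0). The left side carries the opposite frequency, which is
    reflected away on the symmetric interval. *)
Theorem line_inversion (x0 : R) (l : C) : Rderive u x0 l ->
  lim_inf (fun S => CI (fun k => osc x0 k * line_transform k)%C (- S) S) (RtoC (2 * PI) * u x0)%C.
Proof.
  intros Hd. assert (HM0 : 0 <= M) by (apply (dom_M_pos u); auto).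
  pose proof (Rle_0_sqr x0) as Hx0. unfold Rsqr in Hx0.
  assert (C1 : forall x, Ccont (fun x => u (x0 + x)) x) by (intros; apply (Ccont_comp_R1 u); auto; apply continuous_shift).
  assert (C2 : forall x, Ccont (fun x => u (x0 - x)) x) by (intros; apply (Ccont_comp_R1 u); auto; apply continuous_reflect).
  assert (B1 : forall x, 0 <= x -> Cmod (u (x0 + x)) <= M * (2 * (1 + x0 * x0)) * phi x).
  { intros x _. rewrite Rmult_assoc. eapply Rle_trans; [apply HM|]. apply Rmult_le_compat_l; [exact HM0|apply phi_peetre]. }
  assert (B2 : forall x, 0 <= x -> Cmod (u (x0 - x)) <= M * (2 * (1 + x0 * x0)) * phi x).
  { intros x _. rewrite Rmult_assoc. eapply Rle_trans; [apply HM|]. apply Rmult_le_compat_l; [exact HM0|apply phi_reflect]. }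
  assert (D1 : Rderive (fun x => u (x0 + x)) 0 (RtoC 1 * l)%C).
  { apply (Rderive_comp_R u (fun x => x0 + x)); [auto_derive; auto|]. now rewrite Rplus_0_r. }
  assert (D2 : Rderive (fun x => u (x0 - x)) 0 (RtoC (-1) * l)%C).
  { apply (Rderive_comp_R u (fun x => x0 - x)); [auto_derive; auto; ring|]. now rewrite Rminus_0_r. }
  pose proof (half_inversion _ _ C1 D1 _ B1) as L1.
  pose proof (half_inversion _ _ C2 D2 _ B2) as L2.
  pose proof (lim_inf_plus _ _ _ _ L1 L2) as L. cbv beta in L. rewrite Rplus_0_r, Rminus_0_r in L.
  replace (RtoC PI * u x0 + RtoC PI * u x0)%C with (RtoC (2 * PI) * u x0)%C in L by (rewrite RtoC_mult; ring).
  apply (lim_inf_ext _ _ _ 0) with (2 := L). intros S HS. symmetry. apply CI_unique.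
  assert (K1 : forall p, Ccont (fun p => I0 (fun x => osc (- p) x * u (x0 + x)%R)%C) p) by (intros; now apply (I0_osc_cont (fun x => u (x0 + x)) _ p C1 B1)).
  assert (K2 : forall p, Ccont (fun p => I0 (fun x => osc (- p) x * u (x0 - x)%R)%C) p) by (intros; now apply (I0_osc_cont (fun x => u (x0 - x)) _ p C2 B2)).
  cbv beta. match goal with |- is_CI _ _ _ (Cplus ?a ?b) => rewrite <- (CI_sym_opp _ S K2 : _ = b) end.
  eapply is_CI_ext; [|apply is_CI_plus; apply CI_correct, ex_CI_cont].
  - intros k _. simpl. rewrite line_transform_eq, Ropp_involutive. reflexivity.
  - intros; apply K1.
  - intros. apply (Ccont_comp_R1 (fun p => I0 (fun x => osc (- p) x * u (x0 - x)%R)%C)); auto.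
    apply (continuous_opp (V := R_NormedModule)), continuous_id.
Qed.

Lemma line_transform_cont (k : R) : Ccont line_transform k.
Proof.
  assert (C2 : forall x, Ccont (fun x => u (0 - x)) x) by (intros; apply (Ccont_comp_R1 u); auto; apply continuous_reflect).
  assert (C1 : forall x, Ccont (fun x => u (0 + x)) x) by (intros; apply (Ccont_comp_R1 u); auto; apply continuous_shift).
  assert (B1 : forall x, 0 <= x -> Cmod (u (0 + x)) <= M * phi x) by (intros x _; rewrite Rplus_0_l; auto).
  assert (B2 : forall x, 0 <= x -> Cmod (u (0 - x)) <= M * phi x) by (intros x _; rewrite Rminus_0_l, <- (phi_opp x); auto).
  apply (continuous_ext (fun k => (I0 (fun x => osc (- k) x * u (0 + x)%R) + I0 (fun x => osc k x * u (0 - x)%R))%C)).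
  - intros p. rewrite <- line_transform_eq. unfold osc at 1. rewrite Rmult_0_l, Cmult_0_r, Cexp_0. cring.
  - apply Ccont_plus; [now apply (I0_osc_cont (fun x => u (0 + x)) M)|].
    apply (continuous_ext (fun k => I0 (fun x => osc (- - k) x * u (0 - x)%R)%C)).
    + intros p. now rewrite Ropp_involutive.
    + apply (Ccont_comp_R1 (fun k => I0 (fun x => osc (- k) x * u (0 - x)%R)%C)).
      * intros y. now apply (I0_osc_cont (fun x => u (0 - x)) M).
      * apply (continuous_opp (V := R_NormedModule)), continuous_id.
Qed.

(** An absolutely convergent line integral exists, and its value is then the limit over symmetric
    intervals. *)
Theorem line_inversion_abs (x0 K : R) (l : C) : Rderive u x0 l ->
  (forall k, Cmod (line_transform k) <= K * phi k) ->
  is_CRInt_line (fun k => osc x0 k * line_transform k)%C (RtoC (2 * PI) * u x0)%C.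
Proof.
  intros Hd HK.
  assert (C1 : forall k, Ccont (fun k => osc x0 k * line_transform k)%C k).
  { intros k. apply Ccont_mult; [apply osc_cont|apply line_transform_cont]. }
  assert (H : is_CRInt_line (fun k => osc x0 k * line_transform k)%C
    (I0 (fun k => osc x0 k * line_transform k) + I0 (fun k => osc x0 (- k)%R * line_transform (- k)%R))%C).
  { apply (is_line_dom (fun k => osc x0 k * line_transform k)%C K C1).
    intros k. rewrite Cmod_mult, Cmod_osc, Rmult_1_l. auto. }
  rewrite (lim_inf_unique _ _ _ (line_inversion x0 l Hd) (is_line_lim _ _ C1 H)). exact H.
Qed.

End LineInversion.

(** * Inversion at an interior point of the half line *)

Lemma is_I0_split (g : R -> C) (v : C) (y : R) : (forall x, Ccont g x) -> is_I0 g v ->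
  is_I0 (fun x => g (y + x)) (v - CI g 0 y)%C.
Proof.
  intros Hg. rewrite !is_I0_eps. intros H eps He. destruct (H eps He) as [B HB].
  exists (B - y). intros b Hb. destruct (HB (y + b) ltac:(lra)) as (z & Hz1 & Hz2).
  exists (z - CI g 0 y)%C. split.
  - assert (K : is_CI g 0 y (CI g 0 y)) by (apply CI_correct, ex_CI_cont; auto).
    pose proof (is_CI_Chasles _ _ _ _ _ _ (is_CI_swap _ _ _ _ K) Hz1) as K2.
    replace (z - CI g 0 y)%C with (- CI g 0 y + z)%C by ring.
    apply (is_CI_ext (fun x => g (x + y))); [intros x _; f_equal; ring|].
    apply (is_CI_shift g y 0 b). rewrite Rplus_0_l, Rplus_comm. exact K2.
  - replace (z - CI g 0 y - (v - CI g 0 y))%C with (z - v)%C by ring. exact Hz2.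
Qed.

Lemma CI_reflect (g : R -> C) (y : R) : (forall x, Ccont g x) -> CI g 0 y = CI (fun x => g (y - x)) 0 y.
Proof.
  intros Hg. symmetry. apply CI_unique.
  assert (K : is_CI g (- 0 + y) (- y + y) (- CI g 0 y)%C).
  { replace (- 0 + y) with y by ring. replace (- y + y) with 0 by ring.
    apply is_CI_swap, CI_correct, ex_CI_cont; auto. }
  apply is_CI_shift in K. apply (is_CI_comp_opp (fun x => g (x + y))) in K.
  eapply is_CI_eq; [eapply is_CI_ext; [|exact K]|cring].
  intros x _. simpl. f_equal. ring.
Qed.

(** Extension by zero would jump at 0, so inversion on the line does not apply. Instead the half
    line is cut at y: [y, oo) falls under [half_inversion], and the reflected interval [0, y] under
    [half_inversion_fin]. Because beta(0) may be nonzero, only the symmetric limit is claimed. *)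
Theorem halfline_inversion (beta : R -> C) (y M : R) (l : C) : 0 < y ->
  (forall x, Ccont beta x) -> (forall x, 0 <= x -> Cmod (beta x) <= M * phi x) -> Rderive beta y l ->
  lim_inf (fun S => CI (fun p => osc y p * I0 (fun z => osc (- p) z * beta z))%C (- S) S) (RtoC (2 * PI) * beta y)%C.
Proof.
  intros Hy Hc HM Hd. assert (HM0 : 0 <= M) by (apply (dom_M_pos beta); auto).
  pose proof (Rle_0_sqr y) as Hy0. unfold Rsqr in Hy0.
  assert (C1 : forall x, Ccont (fun x => beta (y + x)) x) by (intros; apply (Ccont_comp_R1 beta); auto; apply continuous_shift).
  assert (C2 : forall x, Ccont (fun x => beta (y - x)) x) by (intros; apply (Ccont_comp_R1 beta); auto; apply continuous_reflect).
  assert (B1 : forall x, 0 <= x -> Cmod (beta (y + x)) <= M * (2 * (1 + y * y)) * phi x).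
  { intros x Hx. rewrite Rmult_assoc. eapply Rle_trans; [apply HM; lra|]. apply Rmult_le_compat_l; [exact HM0|apply phi_peetre]. }
  assert (D1 : Rderive (fun x => beta (y + x)) 0 (RtoC 1 * l)%C).
  { apply (Rderive_comp_R beta (fun x => y + x)); [auto_derive; auto|]. now rewrite Rplus_0_r. }
  assert (D2 : Rderive (fun x => beta (y - x)) 0 (RtoC (-1) * l)%C).
  { apply (Rderive_comp_R beta (fun x => y - x)); [auto_derive; auto; ring|]. now rewrite Rminus_0_r. }
  pose proof (half_inversion _ _ C1 D1 _ B1) as L1.
  pose proof (half_inversion_fin _ _ C2 D2 y Hy) as L2.
  pose proof (lim_inf_plus _ _ _ _ L1 L2) as L. cbv beta in L. rewrite Rplus_0_r, Rminus_0_r in L.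
  replace (RtoC PI * beta y + RtoC PI * beta y)%C with (RtoC (2 * PI) * beta y)%C in L by (rewrite RtoC_mult; ring).
  apply (lim_inf_ext _ _ _ 0) with (2 := L). intros S HS. symmetry. apply CI_unique.
  assert (K1 : forall p, Ccont (fun p => I0 (fun x => osc (- p) x * beta (y + x)%R)%C) p) by (intros; now apply (I0_osc_cont (fun x => beta (y + x)) _ p C1 B1)).
  assert (K2 : forall p, Ccont (fun p => CI (fun x => osc (- p) x * beta (y - x)%R)%C 0 y) p).
  { intros p. apply (CI_param_cont (fun p x => osc (- p) x * beta (y - x)%R)%C); [lra| |].
    - intros x _. apply Ccont_mult; [apply osc_cont2|].
      apply (continuous_comp (fun q : R * R => snd q) (fun x => beta (y - x))); [apply continuous_snd|apply C2].
    - apply filter_forall. intros r. apply ex_CI_cont. intros x _. apply Ccont_mult; [apply osc_cont|apply C2]. }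
  cbv beta. match goal with |- is_CI _ _ _ (Cplus ?a ?b) => rewrite <- (CI_sym_opp _ S K2 : _ = b) end.
  eapply is_CI_ext; [|apply is_CI_plus; apply CI_correct, ex_CI_cont].
  - intros p _. simpl. rewrite Ropp_involutive.
    assert (G : forall x, Ccont (fun z => osc (- p) z * beta z)%C x) by (intros x; apply Ccont_mult; [apply osc_cont|apply Hc]).
    assert (I : is_I0 (fun z => osc (- p) z * beta z)%C (I0 (fun z => osc (- p) z * beta z)%C)).
    { apply (is_I0_dom _ M); auto. intros x Hx. rewrite Cmod_mult, Cmod_osc, Rmult_1_l. auto. }
    pose proof (is_I0_scal (osc y p) _ _ (is_I0_split _ _ y G I)) as I2.
    rewrite (CI_reflect _ y G) in I2.
    assert (E1 : I0 (fun x => osc (- p) x * beta (y + x)%R)%C = (osc y p * (I0 (fun z => osc (- p) z * beta z) - CI (fun x => osc (- p) (y - x)%R * beta (y - x)%R) 0 y))%C).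
    { apply I0_unique. eapply is_I0_ext; [|exact I2]. intros x _. simpl.
      rewrite <- (osc_cancel y p x). ring. }
    assert (E2 : CI (fun x => osc p x * beta (y - x)%R)%C 0 y = (osc y p * CI (fun x => osc (- p) (y - x)%R * beta (y - x)%R)%C 0 y)%C).
    { apply CI_unique.
      eapply is_CI_ext; [|apply is_CI_scal; apply CI_correct, ex_CI_cont].
      - intros x _. simpl. replace p with (- - p) at 3 by ring. rewrite (osc_opp (- p) x). rewrite <- (osc_cancel y p (- x)).
        unfold Rminus. ring.
      - intros x _. apply (Ccont_comp_R1 (fun z => osc (- p) z * beta z)%C); auto. apply continuous_reflect. }
    rewrite E1, E2. ring.
  - intros; apply K1.
  - intros. apply (Ccont_comp_R1 (fun p => CI (fun x => osc (- p) x * beta (y - x)%R)%C 0 y)); auto.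
    apply (continuous_opp (V := R_NormedModule)), continuous_id.
Qed.

(** * Transforms on the half line and in time *)

(** The sign of the exponent is opposite to that in [hat], so that the natural domain is the closed
    upper half plane; [LT1] is the derivative of [LT]. *)
Definition LT (beta : R -> C) (zeta : C) : C := I0 (fun z => Cexp (Ci * zeta * RtoC z) * beta z)%C.
Definition LT1 (beta : R -> C) (zeta : C) : C := I0 (fun z => Ci * RtoC z * Cexp (Ci * zeta * RtoC z) * beta z)%C.

Lemma Re_Ci_mult (zeta : C) (z : R) : Re (Ci * zeta * RtoC z) = - (Im zeta * z).
Proof. unfold Re, Im; simpl. ring. Qed.

Lemma Re_Ci_le (zeta : C) (z : R) : 0 <= Im zeta -> 0 <= z -> Re (Ci * zeta * RtoC z) <= 0.
Proof. intros H1 H2. rewrite Re_Ci_mult. nra. Qed.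

Lemma xx_phi (x : R) : x * x * phi x <= 1.
Proof.
  unfold phi. assert (P : 0 < 1 + x * x) by nra.
  apply (Rmult_le_reg_r (1 + x * x)); [exact P|]. rewrite Rmult_assoc, Rinv_l by lra. lra.
Qed.

Section LTs.
Variables (beta : R -> C) (M : R).
Hypotheses (Hc : forall x, Ccont beta x) (HM : forall x, 0 <= x -> Cmod (beta x) <= M * phi x * phi x).

Lemma LT_M_pos : 0 <= M.
Proof.
  pose proof (HM 0 (Rle_refl 0)) as H. unfold phi in H. rewrite Rmult_0_l, Rplus_0_r, Rinv_1 in H.
  pose proof (Cmod_ge_0 (beta 0)). lra.
Qed.

Lemma LT_exp_cont (zeta : C) (x : R) : Ccont (fun z => Cexp (Ci * zeta * RtoC z)) x.
Proof.
  apply Ccont_exp, Ccont_mult; [apply Ccont_const|]. apply Ccont_RtoC, continuous_id.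
Qed.

(** Of the two factors [phi] in the hypothesis on [beta], one absorbs a kernel growing like x^2, as
    in second-order Taylor remainders, and the other keeps the product integrable. *)
Lemma LT_dom (g : R -> C) (K x : R) : 0 <= x -> 0 <= K -> Cmod (g x) <= K * Rmax 1 (x * x) ->
  Cmod (g x * beta x) <= (K * M) * phi x.
Proof.
  intros Hx HK Hg. rewrite Cmod_mult. pose proof LT_M_pos as HM0. pose proof (HM x Hx) as HMx. pose proof (phi_pos x) as Hp. pose proof (Cmod_ge_0 (beta x)). pose proof (Cmod_ge_0 (g x)).
  apply Rle_trans with (K * Rmax 1 (x * x) * (M * phi x * phi x)).
  - apply Rmult_le_compat; auto.
  - replace (K * Rmax 1 (x * x) * (M * phi x * phi x)) with (Rmax 1 (x * x) * phi x * (K * M * phi x)) by ring.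
    rewrite <- (Rmult_1_l (K * M * phi x)) at 2. apply Rmult_le_compat_r.
    + repeat apply Rmult_le_pos; lra.
    + unfold Rmax. destruct Rle_dec; [apply xx_phi|]. rewrite Rmult_1_l. apply phi_le_1.
Qed.

Lemma LT_dom1 (zeta : C) (x : R) : 0 <= Im zeta -> 0 <= x -> Cmod (Cexp (Ci * zeta * RtoC x) * beta x) <= M * phi x.
Proof.
  intros Hz Hx. rewrite <- (Rmult_1_l M). apply (LT_dom (fun x => Cexp (Ci * zeta * RtoC x)) 1 x Hx Rle_0_1).
  rewrite Rmult_1_l, Cmod_Cexp. apply Rle_trans with 1; [|apply Rmax_l].
  rewrite <- exp_0. apply exp_le_exp. now apply Re_Ci_le.
Qed.

Lemma x_le_max (x : R) : 0 <= x -> x <= Rmax 1 (x * x).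
Proof.
  intros Hx. destruct (Rle_lt_dec x 1).
  - apply Rle_trans with 1; [lra|apply Rmax_l].
  - apply Rle_trans with (x * x); [nra|apply Rmax_r].
Qed.

Lemma is_LT (zeta : C) : 0 <= Im zeta -> is_I0 (fun z => Cexp (Ci * zeta * RtoC z) * beta z)%C (LT beta zeta).
Proof.
  intros Hz. apply (is_I0_dom _ M).
  - intros x. apply Ccont_mult; [apply LT_exp_cont|apply Hc].
  - intros x Hx. now apply LT_dom1.
Qed.

Lemma LT1_dom (zeta : C) (x : R) : 0 <= Im zeta -> 0 <= x ->
  Cmod (Ci * RtoC x * Cexp (Ci * zeta * RtoC x) * beta x) <= M * phi x.
Proof.
  intros Hz Hx. rewrite <- (Rmult_1_l M).
  apply (LT_dom (fun x => Ci * RtoC x * Cexp (Ci * zeta * RtoC x))%C 1 x Hx Rle_0_1).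
  rewrite Rmult_1_l, !Cmod_mult, Cmod_Ci, Cmod_RtoC_pos, Cmod_Cexp, Rmult_1_l by exact Hx.
  assert (exp (Re (Ci * zeta * RtoC x)) <= 1) by (rewrite <- exp_0; apply exp_le_exp; now apply Re_Ci_le).
  pose proof (x_le_max x Hx). nra.
Qed.

Lemma LT1_cont_int (zeta : C) (x : R) : Ccont (fun x => Ci * RtoC x * Cexp (Ci * zeta * RtoC x) * beta x)%C x.
Proof.
  apply Ccont_mult; [|apply Hc]. apply Ccont_mult; [|apply LT_exp_cont].
  apply Ccont_mult; [apply Ccont_const|]. apply Ccont_RtoC, continuous_id.
Qed.

Lemma is_LT1 (zeta : C) : 0 <= Im zeta ->
  is_I0 (fun z => Ci * RtoC z * Cexp (Ci * zeta * RtoC z) * beta z)%C (LT1 beta zeta).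
Proof.
  intros Hz. apply (is_I0_dom _ M); [apply LT1_cont_int|]. intros x Hx. now apply LT1_dom.
Qed.

Lemma LT_bound (zeta : C) : 0 <= Im zeta -> Cmod (LT beta zeta) <= 2 * M.
Proof.
  intros Hz. apply I0_bound.
  - intros x. apply Ccont_mult; [apply LT_exp_cont|apply Hc].
  - intros x Hx. now apply LT_dom1.
Qed.

Lemma Cmod_Ci_diff (w z : C) (x : R) : 0 <= x ->
  Cmod (Ci * w * RtoC x - Ci * z * RtoC x) = x * Cmod (w - z).
Proof.
  intros Hx. replace (Ci * w * RtoC x - Ci * z * RtoC x)%C with (Ci * RtoC x * (w - z))%C by ring.
  rewrite !Cmod_mult, Cmod_Ci, Cmod_RtoC_pos by exact Hx. ring.
Qed.

(** The bound that removes the singularity at nu = l: the difference of the values at nu and l,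
    divided by nu - l, stays bounded. *)
Lemma LT_lip (w z : C) : 0 <= Im w -> 0 <= Im z -> Cmod (LT beta w - LT beta z) <= 2 * M * Cmod (w - z).
Proof.
  intros Hw Hz. rewrite <- (I0_unique _ _ (is_I0_minus _ _ _ _ (is_LT w Hw) (is_LT z Hz))).
  replace (2 * M * Cmod (w - z)) with (2 * (Cmod (w - z) * M)) by ring. apply I0_bound.
  - intros x. apply Ccont_minus; (apply Ccont_mult; [apply LT_exp_cont|apply Hc]).
  - intros x Hx.
    replace (Cexp (Ci * w * RtoC x) * beta x - Cexp (Ci * z * RtoC x) * beta x)%C
      with ((Cexp (Ci * w * RtoC x) - Cexp (Ci * z * RtoC x)) * beta x)%C by ring.
    apply (LT_dom (fun x => Cexp (Ci * w * RtoC x) - Cexp (Ci * z * RtoC x))%C _ x Hx (Cmod_ge_0 _)).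
    eapply Rle_trans; [apply (Cexp_lip _ _ 0); now apply Re_Ci_le|].
    rewrite exp_0, Rmult_1_l, Cmod_Ci_diff by exact Hx. rewrite (Rmult_comm x).
    apply Rmult_le_compat_l; [apply Cmod_ge_0|now apply x_le_max].
Qed.

Lemma LT1_lip (w z : C) : 0 <= Im w -> 0 <= Im z -> Cmod (LT1 beta w - LT1 beta z) <= 2 * M * Cmod (w - z).
Proof.
  intros Hw Hz. rewrite <- (I0_unique _ _ (is_I0_minus _ _ _ _ (is_LT1 w Hw) (is_LT1 z Hz))).
  replace (2 * M * Cmod (w - z)) with (2 * (Cmod (w - z) * M)) by ring. apply I0_bound.
  - intros x. apply Ccont_minus; apply LT1_cont_int.
  - intros x Hx.
    replace (Ci * RtoC x * Cexp (Ci * w * RtoC x) * beta x - Ci * RtoC x * Cexp (Ci * z * RtoC x) * beta x)%C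
      with (Ci * RtoC x * (Cexp (Ci * w * RtoC x) - Cexp (Ci * z * RtoC x)) * beta x)%C by ring.
    apply (LT_dom (fun x => Ci * RtoC x * (Cexp (Ci * w * RtoC x) - Cexp (Ci * z * RtoC x)))%C _ x Hx (Cmod_ge_0 _)).
    rewrite !Cmod_mult, Cmod_Ci, Cmod_RtoC_pos, Rmult_1_l by exact Hx.
    apply Rle_trans with (x * (x * Cmod (w - z))).
    + apply Rmult_le_compat_l; [exact Hx|].
      eapply Rle_trans; [apply (Cexp_lip _ _ 0); now apply Re_Ci_le|].
      rewrite exp_0, Rmult_1_l, Cmod_Ci_diff by exact Hx. lra.
    + replace (x * (x * Cmod (w - z))) with (Cmod (w - z) * (x * x)) by ring.
      apply Rmult_le_compat_l; [apply Cmod_ge_0|apply Rmax_r].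
Qed.

Lemma LT_taylor (w z : C) : 0 <= Im w -> 0 <= Im z ->
  Cmod (LT beta w - LT beta z - LT1 beta z * (w - z)) <= 2 * M * (Cmod (w - z) * Cmod (w - z)).
Proof.
  intros Hw Hz. rewrite (Cmult_comm (LT1 beta z)).
  rewrite <- (I0_unique _ _ (is_I0_minus _ _ _ _ (is_I0_minus _ _ _ _ (is_LT w Hw) (is_LT z Hz)) (is_I0_scal (w - z)%C _ _ (is_LT1 z Hz)))).
  replace (2 * M * (Cmod (w - z) * Cmod (w - z))) with (2 * (Cmod (w - z) * Cmod (w - z) * M)) by ring. apply I0_bound.
  - intros x. apply Ccont_minus; [apply Ccont_minus; (apply Ccont_mult; [apply LT_exp_cont|apply Hc])|].
    apply Ccont_mult; [apply Ccont_const|apply LT1_cont_int].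
  - intros x Hx.
    replace (Cexp (Ci * w * RtoC x) * beta x - Cexp (Ci * z * RtoC x) * beta x
        - (w - z) * (Ci * RtoC x * Cexp (Ci * z * RtoC x) * beta x))%C
      with ((Cexp (Ci * w * RtoC x) - Cexp (Ci * z * RtoC x) - (Ci * w * RtoC x - Ci * z * RtoC x) * Cexp (Ci * z * RtoC x)) * beta x)%C by ring.
    apply (LT_dom (fun x => Cexp (Ci * w * RtoC x) - Cexp (Ci * z * RtoC x) - (Ci * w * RtoC x - Ci * z * RtoC x) * Cexp (Ci * z * RtoC x))%C _ x Hx).
    { apply Rmult_le_pos; apply Cmod_ge_0. }
    eapply Rle_trans; [apply (Cexp_taylor _ _ 0); now apply Re_Ci_le|].
    rewrite exp_0, Rmult_1_l, Cmod_Ci_diff by exact Hx.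
    replace (x * Cmod (w - z) * (x * Cmod (w - z))) with (Cmod (w - z) * Cmod (w - z) * (x * x)) by ring.
    apply Rmult_le_compat_l; [apply Rmult_le_pos; apply Cmod_ge_0|apply Rmax_r].
Qed.

Lemma holo_LT : holo (fun z => 0 < Im z) (LT beta).
Proof.
  (* The radius Im z keeps the disc inside the closed upper half plane, where the bounds hold. *)
  apply (holo_quad _ (LT beta) (LT1 beta)). intros z Hz. exists (Im z), (2 * M).
  pose proof LT_M_pos. split; [exact Hz|]. split; [lra|]. intros w Hw.
  assert (Hw0 : 0 <= Im w).
  { pose proof (Im_le_Cmod (w - z)) as H1. apply Rabs_le_between in H1.
    unfold Im in *; simpl in *. lra. }
  split; [apply LT_taylor|apply LT1_lip]; lra.
Qed.

End LTs.

(** * The transform in time *)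

Definition mT (beta : R -> C) (t : R) (w : C) : C := CI (fun tau => Cexp (w * RtoC tau) * beta tau)%C 0 t.

Section MTs.
Variables (beta : R -> C) (t B : R).
Hypotheses (Ht : 0 <= t) (Hc : forall x, Ccont beta x) (HB : forall x, 0 <= x <= t -> Cmod (beta x) <= B).

Lemma MT_exp_cont (w : C) (x : R) : Ccont (fun z => Cexp (w * RtoC z)) x.
Proof. apply Ccont_exp, Ccont_mult; [apply Ccont_const|]. apply Ccont_RtoC, continuous_id. Qed.

Lemma MT_B_pos : 0 <= B.
Proof. pose proof (HB 0 ltac:(lra)). pose proof (Cmod_ge_0 (beta 0)). lra. Qed.

Lemma is_mT (w : C) : is_CI (fun tau => Cexp (w * RtoC tau) * beta tau)%C 0 t (mT beta t w).
Proof.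
  apply CI_correct, ex_CI_cont. intros x _. apply Ccont_mult; [apply MT_exp_cont|apply Hc].
Qed.

Definition mT1 (w : C) : C := CI (fun tau => RtoC tau * Cexp (w * RtoC tau) * beta tau)%C 0 t.

Lemma is_mT1 (w : C) : is_CI (fun tau => RtoC tau * Cexp (w * RtoC tau) * beta tau)%C 0 t (mT1 w).
Proof.
  apply CI_correct, ex_CI_cont. intros x _. apply Ccont_mult; [|apply Hc]. apply Ccont_mult; [|apply MT_exp_cont].
  apply Ccont_RtoC, continuous_id.
Qed.

Lemma MT_Re_le (z w : C) (x : R) : 0 <= x <= t -> Cmod (w - z) <= 1 -> Re (w * RtoC x) <= (Rabs (Re z) + 1) * t.
Proof.
  intros Hx Hw. pose proof (Re_le_Cmod (w - z)) as H1. apply Rabs_le_between in H1.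
  pose proof (Rle_abs (Re z)). pose proof (Rabs_pos (Re z)). unfold Re in *; simpl in *.
  assert (fst w <= Rabs (fst z) + 1) by lra. nra.
Qed.

Lemma holo_mT (U : C -> Prop) : holo U (mT beta t).
Proof.
  pose proof MT_B_pos as HB0.
  apply (holo_quad _ (mT beta t) mT1). intros z _.
  (* A bound for |exp (w tau)| over the unit disc around z and 0 <= tau <= t; the time interval is
     bounded, so no half plane has to be singled out. *)
  pose (K := exp ((Rabs (Re z) + 1) * t)).
  assert (HK : 0 < K) by apply exp_pos.
  exists 1, (t * (K * (t * t) * B)). split; [lra|]. split; [repeat apply Rmult_le_pos; lra|].
  intros w Hw.
  assert (Hzz : Cmod (z - z) <= 1) by (replace (z - z)%C with (RtoC 0) by ring; rewrite Cmod_0; lra).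
  assert (D : forall x, 0 <= x -> Cmod (w * RtoC x - z * RtoC x) = x * Cmod (w - z)).
  { intros x Hx. replace (w * RtoC x - z * RtoC x)%C with (RtoC x * (w - z))%C by ring.
    rewrite Cmod_mult, Cmod_RtoC_pos by exact Hx. reflexivity. }
  pose proof (Cmod_ge_0 (w - z)) as Hd.
  split.
  - pose proof (is_CI_minus _ _ _ _ _ _ (is_CI_minus _ _ _ _ _ _ (is_mT w) (is_mT z)) (is_CI_scal (w - z)%C _ _ _ _ (is_mT1 z))) as HI.
    rewrite (Cmult_comm (mT1 z)).
    replace (t * (K * (t * t) * B) * (Cmod (w - z) * Cmod (w - z))) with ((t - 0) * (K * (t * t) * B * (Cmod (w - z) * Cmod (w - z)))) by ring.
    eapply is_CI_norm_const; [exact Ht| |exact HI]. intros x Hx. simpl.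
    replace (Cexp (w * RtoC x) * beta x - Cexp (z * RtoC x) * beta x - (w - z) * (RtoC x * Cexp (z * RtoC x) * beta x))%C
      with ((Cexp (w * RtoC x) - Cexp (z * RtoC x) - (w * RtoC x - z * RtoC x) * Cexp (z * RtoC x)) * beta x)%C by ring.
    rewrite Cmod_mult.
    replace (K * (t * t) * B * (Cmod (w - z) * Cmod (w - z))) with ((K * (t * t) * (Cmod (w - z) * Cmod (w - z))) * B) by ring.
    apply Rmult_le_compat; try apply Cmod_ge_0; [|now apply HB].
    eapply Rle_trans; [apply (Cexp_taylor _ _ ((Rabs (Re z) + 1) * t)); apply MT_Re_le; auto; lra|].
    fold K. rewrite D by lra. rewrite (Rmult_assoc K (t * t)). apply Rmult_le_compat_l; [lra|].
    replace (x * Cmod (w - z) * (x * Cmod (w - z))) with (x * x * (Cmod (w - z) * Cmod (w - z))) by ring.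
    apply Rmult_le_compat_r; nra.
  - pose proof (is_CI_minus _ _ _ _ _ _ (is_mT1 w) (is_mT1 z)) as HI.
    replace (t * (K * (t * t) * B) * Cmod (w - z)) with ((t - 0) * (K * (t * t) * B * Cmod (w - z))) by ring.
    eapply is_CI_norm_const; [exact Ht| |exact HI]. intros x Hx. simpl.
    replace (RtoC x * Cexp (w * RtoC x) * beta x - RtoC x * Cexp (z * RtoC x) * beta x)%C
      with (RtoC x * (Cexp (w * RtoC x) - Cexp (z * RtoC x)) * beta x)%C by ring.
    rewrite !Cmod_mult, Cmod_RtoC_pos by lra.
    replace (K * (t * t) * B * Cmod (w - z)) with ((t * (K * (t * Cmod (w - z)))) * B) by ring.
    apply Rmult_le_compat; [apply Rmult_le_pos; [lra|apply Cmod_ge_0]|apply Cmod_ge_0| |now apply HB].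
    apply Rmult_le_compat; [lra|apply Cmod_ge_0|lra|].
    eapply Rle_trans; [apply (Cexp_lip _ _ ((Rabs (Re z) + 1) * t)); apply MT_Re_le; auto; lra|].
    fold K. rewrite D by lra. apply Rmult_le_compat_l; [lra|]. apply Rmult_le_compat_r; lra.
Qed.

(** The two exponentials combine to exp (-w (t - tau)), of modulus at most 1 when Re w >= 0. *)
Lemma mT_damped_bound (w : C) : 0 <= Re w -> Cmod (Cexp (- (w * RtoC t)) * mT beta t w) <= t * B.
Proof.
  intros Hw. replace (t * B) with ((t - 0) * B) by ring.
  eapply is_CI_norm_const; [exact Ht| |apply is_CI_scal; apply is_mT]. intros x Hx. simpl.
  rewrite Cmult_assoc, <- Cexp_plus, Cmod_mult, Cmod_Cexp. rewrite <- (Rmult_1_l B).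
  apply Rmult_le_compat; [left; apply exp_pos|apply Cmod_ge_0| |now apply HB].
  rewrite <- exp_0. apply exp_le_exp. unfold Re in *; simpl in *. nra.
Qed.

(** One integration by parts in tau. The constant counts two boundary values and an integral of
    length t, each bounded by B after damping. *)
Lemma mT_damped_decay (beta' : R -> C) (w : C) : 0 <= Re w ->
  (forall x, Ccont beta' x) -> (forall x, 0 <= x <= t -> Cmod (beta' x) <= B) ->
  (forall x, 0 < x < t -> Rderive beta x (beta' x)) ->
  Cmod w * Cmod (Cexp (- (w * RtoC t)) * mT beta t w) <= (2 + t) * B.
Proof.
  intros Hw Hc' HB' Hd. pose proof MT_B_pos as HB0. rewrite <- Cmod_mult.
  assert (HI : is_CI (fun tau => w * (Cexp (- (w * RtoC t)) * (Cexp (w * RtoC tau) * beta tau)) + Cexp (- (w * RtoC t)) * (Cexp (w * RtoC tau) * beta' tau))%C 0 t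
    (beta t - Cexp (- (w * RtoC t)) * beta 0)%C).
  { eapply is_CI_eq; [apply (FTC_C_open (fun tau => Cexp (- (w * RtoC t)) * (Cexp (w * RtoC tau) * beta tau))%C); auto|].
    - intros x Hx. eapply Rderive_eq.
      + apply Rderive_mult; [apply Rderive_const|]. apply Rderive_mult; [|now apply Hd].
        apply (Rderive_exp (fun x => w * RtoC x)%C).
        apply (Rderive_mult (fun _ => w) (fun x => RtoC x)); [apply Rderive_const|apply Rderive_id].
      + cring.
    - intros x Hx. apply Ccont_mult; [apply Ccont_const|]. apply Ccont_mult; [apply MT_exp_cont|apply Hc].
    - intros x. apply Ccont_plus.
      + apply Ccont_mult; [apply Ccont_const|]. apply Ccont_mult; [apply Ccont_const|]. apply Ccont_mult; [apply MT_exp_cont|apply Hc].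
      + apply Ccont_mult; [apply Ccont_const|]. apply Ccont_mult; [apply MT_exp_cont|apply Hc'].
    - cbv beta. rewrite !Cmult_assoc, <- !Cexp_plus.
      replace (- (w * RtoC t) + w * RtoC t)%C with (RtoC 0) by ring.
      replace (- (w * RtoC t) + w * RtoC 0)%C with (- (w * RtoC t))%C by ring.
      rewrite Cexp_0. ring. }
  assert (E : forall x, 0 <= x <= t -> Cmod (Cexp (- (w * RtoC t)) * (Cexp (w * RtoC x) * beta' x)) <= B).
  { intros x Hx. rewrite Cmult_assoc, <- Cexp_plus, Cmod_mult, Cmod_Cexp. rewrite <- (Rmult_1_l B).
    apply Rmult_le_compat; [left; apply exp_pos|apply Cmod_ge_0| |now apply HB'].
    rewrite <- exp_0. apply exp_le_exp. unfold Re in *; simpl in *. nra. }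
  assert (H2 : is_CI (fun tau => Cexp (- (w * RtoC t)) * (Cexp (w * RtoC tau) * beta' tau))%C 0 t
    (CI (fun tau => Cexp (- (w * RtoC t)) * (Cexp (w * RtoC tau) * beta' tau))%C 0 t)).
  { apply CI_correct, ex_CI_cont. intros x _. apply Ccont_mult; [apply Ccont_const|]. apply Ccont_mult; [apply MT_exp_cont|apply Hc']. }
  pose proof (is_CI_norm_const _ B 0 t _ Ht E H2) as E2.
  pose proof (is_CI_minus _ _ _ _ _ _ HI H2) as H3.
  assert (H4 : is_CI (fun tau => w * (Cexp (- (w * RtoC t)) * (Cexp (w * RtoC tau) * beta tau)))%C 0 t (w * (Cexp (- (w * RtoC t)) * mT beta t w))%C).
  { apply is_CI_scal, is_CI_scal, is_mT. }
  assert (H5 : is_CI (fun tau => w * (Cexp (- (w * RtoC t)) * (Cexp (w * RtoC tau) * beta tau)))%C 0 t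
    (beta t - Cexp (- (w * RtoC t)) * beta 0 - CI (fun tau => Cexp (- (w * RtoC t)) * (Cexp (w * RtoC tau) * beta' tau))%C 0 t)%C).
  { eapply is_CI_ext; [|exact H3]. intros x _. simpl. ring. }
  rewrite (is_CI_inj _ _ _ _ _ H4 H5).
  assert (E3 : Cmod (beta t - Cexp (- (w * RtoC t)) * beta 0) <= 2 * B).
  { eapply Rle_trans; [apply Cmod_triangle_minus|]. rewrite Cmod_mult, Cmod_Cexp.
    pose proof (HB t ltac:(lra)). pose proof (HB 0 ltac:(lra)). pose proof (Cmod_ge_0 (beta 0)).
    assert (exp (Re (- (w * RtoC t))) <= 1).
    { rewrite <- exp_0. apply exp_le_exp. unfold Re in *; simpl in *. nra. }
    pose proof (exp_pos (Re (- (w * RtoC t)))). nra. }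
  eapply Rle_trans; [apply Cmod_triangle_minus|]. lra.
Qed.

End MTs.

(** * Integrability across a corner of the contour *)

Definition Csum (f : R -> C) (ptd : SF_seq) : C := @Riemann_sum C_R_NormedModule f ptd.

Lemma Csum_minus_le (f g : R -> C) (e : R -> R) (ptd : SF_seq) : pointed_subdiv ptd ->
  (forall t, SF_h ptd <= t <= seq.last (SF_h ptd) (SF_lx ptd) -> Cmod (f t - g t) <= e t) ->
  Cmod (Csum f ptd - Csum g ptd) <= Riemann_sum e ptd.
Proof.
  intros Hp H.
  assert (E : (Csum f ptd - Csum g ptd)%C = Csum (fun x => f x - g x)%C ptd).
  { symmetry. exact (Riemann_sum_minus (V := C_R_NormedModule) f g ptd). }
  rewrite E, <- norm_C.
  apply (Riemann_sum_norm (V := C_R_NormedModule) (fun x => f x - g x)%C e ptd Hp).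
  intros t Ht. rewrite norm_C. now apply H.
Qed.

(** Once the Riemann sums of g and e are close to their integrals, those of f are trapped near the
    integral of g, so they are Cauchy along the filter of fine subdivisions. *)
Lemma ex_CI_sandwich (f : R -> C) (a b : R) : a < b ->
  (forall eps, 0 < eps -> exists (g : R -> C) (e : R -> R) (I : R), ex_CI g a b /\ is_RInt e a b I /\ I < eps /\
     forall x, a <= x <= b -> Cmod (f x - g x) <= e x) -> ex_CI f a b.
Proof.
  intros Hab H. unfold ex_RInt, is_RInt.
  assert (Hs : sign (b - a) = 1) by (apply sign_eq_1; lra). rewrite Hs.
  assert (HS : forall ptd, @scal R_AbsRing C_R_NormedModule 1 (@Riemann_sum C_R_NormedModule f ptd) = Csum f ptd).
  { intros ptd. rewrite scal_C. unfold Csum. cring. }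
  destruct (proj1 (filterlim_locally_cauchy (U := CompleteNormedModule.CompleteSpace _ C_R_CompleteNormedModule)
    (F := Riemann_fine a b) (Csum f))) as [v Hv].
  2:{ exists v. eapply filterlim_ext; [|exact Hv]. intros ptd. now rewrite HS. }
  (* The sums of e stay below 2 eps/6 and those of g within eps/6 of J; the sums of f are thus
     within eps/2 of J, and any two of them within eps of each other. *)
  intros eps. pose proof (cond_pos eps) as Hep. assert (He5 : 0 < eps / 6) by lra.
  destruct (H (eps / 6) He5) as (g & e & I & [J Hg] & He & HI & Hle).
  pose proof (Hg _ (locally_Cmod J _ He5)) as G1.
  pose proof (He _ (proj2 (locally_R_eps I (fun y => Rabs (y - I) < eps / 6)) (ex_intro _ (eps / 6) (conj He5 (fun y h => h))))) as G2.
  unfold filtermap in G1, G2. rewrite Hs in G1, G2.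
  assert (G3 : Riemann_fine a b (fun ptd => pointed_subdiv ptd /\ SF_h ptd = Rmin a b /\ seq.last (SF_h ptd) (SF_lx ptd) = Rmax a b)).
  { unfold Riemann_fine, within. exists (mkposreal 1 Rlt_0_1). auto. }
  exists (fun ptd => Cmod (Csum f ptd - J) < 3 * (eps / 6)). split.
  - generalize (filter_and _ _ G1 (filter_and _ _ G2 G3)). apply filter_imp.
    intros ptd (K1 & K2 & K3 & K4 & K5). rewrite Rmin_left in K4 by lra. rewrite Rmax_right in K5 by lra.
    assert (N : Cmod (Csum f ptd - Csum g ptd) <= Riemann_sum e ptd).
    { apply Csum_minus_le; [exact K3|]. intros t Ht. apply Hle. split; [rewrite <- K4; apply Ht|eapply Rle_trans; [apply Ht|right; exact K5]]. }
    rewrite scal_C in K1. change (Cmod (RtoC 1 * Csum g ptd - J) < eps / 6) in K1. rewrite Cmult_1_l in K1.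
    change (Rabs (1 * Riemann_sum e ptd - I) < eps / 6) in K2. rewrite Rmult_1_l in K2. apply Rabs_def2 in K2.
    replace (Csum f ptd - J)%C with ((Csum f ptd - Csum g ptd) + (Csum g ptd - J))%C by ring.
    eapply Rle_lt_trans; [apply Cmod_triangle|]. lra.
  - intros u v Hu Hv. cbv beta in Hu, Hv.
    assert (D : Cmod (Csum f v - Csum f u) < eps).
    { replace (Csum f v - Csum f u)%C with ((Csum f v - J) - (Csum f u - J))%C by ring.
      eapply Rle_lt_trans; [apply Cmod_triangle_minus|]. lra. }
    pose proof (Re_le_Cmod (Csum f v - Csum f u)) as D1. pose proof (Im_le_Cmod (Csum f v - Csum f u)) as D2.
    unfold Re, Im in D1, D2; simpl in D1, D2.
    split; unfold ball; simpl; unfold AbsRing_ball, abs, minus, plus, opp; simpl; lra.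
Qed.

(** Along the contour the velocity jumps at the corner, and the integrand has an arbitrary value
    there. The cutoff s, zero at c, makes s f continuous because f is bounded, and 1 - s is the
    Lorentz profile eta^2 / ((x - c)^2 + eta^2), whose integral is at most pi eta. *)
Lemma ex_CI_one_jump (f : R -> C) (c M a b : R) : (forall x, x <> c -> Ccont f x) -> (forall x, Cmod (f x) <= M) ->
  ex_CI f a b.
Proof.
  intros Hc HM.
  assert (HM0 : 0 <= M) by (pose proof (HM 0); pose proof (Cmod_ge_0 (f 0)); lra).
  assert (W : forall a b, a < b -> ex_CI f a b).
  { clear a b. intros a b Hab. apply ex_CI_sandwich; [exact Hab|]. intros eps He.
    pose proof PI_RGT_0 as HPI.
    pose (eta := eps / ((M + 1) * PI + 1)).
    assert (Hq : 0 < (M + 1) * PI) by (apply Rmult_lt_0_compat; lra).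
    assert (Heta : 0 < eta) by (apply Rdiv_lt_0_compat; lra).
    assert (Hden : forall x, 0 < (x - c) * (x - c) + eta * eta).
    { intros x. pose proof (Rle_0_sqr (x - c)) as Q. unfold Rsqr in Q. assert (0 < eta * eta) by (now apply Rmult_lt_0_compat). lra. }
    pose (s := fun x => (x - c) * (x - c) / ((x - c) * (x - c) + eta * eta)).
    assert (Hs : forall x, continuous s x).
    { intros x. apply (ex_derive_continuous (V := R_NormedModule)). unfold s. pose proof (Hden x).
      auto_derive. unfold Rminus in *. lra. }
    assert (Hs01 : forall x, 0 <= s x <= 1).
    { intros x. pose proof (Hden x). pose proof (Rle_0_sqr (x - c)) as Q. unfold Rsqr in Q. unfold s. split.
      - apply Rmult_le_pos; [exact Q|]. left. now apply Rinv_0_lt_compat.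
      - apply Rle_div_l; [lra|]. assert (0 < eta * eta) by (now apply Rmult_lt_0_compat). lra. }
    exists (fun x => RtoC (s x) * f x)%C, (fun x => M * (eta * eta / ((x - c) * (x - c) + eta * eta))),
      (M * (eta * (atan ((b - c) / eta) - atan ((a - c) / eta)))).
    split; [|split; [|split]].
    - apply ex_CI_cont. intros x _. destruct (Req_dec x c) as [->|Hx].
      + apply continuous_RC_eps. intros e1 He1.
        assert (S0 : s c = 0) by (unfold s; rewrite Rminus_diag; unfold Rdiv; ring).
        pose proof (Hs c) as K. rewrite S0 in *.
        assert (Hq2 : 0 < e1 / (M + 1)) by (apply Rdiv_lt_0_compat; lra).
        pose proof (proj1 (filterlim_locally _ _) K (mkposreal _ Hq2)) as K2.
        apply locally_R_eps in K2. destruct K2 as (d & Hd & K2). exists d. split; [exact Hd|].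
        intros y Hy. specialize (K2 y Hy). unfold ball in K2; simpl in K2; unfold AbsRing_ball, abs, minus, plus, opp in K2; simpl in K2.
        rewrite S0, Ropp_0, Rplus_0_r in K2.
        replace (RtoC (s y) * f y - RtoC 0 * f c)%C with (RtoC (s y) * f y)%C by ring.
        rewrite Cmod_mult, Cmod_R. pose proof (HM y). pose proof (Cmod_ge_0 (f y)). pose proof (Rabs_pos (s y)).
        apply Rlt_div_r in K2; [|lra]. nra.
      + apply Ccont_mult; [|now apply Hc]. apply Ccont_RtoC, Hs.
    - apply (is_RInt_scal (V := R_NormedModule)).
      replace (eta * (atan ((b - c) / eta) - atan ((a - c) / eta))) with
        (minus (eta * atan ((b - c) / eta)) (eta * atan ((a - c) / eta))) by (unfold minus, plus, opp; simpl; ring).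
      apply (is_RInt_derive (V := R_CompleteNormedModule) (fun x => eta * atan ((x - c) / eta))).
      + intros x _. pose proof (Hden x) as Hdx.
        assert (0 < 1 + ((x - c) / eta) * ((x - c) / eta)) by (pose proof (Rle_0_sqr ((x - c) / eta)) as Q; unfold Rsqr in Q; lra).
        auto_derive; [lra|]. field. split; [|lra]. 
        intros E. unfold Rsqr in *. unfold Rminus in *. ring_simplify in E. ring_simplify in Hdx. lra.
      + intros x _. apply (ex_derive_continuous (V := R_NormedModule)). pose proof (Hden x).
        auto_derive. unfold Rminus in *. lra.
    - pose proof (atan_bound ((b - c) / eta)). pose proof (atan_bound ((a - c) / eta)).
      apply Rle_lt_trans with (M * (eta * PI)).
      + apply Rmult_le_compat_l; [exact HM0|]. apply Rmult_le_compat_l; lra.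
      + unfold eta. replace (M * (eps / ((M + 1) * PI + 1) * PI)) with (M * PI * eps / ((M + 1) * PI + 1)) by (field; lra).
        apply Rlt_div_l; nra.
    - intros x _. pose proof (Hs01 x). pose proof (Hden x).
      replace (f x - RtoC (s x) * f x)%C with (RtoC (1 - s x) * f x)%C by (rewrite RtoC_minus; ring).
      rewrite Cmod_mult, Cmod_RtoC_pos, Rmult_comm by lra.
      replace (eta * eta / ((x - c) * (x - c) + eta * eta)) with (1 - s x) by (unfold s; field; lra).
      apply Rmult_le_compat_r; [lra|apply HM]. }
  destruct (Rtotal_order a b) as [H|[->|H]].
  - auto.
  - apply ex_RInt_point.
  - apply ex_RInt_swap. auto.
Qed.

(** A fundamental theorem in which the primitive is known only to the right of 0 and tends to 0
    there; boundedness of f makes the integral over [0, e] small. *)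
Lemma CI_from_0 (D f : R -> C) (M P : R) : 0 < P -> ex_CI f 0 P -> (forall x, 0 <= x <= P -> Cmod (f x) <= M) ->
  (forall x, 0 < x <= P -> Rderive D x (f x) /\ Ccont f x) ->
  (forall eps, 0 < eps -> exists d, 0 < d /\ forall x, 0 < x < d -> Cmod (D x) < eps) ->
  CI f 0 P = D P.
Proof.
  intros HP Hex HM HD Hlim.
  assert (HM0 : 0 <= M) by (pose proof (HM 0 ltac:(lra)); pose proof (Cmod_ge_0 (f 0)); lra).
  assert (Z : (CI f 0 P - D P)%C = RtoC 0).
  { apply NNPP. intros Hz. apply Cmod_gt_0 in Hz. set (z := Cmod (CI f 0 P - D P)) in *.
    destruct (Hlim (z / 2) ltac:(lra)) as (d & Hd & K).
    assert (Hq : 0 < z / (4 * (M + 1))) by (apply Rdiv_lt_0_compat; lra).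
    pose (e := Rmin (d / 2) (Rmin P (z / (4 * (M + 1))))).
    assert (He : 0 < e) by (repeat apply Rmin_pos; lra).
    assert (E1 : e <= d / 2) by apply Rmin_l.
    assert (E2 : e <= P) by (eapply Rle_trans; [apply Rmin_r|apply Rmin_l]).
    assert (E3 : e <= z / (4 * (M + 1))) by (eapply Rle_trans; [apply Rmin_r|apply Rmin_r]).
    specialize (K e ltac:(lra)).
    assert (H1 : is_CI f e P (D P - D e)%C).
    { apply FTC_C; intros x Hx; rewrite Rmin_left, Rmax_right in Hx by lra; apply HD; lra. }
    assert (X : ex_CI f 0 e).
    { apply (ex_RInt_Chasles_1 (V := C_R_CompleteNormedModule) f 0 e P); [lra|exact Hex]. }
    pose proof (CI_correct _ _ _ X) as H2.
    assert (H3 : Cmod (CI f 0 e) <= (e - 0) * M) by (apply (is_CI_norm_const f M 0 e); auto; [lra|intros; apply HM; lra]).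
    assert (E : CI f 0 P = (CI f 0 e + (D P - D e))%C) by (apply CI_unique; eapply is_CI_Chasles; eauto).
    assert (Q : z <= (e - 0) * M + Cmod (D e)).
    { unfold z. rewrite E. replace (CI f 0 e + (D P - D e) - D P)%C with (CI f 0 e - D e)%C by ring.
      eapply Rle_trans; [apply Cmod_triangle_minus|]. lra. }
    apply Rle_div_r in E3; [|lra]. nra. }
  replace (CI f 0 P) with (CI f 0 P - D P + D P)%C by ring. rewrite Z. ring.
Qed.

Lemma exp_pow (x : R) (n : nat) : exp x ^ n = exp (INR n * x).
Proof.
  induction n as [|n IH]; [simpl; now rewrite Rmult_0_l, exp_0|].
  rewrite S_INR. simpl pow. rewrite IH, <- exp_plus. f_equal. ring.
Qed.

Lemma poly_exp_bound (c : R) (n : nat) : 0 < c -> exists K, 0 <= K /\ forall s, 0 <= s -> (1 + s) ^ n * exp (- (c * s)) <= K.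
Proof.
  intros Hc.
  (* m (1 + s) <= 1 + c s / (n + 1) <= exp (c s / (n + 1)), and the n-th power of the right-hand
     side is at most exp (c s). Dividing by n + 1 rather than n also covers n = 0. *)
  pose (m := Rmin 1 (c / INR (S n))).
  assert (HS : 0 < INR (S n)) by (apply lt_0_INR; lia).
  assert (Hm : 0 < m) by (apply Rmin_pos; [lra|now apply Rdiv_lt_0_compat]).
  exists (/ m ^ n). split; [left; apply Rinv_0_lt_compat, pow_lt, Hm|]. intros s Hs.
  assert (H1 : m * (1 + s) <= exp (c / INR (S n) * s)).
  { eapply Rle_trans; [|apply exp_ineq1_le]. assert (m <= 1) by apply Rmin_l. assert (m <= c / INR (S n)) by apply Rmin_r. nra. }
  assert (H2 : m ^ n * (1 + s) ^ n <= exp (c * s)).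
  { rewrite <- Rpow_mult_distr. apply Rle_trans with (exp (c / INR (S n) * s) ^ n).
    - apply pow_incr. split; [apply Rmult_le_pos; lra|exact H1].
    - rewrite exp_pow. apply exp_le_exp.
      replace (c * s) with (INR (S n) * (c / INR (S n) * s)) by (field; lra).
      rewrite S_INR. assert (0 <= c / INR (S n) * s) by (apply Rmult_le_pos; [left; now apply Rdiv_lt_0_compat|exact Hs]).
      rewrite S_INR in H. nra. }
  rewrite exp_Ropp. pose proof (exp_pos (c * s)). pose proof (pow_lt m n Hm).
  apply (Rmult_le_reg_l (m ^ n)); [lra|]. rewrite Rinv_r by lra.
  rewrite <- Rmult_assoc. apply Rle_div_l; lra.
Qed.

(** [derive_on] is defined by description, so its value is known only where the derivative is
    unique, that is at accumulation points of [S]. *)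
Lemma derive_on_eq (S : R -> Prop) (f : R -> C) (x : R) (l : C) : S x ->
  (forall d, 0 < d -> exists y, S y /\ y <> x /\ Rabs (y - x) < d) ->
  is_derive_on S f x l -> derive_on S f x = l.
Proof.
  intros Sx Hacc Hl. unfold derive_on.
  apply (iota_unique (V := C_R_CompleteNormedModule)); [|exact Hl].
  intros m Hm. rewrite is_derive_on_eps in Hl, Hm by exact Sx.
  assert (Z : (m - l)%C = RtoC 0).
  { apply NNPP. intros Hz. apply Cmod_gt_0 in Hz.
    destruct (Hl (Cmod (m - l) / 4) ltac:(lra)) as (d1 & Hd1 & K1).
    destruct (Hm (Cmod (m - l) / 4) ltac:(lra)) as (d2 & Hd2 & K2).
    destruct (Hacc (Rmin d1 d2)) as (y & Sy & Hyx & Hy); [now apply Rmin_pos|].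
    pose proof (Rmin_l d1 d2). pose proof (Rmin_r d1 d2).
    specialize (K1 y Sy ltac:(lra)). specialize (K2 y Sy ltac:(lra)).
    assert (Hp : 0 < Rabs (y - x)) by (apply Rabs_pos_lt; lra).
    assert (Q : Rabs (y - x) * Cmod (m - l) <= Cmod (m - l) / 2 * Rabs (y - x)).
    { rewrite <- (Cmod_R (y - x)) at 1. rewrite <- Cmod_mult.
      replace (RtoC (y - x) * (m - l))%C with ((f y - f x - RtoC (y - x) * l) - (f y - f x - RtoC (y - x) * m))%C by ring.
      eapply Rle_trans; [apply Cmod_triangle_minus|]. lra. }
    nra. }
  change (m = l :> C). replace m with (m - l + l)%C by ring. rewrite Z. ring.
Qed.

Lemma velocity_eq (g : R -> C) (x : R) (l : C) : Rderive g x l -> velocity g x = l.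
Proof.
  intros H. unfold velocity. apply derive_on_eq; [exact I| |].
  - intros d Hd. exists (x + d / 2). split; [exact I|]. split; [lra|].
    replace (x + d / 2 - x) with (d / 2) by ring. rewrite Rabs_pos_eq; lra.
  - apply is_derive_on_eps; [exact I|]. rewrite Rderive_eps in H. intros eps He.
    destruct (H eps He) as (d & Hd & K). exists d. split; auto.
Qed.

(** * Geometry of the contour *)

Definition ww (k s : R) : R := sqrt (2 * s ^ 2 + k ^ 2).

Lemma bd_right_eq (k s : R) : bd_right k s = (Rabs s, ww k s - s).
Proof. reflexivity. Qed.

Lemma bd_left_eq (k s : R) : bd_left k s = (- Rabs s, ww k s + s).
Proof. reflexivity. Qed.

Lemma ww_sqr (k s : R) : ww k s * ww k s = 2 * (s * s) + k * k.
Proof. apply (proj1 (proj2 (sqrt_facts k s))). Qed.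

Lemma ww_pos (k s : R) : 0 <= ww k s.
Proof. apply sqrt_pos. Qed.

Lemma ww_opp (k s : R) : ww k (- s) = ww k s.
Proof. unfold ww. do 2 f_equal. ring. Qed.

(** 4/3 is a rational lower bound for the square root of 2. What matters is that it exceeds 1: the
    imaginary part on the contour is then at least |s|/3, which produces exponential decay in s. *)
Lemma ww_ge (k s : R) : 4 / 3 * Rabs s <= ww k s.
Proof.
  pose proof (ww_sqr k s). pose proof (ww_pos k s). pose proof (Rabs_pos s).
  assert (Rabs s * Rabs s = s * s) by (rewrite <- Rabs_mult; apply Rabs_pos_eq; nra). nra.
Qed.

Lemma ww_le (k s : R) : ww k s <= 2 * Rabs s + Rabs k.
Proof.
  pose proof (ww_sqr k s). pose proof (ww_pos k s). pose proof (Rabs_pos s). pose proof (Rabs_pos k).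
  assert (Rabs s * Rabs s = s * s) by (rewrite <- Rabs_mult; apply Rabs_pos_eq; nra).
  assert (Rabs k * Rabs k = k * k) by (rewrite <- Rabs_mult; apply Rabs_pos_eq; nra). nra.
Qed.

Lemma ww_pos_lt (k s : R) : s <> 0 -> 0 < ww k s.
Proof. intros H. pose proof (ww_ge k s). pose proof (Rabs_pos_lt s H). lra. Qed.

(** The derivative of |s| away from 0; its value at 0 is a mere convention. *)
Definition sgn (s : R) : R := if Rle_dec 0 s then 1 else -1.
Definition vR (k s : R) : C := (sgn s, 2 * s / ww k s - 1).
Definition vL (k s : R) : C := (- sgn s, 2 * s / ww k s + 1).

Lemma is_derive_Rabs (s : R) : s <> 0 -> is_derive Rabs s (sgn s).
Proof.
  intros H. unfold sgn. destruct (Rle_dec 0 s); [apply is_derive_abs_pos|apply is_derive_abs_neg]; lra.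
Qed.

Lemma Rderive_R (k s : R) : s <> 0 -> Rderive (bd_right k) s (vR k s).
Proof. intros H. apply is_derive_bd_right; [exact H|now apply is_derive_Rabs]. Qed.

Lemma Rderive_L (k s : R) : s <> 0 -> Rderive (bd_left k) s (vL k s).
Proof. intros H. apply is_derive_bd_left; [exact H|now apply is_derive_Rabs]. Qed.

Lemma ratio_ww_cont (k s : R) : s <> 0 -> continuous (fun s => 2 * s / ww k s) s.
Proof.
  intros H. pose proof (ww_pos_lt k s H) as Hp.
  apply (continuous_mult (K := R_AbsRing) (fun s => 2 * s) (fun s => / ww k s)).
  - apply (ex_derive_continuous (V := R_NormedModule)). auto_derive; auto.
  - apply continuous_Rinv_comp; [|lra]. apply (ex_derive_continuous (V := R_NormedModule)). 
    eexists. now apply is_derive_w.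
Qed.

Lemma sgn_cont (s : R) : s <> 0 -> continuous sgn s.
Proof.
  intros H. apply (continuous_ext_loc (T := R_UniformSpace) (U := R_UniformSpace) sgn (fun _ => sgn s) s).
  - apply locally_R_eps. exists (Rabs s). split; [now apply Rabs_pos_lt|]. intros y Hy.
    unfold sgn. apply Rabs_def2 in Hy. unfold Rabs in Hy. destruct Rcase_abs; repeat destruct Rle_dec; lra.
  - apply continuous_const.
Qed.

Lemma vR_cont (k s : R) : s <> 0 -> Ccont (vR k) s.
Proof.
  intros H. apply Ccont_pair; [now apply sgn_cont|].
  apply (continuous_minus (V := R_NormedModule)); [now apply ratio_ww_cont|apply continuous_const].
Qed.

Lemma vL_cont (k s : R) : s <> 0 -> Ccont (vL k) s.
Proof.
  intros H. apply Ccont_pair.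
  - apply (continuous_opp (V := R_NormedModule)). now apply sgn_cont.
  - apply (continuous_plus (V := R_NormedModule)); [now apply ratio_ww_cont|apply continuous_const].
Qed.

Lemma ratio_ww_bound (k s : R) : Rabs (2 * s / ww k s) <= 2.
Proof.
  destruct (Req_dec s 0) as [->|H].
  - rewrite Rmult_0_r. unfold Rdiv. rewrite Rmult_0_l, Rabs_R0. lra.
  - pose proof (ww_pos_lt k s H). pose proof (ww_ge k s). pose proof (Rabs_pos s).
    unfold Rdiv. rewrite !Rabs_mult, Rabs_inv, (Rabs_pos_eq 2), (Rabs_pos_eq (ww k s)) by lra.
    apply Rle_div_l; lra.
Qed.

Lemma Rabs_sgn (s : R) : Rabs (sgn s) = 1.
Proof. unfold sgn. destruct Rle_dec; unfold Rabs; destruct Rcase_abs; lra. Qed.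

Lemma vR_bound (k s : R) : Cmod (vR k s) <= 4.
Proof.
  eapply Rle_trans; [apply Cmod_le_sum|]. unfold vR, Re, Im; simpl. rewrite Rabs_sgn.
  pose proof (ratio_ww_bound k s) as H. apply Rabs_le_between in H.
  assert (Rabs (2 * s / ww k s - 1) <= 3) by (apply Rabs_le; lra). lra.
Qed.

Lemma vL_bound (k s : R) : Cmod (vL k s) <= 4.
Proof.
  eapply Rle_trans; [apply Cmod_le_sum|]. unfold vL, Re, Im; simpl. rewrite Rabs_Ropp, Rabs_sgn.
  pose proof (ratio_ww_bound k s) as H. apply Rabs_le_between in H.
  assert (Rabs (2 * s / ww k s + 1) <= 3) by (apply Rabs_le; lra). lra.
Qed.

Lemma Im_R (k s : R) : Rabs s / 3 <= Im (bd_right k s).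
Proof.
  unfold Im. rewrite bd_right_eq. cbn [fst snd]. pose proof (ww_ge k s). pose proof (Rle_abs s). lra.
Qed.

Lemma Im_L (k s : R) : Rabs s / 3 <= Im (bd_left k s).
Proof.
  unfold Im. rewrite bd_left_eq. cbn [fst snd]. pose proof (ww_ge k s). pose proof (Rle_abs (- s)).
  rewrite Rabs_Ropp in *. lra.
Qed.

(** [bd_left] at s is the mirror image in the imaginary axis of [bd_right] at -s, so bounds on the
    modulus pass from one branch to the other. *)
Lemma Cmod_L (k s : R) : Cmod (bd_left k s) = Cmod (bd_right k (- s)).
Proof.
  rewrite bd_left_eq, bd_right_eq. unfold Cmod; cbn [fst snd].
  rewrite ww_opp, Rabs_Ropp. f_equal. ring.
Qed.

Lemma Cmod_R_le (k s : R) : Cmod (bd_right k s) <= 4 * Rabs s + Rabs k.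
Proof.
  eapply Rle_trans; [apply Cmod_le_sum|]. unfold Re, Im. rewrite bd_right_eq. cbn [fst snd].
  rewrite Rabs_Rabsolu. pose proof (ww_ge k s). pose proof (ww_le k s). pose proof (Rle_abs s).
  pose proof (Rle_abs (- s)). rewrite Rabs_Ropp in *. rewrite (Rabs_pos_eq (ww k s - s)) by lra. lra.
Qed.

Lemma Cmod_L_le (k s : R) : Cmod (bd_left k s) <= 4 * Rabs s + Rabs k.
Proof. rewrite Cmod_L. eapply Rle_trans; [apply Cmod_R_le|]. rewrite Rabs_Ropp. lra. Qed.

Lemma Cmod_R_ge (k s : R) : Rabs s <= Cmod (bd_right k s).
Proof.
  eapply Rle_trans; [|apply Re_le_Cmod]. unfold Re. rewrite bd_right_eq. cbn [fst snd]. rewrite Rabs_Rabsolu. lra.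
Qed.

Lemma R_cont (k s : R) : Ccont (bd_right k) s.
Proof.
  assert (Hw : continuous (fun x => sqrt (2 * x ^ 2 + k ^ 2)) s).
  { apply (continuous_comp (fun x => 2 * x ^ 2 + k ^ 2) sqrt).
    - apply (ex_derive_continuous (V := R_NormedModule)). auto_derive; auto.
    - apply continuous_sqrt. }
  apply Ccont_pair; [apply continuous_Rabs|].
  apply (continuous_minus (V := R_NormedModule)); [exact Hw|apply continuous_id].
Qed.

Lemma L_cont (k s : R) : Ccont (bd_left k) s.
Proof.
  apply (continuous_ext (fun s => (- Re (bd_right k (- s)), Im (bd_right k (- s))))).
  - intros x. rewrite bd_left_eq, bd_right_eq. unfold Re, Im; cbn [fst snd]. rewrite Rabs_Ropp, ww_opp. f_equal. ring.
  - assert (H : Ccont (fun s => bd_right k (- s)) s).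
    { apply (Ccont_comp_R1 (bd_right k)); [apply R_cont|]. apply (continuous_opp (V := R_NormedModule)), continuous_id. }
    apply Ccont_pair; [apply (continuous_opp (V := R_NormedModule)); now apply Ccont_Re|now apply Ccont_Im].
Qed.

(** * Truncation of the contour by modulus *)

Lemma ww_convex (k s1 s2 th : R) : 0 <= th <= 1 ->
  ww k (th * s1 + (1 - th) * s2) <= th * ww k s1 + (1 - th) * ww k s2.
Proof.
  intros Hth. pose proof (ww_sqr k s1) as E1. pose proof (ww_sqr k s2) as E2.
  pose proof (ww_sqr k (th * s1 + (1 - th) * s2)) as E3.
  pose proof (ww_pos k s1) as P1. pose proof (ww_pos k s2) as P2. pose proof (ww_pos k (th * s1 + (1 - th) * s2)) as P3.
  set (w1 := ww k s1) in *. set (w2 := ww k s2) in *. set (w3 := ww k (th * s1 + (1 - th) * s2)) in *. clearbody w1 w2 w3.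
  (* [ww] k s is the Euclidean norm of (sqrt 2 s, k); its convexity is the triangle inequality,
     which rests on this case of Cauchy-Schwarz. *)
  assert (CS : 2 * (s1 * s2) + k * k <= w1 * w2).
  { apply Rnot_lt_le. intros H. assert (0 <= w1 * w2) by (now apply Rmult_le_pos).
    assert (Q : (w1 * w2) * (w1 * w2) < (2 * (s1 * s2) + k * k) * (2 * (s1 * s2) + k * k)) by (apply Rmult_le_0_lt_compat; lra).
    replace ((w1 * w2) * (w1 * w2)) with ((w1 * w1) * (w2 * w2)) in Q by ring. rewrite E1, E2 in Q.
    pose proof (Rle_0_sqr (k * (s1 - s2))) as Z. unfold Rsqr in Z. ring_simplify in Q. ring_simplify in Z. lra. }
  assert (N : 0 <= th * w1 + (1 - th) * w2) by (apply Rplus_le_le_0_compat; apply Rmult_le_pos; lra).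
  apply Rnot_lt_le. intros H.
  assert (Q : (th * w1 + (1 - th) * w2) * (th * w1 + (1 - th) * w2) < w3 * w3) by (apply Rmult_le_0_lt_compat; lra).
  rewrite E3 in Q.
  assert (0 <= th * (1 - th)) by (apply Rmult_le_pos; lra).
  assert (th * (1 - th) * (2 * (s1 * s2) + k * k) <= th * (1 - th) * (w1 * w2)) by (now apply Rmult_le_compat_l).
  replace ((th * w1 + (1 - th) * w2) * (th * w1 + (1 - th) * w2)) with
    (th * th * (w1 * w1) + (1 - th) * (1 - th) * (w2 * w2) + 2 * (th * (1 - th) * (w1 * w2))) in Q by ring.
  rewrite E1, E2 in Q.
  replace (2 * ((th * s1 + (1 - th) * s2) * (th * s1 + (1 - th) * s2)) + k * k) with
    (th * th * (2 * (s1 * s1) + k * k) + (1 - th) * (1 - th) * (2 * (s2 * s2) + k * k) + 2 * (th * (1 - th) * (2 * (s1 * s2) + k * k))) in Q by ring.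
  lra.
Qed.

(** The coordinates |s| and [ww] k s - s are convex and nonnegative, hence the modulus is convex
    along the branch and its sublevel sets are intervals. *)
Lemma Cmod_R_quasiconvex (k s1 s s2 r : R) : s1 <= s <= s2 ->
  Cmod (bd_right k s1) <= r -> Cmod (bd_right k s2) <= r -> Cmod (bd_right k s) <= r.
Proof.
  intros Hs H1 H2.
  destruct (Req_dec s1 s2) as [E|E]; [replace s with s1 by lra; exact H1|].
  pose (th := (s2 - s) / (s2 - s1)).
  assert (Hth : 0 <= th <= 1).
  { unfold th. split; [apply Rmult_le_pos; [lra|left; apply Rinv_0_lt_compat; lra]|apply Rle_div_l; lra]. }
  assert (Es : s = th * s1 + (1 - th) * s2) by (unfold th; field; lra).
  pose proof (ww_convex k s1 s2 th Hth) as Hw. rewrite <- Es in Hw.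
  assert (Hab : Rabs s <= th * Rabs s1 + (1 - th) * Rabs s2).
  { rewrite Es. eapply Rle_trans; [apply Rabs_triang|]. rewrite !Rabs_mult, (Rabs_pos_eq th), (Rabs_pos_eq (1 - th)) by lra. lra. }
  pose proof (ww_ge k s). pose proof (Rle_abs s). pose proof (Rabs_pos s).
  apply Rle_trans with (Cmod (RtoC th * bd_right k s1 + RtoC (1 - th) * bd_right k s2)).
  - assert (Q : forall z w : C, 0 <= Re z <= Re w -> 0 <= Im z <= Im w -> Cmod z <= Cmod w).
    { intros z w A B. pose proof (Cmod_sqr_eq z). pose proof (Cmod_sqr_eq w). pose proof (Cmod_ge_0 z). pose proof (Cmod_ge_0 w). nra. }
    rewrite !bd_right_eq. apply Q; unfold Re, Im; cbn [fst snd Cplus Cmult RtoC]; lra.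
  - eapply Rle_trans; [apply Cmod_triangle|]. rewrite !Cmod_mult, !Cmod_RtoC_pos by lra. nra.
Qed.

(** The supremum of the sublevel set belongs to it by continuity. The lower bound comes from
    |[bd_right] k s| <= 4|s| + |k|. *)
Lemma Cmod_R_level_sup (k r : R) : Rabs k <= r ->
  exists b, (r - Rabs k) / 4 <= b /\ Cmod (bd_right k b) <= r /\ forall s, Cmod (bd_right k s) <= r -> s <= b.
Proof.
  intros Hr.
  destruct (completeness (fun s => Cmod (bd_right k s) <= r)) as (b & Hub & Hlub).
  - exists r. intros s Hs. pose proof (Cmod_R_ge k s). pose proof (Rle_abs s). lra.
  - exists 0. pose proof (Cmod_R_le k 0). rewrite Rabs_R0 in *. lra.
  - exists b. split; [|split].
    + apply Hub. pose proof (Cmod_R_le k ((r - Rabs k) / 4)). rewrite (Rabs_pos_eq ((r - Rabs k) / 4)) in * by lra. lra.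
    + apply Rnot_lt_le. intros H.
      pose proof (Ccont_mod _ _ (R_cont k b)) as Hc.
      pose proof (proj1 (filterlim_locally _ _) Hc (mkposreal _ (proj2 (Rlt_0_minus _ _) H))) as K.
      apply locally_R_eps in K. destruct K as (d & Hd & K).
      assert (Hbb : b <= b - d / 2).
      { apply Hlub. intros s Hs. apply Rnot_lt_le. intros Hs2.
        assert (Hsb : s <= b) by now apply Hub.
        specialize (K s ltac:(apply Rabs_def1; lra)).
        unfold ball in K; simpl in K; unfold AbsRing_ball, abs, minus, plus, opp in K; simpl in K.
        apply Rabs_def2 in K. lra. }
      lra.
    + exact Hub.
Qed.

Lemma Cmod_R_level_inf (k r : R) : Rabs k <= r ->
  exists a, a <= - ((r - Rabs k) / 4) /\ Cmod (bd_right k a) <= r /\ forall s, Cmod (bd_right k s) <= r -> a <= s.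
Proof.
  intros Hr.
  destruct (completeness (fun s => Cmod (bd_right k (- s)) <= r)) as (b & Hub & Hlub).
  - exists r. intros s Hs. pose proof (Cmod_R_ge k (- s)). rewrite Rabs_Ropp in *. pose proof (Rle_abs s). lra.
  - exists 0. rewrite Ropp_0. pose proof (Cmod_R_le k 0). rewrite Rabs_R0 in *. lra.
  - exists (- b). split; [|split].
    + assert ((r - Rabs k) / 4 <= b); [|lra].
      apply Hub. pose proof (Cmod_R_le k (- ((r - Rabs k) / 4))). rewrite Rabs_Ropp, (Rabs_pos_eq ((r - Rabs k) / 4)) in * by lra. lra.
    + apply Rnot_lt_le. intros H.
      pose proof (Ccont_mod _ _ (R_cont k (- b))) as Hc.
      pose proof (proj1 (filterlim_locally _ _) Hc (mkposreal _ (proj2 (Rlt_0_minus _ _) H))) as K.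
      apply locally_R_eps in K. destruct K as (d & Hd & K).
      assert (Hbb : b <= b - d / 2).
      { apply Hlub. intros s Hs. apply Rnot_lt_le. intros Hs2.
        assert (Hsb : s <= b) by now apply Hub.
        specialize (K (- s) ltac:(apply Rabs_def1; lra)).
        unfold ball in K; simpl in K; unfold AbsRing_ball, abs, minus, plus, opp in K; simpl in K.
        apply Rabs_def2 in K. lra. }
      lra.
    + intros s Hs. assert (- s <= b); [|lra]. apply Hub. now rewrite Ropp_involutive.
Qed.

(* Guarantees that the truncation to [|l| <= r] of the contour integral is an integral over one interval of
   parameters, which exhausts the line as [r] grows. *)
Definition windowed (g : R -> C) (k : R) : Prop := forall r, Rabs k <= r ->
  exists a b, a <= - ((r - Rabs k) / 4) /\ (r - Rabs k) / 4 <= b /\ forall s, Cmod (g s) <= r <-> a <= s <= b.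

Lemma windowed_R (k : R) : windowed (bd_right k) k.
Proof.
  intros r Hr. destruct (Cmod_R_level_inf k r Hr) as (a & A1 & A2 & A3).
  destruct (Cmod_R_level_sup k r Hr) as (b & B1 & B2 & B3).
  exists a, b. repeat split; auto. intros H. now apply (Cmod_R_quasiconvex k a s b).
Qed.

Lemma windowed_L (k : R) : windowed (bd_left k) k.
Proof.
  intros r Hr. destruct (windowed_R k r Hr) as (a & b & H1 & H2 & H3).
  exists (- b), (- a). split; [lra|]. split; [lra|]. intros s. rewrite Cmod_L, H3. split; lra.
Qed.

Lemma windowed_id : windowed RtoC 0.
Proof.
  intros r Hr. rewrite Rabs_R0 in *. exists (- r), r. split; [lra|]. split; [lra|]. intros s. rewrite Cmod_R.
  split; [apply Rabs_le_between|apply Rabs_le].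
Qed.

Section CurveInt.
Variables (g : R -> C) (k : R) (F : C -> C) (M : R).
Let psi (s : R) : C := (F (g s) * velocity g s)%C.
Hypotheses (Hwin : windowed g k) (Hex : forall a b, ex_CI psi a b) (HM : forall s, Cmod (psi s) <= M * phi s).

Lemma curve_M_pos : 0 <= M.
Proof. apply (dom_M_pos psi). auto. Qed.

Lemma curve_int_cauchy (a b B : R) (A : C) : 0 < B -> is_CRInt_line psi A -> a <= - B -> B <= b ->
  Cmod (CI psi a b - A) <= 2 * M / B.
Proof.
  intros HB HA Ha Hb. apply le_epsilon. intros eps He.
  destruct (proj1 (is_line_eps _ _) HA eps He) as [B1 K1].
  (* The window is enlarged until its integral is within eps of the limit; the two added pieces lie
     beyond B and contribute at most M/B each. *)
  destruct (K1 (Rmin a (- B1)) (Rmax b B1) (Rmin_r _ _) (Rmax_r _ _)) as (z & Hz & Ez).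
  pose proof (Rmin_l a (- B1)) as Ha1. pose proof (Rmax_l b B1) as Hb1.
  set (a1 := Rmin a _) in *. set (b1 := Rmax b _) in *. clearbody a1 b1.
  assert (E : z = (CI psi a1 a + (CI psi a b + CI psi b b1))%C).
  { apply (is_CI_inj _ _ _ _ _ Hz). eapply is_CI_Chasles; [|eapply is_CI_Chasles]; apply CI_correct, Hex. }
  assert (T2 : Cmod (CI psi b b1) <= M / b).
  { apply (CI_tail psi M b b1); [apply curve_M_pos|lra|exact Hb1|auto|apply CI_correct, Hex]. }
  assert (T1 : Cmod (CI psi a1 a) <= M / - a).
  { apply (CI_tail (fun s => psi (- s)) M (- a) (- a1)); [apply curve_M_pos|lra|lra| |].
    - intros x _. rewrite <- phi_opp. apply HM.
    - eapply is_CI_eq; [apply (is_CI_comp_opp psi (- a) (- a1) (- CI psi a1 a)%C)|cring].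
      rewrite !Ropp_involutive. apply is_CI_swap, CI_correct, Hex. }
  replace (CI psi a b - A)%C with ((z - A) - (CI psi a1 a + CI psi b b1))%C by (rewrite E; ring).
  eapply Rle_trans; [apply Cmod_triangle_minus|].
  pose proof (Cmod_triangle (CI psi a1 a) (CI psi b b1)). pose proof curve_M_pos.
  assert (M / b <= M / B) by (apply Rmult_le_compat_l; [lra|apply Rinv_le_contravar; lra]).
  assert (M / - a <= M / B) by (apply Rmult_le_compat_l; [lra|apply Rinv_le_contravar; lra]).
  replace (2 * M / B) with (M / B + M / B) by (field; lra). lra.
Qed.

Definition curve_upto (r : R) : C := CRInt_line (fun s => if Rle_dec (Cmod (g s)) r then psi s else RtoC 0).

Lemma curve_upto_spec (r : R) : Rabs k <= r ->
  is_curve_int_upto r g F (curve_upto r) /\ exists a b, a <= - ((r - Rabs k) / 4) /\ (r - Rabs k) / 4 <= b /\ curve_upto r = CI psi a b.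
Proof.
  intros Hr. destruct (Hwin r Hr) as (a & b & Ha & Hb & Hab).
  assert (K : is_CRInt_line (fun s => if Rle_dec (Cmod (g s)) r then psi s else RtoC 0) (CI psi a b)).
  { apply is_line_eps. intros eps He. exists (Rabs a + Rabs b). intros a1 b1 Ha1 Hb1.
    exists (CI psi a b). split.
    - pose proof (Rle_abs (- a)). pose proof (Rle_abs b). rewrite Rabs_Ropp in *.
      pose proof (Rabs_pos a). pose proof (Rabs_pos b).
      assert (Z : forall u v, u <= v -> (forall s, u < s < v -> ~ (a <= s <= b)) ->
        is_CI (fun s => if Rle_dec (Cmod (g s)) r then psi s else RtoC 0) u v (RtoC 0)).
      { intros u v Huv Hn. eapply is_CI_ext; [|eapply is_CI_eq; [apply (is_CI_const (RtoC 0))|cring]].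
        intros s Hs. rewrite Rmin_left, Rmax_right in Hs by lra. simpl.
        destruct Rle_dec as [Hle|]; [|reflexivity]. exfalso. apply (Hn s Hs). now apply Hab. }
      replace (CI psi a b) with (RtoC 0 + (CI psi a b + RtoC 0))%C by ring.
      apply (is_CI_Chasles _ a1 a b1); [apply Z; [lra|intros; lra]|].
      apply (is_CI_Chasles _ a b b1); [|apply Z; [lra|intros; lra]].
      eapply is_CI_ext; [|apply CI_correct, Hex].
      intros s Hs. rewrite Rmin_left, Rmax_right in Hs by lra. simpl.
      destruct Rle_dec as [|Hn]; [reflexivity|]. exfalso. apply Hn. apply Hab. lra.
    - replace (CI psi a b - CI psi a b)%C with (RtoC 0) by ring. now rewrite Cmod_0. }
  unfold curve_upto. rewrite (line_unique _ _ K). split; [exact K|]. exists a, b. auto.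
Qed.

Lemma curve_upto_lim (A : C) : is_CRInt_line psi A -> lim_inf curve_upto A.
Proof.
  intros HA eps He. pose proof curve_M_pos. pose proof (Rabs_pos k).
  exists (Rabs k + 4 * ((2 * M + 1) / eps)). intros r Hr.
  assert (Hq : 0 < (2 * M + 1) / eps) by (apply Rdiv_lt_0_compat; lra).
  destruct (curve_upto_spec r ltac:(lra)) as (_ & a & b & Ha & Hb & ->).
  eapply Rle_lt_trans; [apply (curve_int_cauchy a b ((2 * M + 1) / eps) A); auto; lra|].
  apply Rlt_div_l; [exact Hq|]. replace (eps * ((2 * M + 1) / eps)) with (2 * M + 1) by (field; lra). lra.
Qed.

End CurveInt.

Lemma filterlim_lim_inf (F : R -> C) (v : C) : lim_inf F v -> filterlim F (Rbar_locally p_infty) (locally (T := C_UniformSpace) v).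
Proof.
  intros H. apply filterlim_C_eps. intros eps He. destruct (H eps He) as [B HB]. exists B.
  intros x Hx. apply HB. lra.
Qed.

Lemma is_contour_int_line (F : C -> C) (M : R) (A : C) : (forall s : R, Ccont (fun s => F (RtoC s)) s) ->
  (forall s : R, Cmod (F (RtoC s)) <= M * phi s) -> is_CRInt_line (fun s => F (RtoC s)) A -> is_contour_int real_line F A.
Proof.
  intros Hc HM HA.
  assert (E : forall s : R, (F (RtoC s) * velocity RtoC s)%C = F (RtoC s)).
  { intros s. rewrite (velocity_eq RtoC s (RtoC 1)); [ring|apply Rderive_id]. }
  assert (Hex : forall a b, ex_CI (fun s => F (RtoC s) * velocity RtoC s)%C a b).
  { intros a b. apply ex_CI_cont. intros x _. apply (continuous_ext (fun s => F (RtoC s))); [intros; now rewrite E|apply Hc]. }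
  assert (HM' : forall s, Cmod (F (RtoC s) * velocity RtoC s) <= M * phi s) by (intros s; rewrite E; auto).
  assert (HA' : is_CRInt_line (fun s => F (RtoC s) * velocity RtoC s)%C A) by (eapply is_line_ext; [|exact HA]; intros; now rewrite E).
  exists (fun r => curve_upto RtoC F r). split.
  - exists 0. intros r Hr. exists (curve_upto RtoC F r), (RtoC 0). split; [|split; [reflexivity|ring]].
    apply (curve_upto_spec RtoC 0 F windowed_id Hex). rewrite Rabs_R0. lra.
  - apply filterlim_lim_inf. apply (curve_upto_lim RtoC 0 F M windowed_id Hex HM' A HA').
Qed.

Lemma is_line_ex (psi : R -> C) (M : R) : (forall a b, ex_CI psi a b) -> (forall s, Cmod (psi s) <= M * phi s) ->
  exists A, is_CRInt_line psi A.
Proof.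
  intros Hex HM.
  destruct (ex_I0_dom psi M Hex) as [v Hv]; [auto|].
  destruct (ex_I0_dom (fun s => psi (- s)) M) as [w Hw].
  - intros a b. exists (- CI psi (- a) (- b))%C. apply is_CI_comp_opp. apply CI_correct, Hex.
  - intros s _. rewrite <- phi_opp. auto.
  - exists (v + w)%C. now apply is_line_I0.
Qed.

(** * The contour integral *)

Lemma Re_symb (k : R) (l : C) : Re (symb k l) = symb_poly k l.
Proof. destruct l as [a b]. unfold symb. rewrite symb_factor. unfold symb_poly; cbn [fst snd]. ring. Qed.

Lemma symb_poly_R (k s : R) : symb_poly k (bd_right k s) = 0.
Proof. apply (bd_Domp_sub k (bd_right k)). now left. Qed.

Lemma symb_poly_L (k s : R) : symb_poly k (bd_left k s) = 0.
Proof. apply (bd_Domp_sub k (bd_left k)). now right; left. Qed.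

Lemma prim_bound (U : C -> Prop) (h H : C -> C) (z w : C) (B : R) : convexC U -> holo U h ->
  (forall z, U z -> Cdiff H z (h z)) -> U z -> U w ->
  (forall s, 0 <= s <= 1 -> Cmod (h (segm z w s)) <= B) -> Cmod (H w - H z) <= B * Cmod (w - z).
Proof.
  intros HU Hh HH Hz Hw HB.
  assert (K : is_CI (fun s => h (segm z w s) * (w - z))%C 0 1 (H (segm z w 1) - H (segm z w 0))%C).
  { apply (is_CI_primitive U h H (segm z w) (fun _ => (w - z)%C)); auto.
    intros s Hs. rewrite Rmin_left, Rmax_right in Hs by lra. split; [now apply HU|].
    split; [apply Rderive_segm|apply Ccont_const]. }
  replace (segm z w 1) with w in K by (unfold segm; ring).
  replace (segm z w 0) with z in K by (unfold segm; ring).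
  replace (B * Cmod (w - z)) with ((1 - 0) * (B * Cmod (w - z))) by ring.
  eapply is_CI_norm_const; [lra| |exact K]. intros s Hs. simpl. rewrite Cmod_mult.
  apply Rmult_le_compat_r; [apply Cmod_ge_0|auto].
Qed.

Lemma convexC_True : convexC (fun _ => True).
Proof. intros z w s _ _ _. exact I. Qed.

Lemma openC_True : openC (fun _ => True).
Proof. intros z _. exists 1. split; [lra|auto]. Qed.

(** e = 1 and e = -1 select the open first and second quadrants. Both are convex and avoid the
    imaginary axis, where the argument of the square root in [nu] becomes real. *)
Definition quadrant (e : R) (z : C) : Prop := 0 < e * Re z /\ 0 < Im z.

Lemma convexC_quadrant (e : R) : convexC (quadrant e).
Proof.
  intros z w s [H1 H2] [H3 H4] Hs. unfold quadrant, segm, Re, Im in *; simpl in *.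
  destruct (Req_dec s 0) as [->|Hs0].
  - split; ring_simplify; lra.
  - assert (0 < s) by lra. split.
    + replace (e * (fst z + (s * (fst w + - fst z) - 0 * (snd w + - snd z)))) with ((1 - s) * (e * fst z) + s * (e * fst w)) by ring.
      assert (0 < s * (e * fst w)) by (now apply Rmult_lt_0_compat). assert (0 <= (1 - s) * (e * fst z)) by (apply Rmult_le_pos; lra). lra.
    + replace (snd z + (s * (snd w + - snd z) + 0 * (fst w + - fst z))) with ((1 - s) * snd z + s * snd w) by ring.
      assert (0 < s * snd w) by (now apply Rmult_lt_0_compat). assert (0 <= (1 - s) * snd z) by (apply Rmult_le_pos; lra). lra.
Qed.

Lemma openC_quadrant (e : R) : e = 1 \/ e = -1 -> openC (quadrant e).
Proof.
  intros He z [H1 H2]. exists (Rmin (e * Re z) (Im z)). split; [now apply Rmin_pos|]. intros w Hw.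
  pose proof (Rmin_l (e * Re z) (Im z)). pose proof (Rmin_r (e * Re z) (Im z)).
  pose proof (Re_le_Cmod (w - z)) as A1. pose proof (Im_le_Cmod (w - z)) as A2.
  apply Rabs_le_between in A1. apply Rabs_le_between in A2.
  unfold quadrant, Re, Im in *; simpl in *. destruct He as [-> | ->]; split; lra.
Qed.

Lemma R_quadrant (k s : R) : s <> 0 -> quadrant 1 (bd_right k s).
Proof.
  intros Hs. pose proof (Rabs_pos_lt s Hs). split.
  - unfold Re. rewrite bd_right_eq. cbn [fst]. lra.
  - pose proof (Im_R k s). lra.
Qed.

Lemma L_quadrant (k s : R) : s <> 0 -> quadrant (-1) (bd_left k s).
Proof.
  intros Hs. pose proof (Rabs_pos_lt s Hs). split.
  - unfold Re. rewrite bd_left_eq. cbn [fst]. lra.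
  - pose proof (Im_L k s). lra.
Qed.

(** Folding at 0 puts the corner at the left end of the interval, where [CI_from_0] can deal with
    it. *)
Lemma CI_fold (psi : R -> C) (P : R) : (forall a b, ex_CI psi a b) ->
  is_CI (fun s => psi s + psi (- s)%R)%C 0 P (CI psi (- P) P).
Proof.
  intros Hex. eapply is_CI_eq; [apply is_CI_plus; [apply CI_correct, Hex|apply (is_CI_comp_opp psi 0 P (- CI psi (- P) 0)%C)]|].
  - rewrite Ropp_0. apply is_CI_swap, CI_correct, Hex.
  - symmetry. rewrite (CI_unique psi (- P) P (CI psi (- P) 0 + CI psi 0 P)%C); [cring|].
    eapply is_CI_Chasles; apply CI_correct, Hex.
Qed.

(** * Deformation of the contour to the real axis *)

Section Contour.
Variables (k y C0 R0 : R) (F f h : C -> C) (v : C).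
Hypotheses (Hy : 0 < y) (HC0 : 0 <= C0).
Hypothesis (Hf : holo (fun _ => True) f).
Hypothesis (Hh : forall e, e = 1 \/ e = -1 -> holo (quadrant e) h).
(** f is bounded only where the symbol has nonnegative real part, that is off D; the contour itself,
    where the real part is 0, is included. For h a bound holds in the whole of both quadrants, so
    its segments may cross D. *)
Hypothesis (Bf : forall l, 0 <= Im l -> 0 <= Re (symb k l) -> Cmod (f l) <= C0 * (1 + Cmod l) ^ 3 * exp (- (y * Im l))).
Hypothesis (Bf2 : forall l, 0 <= Im l -> 0 <= Re (symb k l) -> R0 <= Cmod l -> Cmod l * Cmod (f l) <= C0 * exp (- (y * Im l))).
Hypothesis (Bh : forall e l, e = 1 \/ e = -1 -> quadrant e l -> Cmod (h l) <= C0 * (1 + Cmod l) * exp (- (y * Im l))).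
Hypothesis (HF : forall e l, e = 1 \/ e = -1 -> quadrant e l -> Re (symb k l) = 0 -> F l = (f l + h l)%C).
Hypothesis (Hlim : lim_inf (fun P => CI (fun p => f (RtoC p)) (- P) P) v).

Let psiR (s : R) : C := (F (bd_right k s) * velocity (bd_right k) s)%C.
Let psiL (s : R) : C := (F (bd_left k s) * velocity (bd_left k) s)%C.

Lemma psiR_eq (s : R) : s <> 0 -> psiR s = ((f (bd_right k s) + h (bd_right k s)) * vR k s)%C.
Proof.
  intros Hs. unfold psiR. rewrite (velocity_eq _ _ _ (Rderive_R k s Hs)).
  rewrite (HF 1); auto; [now apply R_quadrant|]. rewrite Re_symb. apply symb_poly_R.
Qed.

Lemma psiL_eq (s : R) : s <> 0 -> psiL s = ((f (bd_left k s) + h (bd_left k s)) * vL k s)%C.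
Proof.
  intros Hs. unfold psiL. rewrite (velocity_eq _ _ _ (Rderive_L k s Hs)).
  rewrite (HF (-1)); auto; [now apply L_quadrant|]. rewrite Re_symb. apply symb_poly_L.
Qed.

Lemma nonzero_near (s : R) : s <> 0 -> locally s (fun x => x <> 0).
Proof.
  intros Hs. apply locally_R_eps. exists (Rabs s). split; [now apply Rabs_pos_lt|].
  intros x Hx ->. rewrite Rminus_0_l, Rabs_Ropp in Hx. lra.
Qed.

Lemma f_cont (l : C) : Ccont f l.
Proof. now apply (holo_cont (fun _ => True)). Qed.

Lemma psiR_cont (s : R) : s <> 0 -> Ccont psiR s.
Proof.
  intros Hs. apply (continuous_ext_loc (T := R_UniformSpace) (U := C_UniformSpace) psiR
    (fun s => (f (bd_right k s) + h (bd_right k s)) * vR k s)%C s).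
  - generalize (nonzero_near s Hs). apply filter_imp. intros x Hx. symmetry. now apply psiR_eq.
  - apply Ccont_mult; [|now apply vR_cont].
    apply Ccont_plus; (apply Ccont_comp_C; [apply R_cont|]); [apply f_cont|].
    apply (holo_cont (quadrant 1)); [apply Hh; auto|now apply R_quadrant].
Qed.

Lemma psiL_cont (s : R) : s <> 0 -> Ccont psiL s.
Proof.
  intros Hs. apply (continuous_ext_loc (T := R_UniformSpace) (U := C_UniformSpace) psiL
    (fun s => (f (bd_left k s) + h (bd_left k s)) * vL k s)%C s).
  - generalize (nonzero_near s Hs). apply filter_imp. intros x Hx. symmetry. now apply psiL_eq.
  - apply Ccont_mult; [|now apply vL_cont].
    apply Ccont_plus; (apply Ccont_comp_C; [apply L_cont|]); [apply f_cont|].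
    apply (holo_cont (quadrant (-1))); [apply Hh; auto|now apply L_quadrant].
Qed.

Lemma fh_contour_bound (e : R) (l : C) (s : R) : e = 1 \/ e = -1 -> quadrant e l -> Re (symb k l) = 0 ->
  Cmod l <= 4 * Rabs s + Rabs k -> Rabs s / 3 <= Im l ->
  Cmod (f l + h l) <= 2 * C0 * (4 + Rabs k) ^ 3 * ((1 + Rabs s) ^ 3 * exp (- (y / 3 * Rabs s))).
Proof.
  intros He Hq Hs Hl Hi. pose proof (Cmod_ge_0 l) as Hl0. pose proof (Rabs_pos s). pose proof (Rabs_pos k).
  assert (E : exp (- (y * Im l)) <= exp (- (y / 3 * Rabs s))).
  { apply exp_le_exp. apply Ropp_le_contravar. replace (y / 3 * Rabs s) with (y * (Rabs s / 3)) by field.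
    apply Rmult_le_compat_l; lra. }
  assert (P : 1 + Cmod l <= (4 + Rabs k) * (1 + Rabs s)) by nra.
  assert (P3 : (1 + Cmod l) ^ 3 <= (4 + Rabs k) ^ 3 * (1 + Rabs s) ^ 3).
  { rewrite <- Rpow_mult_distr. apply pow_incr. lra. }
  assert (P1 : 1 + Cmod l <= (1 + Cmod l) ^ 3).
  { rewrite <- (pow_1 (1 + Cmod l)) at 1. apply Rle_pow; [lra|lia]. }
  assert (F1 : Cmod (f l) <= C0 * (1 + Cmod l) ^ 3 * exp (- (y * Im l))).
  { apply Bf; [|lra]. destruct Hq. lra. }
  assert (F2 : Cmod (h l) <= C0 * (1 + Cmod l) ^ 3 * exp (- (y * Im l))).
  { eapply Rle_trans; [now apply (Bh e)|]. apply Rmult_le_compat_r; [left; apply exp_pos|]. apply Rmult_le_compat_l; lra. }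
  assert (F3 : C0 * (1 + Cmod l) ^ 3 * exp (- (y * Im l)) <= C0 * ((4 + Rabs k) ^ 3 * (1 + Rabs s) ^ 3) * exp (- (y / 3 * Rabs s))).
  { apply Rmult_le_compat; [apply Rmult_le_pos; [lra|apply pow_le; lra]|left; apply exp_pos| |exact E].
    apply Rmult_le_compat_l; lra. }
  eapply Rle_trans; [apply Cmod_triangle|].
  replace (2 * C0 * (4 + Rabs k) ^ 3 * ((1 + Rabs s) ^ 3 * exp (- (y / 3 * Rabs s)))) with
    (2 * (C0 * ((4 + Rabs k) ^ 3 * (1 + Rabs s) ^ 3) * exp (- (y / 3 * Rabs s)))) by ring. lra.
Qed.

Lemma contour_dominated : exists M, (forall s, Cmod (psiR s) <= M * phi s) /\ (forall s, Cmod (psiL s) <= M * phi s).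
Proof.
  (* Three powers for the growth of f and two more to extract the factor [phi]; the rate y/3 comes
     from Im l >= |s|/3. *)
  destruct (poly_exp_bound (y / 3) 5) as (K & HK0 & HK); [lra|].
  pose (M1 := 8 * C0 * (4 + Rabs k) ^ 3 * K).
  assert (A0 : 0 <= 2 * C0 * (4 + Rabs k) ^ 3).
  { pose proof (Rabs_pos k). apply Rmult_le_pos; [lra|]. apply pow_le; lra. }
  assert (HM1 : 0 <= M1) by (unfold M1; nra).
  assert (A : forall s b, b <= 2 * C0 * (4 + Rabs k) ^ 3 * ((1 + Rabs s) ^ 3 * exp (- (y / 3 * Rabs s))) -> b * 4 <= M1 * phi s).
  { intros s b Hb. pose proof (Rabs_pos s) as Hs. specialize (HK (Rabs s) Hs).
    assert (Q : (1 + Rabs s) ^ 3 * exp (- (y / 3 * Rabs s)) <= K * phi s).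
    { unfold phi. assert (Pp : 0 < 1 + s * s) by nra. apply (proj1 (Rle_div_r _ K (1 + s * s) Pp)).
      eapply Rle_trans; [|exact HK]. replace ((1 + Rabs s) ^ 5) with ((1 + Rabs s) ^ 3 * ((1 + Rabs s) * (1 + Rabs s))) by ring.
      replace ((1 + Rabs s) ^ 3 * ((1 + Rabs s) * (1 + Rabs s)) * exp (- (y / 3 * Rabs s)))
       with ((1 + Rabs s) ^ 3 * exp (- (y / 3 * Rabs s)) * ((1 + Rabs s) * (1 + Rabs s))) by ring.
      apply Rmult_le_compat_l.
      - apply Rmult_le_pos; [apply pow_le; lra|left; apply exp_pos].
      - assert (Rabs s * Rabs s = s * s) by (rewrite <- Rabs_mult; apply Rabs_pos_eq; nra). nra. }
    assert (b <= 2 * C0 * (4 + Rabs k) ^ 3 * (K * phi s)).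
    { eapply Rle_trans; [exact Hb|]. now apply Rmult_le_compat_l. }
    unfold M1. lra. }
  assert (BR : forall s, s <> 0 -> Cmod (psiR s) <= M1 * phi s).
  { intros s Hs. rewrite psiR_eq by exact Hs. rewrite Cmod_mult.
    eapply Rle_trans; [apply Rmult_le_compat_l; [apply Cmod_ge_0|apply vR_bound]|]. apply A.
    apply (fh_contour_bound 1); auto; [now apply R_quadrant|rewrite Re_symb; apply symb_poly_R|apply Cmod_R_le|apply Im_R]. }
  assert (BL : forall s, s <> 0 -> Cmod (psiL s) <= M1 * phi s).
  { intros s Hs. rewrite psiL_eq by exact Hs. rewrite Cmod_mult.
    eapply Rle_trans; [apply Rmult_le_compat_l; [apply Cmod_ge_0|apply vL_bound]|]. apply A.
    apply (fh_contour_bound (-1)); auto; [now apply L_quadrant|rewrite Re_symb; apply symb_poly_L|apply Cmod_L_le|apply Im_L]. }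
  (* At s = 0 the values of [F] and of the velocity are uncontrolled, so they are simply added to
     the constant. *)
  assert (P0 : phi 0 = 1) by (unfold phi; rewrite Rmult_0_l, Rplus_0_r; apply Rinv_1).
  pose proof (Cmod_ge_0 (psiR 0)). pose proof (Cmod_ge_0 (psiL 0)).
  exists (M1 + Cmod (psiR 0) + Cmod (psiL 0)). split; intros s; pose proof (phi_pos s);
    (destruct (Req_dec s 0) as [->|Hs]; [rewrite P0; lra|]).
  - specialize (BR s Hs). nra.
  - specialize (BL s Hs). nra.
Qed.

Lemma psi_ex : (forall a b, ex_CI psiR a b) /\ (forall a b, ex_CI psiL a b).
Proof.
  destruct contour_dominated as (M & HR & HL).
  assert (HM : 0 <= M) by (apply (dom_M_pos psiR); auto).
  split; intros a b.
  - apply (ex_CI_one_jump psiR 0 M); [exact psiR_cont|]. intros x. eapply Rle_trans; [apply HR|].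
    pose proof (phi_le_1 x). pose proof (phi_pos x). nra.
  - apply (ex_CI_one_jump psiL 0 M); [exact psiL_cont|]. intros x. eapply Rle_trans; [apply HL|].
    pose proof (phi_le_1 x). pose proof (phi_pos x). nra.
Qed.

Section Primitives.
Variables (Phi H1 H2 : C -> C).
Hypotheses (HPhi : forall z, True -> Cdiff Phi z (f z)).
Hypotheses (HH1 : forall z, quadrant 1 z -> Cdiff H1 z (h z)) (HH2 : forall z, quadrant (-1) z -> Cdiff H2 z (h z)).

(** The primitive of the folded integrand: increments over parameters -s to s on both branches.
    [Phi] is entire and serves for both, whereas h has one primitive for each quadrant. *)
Let D (s : R) : C := (Phi (bd_right k s) - Phi (bd_right k (- s)) + (Phi (bd_left k s) - Phi (bd_left k (- s)))
  + (H1 (bd_right k s) - H1 (bd_right k (- s))) + (H2 (bd_left k s) - H2 (bd_left k (- s))))%C.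

Lemma Rderive_opp_arg (g : R -> C) (s : R) (a : C) : Rderive g (- s) a -> Rderive (fun x => g (- x)) s (- a)%C.
Proof.
  intros H. eapply Rderive_eq; [apply (Rderive_comp_R g (fun x => - x) s (-1) a); [auto_derive; auto|exact H]|].
  apply C_ext; unfold Re, Im; simpl; ring.
Qed.

Lemma D_derive (s : R) : 0 < s -> Rderive D s (psiR s + psiR (- s)%R + (psiL s + psiL (- s)%R))%C.
Proof.
  intros Hs. assert (S1 : s <> 0) by lra. assert (S2 : - s <> 0) by lra.
  rewrite (psiR_eq s S1), (psiR_eq (- s) S2), (psiL_eq s S1), (psiL_eq (- s) S2).
  eapply Rderive_eq.
  - unfold D. apply Rderive_plus; [apply Rderive_plus; [apply Rderive_plus|]|]; apply Rderive_minus.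
    + apply (Cdiff_chain Phi (bd_right k) s); [now apply HPhi|now apply Rderive_R].
    + apply (Rderive_opp_arg (fun x => Phi (bd_right k x))). apply (Cdiff_chain Phi (bd_right k)); [now apply HPhi|now apply Rderive_R].
    + apply (Cdiff_chain Phi (bd_left k) s); [now apply HPhi|now apply Rderive_L].
    + apply (Rderive_opp_arg (fun x => Phi (bd_left k x))). apply (Cdiff_chain Phi (bd_left k)); [now apply HPhi|now apply Rderive_L].
    + apply (Cdiff_chain H1 (bd_right k) s); [apply HH1; now apply R_quadrant|now apply Rderive_R].
    + apply (Rderive_opp_arg (fun x => H1 (bd_right k x))). apply (Cdiff_chain H1 (bd_right k)); [apply HH1; now apply R_quadrant|now apply Rderive_R].
    + apply (Cdiff_chain H2 (bd_left k) s); [apply HH2; now apply L_quadrant|now apply Rderive_L].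
    + apply (Rderive_opp_arg (fun x => H2 (bd_left k x))). apply (Cdiff_chain H2 (bd_left k)); [apply HH2; now apply L_quadrant|now apply Rderive_L].
  - cring.
Qed.

Lemma R_diff (s : R) : (bd_right k (- s) - bd_right k s)%C = (0, 2 * s).
Proof. rewrite !bd_right_eq, ww_opp, Rabs_Ropp. apply C_ext; unfold Re, Im; simpl; ring. Qed.

Lemma L_diff (s : R) : (bd_left k (- s) - bd_left k s)%C = (0, - (2 * s)).
Proof. rewrite !bd_left_eq, ww_opp, Rabs_Ropp. apply C_ext; unfold Re, Im; simpl; ring. Qed.

Lemma Cmod_imag (b : R) : Cmod (0, b) = Rabs b.
Proof.
  unfold Cmod; cbn [fst snd]. replace (0 ^ 2 + b ^ 2) with (b²) by (unfold Rsqr; ring). apply sqrt_Rsqr_abs.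
Qed.

Lemma Cmod_segm_le (z w : C) (s B : R) : 0 <= s <= 1 -> Cmod z <= B -> Cmod w <= B -> Cmod (segm z w s) <= B.
Proof.
  intros Hs Hz Hw. unfold segm. replace (z + RtoC s * (w - z))%C with (RtoC (1 - s) * z + RtoC s * w)%C by (rewrite RtoC_minus; ring).
  eapply Rle_trans; [apply Cmod_triangle|]. rewrite !Cmod_mult, !Cmod_RtoC_pos by lra. nra.
Qed.

Lemma Im_segm_ge (z w : C) (s b : R) : 0 <= s <= 1 -> b <= Im z -> b <= Im w -> b <= Im (segm z w s).
Proof. intros. unfold segm, Im in *; simpl in *. nra. Qed.

Lemma h_segm_bound (e : R) (z w : C) (s B b : R) : e = 1 \/ e = -1 -> quadrant e z -> quadrant e w -> 0 <= s <= 1 ->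
  Cmod z <= B -> Cmod w <= B -> b <= Im z -> b <= Im w ->
  Cmod (h (segm z w s)) <= C0 * (1 + B) * exp (- (y * b)).
Proof.
  intros He Hz Hw Hs Bz Bw bz bw.
  eapply Rle_trans; [apply (Bh e); [exact He|now apply convexC_quadrant]|].
  pose proof (Cmod_segm_le z w s B Hs Bz Bw). pose proof (Im_segm_ge z w s b Hs bz bw). pose proof (Cmod_ge_0 (segm z w s)).
  apply Rmult_le_compat; [apply Rmult_le_pos; lra|left; apply exp_pos|apply Rmult_le_compat_l; lra|].
  apply exp_le_exp. nra.
Qed.

(* The two ends of the right branch are joined by a vertical segment of length [2 s], along which the exponential
   decay beats the growth of [h]. *)
Lemma H1_vertical (s : R) : 0 < s ->
  Cmod (H1 (bd_right k s) - H1 (bd_right k (- s))) <= C0 * (1 + (4 * s + Rabs k)) * exp (- (y * (s / 3))) * (2 * s).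
Proof.
  intros Hs. rewrite Cmod_minus_sym.
  replace (2 * s) with (Cmod (bd_right k (- s) - bd_right k s)) by (rewrite R_diff, Cmod_imag; apply Rabs_pos_eq; lra).
  apply (prim_bound (quadrant 1) h H1); auto; [apply convexC_quadrant|apply R_quadrant; lra|apply R_quadrant; lra|].
  intros t Ht. pose proof (Cmod_R_le k s) as A1. pose proof (Cmod_R_le k (- s)) as A2. pose proof (Im_R k s) as A3. pose proof (Im_R k (- s)) as A4.
  rewrite Rabs_Ropp in A2, A4. rewrite (Rabs_pos_eq s) in * by lra.
  apply (h_segm_bound 1); auto; apply R_quadrant; lra.
Qed.

Lemma H2_vertical (s : R) : 0 < s ->
  Cmod (H2 (bd_left k s) - H2 (bd_left k (- s))) <= C0 * (1 + (4 * s + Rabs k)) * exp (- (y * (s / 3))) * (2 * s).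
Proof.
  intros Hs. rewrite Cmod_minus_sym.
  replace (2 * s) with (Cmod (bd_left k (- s) - bd_left k s)) by (rewrite L_diff, Cmod_imag, Rabs_Ropp; apply Rabs_pos_eq; lra).
  apply (prim_bound (quadrant (-1)) h H2); auto; [apply convexC_quadrant|apply L_quadrant; lra|apply L_quadrant; lra|].
  intros t Ht. pose proof (Cmod_L_le k s) as A1. pose proof (Cmod_L_le k (- s)) as A2. pose proof (Im_L k s) as A3. pose proof (Im_L k (- s)) as A4.
  rewrite Rabs_Ropp in A2, A4. rewrite (Rabs_pos_eq s) in * by lra.
  apply (h_segm_bound (-1)); auto; apply L_quadrant; lra.
Qed.

Lemma odd_part_small (g : R -> C) : (forall x, Ccont g x) -> forall eps, 0 < eps ->
  exists d, 0 < d /\ forall x, 0 < x < d -> Cmod (g x - g (- x)) < eps.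
Proof.
  intros Hg eps He. destruct (proj1 (continuous_RC_eps _ _) (Hg 0) (eps / 2) ltac:(lra)) as (d & Hd & K).
  exists d. split; [exact Hd|]. intros x Hx.
  pose proof (K x ltac:(rewrite Rminus_0_r, Rabs_pos_eq; lra)). pose proof (K (- x) ltac:(rewrite Rminus_0_r, Rabs_Ropp, Rabs_pos_eq; lra)).
  replace (g x - g (- x)%R)%C with ((g x - g 0) - (g (- x)%R - g 0))%C by ring.
  eapply Rle_lt_trans; [apply Cmod_triangle_minus|]. lra.
Qed.

Lemma D_lim_0 (eps : R) : 0 < eps -> exists d, 0 < d /\ forall x, 0 < x < d -> Cmod (D x) < eps.
Proof.
  intros He.
  assert (PR : forall x, Ccont (fun x => Phi (bd_right k x)) x) by (intros x; apply Ccont_comp_C; [apply R_cont|eapply Cdiff_cont; now apply HPhi]).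
  assert (PL : forall x, Ccont (fun x => Phi (bd_left k x)) x) by (intros x; apply Ccont_comp_C; [apply L_cont|eapply Cdiff_cont; now apply HPhi]).
  destruct (odd_part_small _ PR (eps / 4) ltac:(lra)) as (d1 & Hd1 & K1).
  destruct (odd_part_small _ PL (eps / 4) ltac:(lra)) as (d2 & Hd2 & K2).
  pose proof (Rabs_pos k) as Hk.
  pose (Q := C0 * (5 + Rabs k) * 2 + 1).
  assert (HQ : 0 < Q) by (unfold Q; nra).
  exists (Rmin (Rmin d1 d2) (Rmin 1 (eps / 4 / Q))). split.
  { repeat apply Rmin_pos; try lra. repeat apply Rdiv_lt_0_compat; lra. }
  intros x [Hx0 Hx].
  assert (X1 : x < d1) by (eapply Rlt_le_trans; [exact Hx|]; eapply Rle_trans; [apply Rmin_l|apply Rmin_l]).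
  assert (X2 : x < d2) by (eapply Rlt_le_trans; [exact Hx|]; eapply Rle_trans; [apply Rmin_l|apply Rmin_r]).
  assert (X3 : x < 1) by (eapply Rlt_le_trans; [exact Hx|]; eapply Rle_trans; [apply Rmin_r|apply Rmin_l]).
  assert (X4 : x < eps / 4 / Q) by (eapply Rlt_le_trans; [exact Hx|]; eapply Rle_trans; [apply Rmin_r|apply Rmin_r]).
  apply Rlt_div_r in X4; [|lra].
  assert (V : C0 * (1 + (4 * x + Rabs k)) * exp (- (y * (x / 3))) * (2 * x) <= x * Q).
  { assert (E : exp (- (y * (x / 3))) <= 1) by (rewrite <- exp_0; apply exp_le_exp; nra).
    pose proof (exp_pos (- (y * (x / 3)))).
    assert (T : C0 * (1 + (4 * x + Rabs k)) * exp (- (y * (x / 3))) <= C0 * (5 + Rabs k) * 1).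
    { apply Rmult_le_compat; [apply Rmult_le_pos; lra|lra|apply Rmult_le_compat_l; lra|exact E]. }
    unfold Q. nra. }
  pose proof (H1_vertical x Hx0). pose proof (H2_vertical x Hx0). specialize (K1 x ltac:(lra)). specialize (K2 x ltac:(lra)).
  cbv beta in K1, K2. unfold D.
  eapply Rle_lt_trans; [apply Cmod_triangle|]. eapply Rle_lt_trans; [apply Rplus_le_compat_r, Cmod_triangle|].
  eapply Rle_lt_trans; [apply Rplus_le_compat_r, Rplus_le_compat_r, Cmod_triangle|]. lra.
Qed.

Lemma contour_total (P : R) : 0 < P -> (CI psiR (- P) P + CI psiL (- P) P)%C = D P.
Proof.
  intros HP. destruct psi_ex as [XR XL]. destruct contour_dominated as (M & HR & HL).
  assert (HM : 0 <= M) by (apply (dom_M_pos psiR); auto).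
  pose proof (is_CI_plus _ _ _ _ _ _ (CI_fold psiR P XR) (CI_fold psiL P XL)) as K.
  rewrite <- (CI_unique _ _ _ _ K).
  apply (CI_from_0 D _ (4 * M)); [exact HP|eexists; exact K| | |exact D_lim_0].
  - intros x _. assert (N : forall x, Cmod (psiR x) <= M /\ Cmod (psiL x) <= M).
    { intros z. pose proof (HR z). pose proof (HL z). pose proof (phi_le_1 z). pose proof (phi_pos z). split; nra. }
    destruct (N x). destruct (N (- x)).
    eapply Rle_trans; [apply Cmod_triangle|]. pose proof (Cmod_triangle (psiR x) (psiR (- x))). pose proof (Cmod_triangle (psiL x) (psiL (- x))). lra.
  - intros x Hx. split; [apply D_derive; lra|].
    assert (CR : Ccont (fun s => psiR (- s)) x).
    { apply (Ccont_comp_R (U := R_UniformSpace) (fun s => - s) psiR); [|apply psiR_cont; lra]. apply (continuous_opp (V := R_NormedModule)), continuous_id. }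
    assert (CL : Ccont (fun s => psiL (- s)) x).
    { apply (Ccont_comp_R (U := R_UniformSpace) (fun s => - s) psiL); [|apply psiL_cont; lra]. apply (continuous_opp (V := R_NormedModule)), continuous_id. }
    apply Ccont_plus; apply Ccont_plus; auto; [apply psiR_cont|apply psiL_cont]; lra.
Qed.

(** The region below both boundary curves. With [zone_high], the region above them over |a| <= P, it
    contains the paths along which f is integrated. *)
Lemma zone_low (a b : R) : 0 <= b -> b <= ww k a - Rabs a -> 0 <= Re (symb k (a, b)).
Proof.
  intros Hb H. rewrite Re_symb. unfold symb_poly; cbn [fst snd].
  pose proof (ww_sqr k a) as W. pose proof (ww_pos k a). pose proof (Rle_abs a). pose proof (Rle_abs (- a)). rewrite Rabs_Ropp in *.
  replace (2 * (a * a) + k ^ 2) with (ww k a * ww k a) by (rewrite W; ring).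
  replace (ww k a * ww k a - (b + a) * (b + a)) with ((ww k a - (b + a)) * (ww k a + (b + a))) by ring.
  replace (ww k a * ww k a - (b - a) * (b - a)) with ((ww k a - (b - a)) * (ww k a + (b - a))) by ring.
  repeat apply Rmult_le_pos; lra.
Qed.

Lemma zone_high (a b P : R) : Rabs a <= P -> ww k P + P <= b -> 0 <= Re (symb k (a, b)).
Proof.
  intros Ha H. rewrite Re_symb. unfold symb_poly; cbn [fst snd].
  pose proof (Rabs_pos a). pose proof (ww_pos k P). pose proof (ww_sqr k P) as W. 
  assert (Rabs a * Rabs a = a * a) by (rewrite <- Rabs_mult; apply Rabs_pos_eq; nra).
  assert (Q : 2 * (a * a) + k ^ 2 <= ww k P * ww k P) by (rewrite W; simpl; nra).
  pose proof (Rle_abs a). pose proof (Rle_abs (- a)). rewrite Rabs_Ropp in *.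
  assert (ww k P * ww k P <= (b + a) * (b + a)) by (apply Rmult_le_compat; lra).
  assert (ww k P * ww k P <= (b - a) * (b - a)) by (apply Rmult_le_compat; lra).
  set (u := 2 * (a * a) + k ^ 2) in *. nra.
Qed.

(** Descent from the lower end of a branch to the real axis. On this vertical path |l| >= P, so f is
    at most (C0/P) exp (-y b) at height b, with integral at most C0 / (P y). *)
Lemma Phi_low (P s : R) : 0 < P -> R0 <= P -> Rabs s = P ->
  Cmod (Phi (s, (ww k P - P)%R) - Phi (RtoC s)) <= C0 / P / y.
Proof.
  intros HP HR Hs. pose proof (ww_ge k P) as Hw. rewrite (Rabs_pos_eq P) in Hw by lra.
  assert (Ews : ww k s = ww k P).
  { unfold ww. do 2 f_equal. f_equal. rewrite <- (pow2_abs s), Hs. reflexivity. }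
  assert (K : is_CI (fun b => f (s, b) * Ci)%C 0 (ww k P - P) (Phi (s, (ww k P - P)%R) - Phi (s, 0%R))%C).
  { apply (is_CI_primitive (fun _ => True) f Phi (fun b => (s, b)) (fun _ => Ci)); auto.
    intros b _. split; [exact I|]. split; [|apply Ccont_const].
    apply is_derive_pair; [exact (is_derive_const (K := R_AbsRing) (V := R_NormedModule) s b)|apply (is_derive_id (K := R_AbsRing))]. }
  assert (E : is_RInt (fun b => C0 / P * exp (- (y * b))) 0 (ww k P - P) (C0 / P * ((1 - exp (- (y * (ww k P - P)))) / y))).
  { apply (is_RInt_scal (V := R_NormedModule)).
    replace ((1 - exp (- (y * (ww k P - P)))) / y) with (minus (- exp (- (y * (ww k P - P))) / y) (- exp (- (y * 0)) / y)).
    2:{ unfold minus, plus, opp; simpl. rewrite Rmult_0_r, Ropp_0, exp_0. field. lra. }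
    apply (is_RInt_derive (V := R_CompleteNormedModule) (fun b => - exp (- (y * b)) / y)).
    - intros b _. auto_derive; auto. field. lra.
    - intros b _. apply (ex_derive_continuous (V := R_NormedModule)). auto_derive; auto. }
  eapply Rle_trans; [eapply (is_CI_norm _ _ 0 (ww k P - P)); [lra| |exact K|exact E]|].
  - intros b Hb. cbv beta. rewrite Cmod_mult, Cmod_Ci, Rmult_1_r.
    assert (Hl : P <= Cmod (s, b)). { rewrite <- Hs. eapply Rle_trans; [|apply Re_le_Cmod]. apply Rle_refl. }
    assert (B2 : Cmod (s, b) * Cmod (f (s, b)) <= C0 * exp (- (y * b))).
    { apply (Bf2 (s, b)); [unfold Im; simpl; lra| |lra]. apply zone_low; [lra|]. rewrite Ews, Hs. lra. }
    replace (C0 / P * exp (- (y * b))) with (C0 * exp (- (y * b)) / P) by (field; lra).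
    apply (proj1 (Rle_div_r _ _ P HP)). eapply Rle_trans; [|exact B2]. rewrite Rmult_comm.
    apply Rmult_le_compat_r; [apply Cmod_ge_0|exact Hl].
  - assert (A : 0 <= C0 / P) by (apply Rmult_le_pos; [lra|left; now apply Rinv_0_lt_compat]).
    unfold Rdiv at 3. apply Rmult_le_compat_l; [exact A|].
    apply Rle_div_l; [lra|]. rewrite Rinv_l by lra. pose proof (exp_pos (- (y * (ww k P - P)))). lra.
Qed.

(** The upper ends of the two branches are joined by a horizontal segment of length 2P at height
    [ww] k P + P >= P. Points on it have modulus at most P + (2P + |k|) + P <= 5P. *)
Lemma Phi_high (P : R) : 0 < P -> Rabs k <= P ->
  Cmod (Phi (bd_right k (- P)) - Phi (bd_left k P)) <= C0 * (1 + 5 * P) ^ 3 * exp (- (y * P)) * (2 * P).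
Proof.
  intros HP Hk. pose proof (Rabs_pos_eq P ltac:(lra)) as EP. pose proof (ww_pos k P) as HW.
  assert (Ed : (bd_right k (- P) - bd_left k P)%C = RtoC (2 * P)).
  { rewrite bd_right_eq, bd_left_eq, ww_opp, Rabs_Ropp, EP. apply C_ext; unfold Re, Im; simpl; ring. }
  replace (2 * P) with (Cmod (bd_right k (- P) - bd_left k P)) by (rewrite Ed; apply Cmod_RtoC_pos; lra).
  apply (prim_bound (fun _ => True) f Phi); auto; [exact convexC_True|].
  intros t Ht.
  assert (Es : segm (bd_left k P) (bd_right k (- P)) t = ((2 * t - 1) * P, ww k P + P)).
  { unfold segm. rewrite Ed, bd_left_eq, EP. apply C_ext; unfold Re, Im; simpl; ring. }
  rewrite Es.
  assert (Ha : Rabs ((2 * t - 1) * P) <= P) by (apply Rabs_le; nra).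
  eapply Rle_trans; [apply Bf|].
  - unfold Im; simpl; lra.
  - apply (zone_high _ _ P Ha). lra.
  - assert (HC : Cmod ((2 * t - 1) * P, ww k P + P) <= 5 * P).
    { eapply Rle_trans; [apply Cmod_le_sum|]. unfold Re, Im; cbn [fst snd]. rewrite (Rabs_pos_eq (ww k P + P)) by lra.
      pose proof (ww_le k P). rewrite EP in *. lra. }
    pose proof (Cmod_ge_0 ((2 * t - 1) * P, ww k P + P)) as HC1.
    apply Rmult_le_compat; [apply Rmult_le_pos; [lra|apply pow_le; lra]|left; apply exp_pos| |].
    + apply Rmult_le_compat_l; [lra|]. apply pow_incr. lra.
    + apply exp_le_exp. unfold Im; cbn [snd]. nra.
Qed.

(** Up to the connecting pieces, each O(1/P), the contour cut at parameter P has the same integral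
    as f over [-P, P]. The slowest piece is the descent [Phi_low]; all others are exponentially
    small. *)
Lemma D_asymptotics : exists K, forall P, 1 + Rabs k + Rabs R0 <= P ->
  Cmod (D P - (Phi (RtoC P) - Phi (RtoC (- P)))) <= K / P.
Proof.
  destruct (poly_exp_bound (y / 3) 5) as (K & HK0 & HK); [lra|].
  exists (2 * (C0 / y) + 2 * (C0 * 125 * K) + 4 * (C0 * 5 * K)). intros P HP.
  pose proof (Rabs_pos k) as Hk. pose proof (Rle_abs R0) as HR. pose proof (Rabs_pos R0) as HR'.
  assert (HP1 : 1 <= P) by lra. pose proof (Rabs_pos_eq P ltac:(lra)) as EP.
  pose proof (Phi_low P P ltac:(lra) ltac:(lra) EP) as A1.
  pose proof (Phi_low P (- P) ltac:(lra) ltac:(lra) ltac:(now rewrite Rabs_Ropp)) as A2.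
  pose proof (Phi_high P ltac:(lra) ltac:(lra)) as A3.
  pose proof (H1_vertical P ltac:(lra)) as A4. pose proof (H2_vertical P ltac:(lra)) as A5.
  assert (E1 : bd_right k P = (P, ww k P - P)) by (rewrite bd_right_eq, EP; reflexivity).
  assert (E2 : bd_left k (- P) = (- P, ww k P - P)) by (rewrite bd_left_eq, ww_opp, Rabs_Ropp, EP; reflexivity).
  rewrite <- E1 in A1. rewrite <- E2 in A2.
  set (X := exp (- (y / 3 * P))) in *. specialize (HK P ltac:(lra)). fold X in HK.
  assert (HX : 0 < X) by apply exp_pos.
  assert (E3 : exp (- (y * (P / 3))) = X) by (unfold X; f_equal; field).
  assert (E4 : exp (- (y * P)) <= X) by (unfold X; apply exp_le_exp; nra).
  rewrite E3 in A4, A5.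
  assert (HPX : forall n, (n <= 4)%nat -> (1 + P) ^ n * X <= K / P).
  { intros n Hn. apply (proj1 (Rle_div_r _ K P ltac:(lra))). eapply Rle_trans; [|exact HK].
    replace ((1 + P) ^ n * X * P) with ((1 + P) ^ n * P * X) by ring.
    apply Rmult_le_compat_r; [lra|]. apply Rle_trans with ((1 + P) ^ n * (1 + P)).
    - apply Rmult_le_compat_l; [apply pow_le; lra|lra].
    - replace ((1 + P) ^ n * (1 + P)) with ((1 + P) ^ (S n)) by (simpl; ring). apply Rle_pow; [lra|lia]. }
  assert (B3 : Cmod (Phi (bd_right k (- P)) - Phi (bd_left k P)) <= 2 * (C0 * 125 * (K / P))).
  { eapply Rle_trans; [exact A3|]. specialize (HPX 4%nat ltac:(lia)).
    assert (Q3 : (1 + 5 * P) ^ 3 <= 125 * (1 + P) ^ 3).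
    { replace 125 with (5 ^ 3) by ring. rewrite <- Rpow_mult_distr. apply pow_incr. lra. }
    assert (Q4 : (1 + 5 * P) ^ 3 * exp (- (y * P)) * P <= 125 * ((1 + P) ^ 4 * X)).
    { replace (125 * ((1 + P) ^ 4 * X)) with (125 * (1 + P) ^ 3 * X * (1 + P)) by ring.
      apply Rmult_le_compat; [apply Rmult_le_pos; [apply pow_le; lra|left; apply exp_pos]|lra| |lra].
      apply Rmult_le_compat; [apply pow_le; lra|left; apply exp_pos|exact Q3|exact E4]. }
    replace (C0 * (1 + 5 * P) ^ 3 * exp (- (y * P)) * (2 * P)) with (2 * (C0 * ((1 + 5 * P) ^ 3 * exp (- (y * P)) * P))) by ring.
    apply Rmult_le_compat_l; [lra|]. rewrite (Rmult_assoc C0 125). apply Rmult_le_compat_l; lra. }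
  assert (B4 : C0 * (1 + (4 * P + Rabs k)) * X * (2 * P) <= 2 * (C0 * 5 * (K / P))).
  { specialize (HPX 2%nat ltac:(lia)).
    replace (C0 * (1 + (4 * P + Rabs k)) * X * (2 * P)) with (2 * (C0 * ((1 + (4 * P + Rabs k)) * P * X))) by ring.
    apply Rmult_le_compat_l; [lra|]. rewrite (Rmult_assoc C0 5). apply Rmult_le_compat_l; [lra|].
    apply Rle_trans with (5 * ((1 + P) ^ 2 * X)); [|lra].
    replace (5 * ((1 + P) ^ 2 * X)) with (5 * (1 + P) * (1 + P) * X) by ring.
    apply Rmult_le_compat_r; [lra|]. apply Rmult_le_compat; lra. }
  replace ((2 * (C0 / y) + 2 * (C0 * 125 * K) + 4 * (C0 * 5 * K)) / P) with
    (C0 / P / y + C0 / P / y + 2 * (C0 * 125 * (K / P)) + 2 * (C0 * 5 * (K / P)) + 2 * (C0 * 5 * (K / P))) by (field; lra).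
  (* Closing the path: the two descents to the real axis, the segment across the top, and the two
     vertical segments for h. *)
  replace (D P - (Phi (RtoC P) - Phi (RtoC (- P))))%C with
    ((Phi (bd_right k P) - Phi (RtoC P)) - (Phi (bd_left k (- P)) - Phi (RtoC (- P))) - (Phi (bd_right k (- P)) - Phi (bd_left k P))
      + (H1 (bd_right k P) - H1 (bd_right k (- P))) + (H2 (bd_left k P) - H2 (bd_left k (- P))))%C by (unfold D; ring).
  eapply Rle_trans; [apply Cmod_triangle|]. eapply Rle_trans; [apply Rplus_le_compat_r, Cmod_triangle|].
  eapply Rle_trans; [apply Rplus_le_compat_r, Rplus_le_compat_r, Cmod_triangle_minus|].
  eapply Rle_trans; [apply Rplus_le_compat_r, Rplus_le_compat_r, Rplus_le_compat_r, Cmod_triangle_minus|]. lra.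
Qed.

End Primitives.

Lemma contour_total_lim : lim_inf (fun P => CI psiR (- P) P + CI psiL (- P) P)%C v.
Proof.
  destruct (holo_primitive (fun _ => True) f (RtoC 0) convexC_True openC_True I Hf) as [Phi HPhi].
  assert (Q1 : quadrant 1 (1, 1)) by (unfold quadrant, Re, Im; simpl; lra).
  assert (Q2 : quadrant (-1) (-1, 1)) by (unfold quadrant, Re, Im; simpl; lra).
  destruct (holo_primitive (quadrant 1) h (1, 1) (convexC_quadrant 1) (openC_quadrant 1 (or_introl eq_refl)) Q1 (Hh 1 (or_introl eq_refl))) as [H1 HH1].
  destruct (holo_primitive (quadrant (-1)) h (-1, 1) (convexC_quadrant (-1)) (openC_quadrant (-1) (or_intror eq_refl)) Q2 (Hh (-1) (or_intror eq_refl))) as [H2 HH2].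
  destruct (D_asymptotics Phi H1 H2 HPhi HH1 HH2) as [K HK].
  intros eps He. destruct (Hlim (eps / 2) ltac:(lra)) as [B HB].
  pose proof (Rabs_pos k). pose proof (Rabs_pos R0). pose proof (Rle_abs K). pose proof (Rabs_pos K).
  assert (HQ : 0 < (Rabs K + 1) / (eps / 2)) by (apply Rdiv_lt_0_compat; lra).
  exists (Rmax B (Rmax (1 + Rabs k + Rabs R0) ((Rabs K + 1) / (eps / 2)))). intros P HP.
  assert (P1 : B <= P) by (eapply Rle_trans; [apply Rmax_l|exact HP]).
  assert (P2 : 1 + Rabs k + Rabs R0 <= P) by (eapply Rle_trans; [|exact HP]; eapply Rle_trans; [apply Rmax_l|apply Rmax_r]).
  assert (P3 : (Rabs K + 1) / (eps / 2) <= P) by (eapply Rle_trans; [|exact HP]; eapply Rle_trans; [apply Rmax_r|apply Rmax_r]).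
  rewrite (contour_total Phi H1 H2 HPhi HH1 HH2) by lra.
  specialize (HB P P1). specialize (HK P P2).
  assert (E : CI (fun p => f (RtoC p)) (- P) P = (Phi (RtoC P) - Phi (RtoC (- P)))%C).
  { apply CI_unique. eapply is_CI_ext; [|apply (is_CI_primitive (fun _ => True) f Phi RtoC (fun _ => RtoC 1)); auto].
    - intros x _. simpl. ring.
    - intros s _. split; [exact I|]. split; [apply Rderive_id|apply Ccont_const]. }
  rewrite E in HB.
  assert (K / P < eps / 2).
  { apply Rlt_div_l; [lra|]. apply Rle_div_l in P3; lra. }
  match goal with |- Cmod (Cminus ?d v) < _ => replace (d - v)%C with ((d - (Phi (RtoC P) - Phi (RtoC (- P)))) + ((Phi (RtoC P) - Phi (RtoC (- P))) - v))%C by ring end.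
  eapply Rle_lt_trans; [apply Cmod_triangle|]. lra.
Qed.

(** The definition truncates by modulus, which cuts the two branches at unequal parameters, while
    the deformation used equal ones. Both limits exist and agree because the integrands on the
    branches are dominated by [phi]. *)
Theorem contour_int_eq : is_contour_int (bd_Domp k) F v.
Proof.
  destruct psi_ex as [XR XL]. destruct contour_dominated as (M & BR & BL).
  destruct (is_line_ex psiR M XR BR) as [AR HR]. destruct (is_line_ex psiL M XL BL) as [AL HL].
  assert (LM : forall psi A, (forall a b, ex_CI psi a b) -> is_CRInt_line psi A -> lim_inf (fun P => CI psi (- P) P) A).
  { intros psi A Hex HA eps He. destruct (proj1 (is_line_eps _ _) HA eps He) as [B HB]. exists B. intros P HP.
    destruct (HB (- P) P ltac:(lra) HP) as (z & Hz1 & Hz2). now rewrite (CI_unique _ _ _ _ Hz1). }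
  assert (E : v = (AR + AL)%C).
  { apply (lim_inf_unique _ _ _ contour_total_lim). apply lim_inf_plus; now apply LM. }
  exists (fun r => (curve_upto (bd_right k) F r + curve_upto (bd_left k) F r)%C). split.
  - exists (Rabs k). intros r Hr.
    exists (curve_upto (bd_right k) F r), (curve_upto (bd_left k) F r).
    split; [apply (curve_upto_spec (bd_right k) k F (windowed_R k) XR); lra|]. split; [|reflexivity].
    exists (curve_upto (bd_left k) F r), (RtoC 0).
    split; [apply (curve_upto_spec (bd_left k) k F (windowed_L k) XL); lra|]. split; [reflexivity|ring].
  - apply filterlim_lim_inf. rewrite E.
    apply lim_inf_plus; [apply (curve_upto_lim (bd_right k) k F M (windowed_R k) XR BR AR HR)|apply (curve_upto_lim (bd_left k) k F M (windowed_L k) XL BL AL HL)].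
Qed.

End Contour.

(** * The problem on the half line *)

Lemma Cexp_Ci (r : R) : Cexp (Ci * RtoC r) = (cos r, sin r).
Proof.
  pose proof (osc_eq 1 r) as H. unfold osc in H. rewrite !Rmult_1_l in H. exact H.
Qed.

Lemma Csqrt_sqr (z : C) : (Csqrt z * Csqrt z)%C = z.
Proof.
  destruct (classic (z = RtoC 0)) as [->|Hz].
  - unfold Csqrt. rewrite Cmod_0, sqrt_0. ring.
  - unfold Csqrt. rewrite (Carg_polar z Hz) at 5.
    replace (RtoC (sqrt (Cmod z)) * Cexp (Ci * RtoC (Carg z / 2)) * (RtoC (sqrt (Cmod z)) * Cexp (Ci * RtoC (Carg z / 2))))%C
      with (RtoC (sqrt (Cmod z)) * RtoC (sqrt (Cmod z)) * (Cexp (Ci * RtoC (Carg z / 2)) * Cexp (Ci * RtoC (Carg z / 2))))%C by ring.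
    rewrite <- RtoC_mult, sqrt_sqrt by apply Cmod_ge_0. rewrite <- Cexp_plus. f_equal. f_equal.
    replace (Carg z) with (Carg z / 2 + Carg z / 2) at 3 by field. rewrite RtoC_plus. ring.
Qed.

(** With the argument in [0, 2 pi) the half argument lies in [0, pi), where the sine is nonnegative.
    So [nu] always has a half-line transform. *)
Lemma Im_Csqrt (z : C) : 0 <= Im (Csqrt z).
Proof.
  destruct (classic (z = RtoC 0)) as [->|Hz].
  - unfold Csqrt. rewrite Cmod_0, sqrt_0. unfold Im; simpl. lra.
  - pose proof (Carg_bound z Hz) as H. unfold Csqrt. rewrite Cexp_Ci. unfold Im; simpl.
    rewrite Rmult_0_l, Rplus_0_r. apply Rmult_le_pos; [apply sqrt_pos|]. apply sin_ge_0; lra.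
Qed.

Lemma Im_Csqrt_pos (z : C) : Im z <> 0 -> 0 < Im (Csqrt z).
Proof.
  intros Hz. destruct (Im_Csqrt z) as [H|H]; [exact H|]. exfalso. apply Hz.
  pose proof (f_equal Im (Csqrt_sqr z)) as E. set (r := Csqrt z) in *. clearbody r.
  rewrite <- E. unfold Im in *; simpl. rewrite <- H. ring.
Qed.

Lemma Csqrt_sum_neq_0 (w z : C) : Im z <> 0 -> (Csqrt w + Csqrt z)%C <> 0.
Proof.
  intros Hz H. pose proof (Im_Csqrt_pos z Hz). pose proof (Im_Csqrt w).
  apply (f_equal Im) in H. set (r := Csqrt w) in *. set (q := Csqrt z) in *. clearbody r q.
  unfold Im in *; simpl in *. lra.
Qed.

(** Continuity and differentiability of the root follow from this factorisation alone, without any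
    study of [Carg]: the sum of the roots cannot vanish, both imaginary parts being nonnegative and
    one of them positive. *)
Lemma Csqrt_diff (w z : C) : Im z <> 0 -> (Csqrt w - Csqrt z)%C = (/ (Csqrt w + Csqrt z) * (w - z))%C.
Proof.
  intros Hz.
  replace (w - z)%C with (Csqrt w * Csqrt w - Csqrt z * Csqrt z)%C by (rewrite !Csqrt_sqr; reflexivity). field. now apply Csqrt_sum_neq_0.
Qed.

Lemma Csqrt_cont (z : C) : Im z <> 0 -> Ccont Csqrt z.
Proof.
  intros Hz. pose proof (Im_Csqrt_pos z Hz) as Hp.
  apply (continuous_C_eps (U := C_UniformSpace)). intros eps He.
  assert (Hd : 0 < eps * Im (Csqrt z)) by now apply Rmult_lt_0_compat.
  generalize (locally_Cmod z _ Hd). apply filter_imp. intros w Hw.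
  rewrite (Csqrt_diff w z Hz). pose proof (Csqrt_sum_neq_0 w z Hz) as Hn.
  rewrite Cmod_mult, Cmod_inv by exact Hn.
  assert (Im (Csqrt z) <= Cmod (Csqrt w + Csqrt z)).
  { pose proof (Im_le_Cmod (Csqrt w + Csqrt z)) as H. apply Rabs_le_between in H. pose proof (Im_Csqrt w) as Hw0.
    set (r := Csqrt w) in *. set (q := Csqrt z) in *. clearbody r q. unfold Im in *; simpl in *. lra. }
  rewrite Rmult_comm. apply Rlt_div_l; [lra|]. nra.
Qed.

Lemma holo_Csqrt : holo (fun z => Im z <> 0) Csqrt.
Proof.
  exists (fun z => / (Csqrt z + Csqrt z))%C. intros z Hz. split.
  - exists (fun w => / (Csqrt w + Csqrt z))%C. split; [|split; [|reflexivity]].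
    + intros w. rewrite <- (Csqrt_diff w z Hz). ring.
    + apply (Ccont_inv (U := C_UniformSpace)); [|now apply Csqrt_sum_neq_0].
      apply (Ccont_plus (U := C_UniformSpace)); [now apply Csqrt_cont|apply Ccont_const].
  - apply (Ccont_inv (U := C_UniformSpace)); [|now apply Csqrt_sum_neq_0].
    apply (Ccont_plus (U := C_UniformSpace)); now apply Csqrt_cont.
Qed.

Lemma nu_sqr (k : R) (l : C) : (nu k l * nu k l)%C = (- (l * l) - 2 * (RtoC k * RtoC k))%C.
Proof. unfold nu. rewrite Csqrt_sqr. ring. Qed.

Lemma Im_nu_arg (k : R) (l : C) : Im (- l ^ 2 - 2 * RtoC k ^ 2)%C = - (2 * Re l * Im l).
Proof. unfold Re, Im; simpl. ring. Qed.

Lemma quadrant_arg (k e : R) (l : C) : e = 1 \/ e = -1 -> quadrant e l -> Im (- l ^ 2 - 2 * RtoC k ^ 2)%C <> 0.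
Proof.
  intros He [H1 H2]. rewrite Im_nu_arg. intros H.
  assert (Hp : 0 < (e * Re l) * Im l) by now apply Rmult_lt_0_compat.
  destruct He as [-> | ->]; lra.
Qed.

Lemma Im_nu_pos (k e : R) (l : C) : e = 1 \/ e = -1 -> quadrant e l -> 0 < Im (nu k l).
Proof. intros He Hq. unfold nu. apply Im_Csqrt_pos. now apply (quadrant_arg k e). Qed.

Lemma holo_nu (k e : R) : e = 1 \/ e = -1 -> holo (quadrant e) (nu k).
Proof.
  intros He. apply (holo_comp (quadrant e) (fun z => Im z <> 0) Csqrt (fun l => - l ^ 2 - 2 * RtoC k ^ 2)%C).
  - exact holo_Csqrt.
  - apply holo_minus; [apply holo_opp, holo_pow, holo_id|]. apply holo_const.
  - intros l Hl. now apply (quadrant_arg k e).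
Qed.

(** If nu = l, then l^2 = -k^2 is real, which is impossible in an open quadrant. *)
Lemma nu_neq (k e : R) (l : C) : e = 1 \/ e = -1 -> quadrant e l -> (nu k l - l)%C <> 0.
Proof.
  intros He Hq H. apply (quadrant_arg k e l He Hq).
  assert (E : nu k l = l) by (replace (nu k l) with (nu k l - l + l)%C by ring; rewrite H; ring).
  pose proof (nu_sqr k l) as S. rewrite E in S.
  assert (S2 : Im (l * l)%C = Im (- (l * l) - 2 * (RtoC k * RtoC k))%C) by now rewrite <- S.
  unfold Im in *; simpl in *. lra.
Qed.

(** k^2 + nu^2 = -(k^2 + l^2), and the symbol is the square. *)
Lemma symb_nu (k : R) (l : C) : symb k (nu k l) = symb k l.
Proof.
  unfold symb. replace (RtoC k ^ 2 + nu k l ^ 2)%C with (RtoC k * RtoC k + nu k l * nu k l)%C by ring.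
  rewrite nu_sqr. ring.
Qed.

Lemma symb_opp (k : R) (l : C) : symb k (- l) = symb k l.
Proof. unfold symb. ring. Qed.

Lemma holo_symb (U : C -> Prop) (k : R) : holo U (symb k).
Proof. unfold symb. apply holo_pow, holo_plus; [apply holo_const|apply holo_pow, holo_id]. Qed.

(** * Global relation and splitting of the integrand *)

Section OneDim.
(** [vs] j is the j-th y-derivative of the transformed solution, [vt] its time derivative, and [db]
    j the time derivative of the boundary value of [vs] j. Derivatives are assumed only in the open
    ranges of z and time. *)
Variables (k T y t M : R) (vs : nat -> R -> R -> C) (vt : R -> R -> C) (db : nat -> R -> C).
Hypotheses (Hy : 0 < y) (Ht : 0 < t < T).
Hypothesis (Hc : forall j z tau, Ccont2 (vs j) z tau).
Hypothesis (Hct : forall z tau, Ccont2 vt z tau).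
Hypothesis (HM : forall j z tau, (j <= 4)%nat -> 0 <= z -> Cmod (vs j z tau) <= M * phi z * phi z).
Hypothesis (HMt : forall z tau, 0 <= z -> Cmod (vt z tau) <= M * phi z * phi z).
Hypothesis (Dz : forall j z tau, (j < 4)%nat -> 0 < z -> 0 < tau < T -> Rderive (fun z => vs j z tau) z (vs (S j) z tau)).
Hypothesis (Dt : forall z tau, 0 < z -> 0 < tau < T -> Rderive (fun tau => vs 0%nat z tau) tau (vt z tau)).
Hypothesis (Db : forall j tau, (j < 4)%nat -> 0 < tau < T -> Rderive (fun tau => vs j 0 tau) tau (db j tau)).
Hypothesis (Hdb : forall j tau, Ccont (db j) tau).
Hypothesis (PDE : forall z tau, 0 < z -> 0 < tau < T ->
  vt z tau = (- (RtoC k ^ 4 * vs 0%nat z tau - 2 * RtoC k ^ 2 * vs 2%nat z tau + vs 4%nat z tau))%C).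

Lemma vs_cont_z (j : nat) (tau z : R) : Ccont (fun z => vs j z tau) z.
Proof. apply (Ccont2_slice (fun tau z => vs j z tau)). apply Ccont2_swap. apply Hc. Qed.

Lemma vs_cont_t (j : nat) (z tau : R) : Ccont (fun tau => vs j z tau) tau.
Proof. apply (Ccont2_slice (vs j)). apply Hc. Qed.

Let V (j : nat) (zeta : C) (tau : R) : C := LT (fun z => vs j z tau) zeta.

Lemma V_is (j : nat) (zeta : C) (tau : R) : (j <= 4)%nat -> 0 <= Im zeta ->
  is_I0 (fun z => Cexp (Ci * zeta * RtoC z) * vs j z tau)%C (V j zeta tau).
Proof.
  intros Hj Hz. apply (is_LT _ M); auto. intros z. apply vs_cont_z.
Qed.

Lemma V_by_parts (j : nat) (zeta : C) (tau : R) : (j < 4)%nat -> 0 <= Im zeta -> 0 < tau < T ->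
  V (S j) zeta tau = (- vs j 0 tau - Ci * zeta * V j zeta tau)%C.
Proof.
  intros Hj Hz Htau.
  assert (H : is_I0 (fun z => Ci * zeta * (Cexp (Ci * zeta * RtoC z) * vs j z tau) + Cexp (Ci * zeta * RtoC z) * vs (S j) z tau)%C
    (- (Cexp (Ci * zeta * RtoC 0) * vs j 0 tau))%C).
  { apply (is_I0_FTC (fun z => Cexp (Ci * zeta * RtoC z) * vs j z tau)%C _ M).
    - intros b Hb. apply (FTC_C_open (fun z => Cexp (Ci * zeta * RtoC z) * vs j z tau)%C); [exact Hb| | |].
      + intros z Hz'. eapply Rderive_eq.
        * apply Rderive_mult; [|apply Dz; auto; lra]. apply (Rderive_exp (fun z => Ci * zeta * RtoC z)%C).
          apply (Rderive_mult (fun _ => Ci * zeta)%C (fun x => RtoC x)); [apply Rderive_const|apply Rderive_id].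
        * cring.
      + intros z _. apply Ccont_mult; [apply LT_exp_cont|apply vs_cont_z].
      + intros z. apply Ccont_plus; [apply Ccont_mult; [apply Ccont_const|]|]; (apply Ccont_mult; [apply LT_exp_cont|apply vs_cont_z]).
    - intros z Hz'. apply (LT_dom1 (fun z => vs j z tau)); auto. intros x Hx. apply HM; auto. lia. }
  pose proof (is_I0_plus _ _ _ _ (is_I0_scal (Ci * zeta)%C _ _ (V_is j zeta tau ltac:(lia) Hz)) (V_is (S j) zeta tau ltac:(lia) Hz)) as H2.
  pose proof (is_I0_inj _ _ _ H H2) as E.
  replace (Ci * zeta * RtoC 0)%C with (RtoC 0) in E by ring. rewrite Cexp_0 in E.
  replace (V (S j) zeta tau) with (Ci * zeta * V j zeta tau + V (S j) zeta tau - Ci * zeta * V j zeta tau)%C by ring.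
  rewrite <- E. ring.
Qed.

Let W (zeta : C) (tau : R) : C := LT (fun z => vt z tau) zeta.

Lemma W_integrand_cont (zeta : C) (tau z : R) : Ccont2 (fun tau z => Cexp (Ci * zeta * RtoC z) * vt z tau)%C tau z.
Proof.
  apply Ccont_mult.
  - apply Ccont_exp, Ccont_mult; [apply Ccont_const|]. apply Ccont_RtoC, continuous_snd.
  - apply (Ccont2_swap vt). apply Hct.
Qed.

Lemma W_cont (zeta : C) (tau : R) : 0 <= Im zeta -> Ccont (W zeta) tau.
Proof.
  intros Hz. apply (I0_param_cont (fun tau z => Cexp (Ci * zeta * RtoC z) * vt z tau)%C M).
  - intros z _. apply W_integrand_cont.
  - apply filter_forall. intros s. split.
    + intros z. apply (Ccont2_slice (fun tau z => Cexp (Ci * zeta * RtoC z) * vt z tau)%C). apply W_integrand_cont.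
    + intros z Hz'. apply (LT_dom1 (fun z => vt z s)); auto.
Qed.

(** The integrated form of V_t = W: an exchange of integrals replaces differentiation under the
    improper integral, and the closed time interval is reached at once. *)
Lemma V_evol (zeta : C) (s : R) : 0 <= Im zeta -> 0 <= s <= T -> V 0 zeta s = (V 0 zeta 0 + CI (W zeta) 0 s)%C.
Proof.
  intros Hz Hs.
  assert (H : CI (W zeta) 0 s = (V 0 zeta s - V 0 zeta 0)%C).
  { assert (Wb : forall p x, 0 <= p <= s -> 0 <= x -> Cmod (Cexp (Ci * zeta * RtoC x) * vt x p) <= M * phi x).
    { intros p x _ Hx. apply (LT_dom1 (fun z => vt z p)); auto. }
    pose proof (I0_Fubini_fin (fun tau z => Cexp (Ci * zeta * RtoC z) * vt z tau)%C M 0 s (proj1 Hs) (W_integrand_cont zeta) Wb) as HF.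
    change (fun p => I0 ((fun tau z => Cexp (Ci * zeta * RtoC z) * vt z tau)%C p)) with (W zeta) in HF.
    rewrite (CI_unique _ _ _ _ HF). apply I0_unique.
    eapply is_I0_ext; [|apply is_I0_minus; apply V_is; auto; lia].
    intros z Hz'. simpl. symmetry. apply CI_unique.
    eapply is_CI_eq; [apply (FTC_C_open (fun tau => Cexp (Ci * zeta * RtoC z) * vs 0%nat z tau)%C)|]; [lra| | | |].
    - intros tau Htau. eapply Rderive_eq; [apply Rderive_mult; [apply Rderive_const|apply Dt; lra]|]. cring.
    - intros tau _. apply Ccont_mult; [apply Ccont_const|apply vs_cont_t].
    - intros tau. apply (Ccont2_slice (fun z tau => Cexp (Ci * zeta * RtoC z) * vt z tau)%C).
      apply (Ccont2_swap (fun tau z => Cexp (Ci * zeta * RtoC z) * vt z tau)%C). apply W_integrand_cont.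
    - cring. }
  rewrite H. ring.
Qed.

(* The boundary terms of four integrations by parts in y. *)
Let Bd (zeta : C) (tau : R) : C :=
  (vs 3%nat 0 tau - Ci * zeta * vs 2%nat 0 tau + (- (zeta * zeta) - 2 * (RtoC k * RtoC k)) * (vs 1%nat 0 tau - Ci * zeta * vs 0%nat 0 tau))%C.

Lemma W_eq (zeta : C) (tau : R) : 0 <= Im zeta -> 0 < tau < T -> W zeta tau = (Bd zeta tau - symb k zeta * V 0 zeta tau)%C.
Proof.
  intros Hz Htau.
  assert (H : W zeta tau = (- (RtoC k ^ 4 * V 0 zeta tau - 2 * RtoC k ^ 2 * V 2 zeta tau + V 4 zeta tau))%C).
  { apply I0_unique.
    replace (- (RtoC k ^ 4 * V 0 zeta tau - 2 * RtoC k ^ 2 * V 2 zeta tau + V 4 zeta tau))%C with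
      (- RtoC k ^ 4 * V 0 zeta tau + 2 * RtoC k ^ 2 * V 2 zeta tau + RtoC (-1) * V 4 zeta tau)%C
      by (apply C_ext; unfold Re, Im; simpl; ring).
    eapply is_I0_ext; [|apply is_I0_plus; [apply is_I0_plus|]; apply is_I0_scal; apply V_is; auto; lia].
    intros z Hz'. simpl. rewrite PDE by auto. apply C_ext; unfold Re, Im; simpl; ring. }
  rewrite H. rewrite !V_by_parts by (auto; lia). unfold Bd, symb.
  apply C_ext; unfold Re, Im; simpl; ring.
Qed.

Let m (j : nat) (w : C) : C := mT (fun tau => vs j 0 tau) t w.

Lemma m_is (j : nat) (w : C) : is_CI (fun tau => Cexp (w * RtoC tau) * vs j 0 tau)%C 0 t (m j w).
Proof. apply is_mT. intros; apply vs_cont_t. Qed.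

(** By [W_eq], V_t + w V is the boundary expression [Bd]; the integrating factor exp (w tau) turns
    this into the t-transforms of the boundary values. *)
Theorem global_relation (zeta : C) : 0 <= Im zeta ->
  V 0 zeta t = (Cexp (- (symb k zeta * RtoC t)) * (V 0 zeta 0 + (m 3 (symb k zeta) - Ci * zeta * m 2 (symb k zeta)
    + (- (zeta * zeta) - 2 * (RtoC k * RtoC k)) * (m 1 (symb k zeta) - Ci * zeta * m 0 (symb k zeta)))))%C.
Proof.
  intros Hz. set (w := symb k zeta).
  (* V is represented by V(0) plus the integral of W, which is differentiable for every tau,
     including the ends of [0, t]. *)
  assert (H1 : is_CI (fun tau => w * Cexp (w * RtoC tau) * (V 0 zeta 0 + CI (W zeta) 0 tau) + Cexp (w * RtoC tau) * W zeta tau)%C 0 t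
    (Cexp (w * RtoC t) * (V 0 zeta 0 + CI (W zeta) 0 t) - Cexp (w * RtoC 0) * (V 0 zeta 0 + CI (W zeta) 0 0))%C).
  { assert (DW : forall s, Rderive (fun s => V 0 zeta 0 + CI (W zeta) 0 s)%C s (RtoC 0 + W zeta s)%C).
    { intros s. apply Rderive_plus; [apply Rderive_const|]. apply Rderive_CI. intros; now apply W_cont. }
    apply (FTC_C (fun tau => Cexp (w * RtoC tau) * (V 0 zeta 0 + CI (W zeta) 0 tau))%C).
    - intros s _. eapply Rderive_eq.
      + apply Rderive_mult; [|apply DW]. apply (Rderive_exp (fun z => w * RtoC z)%C).
        apply (Rderive_mult (fun _ => w)%C (fun x => RtoC x)); [apply Rderive_const|apply Rderive_id].
      + cring.
    - intros s _. pose proof (Rderive_cont _ _ _ (DW s)). apply Ccont_plus.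
      + apply Ccont_mult; [|assumption]. apply Ccont_mult; [apply Ccont_const|apply MT_exp_cont].
      + apply Ccont_mult; [apply MT_exp_cont|now apply W_cont]. }
  rewrite (CI_unique (W zeta) 0 0 (RtoC 0)) in H1 by apply is_CI_point.
  rewrite <- (V_evol zeta t) in H1 by (auto; lra).
  assert (H2 : is_CI (fun tau => w * Cexp (w * RtoC tau) * (V 0 zeta 0 + CI (W zeta) 0 tau) + Cexp (w * RtoC tau) * W zeta tau)%C 0 t
    (m 3 w + (- (Ci * zeta)) * m 2 w + (- (zeta * zeta) - 2 * (RtoC k * RtoC k)) * m 1 w
      + ((- (zeta * zeta) - 2 * (RtoC k * RtoC k)) * - (Ci * zeta)) * m 0 w)%C).
  { eapply is_CI_ext; [|apply is_CI_plus; [apply is_CI_plus; [apply is_CI_plus|]|]; [apply m_is| | |]; apply is_CI_scal, m_is].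
    intros tau Htau. rewrite Rmin_left, Rmax_right in Htau by lra. simpl.
    rewrite <- (V_evol zeta tau) by (auto; lra). rewrite W_eq by (auto; lra). fold w. unfold Bd. ring. }
  pose proof (is_CI_inj _ _ _ _ _ H1 H2) as E.
  replace (w * RtoC 0)%C with (RtoC 0) in E by ring. rewrite Cexp_0 in E.
  assert (X : (Cexp (- (w * RtoC t)) * Cexp (w * RtoC t))%C = RtoC 1).
  { rewrite <- Cexp_plus, <- Cexp_0. f_equal. ring. }
  transitivity (Cexp (- (w * RtoC t)) * Cexp (w * RtoC t) * V 0 zeta t)%C; [rewrite X; ring|].
  replace (Cexp (- (w * RtoC t)) * Cexp (w * RtoC t) * V 0 zeta t)%C with
    (Cexp (- (w * RtoC t)) * (Cexp (w * RtoC t) * V 0 zeta t - 1 * (V 0 zeta 0 + RtoC 0) + V 0 zeta 0))%C by ring.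
  rewrite E. ring.
Qed.

(** The boundary terms of the global relation at -l. They make sense for every l, although the
    relation itself holds at -l only when Im l <= 0. *)
Let B0 (l : C) : C :=
  (m 3 (symb k l) + Ci * l * m 2 (symb k l) + (- (l * l) - 2 * (RtoC k * RtoC k)) * (m 1 (symb k l) + Ci * l * m 0 (symb k l)))%C.
Let f0 (l : C) : C := (Cexp (Ci * l * RtoC y) * (Cexp (- (symb k l * RtoC t)) * B0 l))%C.
Let h0 (l : C) : C := (Cexp (Ci * l * RtoC y) *
  (- ((nu k l + l) / (nu k l - l)) * V 0 l t + 2 * l / (nu k l - l) * V 0 (nu k l) t))%C.

Definition Gdata (l : C) : C := (- ((nu k l + l) / (nu k l - l)) * V 0 l 0 + 2 * l / (nu k l - l) * V 0 (nu k l) 0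
  - 2 * l * (l + nu k l) * m 1 (symb k l) + 2 * Ci * l * nu k l * (nu k l + l) * m 0 (symb k l))%C.

(* The global relations at [l] and [nu], which have the same symbol, contain the same t-transforms of the unknown
   second and third derivatives; in this combination they survive only inside the entire function [f0]. *)
Lemma G_split (e : R) (l : C) : e = 1 \/ e = -1 -> quadrant e l ->
  (Cexp (Ci * l * RtoC y) * (Cexp (- (symb k l * RtoC t)) * Gdata l))%C = (f0 l + h0 l)%C.
Proof.
  intros He Hq. pose proof (nu_neq k e l He Hq) as Hn. pose proof (Im_nu_pos k e l He Hq) as Hp.
  unfold h0. rewrite (global_relation l) by (destruct Hq; lra).
  rewrite (global_relation (nu k l)) by lra. rewrite symb_nu.
  unfold f0, B0, Gdata.
  replace (- (nu k l * nu k l) - 2 * (RtoC k * RtoC k))%C with (l * l)%C by (rewrite nu_sqr; ring).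
  replace (- (l * l) - 2 * (RtoC k * RtoC k))%C with (nu k l * nu k l)%C by (rewrite nu_sqr; reflexivity).
  set (n := nu k l) in *. set (X := Cexp (- (symb k l * RtoC t))). set (Y := Cexp (Ci * l * RtoC y)).
  set (V1 := V 0 l 0). set (V2 := V 0 n 0).
  set (a0 := m 0 (symb k l)). set (a1 := m 1 (symb k l)). set (a2 := m 2 (symb k l)). set (a3 := m 3 (symb k l)).
  clearbody n X Y V1 V2 a0 a1 a2 a3. field. exact Hn.
Qed.

(** For real p the point -p lies in the closed upper half plane, so the relation at -p trades the
    boundary terms for the transforms at times t and 0; the former is the integrand of the half-line
    inversion. *)
Lemma f0_real (p : R) : f0 (RtoC p) =
  (osc y p * V 0 (- RtoC p) t - Cexp (Ci * RtoC p * RtoC y) * (Cexp (- (symb k (RtoC p) * RtoC t)) * V 0 (- RtoC p) 0))%C.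
Proof.
  assert (Hz : 0 <= Im (- RtoC p)%C) by (unfold Im; simpl; lra).
  rewrite (global_relation (- RtoC p)%C Hz), symb_opp. unfold f0, B0, osc.
  replace (Ci * RtoC p * RtoC y)%C with (Ci * RtoC (y * p))%C by (rewrite RtoC_mult; ring). ring.
Qed.

Lemma holo_f0 : holo (fun _ => True) f0.
Proof.
  assert (HmT : forall j, (j <= 4)%nat -> holo (fun _ => True) (fun l => m j (symb k l))).
  { intros j Hj. apply (holo_comp (fun _ => True) (fun _ => True) (m j) (symb k)); auto; [|apply holo_symb].
    apply (holo_mT _ t M); [lra|intros; apply vs_cont_t|].
    intros x _. eapply Rle_trans; [apply HM; [exact Hj|lra]|]. unfold phi. rewrite Rmult_0_l, Rplus_0_r, Rinv_1. lra. }
  assert (HL : holo (fun _ => True) (fun l => Ci * l)%C) by (apply holo_mult; [apply holo_const|apply holo_id]).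
  unfold f0, B0. apply holo_mult.
  - apply holo_exp. apply holo_mult; [exact HL|apply holo_const].
  - apply holo_mult.
    + apply holo_exp, holo_opp, holo_mult; [apply holo_symb|apply holo_const].
    + apply holo_plus; [apply holo_plus; [apply HmT; lia|apply holo_mult; [exact HL|apply HmT; lia]]|].
      apply holo_mult.
      * apply holo_minus; [apply holo_opp, holo_mult; apply holo_id|apply holo_const].
      * apply holo_plus; [apply HmT; lia|apply holo_mult; [exact HL|apply HmT; lia]].
Qed.

Lemma V_M_pos : 0 <= M.
Proof.
  apply (LT_M_pos (fun z => vs 0%nat z 0)). intros; apply HM; [lia|assumption].
Qed.

Lemma holo_h0 (e : R) : e = 1 \/ e = -1 -> holo (quadrant e) h0.
Proof.
  intros He.
  assert (HLT : holo (fun z => 0 < Im z) (fun z => V 0 z t)).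
  { apply (holo_LT _ M); [intros; apply vs_cont_z|]. intros; apply HM; [lia|assumption]. }
  assert (Hinv : holo (quadrant e) (fun l => / (nu k l - l))%C).
  { apply holo_inv; [apply holo_minus; [now apply holo_nu|apply holo_id]|]. intros l Hl. now apply (nu_neq k e). }
  unfold h0, Cdiv. apply holo_mult.
  - apply holo_exp, holo_mult; [apply holo_mult; [apply holo_const|apply holo_id]|apply holo_const].
  - apply holo_plus; apply holo_mult.
    + apply holo_opp, holo_mult; [|exact Hinv]. apply holo_plus; [now apply holo_nu|apply holo_id].
    + apply (holo_comp (quadrant e) (fun z => 0 < Im z) (fun z => V 0 z t) (fun l => l)); [exact HLT|apply holo_id|].
      intros l Hl. apply Hl.
    + apply holo_mult; [|exact Hinv]. apply holo_mult; [apply holo_const|apply holo_id].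
    + apply (holo_comp (quadrant e) (fun z => 0 < Im z) (fun z => V 0 z t) (nu k)); [exact HLT|now apply holo_nu|].
      intros l Hl. now apply (Im_nu_pos k e).
Qed.

Lemma Cmod_Cexp_y (l : C) : Cmod (Cexp (Ci * l * RtoC y)) = exp (- (y * Im l)).
Proof. rewrite Cmod_Cexp, Re_Ci_mult. f_equal. ring. Qed.

Lemma h0_bound (e : R) (l : C) : e = 1 \/ e = -1 -> quadrant e l ->
  Cmod (h0 l) <= 4 * M * (1 + Cmod l) * exp (- (y * Im l)).
Proof.
  intros He Hq. pose proof (nu_neq k e l He Hq) as Hn. pose proof (Im_nu_pos k e l He Hq) as Hp.
  assert (Hl : 0 <= Im l) by (destruct Hq; lra).
  (* -(nu + l)/(nu - l) = -1 - 2l/(nu - l), so the singular coefficient multiplies only V(nu) -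
     V(l), to which [LT_lip] applies. *)
  assert (E : h0 l = (Cexp (Ci * l * RtoC y) * (- V 0 l t + 2 * l * ((V 0 (nu k l) t - V 0 l t) / (nu k l - l))))%C).
  { unfold h0. field. exact Hn. }
  rewrite E, Cmod_mult, Cmod_Cexp_y, Rmult_comm.
  apply Rmult_le_compat_r; [left; apply exp_pos|].
  assert (L1 : Cmod (V 0 l t) <= 2 * M).
  { apply LT_bound; auto; [intros; apply vs_cont_z|]. intros; apply HM; [lia|assumption]. }
  assert (L2 : Cmod (V 0 (nu k l) t - V 0 l t) <= 2 * M * Cmod (nu k l - l)).
  { apply LT_lip; auto; [intros; apply vs_cont_z| |lra]. intros; apply HM; [lia|assumption]. }
  assert (L3 : Cmod ((V 0 (nu k l) t - V 0 l t) / (nu k l - l)) <= 2 * M).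
  { rewrite Cmod_div by exact Hn. apply Cmod_gt_0 in Hn. apply Rle_div_l; lra. }
  eapply Rle_trans; [apply Cmod_triangle|]. rewrite Cmod_opp, !Cmod_mult, Cmod_RtoC_pos by lra.
  pose proof V_M_pos. pose proof (Cmod_ge_0 l).
  assert (2 * Cmod l * Cmod ((V 0 (nu k l) t - V 0 l t) / (nu k l - l)) <= 2 * Cmod l * (2 * M)) by (apply Rmult_le_compat_l; lra).
  nra.
Qed.

Lemma Cmod_N (l : C) : Cmod (- (l * l) - 2 * (RtoC k * RtoC k)) <= Cmod l * Cmod l + 2 * (k * k).
Proof.
  eapply Rle_trans; [apply Cmod_triangle_minus|]. rewrite Cmod_opp, !Cmod_mult, !Cmod_R, (Rabs_pos_eq 2) by lra.
  rewrite <- (Rabs_mult k k), (Rabs_pos_eq (k * k)) by nra. lra.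
Qed.

Lemma f0_bound_gen (l : C) (b : R) : 0 <= b ->
  (forall j, (j < 4)%nat -> Cmod (Cexp (- (symb k l * RtoC t)) * m j (symb k l)) <= b) ->
  Cmod (f0 l) <= (1 + Cmod l) * (1 + (Cmod l * Cmod l + 2 * (k * k))) * b * exp (- (y * Im l)).
Proof.
  intros Hb Hm. unfold f0. rewrite Cmod_mult, Cmod_Cexp_y, Rmult_comm. apply Rmult_le_compat_r; [left; apply exp_pos|].
  unfold B0. set (X := Cexp (- (symb k l * RtoC t))) in *.
  replace (X * (m 3 (symb k l) + Ci * l * m 2 (symb k l) + (- (l * l) - 2 * (RtoC k * RtoC k)) * (m 1 (symb k l) + Ci * l * m 0 (symb k l))))%C
    with ((X * m 3 (symb k l) + Ci * l * (X * m 2 (symb k l))) + (- (l * l) - 2 * (RtoC k * RtoC k)) * (X * m 1 (symb k l) + Ci * l * (X * m 0 (symb k l))))%C by ring.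
  pose proof (Cmod_ge_0 l) as Hl. pose proof (Cmod_N l) as HN.
  assert (P : forall i j, (i < 4)%nat -> (j < 4)%nat -> Cmod (X * m i (symb k l) + Ci * l * (X * m j (symb k l))) <= (1 + Cmod l) * b).
  { intros i j Hi Hj. eapply Rle_trans; [apply Cmod_triangle|]. rewrite (Cmod_mult (Ci * l)), (Cmod_mult Ci), Cmod_Ci, Rmult_1_l.
    pose proof (Hm i Hi). pose proof (Hm j Hj).
    assert (Cmod l * Cmod (X * m j (symb k l)) <= Cmod l * b) by (now apply Rmult_le_compat_l). lra. }
  eapply Rle_trans; [apply Cmod_triangle|].
  rewrite (Cmod_mult (- (l * l) - 2 * (RtoC k * RtoC k))).
  pose proof (P 3%nat 2%nat ltac:(lia) ltac:(lia)) as P1. pose proof (P 1%nat 0%nat ltac:(lia) ltac:(lia)) as P2.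
  assert (Q : Cmod (- (l * l) - 2 * (RtoC k * RtoC k)) * Cmod (X * m 1 (symb k l) + Ci * l * (X * m 0 (symb k l)))
     <= (Cmod l * Cmod l + 2 * (k * k)) * ((1 + Cmod l) * b)).
  { apply Rmult_le_compat; try apply Cmod_ge_0; assumption. }
  lra.
Qed.

Lemma vs0_bound (j : nat) (x : R) : (j <= 4)%nat -> Cmod (vs j 0 x) <= M.
Proof.
  intros Hj. eapply Rle_trans; [apply HM; [exact Hj|lra]|]. unfold phi. rewrite Rmult_0_l, Rplus_0_r, Rinv_1. lra.
Qed.

Lemma f0_bound (l : C) : 0 <= Im l -> 0 <= Re (symb k l) ->
  Cmod (f0 l) <= (1 + 2 * (k * k)) * (t * M) * (1 + Cmod l) ^ 3 * exp (- (y * Im l)).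
Proof.
  intros Hi Hr. pose proof V_M_pos. pose proof (Cmod_ge_0 l).
  assert (Hb : 0 <= t * M) by (apply Rmult_le_pos; lra).
  eapply Rle_trans; [apply (f0_bound_gen l (t * M) Hb)|].
  - intros j Hj. apply mT_damped_bound; auto; [lra|intros; apply vs_cont_t|]. intros x _. apply vs0_bound. lia.
  - apply Rmult_le_compat_r; [left; apply exp_pos|].
    replace ((1 + 2 * (k * k)) * (t * M) * (1 + Cmod l) ^ 3) with ((1 + Cmod l) * ((1 + 2 * (k * k)) * ((1 + Cmod l) * (1 + Cmod l))) * (t * M)) by ring.
    apply Rmult_le_compat_r; [exact Hb|]. apply Rmult_le_compat_l; [lra|]. 
    pose proof (Rle_0_sqr k) as Hk. unfold Rsqr in Hk. nra.
Qed.

(** For |l| >= 2|k| the term k^2 is at most |l|^2/4, so |k^2 + l^2| >= (3/4)|l|^2; squaring gives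
    9/16, rounded down to 1/2. *)
Lemma symb_lower (l : C) : 2 * Rabs k + 1 <= Cmod l -> Cmod l ^ 4 <= 2 * Cmod (symb k l).
Proof.
  intros Hl. pose proof (Rabs_pos k) as Hk. unfold symb. 
  replace ((RtoC k ^ 2 + l ^ 2) ^ 2)%C with ((RtoC k * RtoC k + l * l) * (RtoC k * RtoC k + l * l))%C by ring. rewrite Cmod_mult.
  assert (H : 3 / 4 * (Cmod l * Cmod l) <= Cmod (RtoC k * RtoC k + l * l)).
  { pose proof (Cmod_triangle_minus (RtoC k * RtoC k + l * l) (RtoC k * RtoC k)) as T1.
    replace (RtoC k * RtoC k + l * l - RtoC k * RtoC k)%C with (l * l)%C in T1 by ring.
    rewrite Cmod_mult in T1. rewrite (Cmod_mult (RtoC k)), Cmod_R in T1.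
    assert (4 * (Rabs k * Rabs k) <= Cmod l * Cmod l) by nra. lra. }
  pose proof (Cmod_ge_0 l). assert (0 <= Cmod l * Cmod l) by nra.
  replace (Cmod l ^ 4) with ((Cmod l * Cmod l) * (Cmod l * Cmod l)) by ring.
  set (a := Cmod l * Cmod l) in *. set (b := Cmod (RtoC k * RtoC k + l * l)) in *. 
  assert ((3 / 4 * a) * (3 / 4 * a) <= b * b) by (apply Rmult_le_compat; lra). nra.
Qed.

(** The boundary polynomial is cubic in l, while the damped t-transforms are O(1/|w|) = O(|l|^-4) by
    [mT_damped_decay]. *)
Lemma f0_decay : exists K, 0 <= K /\ forall l, 0 <= Im l -> 0 <= Re (symb k l) -> 2 * Rabs k + 1 <= Cmod l ->
  Cmod l * Cmod (f0 l) <= K * exp (- (y * Im l)).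
Proof.
  pose proof V_M_pos as HM0.
  destruct (Ccont_bounded (db 0%nat) 0 t) as (b0 & Hb0 & Hb0'); [intros; apply Hdb|].
  destruct (Ccont_bounded (db 1%nat) 0 t) as (b1 & Hb1 & Hb1'); [intros; apply Hdb|].
  destruct (Ccont_bounded (db 2%nat) 0 t) as (b2 & Hb2 & Hb2'); [intros; apply Hdb|].
  destruct (Ccont_bounded (db 3%nat) 0 t) as (b3 & Hb3 & Hb3'); [intros; apply Hdb|].
  pose (B := M + b0 + b1 + b2 + b3).
  assert (HB : forall j x, (j < 4)%nat -> 0 <= x <= t -> Cmod (db j x) <= B).
  { intros j x Hj Hx. unfold B. destruct j as [|[|[|[|j]]]]; [| | | |lia].
    - specialize (Hb0' x Hx). lra.
    - specialize (Hb1' x Hx). lra.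
    - specialize (Hb2' x Hx). lra.
    - specialize (Hb3' x Hx). lra. }
  assert (HMB : M <= B) by (unfold B; lra).
  assert (Q0 : 0 <= (2 + t) * B) by (apply Rmult_le_pos; lra).
  (* 12 is 2 from [symb_lower] times 6, since r (1 + r) (1 + r^2 + 2k^2) <= (2 r^2) (3 r^2) for r >=
     1 and 2k^2 <= r^2. *)
  exists (12 * ((2 + t) * B)). split; [lra|].
  intros l Hi Hr Hl. pose proof (Rabs_pos k) as Hk. set (r := Cmod l) in *.
  assert (Hr1 : 1 <= r) by lra.
  pose proof (symb_lower l Hl) as HS. fold r in HS.
  assert (Hr4 : 0 < r ^ 4) by (apply pow_lt; lra).
  assert (Hb : 0 <= 2 * ((2 + t) * B) / r ^ 4) by (apply Rmult_le_pos; [lra|left; now apply Rinv_0_lt_compat]).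
  assert (F : Cmod (f0 l) <= (1 + r) * (1 + (r * r + 2 * (k * k))) * (2 * ((2 + t) * B) / r ^ 4) * exp (- (y * Im l))).
  { apply (f0_bound_gen l _ Hb). intros j Hj. apply (proj1 (Rle_div_r _ _ _ Hr4)).
    assert (D : Cmod (symb k l) * Cmod (Cexp (- (symb k l * RtoC t)) * m j (symb k l)) <= (2 + t) * B).
    { apply (mT_damped_decay (fun tau => vs j 0 tau) t B ltac:(lra)) with (beta' := db j); auto.
      - intros; apply vs_cont_t.
      - intros x _. eapply Rle_trans; [apply vs0_bound; lia|exact HMB].
      - intros x Hx. apply Db; [exact Hj|lra]. }
    pose proof (Cmod_ge_0 (Cexp (- (symb k l * RtoC t)) * m j (symb k l))).
    set (q := Cmod (Cexp (- (symb k l * RtoC t)) * m j (symb k l))) in *. nra. }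
  assert (Hkk : 2 * (k * k) <= r * r).
  { assert (Rabs k * Rabs k = k * k) by (rewrite <- Rabs_mult; apply Rabs_pos_eq; nra). nra. }
  apply Rle_trans with (r * ((1 + r) * (1 + (r * r + 2 * (k * k))) * (2 * ((2 + t) * B) / r ^ 4) * exp (- (y * Im l)))).
  - apply Rmult_le_compat_l; [lra|exact F].
  - replace (r * ((1 + r) * (1 + (r * r + 2 * (k * k))) * (2 * ((2 + t) * B) / r ^ 4) * exp (- (y * Im l)))) with
      (r * (1 + r) * (1 + (r * r + 2 * (k * k))) / r ^ 4 * (2 * ((2 + t) * B)) * exp (- (y * Im l))) by (field; lra).
    apply Rmult_le_compat_r; [left; apply exp_pos|].
    replace (12 * ((2 + t) * B)) with (6 * (2 * ((2 + t) * B))) by ring.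
    apply Rmult_le_compat_r; [lra|]. apply Rle_div_l; [exact Hr4|].
    replace (6 * r ^ 4) with ((r * (2 * r)) * (3 * (r * r))) by ring.
    apply Rmult_le_compat; nra.
Qed.

(** The factor [c] stands for exp (i k x), carried along so that [F] can be the integrand of the
    formula itself. [F] is prescribed only in the open quadrants, hence not at i|k|. [I1] is the
    integral of the initial datum. *)
Theorem one_dim (c : C) (F : C -> C) (I1 : C) :
  (forall e l, e = 1 \/ e = -1 -> quadrant e l -> F l = (c * (Cexp (Ci * l * RtoC y) * (Cexp (- (symb k l * RtoC t)) * Gdata l)))%C) ->
  is_CRInt_line (fun p => Cexp (Ci * RtoC p * RtoC y) * (Cexp (- (symb k (RtoC p) * RtoC t)) * V 0 (- RtoC p) 0))%C I1 ->
  is_contour_int (bd_Domp k) F (c * (RtoC (2 * PI) * vs 0%nat y t - I1))%C.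
Proof.
  intros HF HI. destruct f0_decay as (K & HK0 & HK). pose proof V_M_pos as HM0.
  pose proof (Cmod_ge_0 c) as Hc0.
  assert (Q1 : 0 <= (1 + 2 * (k * k)) * (t * M)).
  { apply Rmult_le_pos; [nra|]. apply Rmult_le_pos; lra. }
  pose (C0 := Cmod c * ((1 + 2 * (k * k)) * (t * M) + K + 4 * M)).
  assert (HC0 : 0 <= C0) by (apply Rmult_le_pos; lra).
  apply (contour_int_eq k y C0 (2 * Rabs k + 1) F (fun l => c * f0 l)%C (fun l => c * h0 l)%C); auto.
  - apply holo_mult; [apply holo_const|exact holo_f0].
  - intros e He. apply holo_mult; [apply holo_const|now apply holo_h0].
  - intros l Hi Hr. rewrite Cmod_mult. unfold C0. rewrite !(Rmult_assoc (Cmod c)). apply Rmult_le_compat_l; [exact Hc0|].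
    rewrite <- !Rmult_assoc. eapply Rle_trans; [now apply f0_bound|].
    apply Rmult_le_compat_r; [left; apply exp_pos|]. pose proof (Cmod_ge_0 l). apply Rmult_le_compat_r; [apply pow_le; lra|]. lra.
  - intros l Hi Hr Hl. rewrite Cmod_mult. unfold C0.
    replace (Cmod l * (Cmod c * Cmod (f0 l))) with (Cmod c * (Cmod l * Cmod (f0 l))) by ring.
    rewrite (Rmult_assoc (Cmod c)). apply Rmult_le_compat_l; [exact Hc0|].
    eapply Rle_trans; [now apply HK|]. apply Rmult_le_compat_r; [left; apply exp_pos|]. lra.
  - intros e l He Hq. rewrite Cmod_mult. unfold C0. rewrite !(Rmult_assoc (Cmod c)). apply Rmult_le_compat_l; [exact Hc0|].
    rewrite <- !Rmult_assoc. eapply Rle_trans; [now apply (h0_bound e)|].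
    apply Rmult_le_compat_r; [left; apply exp_pos|]. pose proof (Cmod_ge_0 l). apply Rmult_le_compat_r; lra.
  - intros e l He Hq _. rewrite (HF e l He Hq), (G_split e l He Hq). ring.
  - assert (B1 : forall x, 0 <= x -> Cmod (vs 0%nat x t) <= M * phi x).
    { intros x Hx. eapply Rle_trans; [apply HM; [lia|exact Hx]|]. pose proof (phi_le_1 x). pose proof (phi_pos x).
      rewrite Rmult_assoc. apply Rmult_le_compat_l; [exact HM0|]. nra. }
    pose proof (halfline_inversion (fun z => vs 0%nat z t) y M _ Hy (vs_cont_z 0 t) B1 (Dz 0 y t ltac:(lia) Hy Ht)) as L1.
    set (g := fun p => (Cexp (Ci * RtoC p * RtoC y) * (Cexp (- (symb k (RtoC p) * RtoC t)) * V 0 (- RtoC p) 0))%C) in *.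
    assert (gC : forall p : R, Ccont g p).
    { intros p. unfold g. apply Ccont_mult; [|apply Ccont_mult].
      - apply Ccont_exp, Ccont_mult; [|apply Ccont_const]. apply Ccont_mult; [apply Ccont_const|]. apply Ccont_RtoC, continuous_id.
      - apply Ccont_exp, Ccont_opp, Ccont_mult; [|apply Ccont_const]. unfold symb. apply Ccont_pow, Ccont_plus; [apply Ccont_const|].
        apply Ccont_pow, Ccont_RtoC, continuous_id.
      - apply (continuous_ext (fun p => I0 (fun x => osc (- p) x * vs 0%nat x 0)%C)).
        + intros q. unfold V, LT. f_equal. apply functional_extensionality. intros z.
          unfold osc. do 2 f_equal. rewrite RtoC_mult, RtoC_opp. ring.
        + apply (I0_osc_cont _ M); [intros; apply vs_cont_z|]. intros x Hx.
          eapply Rle_trans; [apply HM; [lia|exact Hx]|]. pose proof (phi_le_1 x). pose proof (phi_pos x).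
          rewrite Rmult_assoc. apply Rmult_le_compat_l; [exact HM0|]. nra. }
    pose proof (is_line_lim g I1 gC HI) as L2.
    pose proof (lim_inf_scal c _ _ (lim_inf_minus _ _ _ _ L1 L2)) as L.
    apply (lim_inf_ext _ _ _ 0) with (2 := L). intros P HP. symmetry. apply CI_unique.
    eapply is_CI_ext; [|apply is_CI_scal, is_CI_minus; apply CI_correct, ex_CI_cont].
    + intros p _. cbv beta. rewrite f0_real. unfold g. do 3 f_equal.
      unfold V, LT. f_equal. apply functional_extensionality. intros z.
      unfold osc. do 2 f_equal. rewrite RtoC_mult, RtoC_opp. ring.
    + intros p _. apply Ccont_mult; [apply osc_cont|]. apply (I0_osc_cont (fun x => vs 0%nat x t) M); [intros; apply vs_cont_z|exact B1].
    + intros p _. apply gC.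
Qed.

End OneDim.

(** * The transform along the boundary *)

Lemma line_transform_split (u : R -> C) (M k : R) : (forall x, Ccont u x) -> (forall x, Cmod (u x) <= M * phi x) ->
  line_transform u k = (I0 (fun x => osc (- k) x * u x) + I0 (fun x => osc k x * u (- x)%R))%C.
Proof.
  intros Hc HM. pose proof (line_transform_eq u M Hc HM 0 k) as E.
  replace (osc 0 k) with (RtoC 1) in E by (unfold osc; rewrite Rmult_0_l, Cmult_0_r, Cexp_0; reflexivity).
  rewrite Cmult_1_l in E. rewrite E. f_equal; apply (f_equal I0);
    apply functional_extensionality; intros x; do 2 f_equal; ring.
Qed.

Lemma line_transform_bound (u : R -> C) (M k : R) : (forall x, Ccont u x) -> (forall x, Cmod (u x) <= M * phi x) ->
  Cmod (line_transform u k) <= 4 * M.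
Proof.
  intros Hc HM. rewrite (line_transform_split u M k Hc HM). eapply Rle_trans; [apply Cmod_triangle|].
  assert (B1 : Cmod (I0 (fun x => osc (- k) x * u x)%C) <= 2 * M).
  { apply I0_bound; [intros x; apply Ccont_mult; [apply osc_cont|apply Hc]|].
    intros x _. rewrite Cmod_mult, Cmod_osc, Rmult_1_l. auto. }
  assert (B2 : Cmod (I0 (fun x => osc k x * u (- x)%R)%C) <= 2 * M).
  { apply I0_bound.
    - intros x. apply Ccont_mult; [apply osc_cont|]. apply (Ccont_comp_R1 u); auto. apply (continuous_opp (V := R_NormedModule)), continuous_id.
    - intros x _. rewrite Cmod_mult, Cmod_osc, Rmult_1_l, <- phi_opp. auto. }
  lra.
Qed.

Lemma osc_param_cont {P : UniformSpace} (kap : P -> R) (p : P) (x : R) : continuous kap p ->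
  Ccont (fun q : P * R => osc (kap (fst q)) (snd q)) (p, x).
Proof.
  intros Hk. unfold osc. apply Ccont_exp, Ccont_mult; [apply Ccont_const|]. apply Ccont_RtoC.
  apply (continuous_mult (K := R_AbsRing)); [|apply continuous_snd].
  apply (continuous_comp (fun q : P * R => fst q) kap); [apply continuous_fst|exact Hk].
Qed.

Lemma line_transform_param_cont {P : UniformSpace} (f : P -> R -> C) (kap : P -> R) (M : R) (p : P) :
  (forall q x, Ccont2 f q x) -> continuous kap p -> (forall q x, Cmod (f q x) <= M * phi x) ->
  Ccont (fun q => line_transform (f q) (kap q)) p.
Proof.
  intros Hf Hk HM.
  assert (Hf1 : forall q x, Ccont (f q) x) by (intros; now apply Ccont2_slice).
  apply (continuous_ext (fun q => (I0 (fun x => osc (- kap q) x * f q x) + I0 (fun x => osc (kap q) x * f q (- x)%R))%C)).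
  { intros q. symmetry. apply (line_transform_split (f q) M); auto. }
  apply Ccont_plus.
  - apply (I0_param_cont (fun q x => osc (- kap q) x * f q x)%C M).
    + intros x _. apply Ccont_mult; [|apply Hf].
      apply (osc_param_cont (fun q => - kap q)). apply (continuous_opp (V := R_NormedModule)). exact Hk.
    + apply filter_forall. intros q. split; [intros x; apply Ccont_mult; [apply osc_cont|apply Hf1]|].
      intros x _. rewrite Cmod_mult, Cmod_osc, Rmult_1_l. auto.
  - apply (I0_param_cont (fun q x => osc (kap q) x * f q (- x)%R)%C M).
    + intros x _. apply Ccont_mult; [now apply osc_param_cont|].
      apply (Ccont2_comp f (fun q : P * R => fst q) (fun q : P * R => - snd q) (p, x)); [apply continuous_fst| |apply Hf].
      apply (continuous_opp (V := R_NormedModule)), continuous_snd.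
    + apply filter_forall. intros q. split.
      * intros x. apply Ccont_mult; [apply osc_cont|]. apply (Ccont_comp_R1 (f q)); auto. apply (continuous_opp (V := R_NormedModule)), continuous_id.
      * intros x _. rewrite Cmod_mult, Cmod_osc, Rmult_1_l, <- phi_opp. auto.
Qed.

Lemma line_transform_Fubini (g : R -> R -> C) (M k a b : R) : a <= b -> (forall p x, Ccont2 g p x) ->
  (forall p x, Cmod (g p x) <= M * phi x) ->
  is_CI (fun p => line_transform (g p) k) a b (line_transform (fun x => CI (fun p => g p x) a b) k).
Proof.
  intros Hab Hg HM.
  assert (Hg1 : forall q x, Ccont (g q) x) by (intros; now apply Ccont2_slice).
  assert (Hg2 : forall q x, Ccont (fun p => g p x) q).
  { intros q x. apply (Ccont2_slice (fun x p => g p x)). now apply Ccont2_swap. }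
  assert (HI : forall x, is_CI (fun p => g p x) a b (CI (fun p => g p x) a b)) by (intros; apply CI_correct, ex_CI_cont; auto).
  assert (GC : forall x, Ccont (fun x => CI (fun p => g p x) a b) x).
  { intros x. apply (CI_param_cont (fun x p => g p x)); [exact Hab|intros; now apply Ccont2_swap|].
    apply filter_forall. intros q. eexists. apply HI. }
  assert (GB : forall x, Cmod (CI (fun p => g p x) a b) <= (b - a) * M * phi x).
  { intros x. rewrite Rmult_assoc. apply (is_CI_norm_const (fun p => g p x) _ a b _ Hab); auto. }
  rewrite (line_transform_split (fun x => CI (fun p => g p x) a b) ((b - a) * M) k GC GB).
  eapply is_CI_ext; [intros p _; symmetry; apply (line_transform_split (g p) M); auto|].
  apply is_CI_plus.
  - assert (E : I0 (fun x => CI (fun p => osc (- k) x * g p x)%C a b) = I0 (fun x => osc (- k) x * CI (fun p => g p x) a b)%C).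
    { apply (f_equal I0), functional_extensionality. intros x. apply CI_unique, is_CI_scal, HI. }
    rewrite <- E. apply (I0_Fubini_fin (fun p x => osc (- k) x * g p x)%C M); auto.
    + intros p x. apply Ccont_mult; [|apply Hg]. apply (osc_param_cont (fun _ => - k)). apply continuous_const.
    + intros p x _ _. rewrite Cmod_mult, Cmod_osc, Rmult_1_l. auto.
  - assert (E : I0 (fun x => CI (fun p => osc k x * g p (- x)%R)%C a b) = I0 (fun x => osc k x * CI (fun p => g p (- x)%R) a b)%C).
    { apply (f_equal I0), functional_extensionality. intros x. apply CI_unique, is_CI_scal, HI. }
    rewrite <- E. apply (I0_Fubini_fin (fun p x => osc k x * g p (- x)%R)%C M); auto.
    + intros p x. apply Ccont_mult; [apply (osc_param_cont (fun _ => k)), continuous_const|].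
      apply (Ccont2_comp g (fun q : R * R => fst q) (fun q : R * R => - snd q) (p, x)); [apply continuous_fst| |apply Hg].
      apply (continuous_opp (V := R_NormedModule)), continuous_snd.
    + intros p x _ _. rewrite Cmod_mult, Cmod_osc, Rmult_1_l, <- phi_opp. auto.
Qed.

Lemma line_transform_lin (u w : R -> C) (M : R) (c : C) (k : R) :
  (forall x, Ccont u x) -> (forall x, Cmod (u x) <= M * phi x) ->
  (forall x, Ccont w x) -> (forall x, Cmod (w x) <= M * phi x) ->
  line_transform (fun x => u x + c * w x)%C k = (line_transform u k + c * line_transform w k)%C.
Proof.
  intros Hu BU Hw BW. unfold line_transform at 1. apply line_unique.
  eapply is_line_ext; [|apply is_line_plus; [apply (is_line_transform u M Hu BU k)|apply is_line_scal, (is_line_transform w M Hw BW k)]].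
  intros x. simpl. rewrite Cexp_osc. ring.
Qed.

(** No difference quotients: f(q) - f(c) is an integral of g in the parameter, the transform is
    exchanged with that integral, and the result is differentiated by the fundamental theorem. *)
Lemma line_transform_deriv (f g : R -> R -> C) (M k a b p : R) : a < p < b ->
  (forall p x, Ccont2 f p x) -> (forall p x, Cmod (f p x) <= M * phi x) ->
  (forall p x, Ccont2 g p x) -> (forall p x, Cmod (g p x) <= M * phi x) ->
  (forall p x, a < p < b -> Rderive (fun p => f p x) p (g p x)) ->
  Rderive (fun p => line_transform (f p) k) p (line_transform (g p) k).
Proof.
  intros Hp Hf BF Hg BG HD.
  assert (Hf1 : forall q x, Ccont (f q) x) by (intros; now apply Ccont2_slice).
  assert (Hg1 : forall q x, Ccont (g q) x) by (intros; now apply Ccont2_slice).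
  assert (Hg2 : forall q x, Ccont (fun p => g p x) q).
  { intros q x. apply (Ccont2_slice (fun x p => g p x)). now apply Ccont2_swap. }
  assert (GC : forall q, Ccont (fun q => line_transform (g q) k) q).
  { intros q. apply (line_transform_param_cont g (fun _ => k) M); auto. apply continuous_const. }
  (* A base point strictly between a and p, so that the derivative is available on all of [c, q]. *)
  pose (c := (a + p) / 2).
  assert (E : forall q, c < q < b -> (line_transform (f c) k + CI (fun q => line_transform (g q) k) c q)%C = line_transform (f q) k).
  { intros q Hq. pose proof (line_transform_Fubini g M k c q ltac:(lra) Hg BG) as HF.
    rewrite (CI_unique _ _ _ _ HF).
    assert (EI : (fun x => CI (fun p => g p x) c q) = (fun x => f q x + RtoC (-1) * f c x)%C).
    { apply functional_extensionality. intros x. apply CI_unique.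
      eapply is_CI_eq; [apply (FTC_C (fun p => f p x))|].
      - intros r Hr. rewrite Rmin_left, Rmax_right in Hr by lra. apply HD. unfold c in *. lra.
      - intros r _. apply Hg2.
      - apply C_ext; unfold Re, Im; simpl; ring. }
    rewrite EI, (line_transform_lin (f q) (f c) M) by auto.
    apply C_ext; unfold Re, Im; simpl; ring. }
  apply (is_derive_ext_loc (V := C_R_NormedModule) (fun q => line_transform (f c) k + CI (fun q => line_transform (g q) k) c q)%C).
  - apply locally_R_eps. exists (Rmin (p - c) (b - p)). unfold c in *. split; [apply Rmin_pos; lra|].
    intros q Hq. pose proof (Rmin_l (p - (a + p) / 2) (b - p)). pose proof (Rmin_r (p - (a + p) / 2) (b - p)).
    apply Rabs_def2 in Hq. apply E. lra.
  - eapply Rderive_eq; [apply Rderive_plus; [apply Rderive_const|apply Rderive_CI; exact GC]|]. cring.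
Qed.

(** The boundary terms of the two half lines at 0 are opposite, and those at infinity vanish by
    domination. *)
Lemma line_transform_by_parts (f f' : R -> C) (M k : R) :
  (forall x, Ccont f x) -> (forall x, Cmod (f x) <= M * phi x) ->
  (forall x, Ccont f' x) -> (forall x, Cmod (f' x) <= M * phi x) ->
  (forall x, Rderive f x (f' x)) -> line_transform f' k = (Ci * RtoC k * line_transform f k)%C.
Proof.
  intros Hf BF Hf' BF' HD.
  assert (OD : forall s x, Rderive (osc s) x (Ci * RtoC s * osc s x)%C).
  { intros s x. unfold osc. apply (Rderive_exp (fun x => Ci * RtoC (s * x))%C).
    eapply Rderive_eq; [apply Rderive_mult; [apply Rderive_const|apply (Rderive_RtoC (fun x => s * x) x s); auto_derive; auto; ring]|]. cring. }
  assert (Fo : forall (g : R -> C) x, (forall x, Ccont g x) -> Ccont (fun x => g (- x)) x).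
  { intros g x Hg. apply (Ccont_comp_R1 g); auto. apply (continuous_opp (V := R_NormedModule)), continuous_id. }
  assert (HI1 : forall g s, (forall x, Ccont g x) -> (forall x, Cmod (g x) <= M * phi x) -> is_I0 (fun x => osc s x * g x)%C (I0 (fun x => osc s x * g x)%C)).
  { intros g s Hg Bg. apply (is_I0_dom _ M); [intros x; apply Ccont_mult; [apply osc_cont|apply Hg]|].
    intros x _. rewrite Cmod_mult, Cmod_osc, Rmult_1_l. auto. }
  assert (Bo : forall g, (forall x, Cmod (g x) <= M * phi x) -> forall x, Cmod (g (- x)) <= M * phi x).
  { intros g Hg x. rewrite <- phi_opp. auto. }
  rewrite (line_transform_split f M k Hf BF), (line_transform_split f' M k Hf' BF').
  assert (A : is_I0 (fun x => Ci * RtoC (- k) * (osc (- k) x * f x) + osc (- k) x * f' x)%C (- (osc (- k) 0 * f 0))%C).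
  { apply (is_I0_FTC (fun x => osc (- k) x * f x)%C _ M).
    - intros b _. apply (FTC_C (fun x => osc (- k) x * f x)%C).
      + intros x _. eapply Rderive_eq; [apply Rderive_mult; [apply OD|apply HD]|]. cring.
      + intros x _. apply Ccont_plus; [apply Ccont_mult; [apply Ccont_const|]|]; (apply Ccont_mult; [apply osc_cont|auto]).
    - intros x _. rewrite Cmod_mult, Cmod_osc, Rmult_1_l. auto. }
  assert (B : is_I0 (fun x => Ci * RtoC k * (osc k x * f (- x)%R) + RtoC (-1) * (osc k x * f' (- x)%R))%C (- (osc k 0 * f (- 0)%R))%C).
  { apply (is_I0_FTC (fun x => osc k x * f (- x)%R)%C _ M).
    - intros b _. apply (FTC_C (fun x => osc k x * f (- x)%R)%C).
      + intros x _. eapply Rderive_eq; [apply Rderive_mult; [apply OD|apply (Rderive_opp_arg f), HD]|].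
        apply C_ext; unfold Re, Im; simpl; ring.
      + intros x _. apply Ccont_plus; (apply Ccont_mult; [apply Ccont_const|]; apply Ccont_mult; [apply osc_cont|apply Fo; auto]).
    - intros x _. rewrite Cmod_mult, Cmod_osc, Rmult_1_l. auto. }
  pose proof (is_I0_inj _ _ _ A (is_I0_plus _ _ _ _ (is_I0_scal (Ci * RtoC (- k))%C _ _ (HI1 f (- k) Hf BF)) (HI1 f' (- k) Hf' BF'))) as EA.
  pose proof (is_I0_inj _ _ _ B (is_I0_plus _ _ _ _ (is_I0_scal (Ci * RtoC k)%C _ _ (HI1 (fun x => f (- x)) k (fun x => Fo f x Hf) (Bo f BF)))
    (is_I0_scal (RtoC (-1)) _ _ (HI1 (fun x => f' (- x)) k (fun x => Fo f' x Hf') (Bo f' BF'))))) as EB.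
  rewrite Ropp_0 in EB.
  assert (O0 : forall s, osc s 0 = RtoC 1) by (intros s; unfold osc; rewrite Rmult_0_r, Cmult_0_r, Cexp_0; reflexivity).
  rewrite O0 in EA, EB. rewrite RtoC_opp in EA.
  set (a := I0 (fun x => osc (- k) x * f x)%C) in *. set (a' := I0 (fun x => osc (- k) x * f' x)%C) in *.
  set (b := I0 (fun x => osc k x * f (- x)%R)%C) in *. set (b' := I0 (fun x => osc k x * f' (- x)%R)%C) in *.
  assert (E : (a' + b')%C = (Ci * RtoC k * (a + b) + (Ci * - RtoC k * a + a') - (Ci * RtoC k * b + RtoC (-1) * b'))%C).
  { apply C_ext; unfold Re, Im; simpl; ring. }
  rewrite E, <- EA, <- EB. ring.
Qed.

(** * Partial derivatives on the closed domain *)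

Section Partials.
Variables (T : R) (N : nat) (u : R -> R -> R -> C).
Hypotheses (HT : 0 < T) (HC : class_C T N u).

Lemma partial_spec (w : list dir) (d : dir) (x y t : R) : (length w < N)%nat -> closed_dom T (x, y, t) ->
  is_partial T d (partials T w u) x y t (partials T (d :: w) u x y t).
Proof.
  intros Hw Hd. destruct (proj1 HC w d Hw x y t Hd) as [l Hl]. pose proof Hd as [Hy Ht].
  assert (E : partials T (d :: w) u x y t = l).
  { change (partial T d (partials T w u) x y t = l). destruct d; apply derive_on_eq; try exact Hl; auto.
    - intros e He. exists (x + e / 2). split; [exact I|]. split; [lra|]. apply Rabs_def1; lra.
    - intros e He. exists (y + e / 2). split; [lra|]. split; [lra|]. apply Rabs_def1; lra.
    (* At t = T the nearby points of the time interval are found to the left. *)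
    - intros e He. destruct (Rlt_le_dec t T) as [H|H].
      + exists (t + Rmin (e / 2) (T - t)). pose proof (Rmin_l (e / 2) (T - t)). pose proof (Rmin_r (e / 2) (T - t)).
        assert (0 < Rmin (e / 2) (T - t)) by (apply Rmin_pos; lra). split; [lra|]. split; [lra|]. apply Rabs_def1; lra.
      + exists (t - Rmin (e / 2) t). pose proof (Rmin_l (e / 2) t). pose proof (Rmin_r (e / 2) t).
        assert (0 < Rmin (e / 2) t) by (apply Rmin_pos; lra). split; [lra|]. split; [lra|]. apply Rabs_def1; lra. }
  rewrite E. exact Hl.
Qed.

(* Freezing [y] and [t] at the ends of their ranges makes the derivatives continuous on the whole space, so that
   no one-sided continuity has to be carried along. *)
Definition cu (w : list dir) (x y t : R) : C := partials T w u x (Rmax 0 y) (clamp 0 T t).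

Lemma cu_dom (x y t : R) : closed_dom T (x, Rmax 0 y, clamp 0 T t).
Proof. split; [apply Rmax_l|apply clamp_in; lra]. Qed.

Lemma cu_eq (w : list dir) (x y t : R) : 0 <= y -> 0 <= t <= T -> cu w x y t = partials T w u x y t.
Proof. intros Hy Ht. unfold cu. rewrite Rmax_right, clamp_id by lra. reflexivity. Qed.

Lemma Rmax0_cont (y : R) : continuous (Rmax 0) y.
Proof.
  apply continuous_R_lip. intros z. unfold Rmax, Rabs. repeat destruct Rle_dec; repeat destruct Rcase_abs; lra.
Qed.

Lemma cu_cont {P : UniformSpace} (w : list dir) (a b c : P -> R) (p : P) : (length w <= N)%nat ->
  continuous a p -> continuous b p -> continuous c p -> Ccont (fun q => cu w (a q) (b q) (c q)) p.
Proof.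
  intros Hw Ha Hb Hc. pose proof (proj2 HC w Hw (a p, Rmax 0 (b p), clamp 0 T (c p)) (cu_dom _ _ _)) as H.
  unfold cu. 
  apply (filterlim_comp P (R * R * R) C (fun q => (a q, Rmax 0 (b q), clamp 0 T (c q)))
    (fun p : R * R * R => let '(x, y, t) := p in partials T w u x y t) (locally p)
    (within (closed_dom T) (locally (a p, Rmax 0 (b p), clamp 0 T (c p))))); [|exact H].
  intros Q HQ. unfold within in HQ.
  assert (K : continuous (fun q => (a q, Rmax 0 (b q), clamp 0 T (c q))) p).
  { apply (continuous_comp_2 (fun q => (a q, Rmax 0 (b q))) (fun q => clamp 0 T (c q)) (fun v w => (v, w))).
    - apply (continuous_comp_2 a (fun q => Rmax 0 (b q)) (fun v w => (v, w))); [exact Ha| |].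
      + apply (continuous_comp b (Rmax 0)); [exact Hb|apply Rmax0_cont].
      + apply (continuous_ext (fun x => x)); [now intros []|apply continuous_id].
    - apply (continuous_comp c (clamp 0 T)); [exact Hc|apply clamp_cont].
    - apply (continuous_ext (fun x => x)); [now intros []|apply continuous_id]. }
  specialize (K _ HQ). unfold filtermap in *. revert K. apply filter_imp. intros q Hq. apply Hq. apply cu_dom.
Qed.

Lemma cu_dx (w : list dir) (x y t : R) : (length w < N)%nat -> Rderive (fun x => cu w x y t) x (cu (dx :: w) x y t).
Proof.
  intros Hw. pose proof (partial_spec w dx x _ _ Hw (cu_dom x y t)) as H. simpl in H.
  pose proof (proj1 (is_derive_on_eps (fun _ => True) _ _ _ I) H) as K0. apply Rderive_eps. intros eps He.
  destruct (K0 eps He) as (d & Hd & K). exists d. split; [exact Hd|]. intros z Hz. now apply K.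
Qed.

Lemma cu_dy (w : list dir) (x y t : R) : (length w < N)%nat -> 0 < y -> Rderive (fun y => cu w x y t) y (cu (dy :: w) x y t).
Proof.
  intros Hw Hy. pose proof (partial_spec w dy x _ _ Hw (cu_dom x y t)) as H. simpl in H.
  pose proof (proj1 (is_derive_on_eps (fun s => 0 <= s) _ _ _ (Rmax_l 0 y)) H) as K0. apply Rderive_eps. intros eps He.
  destruct (K0 eps He) as (d & Hd & K). rewrite (Rmax_right 0 y) in K by lra.
  exists (Rmin d y). split; [now apply Rmin_pos|]. intros z Hz.
  pose proof (Rmin_l d y). pose proof (Rmin_r d y). pose proof (Rabs_def2 _ _ Hz).
  unfold cu. rewrite (Rmax_right 0 z), (Rmax_right 0 y) by lra. apply K; lra.
Qed.

Lemma cu_dt (w : list dir) (x y t : R) : (length w < N)%nat -> 0 < t < T -> Rderive (fun t => cu w x y t) t (cu (dt :: w) x y t).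
Proof.
  intros Hw Ht. pose proof (partial_spec w dt x _ _ Hw (cu_dom x y t)) as H. simpl in H.
  pose proof (proj1 (is_derive_on_eps (fun s => 0 <= s <= T) _ _ _ (clamp_in 0 T t (Rlt_le _ _ HT))) H) as K0. apply Rderive_eps. intros eps He.
  destruct (K0 eps He) as (d & Hd & K). rewrite (clamp_id 0 T t) in K by lra.
  exists (Rmin d (Rmin t (T - t))). split; [repeat apply Rmin_pos; lra|]. intros z Hz.
  pose proof (Rmin_l d (Rmin t (T - t))). pose proof (Rmin_r d (Rmin t (T - t))).
  pose proof (Rmin_l t (T - t)). pose proof (Rmin_r t (T - t)). pose proof (Rabs_def2 _ _ Hz).
  unfold cu. rewrite (clamp_id 0 T z), (clamp_id 0 T t) by lra. apply K; lra.
Qed.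

End Partials.

(** (1 + x^2) (1 + y^2)^2 <= (1 + |x| + y)^6; this is where the requirement of order 6 comes
    from. *)
Lemma cu_bound (T : R) (N : nat) (u : R -> R -> R -> C) : 0 < T -> (6 <= N)%nat -> decays T N u -> exists M, 0 <= M /\
  forall w x y t, (length w <= N)%nat -> 0 <= y -> Cmod (cu T u w x y t) <= M * phi x * phi y * phi y.
Proof.
  intros HT HN [M HM]. exists (Rabs M). split; [apply Rabs_pos|]. intros w x y t Hw Hy.
  eapply Rle_trans; [apply (HM w Hw); apply (cu_dom T HT x y t)|].
  rewrite (Rmax_right 0 y) by lra. rewrite (Rabs_pos_eq y Hy).
  pose proof (Rabs_pos x) as Hx. set (s := 1 + Rabs x + y).
  assert (Hs1 : 1 <= s) by (unfold s; lra).
  assert (Hxx : Rabs x * Rabs x = x * x) by (rewrite <- Rabs_mult; apply Rabs_pos_eq; nra).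
  assert (P1 : 0 < 1 + x * x) by nra. assert (P2 : 0 < 1 + y * y) by nra.
  assert (A1 : 1 + x * x <= s * s) by (unfold s; nra).
  assert (A2 : 1 + y * y <= s * s) by (unfold s; nra).
  assert (A : (1 + x * x) * (1 + y * y) * (1 + y * y) <= s ^ N).
  { apply Rle_trans with (s ^ 6); [|apply Rle_pow; auto].
    replace (s ^ 6) with ((s * s) * (s * s) * (s * s)) by ring.
    apply Rmult_le_compat; [apply Rmult_le_pos; lra|lra| |exact A2]. apply Rmult_le_compat; lra. }
  assert (Hp : 0 < (1 + x * x) * (1 + y * y) * (1 + y * y)) by (repeat apply Rmult_lt_0_compat; lra).
  replace (Rabs M * phi x * phi y * phi y) with (Rabs M * / ((1 + x * x) * (1 + y * y) * (1 + y * y))) by (unfold phi; field; lra).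
  apply Rle_trans with (Rabs M * / s ^ N).
  - apply Rmult_le_compat_r; [left; apply Rinv_0_lt_compat, pow_lt; lra|apply Rle_abs].
  - apply Rmult_le_compat_l; [apply Rabs_pos|]. apply Rinv_le_contravar; assumption.
Qed.

(** * Reduction to the half line *)

(** [hat] integrates in y first, the reduction to the half line in x first. The exchange is made on
    each quarter plane separately; [e] stands for exp (i l y). *)
Lemma line_half_Fubini (f : R -> R -> C) (e : R -> C) (M k : R) :
  (forall x y, Ccont2 f x y) -> (forall x y, 0 <= y -> Cmod (f x y) <= M * phi x * phi y) ->
  (forall y, Ccont e y) -> (forall y, 0 <= y -> Cmod (e y) <= 1) ->
  is_CRInt_line (fun x => I0 (fun y => osc (- k) x * (e y * f x y))%C)
    (I0 (fun y => e y * line_transform (fun x => f x y) k)%C).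
Proof.
  intros Hf HM He H1.
  assert (Hf1 : forall x y, Ccont (fun x => f x y) x).
  { intros x y. apply (Ccont2_slice (fun y x => f x y)). now apply Ccont2_swap. }
  (* The map r is the identity for x > 0 and the reflection for x < 0. *)
  assert (Half : forall s (r : R -> R), (forall x, continuous r x) -> (forall x, phi (r x) = phi x) ->
    exists v, is_I0 (fun x => I0 (fun y => osc s x * (e y * f (r x) y))%C) v /\
      is_I0 (fun y => e y * I0 (fun x => osc s x * f (r x) y))%C v).
  { intros s r Hr Hp.
    assert (FC : forall x y : R, Ccont (fun q : R * R => osc s (fst q) * (e (snd q) * f (r (fst q)) (snd q)))%C (x, y)).
    { intros x y. apply Ccont_mult; [|apply Ccont_mult].
      - apply (Ccont_comp_R (fun q : R * R => fst q)); [apply continuous_fst|apply osc_cont].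
      - apply (Ccont_comp_R (fun q : R * R => snd q)); [apply continuous_snd|apply He].
      - apply (Ccont2_comp f (fun q : R * R => r (fst q)) (fun q : R * R => snd q) (x, y)); [|apply continuous_snd|apply Hf].
        apply (continuous_comp (fun q : R * R => fst q) r); [apply continuous_fst|apply Hr]. }
    assert (FB : forall x y, 0 <= y -> Cmod (osc s x * (e y * f (r x) y)) <= M * phi x * phi y).
    { intros x y Hy. rewrite !Cmod_mult, Cmod_osc, Rmult_1_l, <- (Hp x), <- (Rmult_1_l (M * _ * _)).
      apply Rmult_le_compat; auto using Cmod_ge_0. }
    pose proof (I0_Fubini (fun x y => osc s x * (e y * f (r x) y))%C M FC (fun x y _ => FB x y)) as A.
    assert (B : is_I0 (fun y => I0 (fun x => osc s x * (e y * f (r x) y))%C) (I0 (fun x => I0 (fun y => osc s x * (e y * f (r x) y))%C))).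
    { apply (I0_Fubini (fun y x => osc s x * (e y * f (r x) y))%C M).
      - intros y x. apply (Ccont2_swap (fun x y => osc s x * (e y * f (r x) y))%C). apply FC.
      - intros y x Hy _. rewrite (Rmult_assoc M), (Rmult_comm (phi y)), <- Rmult_assoc. auto. }
    eexists. split; [exact A|]. rewrite <- (I0_unique _ _ B) in B. eapply is_I0_ext; [|exact B].
    intros y Hy. apply I0_unique.
    apply (is_I0_ext (fun x => e y * (osc s x * f (r x) y))%C); [intros; ring|].
    apply is_I0_scal. apply (is_I0_dom _ (M * phi y)).
    - intros x. apply Ccont_mult; [apply osc_cont|]. apply (Ccont_comp_R1 (fun x => f x y)); auto.
    - intros x _. rewrite Cmod_mult, Cmod_osc, Rmult_1_l, Rmult_assoc, (Rmult_comm (phi y)), <- Rmult_assoc, <- (Hp x).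
      apply HM. lra. }
  destruct (Half (- k) (fun x => x)) as (v & V1 & V2); [intros; apply continuous_id|reflexivity|].
  destruct (Half k Ropp) as (w & W1 & W2); [intros; apply (continuous_opp (V := R_NormedModule)), continuous_id|apply phi_opp|].
  assert (E : I0 (fun y => e y * line_transform (fun x => f x y) k)%C = (v + w)%C).
  { apply I0_unique. eapply is_I0_ext; [|apply is_I0_plus; [exact V2|exact W2]].
    intros y Hy. cbv beta. rewrite (line_transform_split (fun x => f x y) (M * phi y)); [ring|auto|].
    intros x. rewrite Rmult_assoc, (Rmult_comm (phi y)), <- Rmult_assoc. apply HM. lra. }
  rewrite E. apply is_line_I0; [exact V1|]. eapply is_I0_ext; [|exact W1].
  intros x _. cbv beta. apply (f_equal I0), functional_extensionality. intros y.
  now rewrite osc_opp, Ropp_involutive.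
Qed.

Section Reduction.
Variables (T M : R) (u : R -> R -> R -> C).
Hypotheses (HT : 0 < T) (HC : class_C T 6 u)
  (HM : forall w x y t, (length w <= 6)%nat -> 0 <= y -> Cmod (cu T u w x y t) <= M * phi x * phi y * phi y).

Lemma bound_nonneg : 0 <= M.
Proof.
  pose proof (HM [] 0 0 0 ltac:(simpl; lia) (Rle_refl 0)) as H. pose proof (Cmod_ge_0 (cu T u [] 0 0 0)).
  unfold phi in H. rewrite !Rmult_0_l, !Rplus_0_r, Rinv_1, !Rmult_1_r in H. lra.
Qed.

Lemma cu_bound_x (w : list dir) (x y t : R) : (length w <= 6)%nat -> Cmod (cu T u w x y t) <= M * phi x.
Proof.
  intros Hw. pose proof (HM w x (Rmax 0 y) t Hw (Rmax_l 0 y)) as H.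
  assert (E : cu T u w x (Rmax 0 y) t = cu T u w x y t).
  { unfold cu. rewrite (Rmax_right 0 (Rmax 0 y)); [reflexivity|apply Rmax_l]. }
  rewrite E in H. eapply Rle_trans; [exact H|]. pose proof bound_nonneg as M0. pose proof (phi_pos x). 
  pose proof (phi_pos (Rmax 0 y)). pose proof (phi_le_1 (Rmax 0 y)).
  assert (0 <= M * phi x) by nra. set (p := phi (Rmax 0 y)) in *.
  assert (p * p <= 1) by nra. rewrite Rmult_assoc. nra.
Qed.

Lemma cu_cont_x (w : list dir) (y t x : R) : (length w <= 6)%nat -> Ccont (fun x => cu T u w x y t) x.
Proof.
  intros Hw. apply (cu_cont T 6 u HT HC (P := R_UniformSpace) w (fun x => x) (fun _ => y) (fun _ => t)); auto;
    [apply continuous_id|apply continuous_const..].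
Qed.

Definition xtrans (w : list dir) (k y t : R) : C := line_transform (fun x => cu T u w x y t) k.

Lemma xtrans_bound (w : list dir) (k y t : R) : (length w <= 6)%nat -> 0 <= y -> Cmod (xtrans w k y t) <= 4 * M * phi y * phi y.
Proof.
  intros Hw Hy. replace (4 * M * phi y * phi y) with (4 * (M * phi y * phi y)) by ring.
  apply line_transform_bound; [intros; now apply cu_cont_x|].
  intros x. replace (M * phi y * phi y * phi x) with (M * phi x * phi y * phi y) by ring. auto.
Qed.

Lemma xtrans_cont {P : UniformSpace} (w : list dir) (a b c : P -> R) (p : P) : (length w <= 6)%nat ->
  (forall q, continuous a q) -> (forall q, continuous b q) -> (forall q, continuous c q) ->
  Ccont (fun q => xtrans w (a q) (b q) (c q)) p.
Proof.
  intros Hw Ha Hb Hc. apply (line_transform_param_cont (fun q x => cu T u w x (b q) (c q)) a M); auto.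
  - intros q x. apply (cu_cont T 6 u HT HC (P := prod_UniformSpace P R_UniformSpace) w (fun r => snd r) (fun r => b (fst r)) (fun r => c (fst r))); auto.
    + apply continuous_snd.
    + apply (continuous_comp (fun r : P * R => fst r) b); [apply continuous_fst|auto].
    + apply (continuous_comp (fun r : P * R => fst r) c); [apply continuous_fst|auto].
  - intros q x. now apply cu_bound_x.
Qed.

Lemma xtrans_cont_yt (w : list dir) (k y t : R) : (length w <= 6)%nat -> Ccont2 (xtrans w k) y t.
Proof.
  intros Hw. apply (xtrans_cont w (fun _ : R * R => k) (fun q => fst q) (fun q => snd q)); auto; intros q;
    [apply continuous_const|apply continuous_fst|apply continuous_snd].
Qed.

Lemma xtrans_dx (w : list dir) (k y t : R) : (length w < 6)%nat -> xtrans (dx :: w) k y t = (Ci * RtoC k * xtrans w k y t)%C.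
Proof.
  intros Hw. unfold xtrans. apply (line_transform_by_parts _ _ M).
  - intros; apply cu_cont_x; lia.
  - intros; apply cu_bound_x; lia.
  - intros; apply cu_cont_x; simpl; lia.
  - intros; apply cu_bound_x; simpl; lia.
  - intros x. now apply (cu_dx T 6 u HT HC).
Qed.

Lemma xtrans_dy (w : list dir) (k y t : R) : (length w < 6)%nat -> 0 < y ->
  Rderive (fun y => xtrans w k y t) y (xtrans (dy :: w) k y t).
Proof.
  intros Hw Hy.
  assert (K : forall v, (length v <= 6)%nat -> forall p x, Ccont2 (fun y x => cu T u v x y t) p x).
  { intros v Hv p x. apply (cu_cont T 6 u HT HC (P := prod_UniformSpace R_UniformSpace R_UniformSpace) v (fun r => snd r) (fun r => fst r) (fun _ => t)); auto;
      [apply continuous_snd|apply continuous_fst|apply continuous_const]. }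
  apply (line_transform_deriv (fun y x => cu T u w x y t) (fun y x => cu T u (dy :: w) x y t) M k 0 (y + 1) y).
  - lra.
  - apply K. lia.
  - intros; apply cu_bound_x; lia.
  - apply K. simpl. lia.
  - intros; apply cu_bound_x; simpl; lia.
  - intros p x Hp. apply (cu_dy T 6 u HT HC); auto; lra.
Qed.

Lemma xtrans_dt (w : list dir) (k y t : R) : (length w < 6)%nat -> 0 < t < T ->
  Rderive (fun t => xtrans w k y t) t (xtrans (dt :: w) k y t).
Proof.
  intros Hw Ht.
  assert (K : forall v, (length v <= 6)%nat -> forall p x, Ccont2 (fun t x => cu T u v x y t) p x).
  { intros v Hv p x. apply (cu_cont T 6 u HT HC (P := prod_UniformSpace R_UniformSpace R_UniformSpace) v (fun r => snd r) (fun _ => y) (fun r => fst r)); auto;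
      [apply continuous_snd|apply continuous_const|apply continuous_fst]. }
  apply (line_transform_deriv (fun t x => cu T u w x y t) (fun t x => cu T u (dt :: w) x y t) M k 0 T t).
  - lra.
  - apply K. lia.
  - intros; apply cu_bound_x; lia.
  - apply K. simpl. lia.
  - intros; apply cu_bound_x; simpl; lia.
  - intros p x Hp. apply (cu_dt T 6 u HT HC); auto; lra.
Qed.

(** The equation is transformed term by term: nested uses of the two-term linearity, whose majorants
    M, 3M and 4M add up the coefficients, after which each x-derivative becomes a factor i k. *)
Lemma xtrans_pde (k y t : R) : 0 < y -> 0 < t < T ->
  (forall x, (partials T [dt] u x y t + (partials T [dx; dx; dx; dx] u x y t
    + 2 * partials T [dx; dx; dy; dy] u x y t + partials T [dy; dy; dy; dy] u x y t))%C = RtoC 0) ->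
  xtrans [dt] k y t = (- (RtoC k ^ 4 * xtrans [] k y t - RtoC 2 * RtoC k ^ 2 * xtrans [dy; dy] k y t + xtrans [dy; dy; dy; dy] k y t))%C.
Proof.
  intros Hy Ht PDE. pose proof bound_nonneg as M0.
  assert (KC : forall w, (length w <= 6)%nat -> forall x, Ccont (fun x => cu T u w x y t) x) by (intros; now apply cu_cont_x).
  assert (KB : forall w n, (length w <= 6)%nat -> 1 <= n -> forall x, Cmod (cu T u w x y t) <= n * M * phi x).
  { intros w n Hw Hn x. eapply Rle_trans; [now apply cu_bound_x|]. pose proof (phi_pos x).
    assert (0 <= M * phi x) by nra. nra. }
  pose (f1 := fun x => cu T u [dt] x y t). pose (f2 := fun x => cu T u [dx; dx; dx; dx] x y t).
  pose (f3 := fun x => cu T u [dx; dx; dy; dy] x y t). pose (f4 := fun x => cu T u [dy; dy; dy; dy] x y t).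
  assert (C1 : forall x, Ccont f1 x) by (apply KC; simpl; lia). assert (C2 : forall x, Ccont f2 x) by (apply KC; simpl; lia).
  assert (C3 : forall x, Ccont f3 x) by (apply KC; simpl; lia). assert (C4 : forall x, Ccont f4 x) by (apply KC; simpl; lia).
  assert (B1 : forall n, 1 <= n -> forall x, Cmod (f1 x) <= n * M * phi x) by (intros; apply KB; simpl; auto; lia).
  assert (B2 : forall n, 1 <= n -> forall x, Cmod (f2 x) <= n * M * phi x) by (intros; apply KB; simpl; auto; lia).
  assert (B3 : forall n, 1 <= n -> forall x, Cmod (f3 x) <= n * M * phi x) by (intros; apply KB; simpl; auto; lia).
  assert (B4 : forall n, 1 <= n -> forall x, Cmod (f4 x) <= n * M * phi x) by (intros; apply KB; simpl; auto; lia).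
  assert (E0 : line_transform (fun x => f1 x + RtoC 1 * (f2 x + RtoC 1 * (f4 x + RtoC 2 * f3 x)))%C k = RtoC 0).
  { unfold line_transform. apply line_unique.
    apply (is_line_ext (fun _ => RtoC 0)).
    - intros x. specialize (PDE x). rewrite <- !(cu_eq T u) in PDE by lra. fold (f1 x) (f2 x) (f3 x) (f4 x) in PDE.
      replace (f1 x + RtoC 1 * (f2 x + RtoC 1 * (f4 x + RtoC 2 * f3 x)))%C with (f1 x + (f2 x + 2 * f3 x + f4 x))%C by ring.
      rewrite PDE. ring.
    - apply is_line_eps. intros eps He. exists 0. intros a b Ha Hb. exists (RtoC 0). split.
      + eapply is_CI_eq; [apply is_CI_const|]. cring.
      + replace (RtoC 0 - RtoC 0)%C with (RtoC 0) by ring. rewrite Cmod_0. exact He. }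
  assert (D43 : forall x, Cmod (f4 x + RtoC 2 * f3 x) <= 3 * M * phi x).
  { intros x. eapply Rle_trans; [apply Cmod_triangle|]. rewrite Cmod_mult, Cmod_RtoC_pos by lra.
    pose proof (B4 1 (Rle_refl 1) x). pose proof (B3 1 (Rle_refl 1) x). lra. }
  assert (D432 : forall x, Cmod (f2 x + RtoC 1 * (f4 x + RtoC 2 * f3 x)) <= 4 * M * phi x).
  { intros x. eapply Rle_trans; [apply Cmod_triangle|]. rewrite Cmod_mult, Cmod_RtoC_pos by lra.
    pose proof (B2 1 (Rle_refl 1) x). pose proof (D43 x). lra. }
  assert (C43 : forall x, Ccont (fun x => f4 x + RtoC 2 * f3 x)%C x).
  { intros x. apply Ccont_plus; [apply C4|]. apply Ccont_mult; [apply Ccont_const|apply C3]. }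
  assert (C432 : forall x, Ccont (fun x => f2 x + RtoC 1 * (f4 x + RtoC 2 * f3 x))%C x).
  { intros x. apply Ccont_plus; [apply C2|]. apply Ccont_mult; [apply Ccont_const|apply C43]. }
  rewrite (line_transform_lin f1 (fun x => f2 x + RtoC 1 * (f4 x + RtoC 2 * f3 x))%C (4 * M)) in E0; [|exact C1|apply B1; lra|exact C432|exact D432].
  rewrite (line_transform_lin f2 (fun x => f4 x + RtoC 2 * f3 x)%C (3 * M)) in E0; [|exact C2|apply B2; lra|exact C43|exact D43].
  rewrite (line_transform_lin f4 f3 (1 * M)) in E0; [|exact C4|apply B4; lra|exact C3|apply B3; lra].
  change (xtrans [dt] k y t + RtoC 1 * (xtrans [dx; dx; dx; dx] k y t + RtoC 1 * (xtrans [dy; dy; dy; dy] k y t + RtoC 2 * xtrans [dx; dx; dy; dy] k y t)) = RtoC 0)%C in E0.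
  rewrite !xtrans_dx in E0 by (simpl; lia).
  set (a := xtrans [dt] k y t) in *. set (b := xtrans [] k y t) in *.
  set (c := xtrans [dy; dy] k y t) in *. set (d := xtrans [dy; dy; dy; dy] k y t) in *.
  match type of E0 with ?l = _ => replace a with (l - (RtoC k ^ 4 * b - RtoC 2 * RtoC k ^ 2 * c + d))%C end.
  - rewrite E0. ring.
  - apply C_ext; unfold Re, Im; simpl; ring.
Qed.

(** Stated at -l because [hat] is defined in the closed lower half plane and [LT] in the upper
    one. *)
Lemma hat_eq (u0 : R -> R -> C) (k : R) (l : C) : (forall x y, 0 < y -> u x y 0 = u0 x y) -> 0 <= Im l ->
  hat u0 k (- l) = LT (fun z => xtrans [] k z 0) l.
Proof.
  intros H0 Hl. unfold hat. apply line_unique.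
  assert (EC : forall y : R, Ccont (fun y : R => Cexp (Ci * l * RtoC y)) y).
  { intros y. apply Ccont_exp, Ccont_mult; [apply Ccont_const|]. apply Ccont_RtoC, continuous_id. }
  assert (EB : forall y, 0 <= y -> Cmod (Cexp (Ci * l * RtoC y)) <= 1).
  { intros y Hy. rewrite Cmod_Cexp, <- exp_0. apply exp_le_exp. destruct l as [a b]. unfold Re, Im in *. simpl in *. nra. }
  pose proof (line_half_Fubini (fun x y => cu T u [] x y 0) (fun y => Cexp (Ci * l * RtoC y)) M k) as H.
  eapply is_line_ext; [|apply H; auto].
  - intros x. cbv beta. apply (I0_ext _ _ M).
    + intros y. apply Ccont_mult; [apply Ccont_const|]. apply Ccont_mult; [apply EC|].
      apply (cu_cont T 6 u HT HC (P := R_UniformSpace) [] (fun _ => x) (fun y => y) (fun _ => 0)); simpl; try lia;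
        [apply continuous_const|apply continuous_id|apply continuous_const].
    + intros y Hy. rewrite !Cmod_mult, Cmod_osc, Rmult_1_l, <- (Rmult_1_l (M * phi y)).
      apply Rmult_le_compat; auto using Cmod_ge_0.
      eapply Rle_trans; [apply HM; simpl; try lia; auto|].
      pose proof (phi_pos x). pose proof (phi_le_1 x). pose proof (phi_pos y). pose proof (phi_le_1 y). pose proof bound_nonneg.
      assert (phi x * phi y <= 1) by nra.
      replace (M * phi x * phi y * phi y) with (M * phi y * (phi x * phi y)) by ring.
      assert (0 <= M * phi y) by nra. nra.
    + intros y Hy. rewrite (cu_eq T u) by lra. change (partials T [] u x y 0) with (u x y 0). rewrite H0 by exact Hy.
      rewrite <- Cexp_osc, Cmult_assoc, <- Cexp_plus. do 2 f_equal. ring.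
  - intros x y. apply (cu_cont T 6 u HT HC (P := prod_UniformSpace R_UniformSpace R_UniformSpace) [] (fun q => fst q) (fun q => snd q) (fun _ => 0)); simpl; try lia;
        [apply continuous_fst|apply continuous_snd|apply continuous_const].
  - intros x y Hy. eapply Rle_trans; [apply HM; simpl; try lia; auto|].
    pose proof (phi_pos x). pose proof (phi_pos y). pose proof (phi_le_1 y). pose proof bound_nonneg.
    assert (0 <= M * phi x) by nra. assert (0 <= M * phi x * phi y) by nra. nra.
Qed.

(** The boundary data are known only for 0 < tau < T, which suffices since the end points do not
    affect the integral. *)
Lemma ttilde_eq (g : R -> R -> C) (w : list dir) (k t : R) (eta : C) : 0 < t < T ->
  (forall x tau, 0 < tau < T -> partials T w u x 0 tau = g x tau) ->
  ttilde g k eta t = mT (fun tau => xtrans w k 0 tau) t eta.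
Proof.
  intros Ht Hg. unfold ttilde, mT. symmetry. apply CI_ext. intros tau Htau.
  rewrite Rmin_left, Rmax_right in Htau by lra. f_equal. unfold xtrans, line_transform. f_equal.
  apply functional_extensionality. intros x. rewrite (cu_eq T u), Hg by lra. reflexivity.
Qed.

Lemma xtrans_one_dim (y t k : R) (c : C) (F : C -> C) (I1 : C) : 0 < y -> 0 < t < T ->
  (forall x y t : R, 0 < y -> 0 < t < T -> (partials T [dt] u x y t + (partials T [dx; dx; dx; dx] u x y t
    + 2 * partials T [dx; dx; dy; dy] u x y t + partials T [dy; dy; dy; dy] u x y t))%C = RtoC 0) ->
  (forall e l, e = 1 \/ e = -1 -> quadrant e l ->
    F l = (c * (Cexp (Ci * l * RtoC y) * (Cexp (- (symb k l * RtoC t)) * Gdata k t (fun j => xtrans (repeat dy (Nat.min j 4)) k) l)))%C) ->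
  is_CRInt_line (fun p => Cexp (Ci * RtoC p * RtoC y) * (Cexp (- (symb k (RtoC p) * RtoC t)) * LT (fun z => xtrans [] k z 0) (- RtoC p)))%C I1 ->
  is_contour_int (bd_Domp k) F (c * (RtoC (2 * PI) * xtrans [] k y t - I1))%C.
Proof.
  intros Hy Ht PDE HF HI.
  assert (Len : forall j, (length (repeat dy (Nat.min j 4)) <= 4)%nat) by (intros; rewrite repeat_length; lia).
  assert (Step : forall j, (j < 4)%nat -> repeat dy (Nat.min (S j) 4) = dy :: repeat dy (Nat.min j 4)).
  { intros j Hj. rewrite !Nat.min_l by lia. reflexivity. }
  (* The family must be continuous for every index j, but only finitely many derivatives exist; the
     index is therefore capped at 4, which leaves the first four steps of differentiation intact.
     The 4 in 4M is that of [xtrans_bound]. *)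
  apply (one_dim k T y t (4 * M) (fun j => xtrans (repeat dy (Nat.min j 4)) k) (xtrans [dt] k)
    (fun j tau => xtrans (dt :: repeat dy (Nat.min j 4)) k 0 tau)); auto.
  - intros j z tau. apply xtrans_cont_yt. specialize (Len j). lia.
  - intros z tau. apply xtrans_cont_yt. simpl. lia.
  - intros j z tau _ Hz. apply xtrans_bound; [specialize (Len j); lia|exact Hz].
  - intros z tau Hz. apply xtrans_bound; [simpl; lia|exact Hz].
  - intros j z tau Hj Hz _. rewrite (Step j Hj). apply xtrans_dy; [specialize (Len j); lia|exact Hz].
  - intros z tau _ Htau. apply (xtrans_dt []); [simpl; lia|exact Htau].
  - intros j tau Hj Htau. apply xtrans_dt; [specialize (Len j); lia|exact Htau].
  - intros j tau. apply (xtrans_cont (dt :: repeat dy (Nat.min j 4)) (fun _ => k) (fun _ => 0) (fun q : R => q)).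
    + specialize (Len j). simpl. lia.
    + intros; apply continuous_const.
    + intros; apply continuous_const.
    + intros; apply continuous_id.
  - intros z tau Hz Htau. simpl Nat.min. apply (xtrans_pde k z tau Hz Htau). auto.
Qed.

End Reduction.

(** * The initial integral and the outer inversion *)

Lemma exp_neg_symb_phi (t k p : R) : 0 < t ->
  exp (- ((k * k + p * p) * (k * k + p * p) * t)) <= 2 * (1 + / t) * phi k * phi p.
Proof.
  intros Ht. set (r := k * k + p * p). set (s := r * r * t).
  assert (Hs : 0 <= s) by (unfold s; nra).
  assert (He : exp (- s) <= / (1 + s)).
  { rewrite exp_Ropp. apply Rinv_le_contravar; [lra|]. apply exp_ineq1_le. }
  assert (Hit : 0 < / t) by now apply Rinv_0_lt_compat.
  assert (Hts : / t * s = r * r) by (unfold s; field; lra).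
  (* With s = r^2 t the right-hand side contains 2 + 2 r^2, while the left-hand side is at most 1 +
     r + r^2/4 because 4 k^2 p^2 <= r^2; finally r <= (1 + r^2)/2. *)
  assert (K : (1 + k * k) * (1 + p * p) <= 2 * (1 + / t) * (1 + s)).
  { assert (A : 4 * (k * k * (p * p)) <= r * r) by (pose proof (Rle_0_sqr (k * k - p * p)); unfold r, Rsqr in *; lra).
    replace (2 * (1 + / t) * (1 + s)) with (2 + 2 * s + 2 * / t + 2 * (/ t * s)) by ring.
    replace ((1 + k * k) * (1 + p * p)) with (1 + r + k * k * (p * p)) by (unfold r; ring).
    rewrite Hts. pose proof (Rle_0_sqr (r - 1)) as Q. unfold Rsqr in Q. clearbody s r. nra. }
  assert (P1 : 0 < 1 + k * k) by nra. assert (P2 : 0 < 1 + p * p) by nra.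
  eapply Rle_trans; [exact He|]. unfold phi.
  apply (Rmult_le_reg_r ((1 + s) * ((1 + k * k) * (1 + p * p)))); [apply Rmult_lt_0_compat; [lra|now apply Rmult_lt_0_compat]|].
  replace (/ (1 + s) * ((1 + s) * ((1 + k * k) * (1 + p * p)))) with ((1 + k * k) * (1 + p * p)) by (field; lra).
  replace (2 * (1 + / t) * / (1 + k * k) * / (1 + p * p) * ((1 + s) * ((1 + k * k) * (1 + p * p)))) with (2 * (1 + / t) * (1 + s)) by (field; lra).
  exact K.
Qed.

Lemma symb_real (k p : R) : symb k (RtoC p) = RtoC ((k * k + p * p) * (k * k + p * p)).
Proof. unfold symb. apply C_ext; unfold Re, Im; simpl; ring. Qed.

Section Outer.
Variables (T M : R) (u : R -> R -> R -> C).
Hypotheses (HT : 0 < T) (HC : class_C T 6 u)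
  (HM : forall w x y t, (length w <= 6)%nat -> 0 <= y -> Cmod (cu T u w x y t) <= M * phi x * phi y * phi y).
Variables (y t : R).
Hypotheses (Hy : 0 < y) (Ht : 0 < t < T).

Definition initial_integrand (k p : R) : C :=
  (Cexp (Ci * RtoC p * RtoC y) * (Cexp (- (symb k (RtoC p) * RtoC t)) * LT (fun z => xtrans T u [] k z 0) (- RtoC p)))%C.

(** The product of 2 (1 + 1/t) from the Gaussian-type factor and 2 (4M) from the half-line
    transform. *)
Definition initial_bound : R := 16 * M * (1 + / t).

Lemma initial_integrand_cont (k p : R) : Ccont2 initial_integrand k p.
Proof.
  unfold initial_integrand. 
  assert (C1 : Ccont (fun q : R * R => RtoC (fst q)) (k, p)) by (apply Ccont_RtoC, continuous_fst).
  assert (C2 : Ccont (fun q : R * R => RtoC (snd q)) (k, p)) by (apply Ccont_RtoC, continuous_snd).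
  apply Ccont_mult; [|apply Ccont_mult].
  - apply Ccont_exp. apply Ccont_mult; [|apply Ccont_const]. apply Ccont_mult; [apply Ccont_const|exact C2].
  - apply Ccont_exp, Ccont_opp, Ccont_mult; [|apply Ccont_const]. unfold symb.
    apply Ccont_pow, Ccont_plus; apply Ccont_pow; assumption.
  - unfold LT. apply (I0_param_cont (P := prod_UniformSpace R_UniformSpace R_UniformSpace)
      (fun q z => Cexp (Ci * (- RtoC (snd q)) * RtoC z) * xtrans T u [] (fst q) z 0)%C (4 * M)).
    + intros z _. apply Ccont_mult.
      * apply Ccont_exp. apply Ccont_mult; [apply Ccont_mult; [apply Ccont_const|apply Ccont_opp]|].
        -- apply Ccont_RtoC. apply (continuous_comp (fun q : (R * R) * R => fst q) (fun q : R * R => snd q)); [apply continuous_fst|apply continuous_snd].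
        -- apply Ccont_RtoC, continuous_snd.
      * apply (xtrans_cont T M u HT HC HM [] (fun q : (R * R) * R => fst (fst q)) (fun q => snd q) (fun _ => 0)).
        -- simpl; lia.
        -- intros q. apply (continuous_comp (fun q : (R * R) * R => fst q) (fun q : R * R => fst q)); apply continuous_fst.
        -- intros q. apply continuous_snd.
        -- intros q. apply continuous_const.
    + apply filter_forall. intros [a b]. cbn [fst snd]. split.
      * intros z. apply Ccont_mult.
        -- apply Ccont_exp, Ccont_mult; [apply Ccont_const|]. apply Ccont_RtoC, continuous_id.
        -- apply (xtrans_cont T M u HT HC HM [] (fun _ => a) (fun q : R => q) (fun _ => 0)); [simpl; lia|..]; intros; 
             [apply continuous_const|apply continuous_id|apply continuous_const].
      * intros z Hz. rewrite Cmod_mult, Cmod_Cexp.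
        replace (Re (Ci * - RtoC b * RtoC z)) with 0 by (unfold Re; simpl; ring). rewrite exp_0, Rmult_1_l.
        eapply Rle_trans; [apply (xtrans_bound T M u HT HC HM); simpl; try lia; exact Hz|].
        pose proof (phi_pos z). pose proof (phi_le_1 z). pose proof (bound_nonneg T M u HM).
        assert (0 <= 4 * M * phi z) by nra. nra.
Qed.

Lemma initial_integrand_bound (k p : R) : Cmod (initial_integrand k p) <= initial_bound * phi k * phi p.
Proof.
  unfold initial_integrand, initial_bound. rewrite !Cmod_mult, !Cmod_Cexp, symb_real.
  replace (Re (Ci * RtoC p * RtoC y)) with 0 by (unfold Re; simpl; ring). rewrite exp_0, Rmult_1_l.
  replace (Re (- (RtoC ((k * k + p * p) * (k * k + p * p)) * RtoC t))) with (- ((k * k + p * p) * (k * k + p * p) * t)) by (unfold Re; simpl; ring).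
  assert (HL : Cmod (LT (fun z => xtrans T u [] k z 0) (- RtoC p)) <= 2 * (4 * M)).
  { apply LT_bound.
    - intros z. apply (xtrans_cont T M u HT HC HM [] (fun _ => k) (fun q : R => q) (fun _ => 0)); [simpl; lia|..]; intros; 
             [apply continuous_const|apply continuous_id|apply continuous_const].
    - intros z Hz. apply (xtrans_bound T M u HT HC HM); simpl; try lia; exact Hz.
    - unfold Im; simpl; lra. }
  replace (16 * M * (1 + / t) * phi k * phi p) with (2 * (1 + / t) * phi k * phi p * (2 * (4 * M))) by ring.
  apply Rmult_le_compat; [left; apply exp_pos|apply Cmod_ge_0|apply exp_neg_symb_phi; lra|exact HL].
Qed.

Lemma initial_bound_nonneg : 0 <= initial_bound.
Proof.
  unfold initial_bound. pose proof (bound_nonneg T M u HM). assert (0 < / t) by (apply Rinv_0_lt_compat; lra). nra.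
Qed.

Definition initial_inner (k : R) : C := (I0 (initial_integrand k) + I0 (fun p => initial_integrand k (- p)))%C.

Lemma initial_inner_spec (k : R) : is_CRInt_line (initial_integrand k) (initial_inner k).
Proof.
  apply (is_line_dom _ (initial_bound * phi k)); [|apply initial_integrand_bound].
  intros p. apply Ccont2_slice, initial_integrand_cont.
Qed.

Lemma initial_inner_cont (k : R) : Ccont initial_inner k.
Proof.
  assert (B : forall k p, Cmod (initial_integrand k p) <= initial_bound * phi p).
  { intros a p. eapply Rle_trans; [apply initial_integrand_bound|]. pose proof initial_bound_nonneg.
    pose proof (phi_pos p). pose proof (phi_pos a). pose proof (phi_le_1 a). apply Rmult_le_compat_r; [lra|]. nra. }
  assert (C1 : forall k p, Ccont (initial_integrand k) p) by (intros; apply Ccont2_slice, initial_integrand_cont).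
  apply Ccont_plus.
  - apply (I0_param_cont initial_integrand initial_bound).
    + intros p _. apply initial_integrand_cont.
    + apply filter_forall. intros a. split; auto.
  - apply (I0_param_cont (fun k p => initial_integrand k (- p)) initial_bound).
    + intros p _. apply (Ccont2_comp initial_integrand (fun q : R * R => fst q) (fun q : R * R => - snd q) (k, p)); [apply continuous_fst| |apply initial_integrand_cont].
      apply (continuous_opp (V := R_NormedModule)), continuous_snd.
    + apply filter_forall. intros a. split.
      * intros p. apply (Ccont_comp_R1 (initial_integrand a)); auto. apply (continuous_opp (V := R_NormedModule)), continuous_id.
      * intros p _. rewrite <- phi_opp. auto.
Qed.

Lemma initial_inner_bound (k : R) : Cmod (initial_inner k) <= 4 * initial_bound * phi k.
Proof.
  assert (C1 : forall p, Ccont (initial_integrand k) p) by (intros; apply Ccont2_slice, initial_integrand_cont).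
  eapply Rle_trans; [apply Cmod_triangle|].
  assert (B1 : Cmod (I0 (initial_integrand k)) <= 2 * (initial_bound * phi k)).
  { apply I0_bound; auto. intros; apply initial_integrand_bound. }
  assert (B2 : Cmod (I0 (fun p => initial_integrand k (- p))) <= 2 * (initial_bound * phi k)).
  { apply I0_bound.
    - intros p. apply (Ccont_comp_R1 (initial_integrand k)); auto. apply (continuous_opp (V := R_NormedModule)), continuous_id.
    - intros p _. rewrite <- (phi_opp p). apply initial_integrand_bound. }
  lra.
Qed.

(** (1 + k^2) times the transform is the transform of u - u_xx; two x-derivatives are spent on
    integrability in k. *)
Lemma xtrans_decay (k : R) : Cmod (xtrans T u [] k y t) <= 8 * M * phi k.
Proof.
  assert (E : (RtoC (1 + k * k) * xtrans T u [] k y t = xtrans T u [] k y t - xtrans T u [dx; dx] k y t)%C).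
  { rewrite !(xtrans_dx T M u HT HC HM) by (simpl; lia). apply C_ext; unfold Re, Im; simpl; ring. }
  pose proof (bound_nonneg T M u HM) as M0.
  assert (B : forall w, (length w <= 6)%nat -> Cmod (xtrans T u w k y t) <= 4 * M).
  { intros w Hw. eapply Rle_trans; [apply (xtrans_bound T M u HT HC HM); auto; lra|].
    pose proof (phi_pos y). pose proof (phi_le_1 y). assert (phi y * phi y <= 1) by nra. rewrite Rmult_assoc. nra. }
  pose proof (B [] ltac:(simpl; lia)) as B0. pose proof (B [dx; dx] ltac:(simpl; lia)) as B2.
  assert (P : 0 < 1 + k * k) by nra.
  assert (H : (1 + k * k) * Cmod (xtrans T u [] k y t) <= 8 * M).
  { rewrite <- (Cmod_RtoC_pos (1 + k * k)) by lra. rewrite <- Cmod_mult, E.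
    eapply Rle_trans; [apply Cmod_triangle_minus|]. lra. }
  unfold phi. apply (Rmult_le_reg_l (1 + k * k)); [exact P|].
  replace ((1 + k * k) * (8 * M * / (1 + k * k))) with (8 * M) by (field; lra). exact H.
Qed.

Lemma outer_inversion (x : R) : is_CRInt_line (fun k => osc x k * xtrans T u [] k y t)%C (RtoC (2 * PI) * u x y t)%C.
Proof.
  replace (u x y t) with (cu T u [] x y t) by (rewrite (cu_eq T u) by lra; reflexivity).
  apply (line_inversion_abs (fun x => cu T u [] x y t) M) with (K := 8 * M) (l := cu T u [dx] x y t).
  - intros; apply (cu_cont_x T u HT HC). simpl; lia.
  - intros; apply (cu_bound_x T M u HM). simpl; lia.
  - apply (cu_dx T 6 u HT HC). simpl; lia.
  - apply xtrans_decay.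
Qed.

End Outer.

Lemma E_split (x y t k : R) (l : C) :
  E x y t k l = (osc x k * (Cexp (Ci * l * RtoC y) * Cexp (- (symb k l * RtoC t))))%C.
Proof.
  unfold E, osc. rewrite <- !Cexp_plus. f_equal. rewrite RtoC_mult. ring.
Qed.

Theorem mainTheorem2 :
  exists N : nat, (4 <= N)%nat /\
  forall (T : R) (u : R -> R -> R -> C) (u0 g0 g1 : R -> R -> C),
    0 < T ->
    class_C T N u ->
    decays T N u ->
    (forall x y t : R, 0 < y -> 0 < t < T ->
       (partial T dt u x y t
        + (partials T [dx; dx; dx; dx] u x y t
           + 2 * partials T [dx; dx; dy; dy] u x y t
           + partials T [dy; dy; dy; dy] u x y t))%C = RtoC 0) ->
    (forall x t : R, 0 < t < T -> u x 0 t = g0 x t) ->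
    (forall x t : R, 0 < t < T -> partial T dy u x 0 t = g1 x t) ->
    (forall x y : R, 0 < y -> u x y 0 = u0 x y) ->
    forall x y t : R, 0 < y -> 0 < t < T ->
    exists J1 J2 : C,
      is_double_int (fun _ => real_line)
        (fun k l => (E x y t k l * hat u0 k l)%C) J1 /\
      is_double_int bd_Domp
        (fun k l => (E x y t k l * G u0 g0 g1 t k l)%C) J2 /\
      u x y t = (/ (2 * PI) ^ 2 * J1 + / (2 * PI) ^ 2 * J2)%C.
Proof.
  exists 6%nat. split; [lia|].
  intros T u u0 g0 g1 HT HC HD PDE H0 H1 Hi x y t Hy Ht.
  destruct (cu_bound T 6 u HT (le_n 6) HD) as (M & _ & HM).
  pose (in1 := initial_inner T u y t).
  pose (I1 := fun k : R => (osc x k * in1 k)%C).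
  (* The value of the inner contour integral given by [xtrans_one_dim]: full inversion in y minus
     the initial integral. *)
  pose (I2 := fun k : R => (osc x k * (RtoC (2 * PI) * xtrans T u [] k y t - in1 k))%C).
  pose proof (initial_inner_cont T M u HT HC HM y t Ht) as Cin.
  pose proof (initial_inner_bound T M u HT HC HM y t Ht) as Bin.
  assert (L1 : is_CRInt_line I1 (I0 I1 + I0 (fun k => I1 (- k)%R))%C).
  { apply (is_line_dom I1 (4 * initial_bound M t)).
    - intros k. apply Ccont_mult; [apply osc_cont|apply Cin].
    - intros k. unfold I1. rewrite Cmod_mult, Cmod_osc, Rmult_1_l. apply Bin. }
  set (J1 := (I0 I1 + I0 (fun k => I1 (- k)%R))%C) in *.
  assert (Hhat : forall k p : R, (E x y t k (RtoC p) * hat u0 k (RtoC p))%C = (osc x k * initial_integrand T u y t k p)%C).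
  { intros k p. rewrite E_split. replace (RtoC p) with (- - RtoC p)%C at 3 by ring.
    rewrite (hat_eq T M u HT HC HM u0 k (- RtoC p)%C Hi) by (unfold Im; simpl; lra). unfold initial_integrand. ring. }
  (* The integral of [I2] over k: one factor 2 pi comes from inversion in y, the other from
     inversion in x, and the initial integral cancels against [J1] in the sum. *)
  exists J1, (RtoC (2 * PI) * (RtoC (2 * PI) * u x y t) + RtoC (-1) * J1)%C. split; [|split].
  - exists I1. split; [|exact L1]. intros k.
    apply (is_contour_int_line _ (initial_bound M t * phi k)).
    + intros p. apply (continuous_ext (fun p => osc x k * initial_integrand T u y t k p)%C); [intros; now rewrite Hhat|].
      apply Ccont_mult; [apply Ccont_const|]. apply Ccont2_slice. apply (initial_integrand_cont T M u HT HC HM y t).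
    + intros p. rewrite Hhat, Cmod_mult, Cmod_osc, Rmult_1_l. apply (initial_integrand_bound T M u HT HC HM y t Ht).
    + eapply is_line_ext; [intros p; symmetry; apply Hhat|]. apply is_line_scal.
      apply (initial_inner_spec T M u HT HC HM y t Ht).
  - exists I2. split.
    + intros k. apply (xtrans_one_dim T M u HT HC HM y t k (osc x k) _ (in1 k) Hy Ht PDE).
      (* In an open quadrant both l and nu have positive imaginary part, so [hat] at -l and at -nu
         is a half-line transform. *)
      * intros e l He Hl. pose proof (Im_nu_pos k e l He Hl) as Hnu. destruct Hl as [_ Hl].
        rewrite E_split. unfold G, Gdata. cbv zeta.
        rewrite (hat_eq T M u HT HC HM u0 k l Hi), (hat_eq T M u HT HC HM u0 k (nu k l) Hi) by lra.
        rewrite (ttilde_eq T u g1 [dy] k t (symb k l) Ht H1), (ttilde_eq T u g0 [] k t (symb k l) Ht H0).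
        cbn [Nat.min repeat]. ring.
      * apply (initial_inner_spec T M u HT HC HM y t Ht).
    + eapply is_line_ext; [|apply is_line_plus; [apply is_line_scal, (outer_inversion T M u HT HC HM y t Hy Ht x)|apply is_line_scal, L1]].
      intros k. unfold I1, I2. cbv beta. apply C_ext; unfold Re, Im; simpl; ring.
  - assert (P : RtoC PI <> RtoC 0) by (intros Q; apply RtoC_inj in Q; pose proof PI_RGT_0; lra).
    assert (P2 : RtoC 2 <> RtoC 0) by (intros Q; apply RtoC_inj in Q; lra).
    rewrite RtoC_mult. replace (RtoC (-1)) with (- RtoC 1)%C by (apply C_ext; unfold Re, Im; simpl; ring). field. auto.
Qed.
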